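(* Let $p$ be $\infty$ or a prime number, let $a$ be an algebraic number with $0<|a|_p<1$, and let $\{R_k\}_{k\geq0}$ be a linear recurrence of nonnegative integers satisfying $R_{k+n}=c_1R_{k+n-1}+\cdots+c_nR_k$ for all $k\geq0$, where $n\geq2$, $R_0,\ldots,R_{n-1}$ are not all zero, and $c_1,\ldots,c_n$ are nonnegative integers with $c_n\neq0$. Suppose that $\{R_k\}_{k\geq0}$ satisfies condition (R)$_p$ (defined in the context). Define $$H(x,y)=\sum_{k=0}^\infty\frac{a^{R_k}x^k}{1-a^{R_k}y},\qquad F_m(x)=\frac{\partial^mH}{\partial y^m}(x,0)=m!\sum_{k=0}^\infty a^{(m+1)R_k}x^k\ (m\geq0),\qquad G(y)=\prod_{k=0}^\infty(1-a^{R_k}y),$$ so that $H$ is holomorphic on $\mathbb{C}_p\times(\mathbb{C}_p\setminus\{a^{-R_k}\}_{k\geq0})$ and $F_m,G$ are entire on $\mathbb{C}_p$. Then the infinite subset $$\left\{\frac{\partial^{l+m}H}{\partial x^l\partial y^m}(\alpha,\beta)\ \middle|\ \alpha\in\overline{\mathbb{Q}}\setminus\{0\},\ \beta\in\overline{\mathbb{Q}}\setminus(\{0\}\cup\{a^{-R_k}\}_{k\geq0}),\ l,m\geq0\right\}$$ $$\cup\left\{F_m^{(l)}(\alpha)\ \middle|\ \alpha\in\overline{\mathbb{Q}}\setminus\{0\},\ l,m\geq0\right\}\cup\left\{G(\beta)\ \middle|\ \beta\in\overline{\mathbb{Q}}\setminus(\{0\}\cup\{a^{-R_k}\}_{k\geq0})\right\}$$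 of $\overline{\mathbb{Q}}_p$ is algebraically independent over $\mathbb{Q}$.
   Context: $|\cdot|_p$ is the usual absolute value on $\mathbb{Q}$ if $p=\infty$ and the standard $p$-adic absolute value if $p$ is prime; $\mathbb{Q}_p$ is the completion, $\overline{\mathbb{Q}}_p$ its algebraic closure, $\mathbb{C}_p$ the completion of $\overline{\mathbb{Q}}_p$ ($\mathbb{C}_\infty=\mathbb{C}$); $\overline{\mathbb{Q}}$ is the algebraic closure of $\mathbb{Q}$ in $\mathbb{C}$, with a fixed embedding into $\mathbb{C}_p$ for prime $p$. Let $\Phi(X)=X^n-c_1X^{n-1}-\cdots-c_n$. Condition (R)$_\infty$: $\Phi(\pm1)\neq0$, the ratio of any two distinct roots of $\Phi$ is not a root of unity, and $\{R_k\}$ is not a geometric progression (i.e. it is not the case that $R_1\neq0$ and $R_kR_{k+2}=R_{k+1}^2$ for all $0\leq k\leq n-2$). For $p$ prime, condition (R)$_p$: $\Phi$ is irreducible over $\mathbb{Q}$ and its roots satisfy $\rho_1>\max\{|\rho_2|_\infty,\ldots,|\rho_n|_\infty\}$. *)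

(* Defs.v *)
From HB Require Import structures.
From mathcomp Require Import all_boot all_order all_algebra all_field.
From mathcomp Require Import all_classical all_reals all_analysis.
(* The notations of mpoly clash with those of MathComp-Analysis. *)
From mathcomp Require Import (canonicals) mpoly.

Set Implicit Arguments.
Unset Strict Implicit.
Unset Printing Implicit Defensive.

Import Order.TTheory GRing.Theory Num.Theory.
Import numFieldNormedType.Exports.

Local Open Scope classical_set_scope.
Local Open Scope ring_scope.

(* A field with a multiplicative absolute value. The library class of normed
   Z-modules cannot be used: it requires |x *+ n| = |x| *+ n, which fails for
   p-adic absolute values. *)
HB.mixin Record Field_hasAbsv (R : realType) K & GRing.Field K := {
  absv : K -> R;
  absv_ge0 : forall x, 0 <= absv x;
  absv_eq0 : forall x, absv x = 0 <-> x = 0;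
  absvM : forall x y, absv (x * y) = absv x * absv y;
  absvD : forall x y, absv (x + y) <= absv x + absv y
}.

#[short(type="valuedFieldType")]
HB.structure Definition ValuedField (R : realType) :=
  {K of GRing.Field K & Field_hasAbsv R K}.

Section Metric.
Variables (R : realType) (K : valuedFieldType R).
Implicit Types x y z : K.

Definition absv_dist x y : R := absv (x - y).

Lemma absv_distxx x : absv_dist x x = 0.
Proof. by rewrite /absv_dist subrr; apply/absv_eq0. Qed.

Lemma absv_dist_eq0 x y : absv_dist x y = 0 -> x = y.
Proof. by move/absv_eq0/eqP; rewrite subr_eq0 => /eqP. Qed.

Lemma absvN x : absv (- x) = absv x.
Proof.
have a1 : absv (1 : K) = 1.
  have /mulfI : absv (1 : K) != 0.
    by apply/eqP => /absv_eq0/eqP; rewrite oner_eq0.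
  by apply; rewrite -absvM !mulr1.
have : absv (-1 : K) ^+ 2 == 1 by rewrite expr2 -absvM mulrNN mulr1 a1.
rewrite sqrf_eq1 => /orP[/eqP aN1|/eqP aN1].
  by rewrite -mulN1r absvM aN1 mul1r.
by have := absv_ge0 (-1 : K); rewrite aN1 lerNr oppr0 ler10.
Qed.

Lemma absv_dist_sym x y : absv_dist x y = absv_dist y x.
Proof. by rewrite /absv_dist -absvN opprB. Qed.

Lemma absv_dist_triangle y x z :
  absv_dist x z <= absv_dist x y + absv_dist y z.
Proof. by rewrite /absv_dist -(subrKA y) absvD. Qed.

HB.instance Definition _ := Pointed.copy (ValuedField.sort K)
  (GRing.Zmodule.sort K).
HB.instance Definition _ := @isMetric.Build R (ValuedField.sort K)
  absv_dist absv_distxx absv_dist_eq0 absv_dist_sym absv_dist_triangle.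

End Metric.

Definition absv_complete (R : realType) (K : valuedFieldType R) : Prop :=
  forall F : set_system K, ProperFilter F -> cauchy F -> cvg F.

Variant place := InfinitePlace | PrimePlace (p : nat) of prime p.

Definition rat_absv (R : realType) (v : place) (x : rat) : R :=
  match v with
  | InfinitePlace => `|ratr x|
  | PrimePlace p _ =>
      if x == 0 then 0
      else p%:R ^ ((logn p `|denq x|%N)%:Z - (logn p `|numq x|%N)%:Z)
  end.

Definition is_completion (R : realType) (K : fieldType) (absK : K -> R)
    (L : valuedFieldType R) (f : {rmorphism K -> L}) : Prop :=
  [/\ forall x, absv (f x) = absK x, dense (range f) & absv_complete L].

Definition is_algebraic_closure (K L : fieldType) (f : {rmorphism K -> L}) :
    Prop :=
  GRing.closed_field_axiom L /\ forall z : L, algebraicOver f z.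

(* The tower Q -> Q_v -> algebraic closure of Q_v -> C_v. Each step determines
   the next one up to isometric isomorphism (an absolute value on a complete
   field extends uniquely to an algebraic extension); for v = oo the tower is
   Q -> R -> C -> C. *)
Record local_tower (R : realType) (v : place) := LocalTower {
  Qv : valuedFieldType R;
  Qvbar : valuedFieldType R;
  Cv : valuedFieldType R;
  rat_to_Qv : {rmorphism rat -> Qv};
  Qv_to_Qvbar : {rmorphism Qv -> Qvbar};
  Qvbar_to_Cv : {rmorphism Qvbar -> Cv};
  Qv_completion : is_completion (rat_absv R v) rat_to_Qv;
  Qvbar_closure : is_algebraic_closure Qv_to_Qvbar;
  Qvbar_absv : forall x, absv (Qv_to_Qvbar x) = absv x;
  Cv_completion : is_completion (@absv R Qvbar) Qvbar_to_Cv
}.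

Definition alg_independent (K : fieldType) (S : set K) : Prop :=
  forall (n : nat) (z : 'I_n -> K), injective z -> (forall i, S (z i)) ->
  forall P : mpoly.mpoly n rat, mpoly.mmap (@ratr K) z P = 0 -> P = 0.

(* [c i] stands for c_i, 1 <= i <= n; the other values of [c] are not used. *)
Definition linear_recurrence (n : nat) (c r : nat -> nat) : Prop :=
  forall k, r (k + n)%N = (\sum_(1 <= i < n.+1) c i * r (k + n - i))%N.

Definition char_poly_rec (n : nat) (c : nat -> nat) : {poly rat} :=
  'X^n - \sum_(1 <= i < n.+1) (c i)%:R *: 'X^(n - i).

Definition char_roots (n : nat) (c : nat -> nat) : set algC :=
  [set z | root (map_poly ratr (char_poly_rec n c)) z].

Definition geometric_progression (n : nat) (r : nat -> nat) : Prop :=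
  r 1%N <> 0%N /\
  forall k, (k <= n - 2)%N -> (r k * r k.+2 = r k.+1 ^ 2)%N.

Definition condR_infinite (n : nat) (c r : nat -> nat) : Prop :=
  [/\ (char_poly_rec n c).[1] != 0,
      (char_poly_rec n c).[-1] != 0,
      forall z w, char_roots n c z -> char_roots n c w -> z != w ->
        forall N, (0 < N)%N -> (z / w) ^+ N != 1
    & ~ geometric_progression n r].

(* In algC, `|z| < rho1 includes that rho1 is real. *)
Definition condR_prime (n : nat) (c : nat -> nat) : Prop :=
  irreducible_poly (char_poly_rec n c) /\
  exists (rho1 : algC) (rhos : seq algC),
    map_poly ratr (char_poly_rec n c) =
      \prod_(z <- rho1 :: rhos) ('X - z%:P) /\
    {in rhos, forall z, `|z| < rho1}.

Definition condR (v : place) (n : nat) (c r : nat -> nat) : Prop :=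
  match v with
  | InfinitePlace => condR_infinite n c r
  | PrimePlace _ _ => condR_prime n c
  end.

Section Functions.
Variables (R : realType) (K : valuedFieldType R).

(* The derivative in the variable of K; [lim] has a default value when the
   limit does not exist. *)
Definition Kderive (f : K -> K) (x : K) : K :=
  lim ((f (x + h) - f x) / h @[h --> 0^']).

Definition Kderiven (n : nat) (f : K -> K) : K -> K := iter n Kderive f.

Definition Kpartial (l m : nat) (f : K -> K -> K) (x y : K) : K :=
  Kderiven l (fun x' => Kderiven m (f x') y) x.

Variables (a : K) (r : nat -> nat).

Definition H_fun (x y : K) : K :=
  \big[+%R/0]_(0 <= k <oo) (a ^+ r k * x ^+ k / (1 - a ^+ r k * y)).

Definition F_fun (m : nat) (x : K) : K := Kderiven m (H_fun x) 0.

Definition G_fun (y : K) : K :=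
  \big[*%R/1]_(0 <= k <oo) (1 - a ^+ r k * y).

End Functions.

Definition admissible (a : algC) (r : nat -> nat) (beta : algC) : Prop :=
  beta != 0 /\ forall k, beta != a ^- r k.

Section Values.
Variables (R : realType) (K : valuedFieldType R).
Variables (emb : {rmorphism algC -> K}) (a : algC) (r : nat -> nat).

Definition H_values : set K :=
  [set w | exists (alpha beta : algC) (l m : nat),
     [/\ alpha != 0, admissible a r beta
       & w = Kpartial l m (H_fun (emb a) r) (emb alpha) (emb beta)]].

Definition F_values : set K :=
  [set w | exists (alpha : algC) (l m : nat),
     alpha != 0 /\ w = Kderiven l (F_fun (emb a) r m) (emb alpha)].

Definition G_values : set K :=
  [set w | exists beta : algC,
     admissible a r beta /\ w = G_fun (emb a) r (emb beta)].

End Values.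

(* Main.v *)
Require Import Defs.
From HB Require Import structures.
From mathcomp Require Import all_boot all_order all_algebra all_field.
From mathcomp Require mpoly.
From mathcomp Require Import boolp(EM, choice, contrapT, funext).
From mathcomp Require Import perm.
From mathcomp Require Import zify ring lra.

(* Mahler's method. The values are combinations of the numbers
   sum_k al^k (a^(r k) / (1 - be a^(r k)))^(m+1) and of products
   prod_k (1 - be a^(r k)). Let Om be the action of the transposed companion
   matrix of the recurrence on monomials in n variables and z(k) the point with
   coordinates a^(x_k(e_i)): then a^(r k) is a monomial vv 0 evaluated at z(k), and
   the series and products satisfy functional equations under z(k) -> z(k+1). They
   are formally algebraically independent over the rational functions, by a Kubota
   type criterion and an analysis of poles along the orbits of Om. Condition (R)
   makes exponential sums along z(k) non-degenerate, so that a relation between the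
   values gives an auxiliary polynomial contradicting the Liouville inequality. The
   values lie in the closure of Q-bar in C_p since finite-dimensional subspaces over
   Q_v are closed. *)

Set Implicit Arguments.
Unset Strict Implicit.
Unset Printing Implicit Defensive.

Import Order.TTheory GRing.Theory Num.Theory.
Local Open Scope ring_scope.

(** Differentiation in x puts the coefficients alpha^k and binomials in k into the functional
    equations. So the relation transported to step k changes with k, and its coefficients are
    polynomials in finitely many sequences [tau] that need not be independent. The auxiliary
    polynomial is therefore built for all k at once, as a family with coefficients in these
    sequences, and its nonvanishing at infinitely many steps has to come from [tau_independent]. A
    second obstacle is that differences of exponents along an orbit may oscillate, because the
    dominant root need not occur in them. Hence the statements about single points z(k) are proved
    on windows of consecutive indices, by counting the bad indices in a window. Both cases of
    condition (R) are reduced to the four facts in [good_roots]. Of the absolute value the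
    diophantine part uses multiplicativity, the triangle inequality and 1/k <= |k|, which treats the
    archimedean and the p-adic places together. All sizes and heights are compared with [E k], the
    solution of the recurrence whose initial values are all 1. *)

Notation nonneg ab := (forall x, 0 <= ab x) (only parsing).
Notation definite ab := (forall x, ab x = 0 <-> x = 0) (only parsing).
Notation multiplicative ab := (forall x y, ab (x * y) = ab x * ab y) (only parsing).
Notation subadditive ab := (forall x y, ab (x + y) <= ab x + ab y) (only parsing).
Notation no_root_of_unity rts := (forall z N, z \in rts -> (0 < N)%N -> z ^+ N != 1) (only parsing).
Notation recurrence m c r := (forall k, r (k + m.+1)%N = (\sum_(j < m.+1) c (m.+1 - j) * r (k + j))%N) (only parsing).

Notation "'for_large' k , P" := (exists k0, forall k, (k0 <= k)%N -> P)
  (at level 200, k name, P at level 200, only parsing).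

Lemma big_fun (A I : Type) (op : A -> A -> A) idx (s : seq I) (P : pred I) (F : I -> nat -> A) :
  (fun k => \big[op/idx]_(i <- s | P i) F i k) = \big[(fun f g k => op (f k) (g k))/(fun=> idx)]_(i <- s | P i) F i.
Proof. by apply: funext => k; elim/big_rec2: _ => // i y x _ ->. Qed.

(** * Extension of an injective ring morphism to the fraction fields *)

Section FracMap.
Local Notation "x %:F" := (@FracField.tofrac _ x).
Variables (A B : idomainType) (s : {rmorphism A -> B}).
Hypothesis s_inj : injective s.

Let s_neq0 y : y != 0 -> s y != 0.
Proof. by apply: contra => /eqP sy0; apply/eqP/s_inj; rewrite sy0 rmorph0. Qed.
Definition fracmap (x : {fraction A}) : {fraction B} := (s \n_(repr x))%:F / (s \d_(repr x))%:F.

Lemma fracE (x : {fraction A}) : x = (\n_(repr x))%:F / (\d_(repr x))%:F.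
Proof.
have d0 := denom_ratioP (repr x).
apply/(mulIf (x := (\d_(repr x))%:F)); first by rewrite tofrac_eq0.
rewrite mulfVK ?tofrac_eq0 //; move: (d0); rewrite -{2}[x]reprK.
move: (repr x) => r r0; rewrite !piE; apply/eqP; rewrite piE /=.
by rewrite /FracField.equivf /FracField.mulf !numden_Ratio ?mulr1 ?oner_eq0 // mulrC.
Qed.

Lemma fracmap_div a b : b != 0 -> fracmap (a%:F / b%:F) = (s a)%:F / (s b)%:F.
Proof.
move=> b0; rewrite /fracmap; set x := a%:F / b%:F.
have d0 := denom_ratioP (repr x).
apply/eqP; rewrite eqr_div ?tofrac_eq0 ?s_neq0 // -!tofracM tofrac_eq.
rewrite -!rmorphM; apply/eqP; congr (s _); apply/eqP.
rewrite -tofrac_eq !tofracM -eqr_div ?tofrac_eq0 //.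
by rewrite -fracE.
Qed.

Lemma fracmap_tofrac a : fracmap a%:F = (s a)%:F.
Proof.
have := @fracmap_div a 1 (oner_neq0 _).
by rewrite !rmorph1 !divr1.
Qed.

Lemma fracmap_ind (P : {fraction A} -> Prop) : (forall a b, b != 0 -> P (a%:F / b%:F)) -> forall x, P x.
Proof. by move=> H x; rewrite [x]fracE; apply/H/denom_ratioP. Qed.

Fact fracmap_zmod : zmod_morphism fracmap.
Proof.
move=> x y; elim/fracmap_ind: x => a b b0; elim/fracmap_ind: y => c d d0.
have bF : b%:F != 0 by rewrite tofrac_eq0.
have dF : d%:F != 0 by rewrite tofrac_eq0.
rewrite -mulNr addf_div // !fracmap_div // -tofracN -!tofracM -tofracD.
rewrite fracmap_div ?mulf_neq0 // -[in RHS]mulNr addf_div ?tofrac_eq0 ?s_neq0 //.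
by rewrite -tofracN -!tofracM -tofracD rmorphD mulNr rmorphN !rmorphM mulNr.
Qed.

Fact fracmap_monoid : monoid_morphism fracmap.
Proof.
split=> [|x y].
  by rewrite -[1 in LHS]tofrac1 fracmap_tofrac !rmorph1.
elim/fracmap_ind: x => a b b0; elim/fracmap_ind: y => c d d0.
rewrite mulf_div -!tofracM !fracmap_div ?mulf_neq0 //.
by rewrite mulf_div -!tofracM !rmorphM.
Qed.

HB.instance Definition _ := GRing.isZmodMorphism.Build _ _ fracmap fracmap_zmod.
HB.instance Definition _ := GRing.isMonoidMorphism.Build _ _ fracmap fracmap_monoid.

Lemma frac_extension : exists f : {rmorphism {fraction A} -> {fraction B}}, forall a, f a%:F = (s a)%:F.
Proof. by exists fracmap => a; exact: fracmap_tofrac. Qed.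

End FracMap.

(** * An algebraic independence criterion *)

Module Criterion.
Section Kubota.
Import mpoly.
Variables (K F : fieldType) (iota : {rmorphism K -> F}) (Ny Nu : nat).
Local Notation N := (Ny + Nu)%N.
Variables (sigma : nat -> {rmorphism F -> F}).
Hypothesis sigma_iota : forall d x, sigma d (iota x) = iota x.
Variables (B : nat -> 'I_Ny -> 'I_Ny -> K).
Variables (b : nat -> 'I_Ny -> F) (pi : nat -> 'I_Nu -> F).
Hypotheses (B_trig : forall d (y y' : 'I_Ny), B d y y' != 0 -> (y <= y')%N) (B_diag : forall d y, B d y y != 0)
 (pi_neq0 : forall d u, pi d u != 0) (charF : [pchar F] =i pred0).

Implicit Types (p q r g : {mpoly F[N]}) (m : 'X_{1..N}).

Definition yvar (y : 'I_Ny) : 'I_N := lshift Nu y.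
Definition uvar (u : 'I_Nu) : 'I_N := rshift Ny u.
(** What the d-fold substitution does to the functions named by the variables: [b d y] will be the
    sum of the first d terms of a series and [pi d u] the product of the first d factors of a
    product. *)
Definition shiftvar d (v : 'I_N) : {mpoly F[N]} := match split v with
  | inl y => \sum_y' iota (B d y y') *: ('X_(yvar y') - (b d y')%:MP) | inr u => (pi d u)^-1 *: 'X_(uvar u) end.
Definition kshift d : {mpoly F[N]} -> {mpoly F[N]} := mmap (@mpolyC N F \o sigma d) (shiftvar d).
HB.instance Definition _ d := GRing.RMorphism.on (kshift d).
Lemma kshiftC d c : kshift d c%:MP = (sigma d c)%:MP.
Proof. by rewrite /kshift mmapC. Qed.
Lemma kshiftZ d c p : kshift d (c *: p) = sigma d c *: kshift d p.
Proof. by rewrite -!mul_mpolyC rmorphM /= kshiftC. Qed.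
Lemma kshiftXm d m : kshift d 'X_[m] = \prod_v shiftvar d v ^+ m v.
Proof. by rewrite /kshift mmapX. Qed.
Lemma kshiftXU d v : kshift d 'X_v = shiftvar d v.
Proof. by rewrite /kshift mmapX mmap1U. Qed.
Lemma shiftvar_y d y : shiftvar d (yvar y) = \sum_y' iota (B d y y') *: ('X_(yvar y') - (b d y')%:MP).
Proof. by rewrite /shiftvar /yvar (unsplitK (inl _ y)). Qed.
Lemma shiftvar_u d u : shiftvar d (uvar u) = (pi d u)^-1 *: 'X_(uvar u).
Proof. by rewrite /shiftvar /uvar (unsplitK (inr _ u)). Qed.

(** Chain rule. Both sides are derivations along the morphism [kshift d]; they vanish on constants
    and agree on the variables. *)
Lemma kshift_deriv d y p : mderiv (yvar y) (kshift d p) = \sum_y' iota (B d y' y) *: kshift d (mderiv (yvar y') p).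
Proof.
pose D1 p := mderiv (yvar y) (kshift d p).
pose D2 p := \sum_y' iota (B d y' y) *: kshift d (mderiv (yvar y') p).
have D1M q r : D1 (q * r) = D1 q * kshift d r + kshift d q * D1 r.
  by rewrite /D1 rmorphM mderivM.
have D2M q r : D2 (q * r) = D2 q * kshift d r + kshift d q * D2 r.
  rewrite /D2 mulr_suml mulr_sumr -big_split /=; apply: eq_bigr => y' _.
  by rewrite mderivM rmorphD !rmorphM scalerDr scalerAl scalerAr.
have D1C c : D1 c%:MP = 0 by rewrite /D1 kshiftC mderivC.
have D2C c : D2 c%:MP = 0.
  by rewrite /D2 big1 // => y' _; rewrite mderivC rmorph0 scaler0.
have DU v : D1 'X_v = D2 'X_v.
  rewrite /D1 /D2 kshiftXU; case: (splitP v) => [y1 vE|u1 vE].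
    have -> : v = yvar y1 by apply: val_inj.
    rewrite shiftvar_y raddf_sum (bigD1 y) //= [RHS](bigD1 y1) //=.
    rewrite mderivZ mderivB mderivC subr0 !mderivX !mnm1E !eqxx.
    have sub (w : 'I_N) : (U_(w) - U_(w) = 0 :> 'X_{1..N})%MM.
      by apply/mnmP => i; rewrite mnmBE subnn mnm0E.
    rewrite !sub mpolyX0 scale1r rmorph1 !big1 //.
      move=> i ni; rewrite mderivX mnm1E /yvar (inj_eq (@lshift_inj _ _)).
      by rewrite eq_sym (negPf ni) scale0r rmorph0 scaler0.
    move=> i ni; rewrite mderivZ mderivB mderivC subr0 mderivX mnm1E.
    by rewrite /yvar (inj_eq (@lshift_inj _ _)) (negPf ni) scale0r scaler0.
  have -> : v = uvar u1 by apply: val_inj.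
  rewrite shiftvar_u mderivZ mderivX mnm1E /uvar /yvar eq_rlshift scale0r scaler0.
  by rewrite big1 // => i _; rewrite mderivX mnm1E eq_rlshift scale0r rmorph0 scaler0.
have D1D q r : D1 (q + r) = D1 q + D1 r by rewrite /D1 rmorphD mderivD.
have D2D q r : D2 (q + r) = D2 q + D2 r.
  by rewrite /D2 -big_split; apply: eq_bigr => y' _; rewrite mderivD rmorphD scalerDr.
have D1Z c q : D1 (c *: q) = sigma d c *: D1 q.
  by rewrite -mul_mpolyC D1M D1C mul0r add0r kshiftC mul_mpolyC.
have D2Z c q : D2 (c *: q) = sigma d c *: D2 q.
  by rewrite -mul_mpolyC D2M D2C mul0r add0r kshiftC mul_mpolyC.
rewrite -/(D1 p) -/(D2 p).
elim/mpolyind: p => [|c m p _ _ IH]; first by rewrite -mpolyC0 D1C D2C.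
rewrite D1D D2D IH D1Z D2Z; congr (_ *: _ + _).
rewrite mpolyXE_id; elim/big_ind: _.
- by rewrite -mpolyC1 D1C D2C.
- by move=> q r eq1 er1; rewrite D1M D2M eq1 er1.
move=> v _; elim: (m v) => [|k IHk]; first by rewrite expr0 -mpolyC1 D1C D2C.
by rewrite exprS D1M D2M DU IHk.
Qed.

(** In the monomial order a variable of smaller index is larger, so by triangularity of [B] the
    variable itself leads its image. *)
Lemma shiftvar_lead d v : mlead (shiftvar d v) = U_(v)%MM /\ mleadc (shiftvar d v) = match split v with
    inl y => iota (B d y y) | inr u => (pi d u)^-1 end.
Proof.
case: (splitP v) => [y vE|u vE].
  have -> : v = yvar y by apply: val_inj.
  rewrite shiftvar_y; set S := \sum_ _ _.
  have cS m : (U_(yvar y)%MM < m)%O -> S@_m = 0.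
    move=> lt; rewrite raddf_sum big1 //= => y' _.
    rewrite mcoeffZ mcoeffB mcoeffX mcoeffC.
    have m0 : (m == 0%MM) = false.
      by apply/negP => /eqP m0; move: lt; rewrite m0 ltNge le0m.
    rewrite m0 mulr0 subr0; case: eqP => [mE|]; last by rewrite mulr0.
    have [B0|B0] := eqVneq (B d y y') 0; first by rewrite B0 rmorph0 mul0r.
    have yy := B_trig B0; move: lt; rewrite -mE.
    have -> : (U_(yvar y)%MM < U_(yvar y')%MM)%O = false; last by [].
    apply/negP => lt2; have e : mdeg U_(yvar y)%MM = mdeg U_(yvar y')%MM.
      by rewrite !mdeg1.
    case/(ltmcP e): lt2 => i ij; rewrite !mnm1E.
    case: (yvar y' =P i) => [iE|_]; last by rewrite ltn0.
    subst i; case: eqP => // /eqP nyy _; have lt1 : (yvar y < yvar y')%N.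
      by rewrite ltn_neqAle yy andbT; apply: contra nyy => /eqP h; apply/eqP/val_inj.
    by have := ij (yvar y) lt1; rewrite !mnm1E eqxx eq_sym (negPf nyy).
  have cU : S@_(U_(yvar y)%MM) = iota (B d y y).
    rewrite raddf_sum (bigD1 y) //= big1 ?addr0.
      by rewrite mcoeffZ mcoeffB mcoeffX mcoeffC mnm1_eq0 eqxx mulr0 subr0 mulr1.
    move=> y' ny; rewrite mcoeffZ mcoeffB mcoeffX mcoeffC mnm1_eq0 mulr0 subr0.
    by rewrite eq_mnm1 (inj_eq (@lshift_inj _ _)) (negPf ny) mulr0.
  have lS : mlead S = U_(yvar y)%MM.
    apply/eqP; rewrite eq_le; apply/andP; split.
      rewrite leNgt; apply/negP => /cS /eqP; rewrite mleadc_eq0 => /eqP S0.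
      by move: cU => /eqP; rewrite S0 mcoeff0 eq_sym fmorph_eq0 (negPf (B_diag _ _)).
    by apply: msupp_le_mlead; rewrite mcoeff_msupp cU fmorph_eq0 B_diag.
  by rewrite lS cU.
have -> : v = uvar u by apply: val_inj.
have p0 : (pi d u)^-1 != 0 by rewrite invr_eq0.
by rewrite shiftvar_u mleadZ // mleadXm mcoeffZ mcoeffX eqxx mulr1.
Qed.

Definition gammac d m : K := \prod_y B d y y ^+ m (yvar y).
Definition piu d m : F := \prod_u pi d u ^+ m (uvar u).
Lemma gammac_neq0 d m : gammac d m != 0.
Proof. by apply/prodf_neq0 => y _; rewrite expf_neq0. Qed.
Lemma piu_neq0 d m : piu d m != 0.
Proof. by apply/prodf_neq0 => u _; rewrite expf_neq0. Qed.

Lemma shiftvar_neq0 d v : shiftvar d v != 0.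
Proof.
rewrite -mleadc_eq0 (proj2 (shiftvar_lead d v)).
by case: splitP => *; rewrite ?fmorph_eq0 ?invr_eq0.
Qed.

Lemma kshiftX_lead d m : mlead (kshift d 'X_[m]) = m /\ mleadc (kshift d 'X_[m]) = iota (gammac d m) / piu d m.
Proof.
have nz v : shiftvar d v ^+ m v != 0 by rewrite expf_neq0 ?shiftvar_neq0.
have lX v : mlead (shiftvar d v ^+ m v) = (U_(v) *+ m v)%MM.
  by rewrite mleadX ?shiftvar_neq0 // (proj1 (shiftvar_lead d v)).
have lE : mlead (kshift d 'X_[m]) = m.
  rewrite kshiftXm mlead_prod => [|v _ _]; last exact: nz.
  by under eq_bigr do rewrite lX; rewrite -multinomUE_id.
split=> //; rewrite kshiftXm in lE *.
have -> : mlead (\prod_v shiftvar d v ^+ m v) = (\sum_v mlead (shiftvar d v ^+ m v))%MM.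
  by rewrite mlead_prod => [|v _ _]; last exact: nz.
rewrite mleadc_prod big_split_ord /=; congr (_ * _).
  rewrite rmorph_prod; apply: eq_bigr => y _.
  rewrite mleadX ?shiftvar_neq0 // mleadcX (proj2 (shiftvar_lead d _)).
  by rewrite (unsplitK (inl _ y)) rmorphXn.
rewrite /piu -prodfV; apply: eq_bigr => u _.
rewrite mleadX ?shiftvar_neq0 // mleadcX (proj2 (shiftvar_lead d _)).
by rewrite (unsplitK (inr _ u)) exprVn.
Qed.

Lemma kshiftE d p : kshift d p = \sum_(m <- msupp p) sigma d p@_m *: kshift d 'X_[m].
Proof.
by rewrite {1}[p]mpolyE raddf_sum; apply: eq_bigr => m _; rewrite /= kshiftZ.
Qed.

Lemma kshift_coef_gt d p m : (mlead p < m)%O -> (kshift d p)@_m = 0.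
Proof.
move=> lt; rewrite kshiftE raddf_sum big_seq big1 //= => k ks.
rewrite mcoeffZ [(kshift _ _)@__]mcoeff_gt_mlead ?mulr0 // (proj1 (kshiftX_lead d k)).
exact: le_lt_trans (msupp_le_mlead ks) lt.
Qed.

Lemma kshift_coef_lead d p : p != 0 -> (kshift d p)@_(mlead p) =
  sigma d (mleadc p) * (iota (gammac d (mlead p)) / piu d (mlead p)).
Proof.
move=> p0; rewrite kshiftE raddf_sum.
rewrite (bigD1_seq (mlead p)) ?msupp_uniq ?mlead_supp //=.
have [e1 e2] := kshiftX_lead d (mlead p); rewrite e1 in e2.
rewrite mcoeffZ e2 big_seq_cond big1 ?addr0 // => k /andP[ks nk].
rewrite mcoeffZ [(kshift _ _)@__]mcoeff_gt_mlead ?mulr0 //.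
by rewrite (proj1 (kshiftX_lead d k)) lt_neqAle nk msupp_le_mlead.
Qed.

Variable rel : {mpoly F[N]} -> Prop.
Hypotheses (relB : forall p q, rel p -> rel q -> rel (p - q)) (relZ : forall c p, rel p -> rel (c *: p))
 (rel_shift : forall d p, rel p -> rel (kshift d p)).

(** Take a nonzero relation with least leading monomial. The image under [kshift d] minus the
    multiple that cancels the leading term is a relation with a smaller one, hence zero. *)
Lemma semi_invariant p : rel p -> p != 0 -> exists P, [/\ rel P, P != 0 & forall d, kshift d P =
     (iota (gammac d (mlead P)) / piu d (mlead P)) *: P].
Proof.
elim/(well_founded_ind (@ltom_wf N)): {p}(mlead p) {-2}p (erefl (mlead p)).
move=> m IH p pm rp p0.
pose P := (mleadc p)^-1 *: p.
have lc0 : (mleadc p)^-1 != 0 by rewrite invr_eq0 mleadc_eq0.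
have P0 : P != 0 by rewrite -mleadc_eq0 mleadcZE mulf_neq0 // mleadc_eq0.
have lP : mlead P = mlead p by rewrite mleadZ.
have lcP : mleadc P = 1 by rewrite mleadcZE mulVf // mleadc_eq0.
have rP : rel P by exact: relZ.
have [[q [rq q0 lq]]|noq] := EM (exists q, [/\ rel q, q != 0 & (mlead q < m)%O]).
  by apply: (IH _ lq q).
exists P; split=> // d; apply/eqP; rewrite -subr_eq0; apply/negPn/negP => D0.
apply: noq; set D := kshift d P - _ in D0 *.
exists D; split=> //; first by apply: relB; [exact: rel_shift|exact: relZ].
have cm : D@_(mlead P) = 0.
  by rewrite mcoeffB mcoeffZ kshift_coef_lead // lcP rmorph1 mul1r mulr1 subrr.
rewrite -pm -lP lt_neqAle; apply/andP; split.
  by apply: contra D0 => /eqP e; rewrite -mleadc_eq0 e cm.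
rewrite leNgt; apply: contra D0 => lt; rewrite -mleadc_eq0.
rewrite mcoeffB mcoeffZ kshift_coef_gt // sub0r oppr_eq0.
by rewrite [P@__]mcoeff_gt_mlead ?mulr0.
Qed.

(** Combinations with constants of K only, because these are the scalars that every [sigma d]
    fixes. *)
Definition inspan (V : lmodType F) (gs : seq V) (w : V) : Prop :=
  exists c : nat -> K, w = \sum_(i < size gs) iota (c i) *: nth 0 gs i.
Lemma inspan0 (V : lmodType F) (gs : seq V) : inspan gs 0.
Proof. by exists (fun=> 0); rewrite big1 // => i _; rewrite rmorph0 scale0r. Qed.

Lemma inspanD (V : lmodType F) (gs : seq V) v w : inspan gs v -> inspan gs w -> inspan gs (v + w).
Proof.
move=> [c ->] [c' ->]; exists (fun i => c i + c' i).
by rewrite -big_split; apply: eq_bigr => i _; rewrite rmorphD scalerDl.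
Qed.

Lemma inspanZ (V : lmodType F) (gs : seq V) x v : inspan gs v -> inspan gs (iota x *: v).
Proof.
move=> [c ->]; exists (fun i => x * c i).
by rewrite scaler_sumr; apply: eq_bigr => i _; rewrite rmorphM scalerA.
Qed.

Lemma inspan_mem (V : lmodType F) (gs : seq V) v : v \in gs -> inspan gs v.
Proof.
move=> vgs; exists (fun i => (i == index v gs)%:R).
have lt : (index v gs < size gs)%N by rewrite index_mem.
rewrite (bigD1 (Ordinal lt)) //= eqxx rmorph1 scale1r nth_index //.
rewrite big1 ?addr0 // => i ni; suff -> : (i == index v gs :> nat) = false.
  by rewrite rmorph0 scale0r.
by apply: contra_neqF ni => /eqP e; apply: val_inj.
Qed.

Lemma inspan_sum (V : lmodType F) (gs : seq V) (I : finType) (f : I -> V) :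
  (forall i, inspan gs (f i)) -> inspan gs (\sum_i f i).
Proof. by move=> H; elim/big_ind: _ => //; [exact: inspan0|exact: inspanD]. Qed.

Lemma inspan_lin (V W : lmodType F) (gs : seq V) (hs : seq W) (h : {additive V -> W}) v :
  (forall x u, h (iota x *: u) = iota x *: h u) ->
  inspan gs v -> (forall e, e \in gs -> inspan hs (h e)) -> inspan hs (h v).
Proof.
move=> hZ [c ->] H; rewrite raddf_sum; apply: inspan_sum => i /=.
by rewrite hZ; apply/inspanZ/H/mem_nth.
Qed.

Fixpoint derivs P k : seq {mpoly F[N]} := if k is k'.+1 then
  [seq mderiv (yvar y) g | g <- derivs P k', y <- enum 'I_Ny] else [:: P].

(** Stated backwards, with a preimage [r'] of each [r], since the chain rule expresses the
    derivative of an image through the images of derivatives. Induction on the order of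
    differentiation. *)
Lemma derivs_shift P (c : nat -> F) : (forall d, kshift d P = c d *: P) -> forall k d r, inspan (derivs P k) r ->
    exists2 r', inspan (derivs P k) r' & kshift d r' = c d *: r.
Proof.
move=> HP k d.
have lin r : (forall g, g \in derivs P k -> exists2 r', inspan (derivs P k) r' & kshift d r' = c d *: g) ->
    inspan (derivs P k) r -> exists2 r', inspan (derivs P k) r' & kshift d r' = c d *: r.
  move=> H [a ->].
  suff S n : (n <= size (derivs P k))%N -> exists2 r', inspan (derivs P k) r' &
      kshift d r' = c d *: \sum_(i < n) iota (a i) *: nth 0 (derivs P k) i.
    exact: S.
  elim: n => [_|n IHn lt]; first by exists 0; [exact: inspan0|rewrite big_ord0 rmorph0 scaler0].
  have [r1 s1 e1] := IHn (ltnW lt); have [r2 s2 e2] := H _ (mem_nth 0 lt).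
  exists (r1 + iota (a n) *: r2); first by apply: inspanD => //; exact: inspanZ.
  rewrite rmorphD /= e1 kshiftZ sigma_iota e2 big_ord_recr /= scalerDr.
  by rewrite !scalerA [_ * c d]mulrC.
move=> r; apply: lin => {r}; elim: k => [|k IHk] g.
  rewrite inE => /eqP ->; exists P => //; apply: inspan_mem; exact: mem_head.
move=> /allpairsP[[g1 y] /= [g1s _ ->]].
have [r1 s1 e1] := IHk _ g1s.
exists (\sum_y' iota (B d y' y) *: mderiv (yvar y') r1).
  apply: inspan_sum => y'; apply: inspanZ.
  apply: (inspan_lin (h := mderiv (yvar y'))) s1 _ => [x u|g2 g2s].
    exact: mderivZ.
  by apply/inspan_mem/allpairsP; exists (g2, y'); rewrite mem_enum.
rewrite raddf_sum /= -mderivZ -e1 kshift_deriv; apply: eq_bigr => y' _.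
by rewrite kshiftZ sigma_iota.
Qed.

Definition cspan (ws : seq F) (w : F) : Prop := exists c : nat -> K, w = \sum_(i < size ws) iota (c i) * nth 0 ws i.

Lemma inspan_coef (gs : seq {mpoly F[N]}) r m : inspan gs r -> cspan [seq g@_m | g <- gs] r@_m.
Proof.
move=> [c ->]; exists c; rewrite raddf_sum size_map; apply: eq_bigr => i _ /=.
by rewrite mcoeffZ (nth_map 0).
Qed.

Definition ypure m := forall y, m (yvar y) = 0%N.

Lemma deriv0_ypure g m : (forall y, mderiv (yvar y) g = 0) -> g@_m != 0 -> ypure m.
Proof.
move=> dg0 gm0 y; apply/eqP; apply: contraR gm0 => my.
have := congr1 (mcoeff (m - U_(yvar y))%MM) (dg0 y).
rewrite mcoeff_deriv mcoeff0 submK; last first.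
  apply/mnm_lepP => i; rewrite mnm1E; case: eqP => // <-; rewrite lt0n //.
move/eqP; rewrite -mulr_natr mulf_eq0 => /orP[] // /eqP.
by move/eqP; rewrite ((pcharf0P F).1 charF).
Qed.

Lemma kshiftX_pure d m : ypure m -> kshift d 'X_[m] = (piu d m)^-1 *: 'X_[m].
Proof.
move=> pm; rewrite kshiftXm big_split_ord /= big1 ?mul1r; last first.
  by move=> y _; rewrite pm expr0.
rewrite [in RHS]mpolyXE_id big_split_ord /= [X in _ *: (X * _)]big1 ?mul1r; last first.
  by move=> y _; rewrite pm expr0.
rewrite (eq_bigr (fun u => ((pi d u)^-1 ^+ m (uvar u))%:MP * 'X_(uvar u) ^+ m (uvar u))).
  rewrite big_split /= -rmorph_prod mul_mpolyC; congr (_ *: _).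
  by rewrite /piu -prodfV; apply: eq_bigr => u _; rewrite exprVn.
by move=> u _; rewrite shiftvar_u exprZn mul_mpolyC.
Qed.

Lemma kshift_coef_pure d r m : (forall y, mderiv (yvar y) r = 0) -> (kshift d r)@_m = sigma d r@_m / piu d m.
Proof.
move=> dr0; rewrite kshiftE raddf_sum /=.
rewrite (eq_big_seq (fun k => sigma d r@_k / piu d k * (k == m)%:R)); last first.
  move=> k; rewrite mcoeff_msupp => /(deriv0_ypure dr0) pk.
  by rewrite mcoeffZ kshiftX_pure // mcoeffZ mcoeffX mulrA.
have [ms|mNs] := boolP (m \in msupp r).
  rewrite (bigD1_seq m) ?msupp_uniq //= eqxx mulr1 big1 ?addr0 // => k nk.
  by rewrite (negPf nk) mulr0.
rewrite (memN_msupp_eq0 mNs) rmorph0 mul0r big_seq big1 // => k ks.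
by case: eqP => [km|]; rewrite ?mulr0 // -km ks in mNs *.
Qed.

Lemma derivs_mdeg P k g m : g \in derivs P k -> g@_m != 0 -> (mdeg m + k < msize P)%N.
Proof.
elim: k g m => [|k IHk] g m.
  by rewrite inE addn0 => /eqP -> ; rewrite -mcoeff_msupp => /msize_mdeg_lt.
move=> /allpairsP[[g1 y] /= [g1s _ ->]]; rewrite mcoeff_deriv => c0.
have : g1@_(m + U_(yvar y)) != 0 by apply: contra c0 => /eqP ->; rewrite mul0rn.
by move/(IHk _ _ g1s); rewrite mdegD mdeg1 addn1 addSnnS.
Qed.

Hypotheses (relU : forall m, ypure m -> ~ rel 'X_[m]) (indep1 : forall (ws : seq F) (m0 m : 'X_{1..N}),
  (exists u, m (uvar u) != m0 (uvar u)) -> (forall d w, w \in ws -> exists2 w', cspan ws w' &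
     sigma d w' = piu d m / piu d m0 * w) -> forall w, w \in ws -> w = 0) (indep2 : forall ws : seq F,
  (forall d w, w \in ws -> exists2 w', cspan ws w' & sigma d w' = w) -> forall w, w \in ws -> exists x, w = iota x)
 (indep3 : forall (ws : seq F) u (kap : 'I_Ny -> K), (forall d, exists2 u', cspan ws u' &
     sigma d u' = u + \sum_y iota (kap y) * b d y) -> forall y, kap y = 0).

(** A semi-invariant relation is differentiated in the y-variables up to the last order D at which
    something is nonzero. There no y occurs: [indep1] kills every monomial whose u-part is not that
    of the leading monomial, and [indep2] makes the remaining coefficient a constant. If D = 0 the
    relation is a pure u-monomial, against [relU]. Otherwise one order lower the elements are linear
    in the y with constant coefficients [kap], and [indep3] gives kap = 0, against the choice of
    D. *)
Theorem kubota p : rel p -> p = 0.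
Proof.
move=> rp; apply/eqP/negPn/negP => /(semi_invariant rp)[P [rP P0 HP]].
set m0 := mlead P in HP.
have shiftP k d r : inspan (derivs P k) r -> exists2 r', inspan (derivs P k) r' & kshift d r' = (piu d m0)^-1 *: r.
  move=> /(derivs_shift HP d)[r' r's e].
  exists (iota (gammac d m0)^-1 *: r'); first exact: inspanZ.
  rewrite kshiftZ sigma_iota e scalerA mulrA -rmorphM mulVf ?gammac_neq0 //.
  by rewrite rmorph1 mul1r.
have exD : exists k, all (fun g => g == 0) (derivs P k.+1).
  exists (msize P); apply/allP => g gs; apply/eqP/mpolyP => m; rewrite mcoeff0.
  apply/eqP/negPn/negP => /(derivs_mdeg gs).
  by rewrite ltnNge addnS leqW // leq_addl.
case: (ex_minnP exD) => D /allP D0 Dmin.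
have dD0 g y : g \in derivs P D -> mderiv (yvar y) g = 0.
  move=> gs; apply/eqP/D0/allpairsP; exists (g, y); split=> //.
  by rewrite mem_enum.
have dDs r y : inspan (derivs P D) r -> mderiv (yvar y) r = 0.
  move=> [c ->]; rewrite raddf_sum big1 // => i _ /=.
  by rewrite mderivZ dD0 ?scaler0 // mem_nth.
(* The u-part of the leading monomial; it is the only monomial left in the top derivatives. *)
pose mG := [multinom (match split i with inl _ => 0%N | inr u => m0 (uvar u) end) | i < N]%MM.
have mGy : ypure mG by move=> y; rewrite mnmE (unsplitK (inl _ y)).
have mGu u : mG (uvar u) = m0 (uvar u) by rewrite mnmE (unsplitK (inr _ u)).
have piG d : piu d mG = piu d m0 by apply: eq_bigr => u _; rewrite mGu.
have topshift m d w : w \in [seq g@_m | g <- derivs P D] -> exists2 w', cspan [seq g@_m | g <- derivs P D] w' &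
      sigma d w' = piu d m / piu d m0 * w.
  move=> /mapP[g gs ->]; have [r' r's e] := shiftP D d g (inspan_mem gs).
  exists r'@_m; first exact: inspan_coef.
  have := congr1 (mcoeff m) e; rewrite kshift_coef_pure => [|y]; last exact: dDs.
  rewrite mcoeffZ => e2; rewrite -mulrA -e2 mulrC divfK //; exact: piu_neq0.
have topE g : g \in derivs P D -> exists k, g = iota k *: 'X_[mG].
  move=> gs.
  have [|x xE] := indep2 (ws := [seq g@_mG | g <- derivs P D]) _ (map_f _ gs).
    move=> d w /(topshift mG d)[w' w's e]; exists w' => //.
    by rewrite e piG divff ?mul1r ?piu_neq0.
  exists x; apply/mpolyP => m; rewrite mcoeffZ mcoeffX.
  have [<-|nm] := eqVneq mG m; first by rewrite mulr1.
  rewrite mulr0; apply/eqP/negPn/negP => gm0.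
  have pm := deriv0_ypure (fun y => dD0 g y gs) gm0.
  have : g@_m = 0; last by apply/eqP.
  apply: (indep1 (ws := [seq g@_m | g <- derivs P D]) (m0 := m0) (m := m)).
  - apply/existsP; apply: contraR nm; rewrite negb_exists => /forallP H.
    apply/eqP/mnmP => i; case: (splitP i) => j ji.
      have -> : i = yvar j by apply: val_inj.
      by rewrite mGy pm.
    have -> : i = uvar j by apply: val_inj.
    by rewrite mGu; apply/esym/eqP; have := H j; rewrite negbK.
  - exact: topshift.
  - exact: map_f.
case: D => [|D] in D0 Dmin dD0 dDs topshift topE *.
  have [k kE] := topE P (mem_head _ _).
  have k0 : iota k != 0 by apply: contraNneq P0 => k0; rewrite kE k0 scale0r.
  apply: (relU mGy); rewrite -['X_[mG]](scalerK k0) -kE; exact: relZ.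
have /allPn[h hs h0] : ~~ all (fun g => g == 0) (derivs P D.+1).
  by apply/negP => /Dmin; rewrite ltnn.
move: hs h0 => /allpairsP[[g0 y0] /= [g0s _ ->]] h0.
have linE r : inspan (derivs P D) r -> exists kap : 'I_Ny -> K, forall y, mderiv (yvar y) r = iota (kap y) *: 'X_[mG].
  move=> rs; suff : forall y, exists k, mderiv (yvar y) r = iota k *: 'X_[mG].
    by move=> /choice[f fE]; exists f.
  move=> y.
  case: rs => c ->.
  have H i : exists k, i \in derivs P D -> mderiv (yvar y) i = iota k *: 'X_[mG].
    have [is_|] := boolP (i \in derivs P D); last by exists 0.
    have [|k kE] := topE (mderiv (yvar y) i); last by exists k.
    by apply/allpairsP; exists (i, y); rewrite mem_enum.
  have [k kE] := choice H.
  exists (\sum_(i < size (derivs P D)) c i * k (nth 0 (derivs P D) i)).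
  rewrite raddf_sum rmorph_sum scaler_suml; apply: eq_bigr => i _ /=.
  by rewrite mderivZ kE ?mem_nth // scalerA rmorphM.
have mGU y : mG != (mG + U_(yvar y))%MM.
  by apply/eqP => /mnmP/(_ (yvar y)); rewrite mnmDE mnm1E eqxx mGy.
have decomp r kap : (forall y, mderiv (yvar y) r = iota (kap y) *: 'X_[mG]) ->
    exists2 r0, (forall y, mderiv (yvar y) r0 = 0) & r = \sum_y iota (kap y) *: ('X_[mG] * 'X_(yvar y)) + r0.
  move=> H; exists (r - \sum_y iota (kap y) *: ('X_[mG] * 'X_(yvar y))); last first.
    by rewrite addrC subrK.
  move=> y; rewrite mderivB H (raddf_sum (mderiv (yvar y))) (bigD1 y) //= mderivZ mderivM.
  rewrite [mderiv _ 'X_[mG]]mderivX mGy scale0r mul0r add0r.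
  rewrite mderivX mnm1E eqxx scale1r.
  have -> : (U_(yvar y) - U_(yvar y) = 0 :> 'X_{1..N})%MM.
    by apply/mnmP => i; rewrite mnmBE subnn mnm0E.
  rewrite mpolyX0 mulr1 big1 ?addr0 ?subrr // => y' ny.
  rewrite mderivZ mderivM !mderivX mGy mnm1E /yvar (inj_eq (@lshift_inj _ _)).
  by rewrite (negPf ny) !scale0r mul0r mulr0 addr0 scaler0.
have [kap kapE] := linE g0 (inspan_mem g0s).
have [r0 r0y g0E] := decomp _ _ kapE.
have kap0 : forall y, kap y = 0.
  apply: (indep3 (ws := [seq g@_mG | g <- derivs P D]) (u := g0@_mG)) => d.
  have [r' r's e] := shiftP D d g0 (inspan_mem g0s).
  have [kap' kap'E] := linE r' r's; have [r0' r0'y r'E] := decomp _ _ kap'E.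
  have mon y : ('X_[mG] * 'X_(yvar y) : {mpoly F[N]})@_mG = 0.
    by rewrite -mpolyXD mcoeffX eq_sym (negPf (mGU y)).
  exists r'@_mG; first exact: inspan_coef.
  have kapB y : iota (kap y) = \sum_y' iota (B d y' y) * iota (kap' y').
    have := congr1 (mderiv (yvar y)) e.
    rewrite kshift_deriv mderivZ kapE => /(congr1 (mcoeff mG)).
    rewrite !mcoeffZ mcoeffX eqxx mulr1 raddf_sum /= => e2.
    apply: (mulfI (x := (piu d m0)^-1)); first by rewrite invr_eq0 piu_neq0.
    rewrite -e2 mulr_sumr; apply: eq_bigr => y' _.
    rewrite kap'E kshiftZ kshiftX_pure // !mcoeffZ mcoeffX eqxx mulr1 sigma_iota piG.
    by rewrite mulrA [LHS]mulrC.
  have := congr1 (mcoeff mG) e; rewrite {1}r'E rmorphD raddf_sum mcoeffD mcoeffZ.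
  rewrite [(kshift d r0')@__]kshift_coef_pure // => e2.
  have r'G : r'@_mG = r0'@_mG.
    rewrite r'E mcoeffD raddf_sum big1 ?add0r //= => y _.
    by rewrite mcoeffZ mon mulr0.
  rewrite r'G.
  (* At the monomial [mG] the image of a linear term contributes only through the constants
     [- b d y'] of the shifted variables. *)
  have : (\sum_y kshift d (iota (kap' y) *: ('X_[mG] * 'X_(yvar y))))@_mG = - (piu d m0)^-1 * \sum_y iota (kap y) * b d y.
    rewrite raddf_sum /= (eq_bigr (fun y => - (piu d m0)^-1 * \sum_y' iota (kap' y) * iota (B d y y') * b d y')).
      rewrite -mulr_sumr exchange_big /=; congr (_ * _); apply: eq_bigr => y _.
      by rewrite kapB mulr_suml; apply: eq_bigr => y' _; rewrite [iota (kap' _) * _]mulrC.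
    move=> y _; rewrite kshiftZ sigma_iota rmorphM /= kshiftX_pure // kshiftXU.
    rewrite shiftvar_y piG -scalerAl !mcoeffZ mulr_sumr raddf_sum /= !mulNr mulrCA.
    rewrite -mulrN; congr (_ * _).
    rewrite -sumrN mulr_sumr; apply: eq_bigr => y' _.
    rewrite -scalerAr mcoeffZ mulrBr mcoeffB mon sub0r [_ * _%:MP]mulrC mul_mpolyC.
    by rewrite mcoeffZ mcoeffX eqxx mulr1 mulrN mulrN mulrA.
  move=> sE; rewrite sE in e2; move: e2; rewrite piG mulNr addrC => /eqP.
  rewrite subr_eq [_ / _]mulrC -mulrDr => /eqP/mulfI; apply.
  by rewrite invr_eq0 piu_neq0.
by move: h0; rewrite kapE kap0 rmorph0 scale0r eqxx.
Qed.

End Kubota.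
End Criterion.
Import Criterion.

(** Uniqueness of digits in base B. It makes the Kronecker substitution of [point_on_coset]
    injective on the monomials in question. *)
Lemma digits_inj B n (a b : nat -> nat) : (forall i, (i < n)%N -> (a i < B)%N) -> (forall i, (i < n)%N -> (b i < B)%N) ->
  (\sum_(i < n) a i * B ^ i = \sum_(i < n) b i * B ^ i)%N -> forall i, (i < n)%N -> a i = b i.
Proof.
elim: n a b => [//|n IHn] a b aB bB.
have shift (c : nat -> nat) : (\sum_(i < n.+1) c i * B ^ i = c 0%N + B * \sum_(i < n) c i.+1 * B ^ i)%N.
  rewrite big_ord_recl expn0 muln1 big_distrr /=; congr (_ + _)%N.
  by apply: eq_bigr => i _; rewrite /bump /= add1n expnS mulnCA.
rewrite !shift => e.
have B0 : (0 < B)%N by apply: leq_ltn_trans (aB 0%N _).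
have e0 : a 0%N = b 0%N.
  have := congr1 (modn^~ B) e.
  by rewrite -![((_ + B * _) %% B)%N]modnDmr !modnMr !addn0 !modn_small ?aB ?bB.
move: e; rewrite e0 => /addnI/eqP; rewrite eqn_pmul2l // => /eqP e.
case=> [//|i] lt; apply: (IHn (fun i => a i.+1) (fun i => b i.+1)) => // k kn.
  exact: aB.
exact: bB.
Qed.

Lemma nonroot_pchar0 (K : fieldType) (q : {poly K}) : [pchar K] =i pred0 -> q != 0 -> exists2 x : K, x != 0 & ~~ root q x.
Proof.
move=> K0 q0; apply: contrapT => H.
pose s := [seq (i.+1)%:R : K | i <- iota 0 (size q)].
have inj : {in iota 0 (size q) &, injective (fun i : nat => i.+1%:R : K)}.
  move=> i j _ _ /= /eqP; wlog le : i j / (i <= j)%N.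
    by move=> W; case: (leqP i j) => [|/ltnW] le e; [exact: W|apply/esym/W; rewrite // eq_sym].
  rewrite eq_sym -subr_eq0 -natrB ?ltnS // ((pcharf0P K).1 K0) subSS subn_eq0 => le2.
  by apply/eqP; rewrite eqn_leq le le2.
have := @max_poly_roots _ q s q0.
rewrite size_map size_iota ltnn map_inj_in_uniq // iota_uniq => /(_ _ isT).
suff -> : all (root q) s by move/(_ isT).
apply/allP => x /mapP[i _ ->]; apply/negPn/negP => nr; apply: H.
by exists i.+1%:R; rewrite // ((pcharf0P K).1 K0).
Qed.

(** * Points on a hypersurface z^v = c that avoid given polynomials *)

Section Parallel.
Import mpoly.
Variable n : nat.
Implicit Types (a b v m : 'X_{1..n}).

(** Subtraction-free form of v_k (a_i - b_i) = v_i (a_k - b_k), so that [par a b v] means that a - b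
    is parallel to v. *)
Definition cross a b v (i k : 'I_n) : bool := (v k * a i + v i * b k == v i * a k + v k * b i)%N.
Definition par a b v := [forall i, forall k, cross a b v i k].
Lemma parP a b v : reflect (forall i k, cross a b v i k) (par a b v).
Proof. by apply: (iffP forallP) => H i; apply/forallP/H. Qed.

Lemma par_par a b v w : a != b -> par a b v -> par a b w -> forall i k, (v i * w k = v k * w i)%N.
Proof.
move=> ab /parP pv /parP pw i k.
have [i0 ne] : exists i0, a i0 != b i0.
  apply/existsP; apply: contraR ab; rewrite negb_exists => /forallP H.
  by apply/eqP/mnmP => j; apply/eqP; have := H j; rewrite negbK.
have {}ne : (a i0)%:Z - (b i0)%:Z != 0 by rewrite subr_eq0 eqz_nat.
have E (u : 'X_{1..n}) x y : cross a b u x y -> (u y)%:Z * ((a x)%:Z - (b x)%:Z) = (u x)%:Z * ((a y)%:Z - (b y)%:Z).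
  by move=> /eqP /(congr1 Posz); rewrite !PoszD !PoszM; lia.
apply/eqP; rewrite -eqz_nat !PoszM; apply/eqP/(mulIf ne).
have e3 := E _ _ _ (pw i0 i); have e4 := E _ _ _ (pw i0 k); have e5 := E _ _ _ (pv k i).
by rewrite -!mulrA e3 e4 mulrCA e5 mulrCA.
Qed.

Variable K : fieldType.
Hypothesis charK : [pchar K] =i pred0.

(** On z^v = c two monomials whose exponents differ by a multiple of v become proportional and could
    cancel; this excludes such pairs among the monomials of Q. *)
Definition nonpar (Q : {mpoly K[n]}) v := forall a b, a \in msupp Q -> b \in msupp Q -> a != b -> ~~ par a b v.

(* On the coset [z^v = c] we look for a point on a one-parameter curve
   [z_i = xi_i x^(h_i)] with [h] orthogonal to [v]; for a generic [h] the
   monomials of each [Q] restrict to distinct powers of [x]. *)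
Lemma point_on_coset (v : 'X_{1..n}) (c : K) (Qs : seq {mpoly K[n]}) : v != 0%MM -> c != 0 ->
  (forall k, (0 < k)%N -> exists xi : K, xi ^+ k = c) -> (forall Q, Q \in Qs -> Q != 0 /\ nonpar Q v) ->
  exists z : 'I_n -> K, [/\ forall i, z i != 0, \prod_i z i ^+ v i = c & forall Q, Q \in Qs -> Q.@[z] != 0].
Proof.
move=> v0 c0 roots HQ.
have [i0 vi0] : exists i0, v i0 != 0%N.
  apply/existsP; apply: contraR v0; rewrite negb_exists => /forallP H.
  by apply/eqP/mnmP => j; rewrite mnm0E; apply/eqP; have := H j; rewrite negbK.
have [|xi xiE] := roots (v i0); first by rewrite lt0n.
have xi0 : xi != 0 by apply: contraNneq c0 => x0; rewrite -xiE x0 expr0n (negPf vi0).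
pose D := (\sum_(Q <- Qs) msize Q)%N.
have QD Q m i : Q \in Qs -> m \in msupp Q -> (m i <= D)%N.
  move=> Qs_ mQ; apply: (@leq_trans (msize Q)); last first.
    by rewrite /D (big_rem _ Qs_) leq_addr.
  apply: ltnW; apply: leq_ltn_trans (msize_mdeg_lt mQ).
  by rewrite mdegE (bigD1 i) //= leq_addr.
pose Bb := (2 * D * mdeg v).+1.
(* With z_i0 = xi / x^V and z_j = x^(v_i0 B^j) the monomial m becomes xi^(m_i0) times a power of x.
   After multiplication by x^(V D) the exponent of x has these nonnegative base-B digits. Equality
   of all digits for m and m' says that m - m' is parallel to v. *)
pose dig m (i : nat) := (if insub i is Some j then if j == i0 then 0 else v i0 * m j + (D - m i0) * v j else 0)%N.
have vle i : (v i <= mdeg v)%N by rewrite mdegE (bigD1 i) //= leq_addr.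
have digB Q m i : Q \in Qs -> m \in msupp Q -> (dig m i < Bb)%N.
  move=> QQ mQ; rewrite /dig; case: insubP => [j _ _|//]; case: eqP => // _.
  rewrite ltnS -mulnA mul2n -addnn leq_add //.
    by rewrite mulnC leq_mul // (QD Q).
  by rewrite leq_mul // leq_subr.
pose E m := (\sum_(i < n) dig m i * Bb ^ i)%N.
have Einj Q m m' : Q \in Qs -> m \in msupp Q -> m' \in msupp Q -> E m = E m' -> m = m'.
  move=> QQ mQ mQ' e; apply/eqP/negPn/negP => nm.
  case/negP: ((HQ Q QQ).2 m m' mQ mQ' nm).
  have dE i : dig m i = dig m' i.
    case: (ltnP i n) => lt; last by rewrite /dig insubF // ltnNge lt.
    apply: (digits_inj (B := Bb) _ _ e) => // k _; exact: (digB Q).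
  have c0' i : (v i0 * m i + v i * m' i0 = v i0 * m' i + v i * m i0)%N.
    have := dE i; rewrite /dig valK; case: eqP => [->|_]; first by move=> _; rewrite addnC.
    have := QD Q m i0 QQ mQ; have := QD Q m' i0 QQ mQ'; nia.
  have zc i : (v i0)%:Z * ((m i)%:Z - (m' i)%:Z) = (v i)%:Z * ((m i0)%:Z - (m' i0)%:Z).
    by have := c0' i => /(congr1 Posz); rewrite !PoszD !PoszM; lia.
  apply/parP => i k; rewrite /cross -eqz_nat !PoszD !PoszM; apply/eqP.
  have vz : (v i0)%:Z != 0 by rewrite eqz_nat.
  suff : (v k)%:Z * ((m i)%:Z - (m' i)%:Z) = (v i)%:Z * ((m k)%:Z - (m' k)%:Z) by lia.
  by apply: (mulfI vz); rewrite mulrCA zc [RHS]mulrCA zc; ring.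
pose V := (\sum_(i < n | i != i0) v i * Bb ^ i)%N.
pose z (x : K) i := if i == i0 then xi / x ^+ V else x ^+ (v i0 * Bb ^ (i : nat)).
pose qp (Q : {mpoly K[n]}) : {poly K} := \sum_(m <- msupp Q) (Q@_m * xi ^+ m i0) *: 'X^(E m).
have monE x m : x != 0 -> (m i0 <= D)%N -> (\prod_i z x i ^+ m i) * x ^+ (V * D) = xi ^+ m i0 * x ^+ (E m).
  move=> x0 mD; rewrite (bigD1 i0) //= {1}/z eqxx expr_div_n -exprM.
  rewrite (eq_bigr (fun i : 'I_n => x ^+ (v i0 * Bb ^ i * m i))); last first.
    by move=> i ni; rewrite /z (negPf ni) -exprM.
  rewrite -expr_sum -!mulrA; congr (_ * _).
  apply: (mulfI (x := x ^+ (V * m i0))); first by rewrite expf_neq0.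
  rewrite mulVKf ?expf_neq0 // -!exprD; congr (_ ^+ _).
  rewrite /E [in RHS](bigD1 i0) //= /dig valK eqxx mul0n add0n.
  rewrite -[in LHS](subnKC mD) mulnDr addnCA; congr (_ + _)%N.
  rewrite /V big_distrl -big_split /=; apply: eq_bigr => i ni.
  by rewrite valK (negPf ni); ring.
have qpE x Q : Q \in Qs -> x != 0 -> Q.@[z x] * x ^+ (V * D) = (qp Q).[x].
  move=> QQ x0; rewrite mevalE mulr_suml horner_sum.
  apply: eq_big_seq => m mQ; rewrite -mulrA monE ?(QD Q) //.
  by rewrite hornerZ hornerXn mulrA.
have qp0 Q : Q \in Qs -> qp Q != 0.
  move=> QQ; have [Q0 _] := HQ Q QQ; have lQ := mlead_supp Q0.
  apply/eqP => /(congr1 (fun p : {poly K} => p`_(E (mlead Q))))/eqP.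
  rewrite coef0 coef_sum (bigD1_seq _ lQ) ?msupp_uniq //=.
  rewrite coefZ coefXn eqxx mulr1 big_seq_cond big1 ?addr0.
    by rewrite mulf_eq0 mleadc_eq0 (negPf Q0) expf_eq0 (negPf xi0) andbF.
  move=> m /andP[mQ nm]; rewrite coefZ coefXn; case: eqP => [e|]; last by rewrite mulr0.
  by case/eqP: nm; apply: (Einj Q) => //; rewrite e.
have [x x0 nr] : exists2 x : K, x != 0 & ~~ root (\prod_(Q <- Qs) qp Q) x.
  by apply: nonroot_pchar0 => //; rewrite prodf_seq_neq0; apply/allP => Q QQ; rewrite qp0.
exists (z x); split.
- move=> i; rewrite /z; case: ifP => _; last by rewrite expf_neq0.
  by rewrite mulf_neq0 // invr_eq0 expf_neq0.
- rewrite (bigD1 i0) //= {1}/z eqxx expr_div_n xiE.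
  rewrite (eq_bigr (fun i : 'I_n => x ^+ (v i * Bb ^ i * v i0))); last first.
    by move=> i ni; rewrite /z (negPf ni) -exprM; congr (_ ^+ _); ring.
  rewrite -expr_sum -big_distrl /= -exprM divfK ?expf_neq0 //.
move=> Q QQ; apply: contra nr => /eqP Q0; rewrite rootE horner_prod.
rewrite prodf_seq_eq0; apply/hasP; exists Q => //=.
by rewrite -qpE // Q0 mul0r.
Qed.
End Parallel.

(** * Congruences between polynomials in several variables *)

Section Truncation.
Import mpoly.
Variables (K : comNzRingType) (n : nat).
Local Notation Kz := {mpoly K[n]}.
Implicit Types p q r : Kz.

(* Membership in the [J]-th power of the ideal of polynomials vanishing at the
   origin; formal power series are handled as compatible families of
   polynomials modulo these ideals. *)
Definition hord J p := forall a, a \in msupp p -> (J <= mdeg a)%N.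
Definition hcong J p q := hord J (p - q).

Lemma hordP J p : hord J p <-> forall a, (mdeg a < J)%N -> p@_a = 0.
Proof.
split=> H a.
  by move=> lt; apply: memN_msupp_eq0; apply/negP => /H; rewrite leqNgt lt.
by rewrite mcoeff_msupp leqNgt => nz; apply/negP => /H /eqP; rewrite (negPf nz).
Qed.

Lemma hord0 J : hord J 0.
Proof. by move=> a; rewrite msupp0. Qed.
Lemma hordD J p q : hord J p -> hord J q -> hord J (p + q).
Proof. by move=> hp hq a /msuppD_le; rewrite mem_cat => /orP[/hp|/hq]. Qed.
Lemma hordN J p : hord J p -> hord J (- p).
Proof. by move=> hp a; rewrite (perm_mem (msuppN p)) => /hp. Qed.
Lemma hordZ J c p : hord J p -> hord J (c *: p).
Proof. by move=> hp a /msuppZ_le/hp. Qed.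

Lemma hordM J J' p q : hord J p -> hord J' q -> hord (J + J') (p * q).
Proof.
move=> hp hq a /msuppM_le/allpairsP[[x y] /= [/hp lx /hq ly ->]].
by rewrite mdegD leq_add.
Qed.

Lemma hord_any p : hord 0 p. Proof. by []. Qed.
Lemma hordMl J p q : hord J q -> hord J (p * q).
Proof. by move=> hq; rewrite -[J]add0n; apply: hordM. Qed.
Lemma hordMr J p q : hord J p -> hord J (p * q).
Proof. by move=> hp; rewrite mulrC; apply: hordMl. Qed.
Lemma hord_leq J J' p : (J <= J')%N -> hord J' p -> hord J p.
Proof. by move=> le hp a /hp; apply: leq_trans. Qed.

Lemma hord_sum J (I : Type) (s : seq I) (P : pred I) (f : I -> Kz) :
  (forall i, P i -> hord J (f i)) -> hord J (\sum_(i <- s | P i) f i).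
Proof. by move=> H; elim/big_ind: _ => //; [exact: hord0|exact: hordD]. Qed.

Lemma hordX_mnm a : hord (mdeg a) 'X_[a].
Proof. by move=> b /mem_msuppXP <-. Qed.
Lemma hcong_refl J p : hcong J p p.
Proof. by rewrite /hcong subrr; exact: hord0. Qed.
Lemma hcong_sym J p q : hcong J p q -> hcong J q p.
Proof. by rewrite /hcong -opprB => /hordN; rewrite opprK. Qed.
Lemma hcong_trans J q p r : hcong J p q -> hcong J q r -> hcong J p r.
Proof. by move=> h1 h2; have := hordD h1 h2; rewrite addrA subrK. Qed.
Lemma hcongD J p q p' q' : hcong J p p' -> hcong J q q' -> hcong J (p + q) (p' + q').
Proof. by move=> h1 h2; have := hordD h1 h2; rewrite addrACA -opprD. Qed.
Lemma hcongN J p p' : hcong J p p' -> hcong J (- p) (- p').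
Proof. by move/hordN; rewrite opprD. Qed.
Lemma hcongB J p q p' q' : hcong J p p' -> hcong J q q' -> hcong J (p - q) (p' - q').
Proof. by move=> h1 h2; apply: hcongD => //; exact: hcongN. Qed.
Lemma hcongZ J c p p' : hcong J p p' -> hcong J (c *: p) (c *: p').
Proof. by move=> h; rewrite /hcong -scalerBr; exact: hordZ. Qed.

Lemma hcongM J p q p' q' : hcong J p p' -> hcong J q q' -> hcong J (p * q) (p' * q').
Proof.
move=> h1 h2; rewrite /hcong (_ : _ - _ = (p - p') * q + p' * (q - q')); last by ring.
by apply: hordD; [exact: hordMr|exact: hordMl].
Qed.

Lemma hcongX J k p p' : hcong J p p' -> hcong J (p ^+ k) (p' ^+ k).
Proof.
move=> h; elim: k => [|k IHk]; first exact: hcong_refl.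
by rewrite !exprS; exact: hcongM.
Qed.

Lemma hcong_sum J (I : Type) (s : seq I) (P : pred I) (f g : I -> Kz) : (forall i, P i -> hcong J (f i) (g i)) ->
  hcong J (\sum_(i <- s | P i) f i) (\sum_(i <- s | P i) g i).
Proof. by move=> H; rewrite /hcong -sumrB; apply: hord_sum. Qed.

Lemma hcong_prod J (I : Type) (s : seq I) (P : pred I) (f g : I -> Kz) : (forall i, P i -> hcong J (f i) (g i)) ->
  hcong J (\prod_(i <- s | P i) f i) (\prod_(i <- s | P i) g i).
Proof. by move=> H; elim/big_ind2: _ => // *; [exact: hcong_refl|exact: hcongM]. Qed.

Lemma hcong0 J p : hcong J p 0 <-> hord J p.
Proof. by rewrite /hcong subr0. Qed.
Lemma hcong_hord J p q : hcong J p q -> hord J q -> hord J p.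
Proof. by move=> /hordD h /h; rewrite subrK. Qed.

End Truncation.

(** * Formal independence *)

Lemma divfMl (E : fieldType) (x y b : E) : b != 0 -> x / y = (x * b) / (b * y).
Proof. by move=> b0; rewrite [b * y]mulrC -mulf_div divff // mulr1. Qed.
Lemma divfMr (E : fieldType) (x y b : E) : b != 0 -> x / y = (x * b) / (y * b).
Proof. by move=> b0; rewrite -mulf_div divff // mulr1. Qed.

Lemma ratio_down (E : fieldType) (a b r s w : E) : a != 0 -> b != 0 -> r != 0 ->
  s != 0 -> w = a * (s / r * ((b * r) / ((a * b) * s) * w)).
Proof. by move=> *; field; apply/and4P; split. Qed.

Lemma ratio_up (E : fieldType) (a b r s w : E) : b != 0 -> s != 0 -> ((a * b) * r) / (b * s) * w = a * (r / s * w).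
Proof. by move=> *; field; apply/andP; split. Qed.
Lemma clear_den (E : fieldType) (a a' d s p : E) : d != 0 -> s != 0 -> a' / s = a / d + p -> d * a' = a * s + p * d * s.
Proof. by move=> d0 s0 e; rewrite -[a'](divfK s0) e; field. Qed.

Section Formal.
Import mpoly.
Variables (K : fieldType) (n : nat).
Hypothesis charK : [pchar K] =i pred0.
Local Notation Kz := {mpoly K[n]}.

(* The fraction field of [Kz] is kept abstract: testing a concrete fraction for
   zero by computation is hopeless. *)
Variables (F : fieldType) (tf : {rmorphism Kz -> F}).
Hypotheses (tf_inj : injective tf) (tf_frac : forall x : F, exists a b, b != 0 /\ x = tf a / tf b).
Local Notation "x %:F" := (tf x).

Let tofracM : {morph tf : x y / x * y}. Proof. exact: rmorphM. Qed.
Let tofracD : {morph tf : x y / x + y}. Proof. exact: rmorphD. Qed.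
Let tofrac1 : tf 1 = 1. Proof. exact: rmorph1. Qed.
Let tofrac0 : tf 0 = 0. Proof. exact: rmorph0. Qed.
Let tofrac_eq p q : (tf p == tf q) = (p == q). Proof. exact: inj_eq. Qed.
Let tofrac_eq0 p : (tf p == 0) = (p == 0). Proof. by rewrite -tofrac0 tofrac_eq. Qed.

Variable Om : 'X_{1..n} -> 'X_{1..n}.
Hypotheses (OmD : forall a b, Om (a + b)%MM = (Om a + Om b)%MM) (Om_inj : injective Om)
 (mdeg_Om : forall a, (mdeg a <= mdeg (Om a))%N).
Local Notation om d := (iter d Om).

Lemma om0 d : om d 0%MM = 0%MM.
Proof.
elim: d => //= d ->; have /esym := OmD 0%MM 0%MM; rewrite addm0.
by rewrite -[RHS]addm0 => /addmI.
Qed.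

Lemma omD d a b : om d (a + b)%MM = (om d a + om d b)%MM.
Proof. by elim: d => //= d ->; rewrite OmD. Qed.
Lemma omMn d a k : om d (a *+ k)%MM = (om d a *+ k)%MM.
Proof. by elim: k => [|k IHk]; rewrite ?mulm0n ?om0 // !mulmS omD IHk. Qed.
Lemma om_inj d : injective (iter d Om).
Proof. by elim: d => [//|d IHd] a b /= /Om_inj/IHd. Qed.
Lemma mdeg_om d a : (mdeg a <= mdeg (om d a))%N.
Proof. by elim: d => //= d IHd; apply: leq_trans (mdeg_Om _). Qed.
Definition sg d : Kz -> Kz := mmap (@mpolyC n K) (fun i => 'X_[om d U_(i)%MM]).
HB.instance Definition _ d := GRing.RMorphism.on (sg d).
Lemma sgC d c : sg d c%:MP = c%:MP.
Proof. by rewrite /sg mmapC. Qed.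
Lemma sgZ d c p : sg d (c *: p) = c *: sg d p.
Proof. by rewrite /sg mmapZ mul_mpolyC. Qed.

Lemma sgX d a : sg d 'X_[a] = 'X_[om d a].
Proof.
rewrite /sg mmapX /mmap1 [in RHS](multinomUE_id a).
rewrite (big_morph (om d) (omD d) (om0 d)) -mprodXE; apply: eq_bigr => i _.
by rewrite omMn mpolyXn.
Qed.

Lemma sgE d p : sg d p = \sum_(a <- msupp p) p@_a *: 'X_[om d a].
Proof.
by rewrite {1}[p]mpolyE raddf_sum; apply: eq_bigr => a _; rewrite /= sgZ sgX.
Qed.

Lemma sg_coef d p a : (sg d p)@_(om d a) = p@_a.
Proof.
rewrite sgE raddf_sum /=; have [as_|aNs] := boolP (a \in msupp p).
  rewrite (bigD1_seq a) ?msupp_uniq //= mcoeffZ mcoeffX eqxx mulr1 big1 ?addr0 //.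
  by move=> b ba; rewrite mcoeffZ mcoeffX (inj_eq (@om_inj d)) (negPf ba) mulr0.
rewrite (memN_msupp_eq0 aNs) big_seq big1 // => b bs.
rewrite mcoeffZ mcoeffX (inj_eq (@om_inj d)); case: eqP => [ba|]; last by rewrite mulr0.
by rewrite -ba bs in aNs.
Qed.

Lemma sg_supp d p : {subset msupp (sg d p) <= [seq om d a | a <- msupp p]}.
Proof.
move=> b; rewrite sgE => /msupp_sum_le /flatten_mapP[a].
rewrite filter_predT => as_ /msuppZ_le /mem_msuppXP <-; exact: map_f.
Qed.

Lemma sg_inj d : injective (sg d).
Proof. by move=> p q e; apply/mpolyP => a; rewrite -(sg_coef d) e sg_coef. Qed.

Lemma sg_eq0 d p : (sg d p == 0) = (p == 0).
Proof. by rewrite -{1}(rmorph0 (sg d)) (inj_eq (@sg_inj d)). Qed.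
Definition iotaF : K -> F := tf \o @mpolyC n K.
HB.instance Definition _ := GRing.RMorphism.on iotaF.

Variable sigF : nat -> {rmorphism F -> F}.
Hypothesis sigF_tofrac : forall d p, sigF d p%:F = (sg d p)%:F.

Lemma sigF_iota d x : sigF d (iotaF x) = iotaF x.
Proof. by rewrite /iotaF /= sigF_tofrac sgC. Qed.
Lemma charF : [pchar F] =i pred0.
Proof. by move=> p; rewrite (fmorph_pchar iotaF) charK. Qed.

Variable vv : nat -> 'X_{1..n}.
Hypotheses (vvS : forall j, vv j.+1 = Om (vv j)) (vv0_neq0 : vv 0%N != 0%MM) (npar : forall j k, j != k -> exists i i',
  (vv j i * vv k i' != vv j i' * vv k i)%N)
 (orb : forall a b s t, a != b -> for_large d, (iter d Om a + s != iter d Om b + t)%MM).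

Lemma vvD d j : vv (d + j) = om d (vv j).
Proof. by elim: d => //= d <-; rewrite -vvS. Qed.

Lemma monomial_neq0 j : vv j != 0%MM.
Proof.
by rewrite -mdeg_eq0 -lt0n (leq_trans _ (_ : mdeg (vv 0%N) <= _)%N) // ?lt0n ?mdeg_eq0 // -[j]addn0 vvD mdeg_om.
Qed.

Definition lin (beta : K) j : Kz := 1 - beta *: 'X_[vv j].

Lemma lin_neq0 beta j : lin beta j != 0.
Proof.
apply/eqP => /(congr1 (mcoeff 0%MM))/eqP; rewrite mcoeffB mcoeff1 mcoeffZ mcoeffX mcoeff0.
by rewrite eqxx (negPf (monomial_neq0 j)) mulr0 subr0 oner_eq0.
Qed.

Lemma linF_neq0 beta j : (lin beta j)%:F != 0.
Proof. by rewrite tofrac_eq0 lin_neq0. Qed.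
Lemma sg_lin d beta j : sg d (lin beta j) = lin beta (d + j).
Proof. by rewrite /lin rmorphB rmorph1 /= sgZ sgX vvD. Qed.
Lemma meval_lin z beta j : (lin beta j).@[z] = 1 - beta * \prod_i z i ^+ vv j i.
Proof. by rewrite /lin mevalB meval1 mevalZ mevalX. Qed.
Definition badidx (S : seq 'X_{1..n}) d j (q : 'X_{1..n} * 'X_{1..n} * bool) :=
  (q.1.1 != q.1.2) && (if q.2 then par q.1.1 q.1.2 (vv j) else par (om d q.1.1) (om d q.1.2) (vv j)).
Definition goodidx (S : seq 'X_{1..n}) d j := forall a b, a \in S -> b \in S ->
  a != b -> ~~ par a b (vv j) && ~~ par (om d a) (om d b) (vv j).

(** The vectors [vv j] are pairwise nonparallel, so each pair of distinct exponents, and its image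
    under the injective iterate, excludes at most one j. The bound, twice the number of pairs, does
    not depend on d, which leaves d free to be chosen later. *)
Lemma few_bad (S : seq 'X_{1..n}) : exists N, forall d (js : seq nat),
  uniq js -> (N < size js)%N -> exists2 j, j \in js & goodidx S d j.
Proof.
pose PP := [seq (x, t) | x <- [seq (a, b) | a <- S, b <- S], t <- [:: true; false]].
exists (size PP) => d js ujs ltN; apply: contrapT => H.
have bad j : j \in js -> has (badidx S d j) PP.
  move=> jjs; apply/negPn/negP => /hasPn nb; apply: H; exists j => // a b aS bS ab.
  have inP t : ((a, b), t) \in PP.
    apply/allpairsP; exists ((a, b), t); split=> //=; last by case: t.
    by apply/allpairsP; exists (a, b).
  by have := nb _ (inP true); have := nb _ (inP false); rewrite /badidx /= ab => -> ->.
pose f j := nth (0%MM, 0%MM, true) PP (find (badidx S d j) PP).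
have fP j : j \in js -> badidx S d j (f j) by move/bad => /(nth_find _); apply.
have finj : {in js &, injective f}.
  move=> j k jjs kjs e; apply/eqP/negPn/negP => /npar[i [i' /eqP]]; apply.
  have := fP j jjs; have := fP k kjs; rewrite e /badidx; case: (f k) => [[a b] t] /=.
  case/andP=> ab; case: t => [pk /andP[_ pj]|pk /andP[_ pj]].
    exact: par_par ab pj pk _ _.
  by apply: par_par pj pk _ _; rewrite (inj_eq (@om_inj d)).
have : (size [seq f j | j <- js] <= size PP)%N.
  apply: uniq_leq_size; first by rewrite map_inj_in_uniq.
  move=> x /mapP[j jjs ->]; rewrite /f mem_nth // -has_find; exact: bad.
by rewrite size_map leqNgt ltN.
Qed.

Lemma good_point (S : seq 'X_{1..n}) d j beta (Qs : seq Kz) (L : seq (K * nat)) : goodidx S d j -> beta != 0 ->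
  (forall k, (0 < k)%N -> exists xi : K, xi ^+ k = beta^-1) -> (forall Q, Q \in Qs -> {subset msupp Q <= S}) ->
  exists z : 'I_n -> K, [/\ forall i, z i != 0, \prod_i z i ^+ vv j i = beta^-1,
    forall Q, Q \in Qs -> Q != 0 -> Q.@[z] != 0 /\ (sg d Q).@[z] != 0
    & forall c k, (c, k) \in L -> k != j -> (lin c k).@[z] != 0].
Proof.
move=> good b0 roots QS.
pose Q0 := [seq Q <- Qs | Q != 0].
pose L0 := [seq x <- L | x.2 != j].
pose All := Q0 ++ [seq sg d Q | Q <- Q0] ++ [seq lin x.1 x.2 | x <- L0].
have [|||Q|z [z0 zv zQ]] := @point_on_coset n K charK (vv j) beta^-1 All.
- exact: monomial_neq0.
- by rewrite invr_eq0.
- exact: roots.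
- rewrite !mem_cat => /or3P[].
  + rewrite mem_filter => /andP[nQ QQ]; split=> // a b aQ bQ ab.
    by have /andP[] := good a b (QS _ QQ _ aQ) (QS _ QQ _ bQ) ab.
  + move=> /mapP[Q1]; rewrite mem_filter => /andP[nQ QQ ->]; split.
      by rewrite sg_eq0.
    move=> a b /sg_supp/mapP[a1 aQ ->] /sg_supp/mapP[b1 bQ ->].
    rewrite (inj_eq (@om_inj d)) => ab.
    by have /andP[] := good a1 b1 (QS _ QQ _ aQ) (QS _ QQ _ bQ) ab.
  + move=> /mapP[[c k]]; rewrite mem_filter /= => /andP[kj _ ->].
    split; first exact: lin_neq0.
    have sub : {subset msupp (lin c k) <= [:: 0%MM; vv k]}.
      move=> a /msuppB_le; rewrite mem_cat msupp1 !inE => /orP[->//|/msuppZ_le].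
      by move/mem_msuppXP => ->; rewrite eqxx orbT.
    have np : ~~ par 0%MM (vv k) (vv j).
      apply/negP => /parP H; have [i [i' /eqP]] := npar kj; apply.
      by have := H i i'; rewrite /cross !mnm0E !muln0 !add0n => /eqP e; rewrite mulnC -e mulnC.
    move=> a b /sub; rewrite !inE => /orP[] /eqP -> /sub; rewrite !inE => /orP[] /eqP ->.
    * by rewrite eqxx.
    * by [].
    * move=> _; apply: contra np => /parP H; apply/parP => i i'.
      by have /eqP := H i i'; rewrite /cross !mnm0E; lia.
    * by rewrite eqxx.
exists z; split=> //.
- move=> Q QQ nQ; split; apply: zQ; rewrite !mem_cat.
    by rewrite mem_filter nQ QQ.
  by rewrite (map_f (sg d)) ?orbT // mem_filter nQ.
- move=> c k cL kj; apply: zQ; rewrite !mem_cat; apply/or3P/Or33.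
  by apply/mapP; exists (c, k) => //; rewrite mem_filter kj.
Qed.

(** [x] is regular at [z] with value [c]. A relation is used because a fraction has no preferred
    numerator and denominator; [EV_inj] gives uniqueness of the value. *)
Definition EV z (x : F) (c : K) := exists p q : Kz, [/\ q.@[z] != 0, x = p%:F / q%:F & c = p.@[z] / q.@[z]].
Lemma EV_q0 z (q : Kz) : q.@[z] != 0 -> q != 0.
Proof. by apply: contraNneq => ->; rewrite meval0. Qed.

Lemma EV_inj z x c c' : EV z x c -> EV z x c' -> c = c'.
Proof.
move=> [p [q [q0 -> ->]]] [p' [q' [q'0 + ->]]]; move/eqP.
rewrite eqr_div ?tofrac_eq0 ?(EV_q0 q0) ?(EV_q0 q'0) //.
rewrite -!tofracM tofrac_eq => /eqP/(congr1 (meval z)).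
by rewrite !mevalM => e; apply/eqP; rewrite eqr_div //; apply/eqP.
Qed.

Lemma EV_poly z (p : Kz) : EV z p%:F p.@[z].
Proof. by exists p, 1; rewrite meval1 tofrac1 !divr1 oner_eq0. Qed.
Lemma EV_div z (p q : Kz) : q.@[z] != 0 -> EV z (p%:F / q%:F) (p.@[z] / q.@[z]).
Proof. by exists p, q. Qed.

Lemma EVM z x y c c' : EV z x c -> EV z y c' -> EV z (x * y) (c * c').
Proof.
move=> [p [q [q0 -> ->]]] [p' [q' [q'0 -> ->]]].
exists (p * p'), (q * q'); rewrite !mevalM mulf_neq0 //.
by rewrite !mulf_div -!tofracM.
Qed.

Lemma EVD z x y c c' : EV z x c -> EV z y c' -> EV z (x + y) (c + c').
Proof.
move=> [p [q [q0 -> ->]]] [p' [q' [q'0 -> ->]]].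
exists (p * q' + p' * q), (q * q'); rewrite mevalD !mevalM mulf_neq0 //.
by rewrite !addf_div // ?tofrac_eq0 ?(EV_q0 q0) ?(EV_q0 q'0) // -!tofracM -tofracD.
Qed.

Lemma EV_iota z c : EV z (iotaF c) c.
Proof. by have := EV_poly z c%:MP; rewrite mevalC. Qed.
Lemma EV0 z : EV z 0 0.
Proof. rewrite -{1}(rmorph0 iotaF); exact: EV_iota. Qed.
Lemma EV1 z : EV z 1 1.
Proof. rewrite -{1}(rmorph1 iotaF); exact: EV_iota. Qed.

Lemma EVB z x y c c' : EV z x c -> EV z y c' -> EV z (x - y) (c - c').
Proof.
move=> ex ey; apply: EVD => //; rewrite -mulN1r -[- c']mulN1r; apply: EVM => //.
by rewrite -[1](rmorph1 iotaF) -rmorphN; exact: EV_iota.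
Qed.

Lemma EVX z x c k : EV z x c -> EV z (x ^+ k) (c ^+ k).
Proof.
by move=> e; elim: k => [|k IHk]; rewrite ?expr0 ?exprS; [exact: EV1|exact: EVM].
Qed.

Lemma EV_sum z (I : Type) (r : seq I) (P : pred I) (f : I -> F) (g : I -> K) :
  (forall i, P i -> EV z (f i) (g i)) -> EV z (\sum_(i <- r | P i) f i) (\sum_(i <- r | P i) g i).
Proof. by move=> H; elim/big_ind2: _ => // *; [exact: EV0|exact: EVD]. Qed.

Lemma EV_prod z (I : Type) (r : seq I) (P : pred I) (f : I -> F) (g : I -> K) :
  (forall i, P i -> EV z (f i) (g i)) -> EV z (\prod_(i <- r | P i) f i) (\prod_(i <- r | P i) g i).
Proof. by move=> H; elim/big_ind2: _ => // *; [exact: EV1|exact: EVM]. Qed.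

Lemma EVV z x c : EV z x c -> c != 0 -> EV z x^-1 c^-1.
Proof.
move=> [p [q [q0 -> ->]]]; rewrite mulf_eq0 invr_eq0 negb_or => /andP[p0 _].
by exists q, p; rewrite !invf_div.
Qed.

Lemma common_den (ws : seq F) : exists2 D : Kz, D != 0 &
  exists A : nat -> Kz, forall i, (i < size ws)%N -> nth 0 ws i = (A i)%:F / D%:F.
Proof.
elim: ws => [|w ws [D D0 [A AE]]]; first by exists 1; rewrite ?oner_eq0 //; exists (fun=> 0).
have [a [b [b0 ->]]] := tf_frac w; exists (b * D); first by rewrite mulf_neq0.
have bF : b%:F != 0 by rewrite tofrac_eq0.
have DF : D%:F != 0 by rewrite tofrac_eq0.
exists (fun i => if i is i'.+1 then A i' * b else a * D).
case=> [_|i lt]; rewrite [RHS]/= !tofracM; first exact: divfMr.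
rewrite -(divfMl _ _ bF); exact: AE.
Qed.

(** The support S depends on [ws] alone. The elements [w'] that the independence hypotheses supply
    for each d thus have numerators in one fixed finite-dimensional space, and d may be chosen after
    S. *)
Lemma common_den_span (ws : seq F) : exists2 D : Kz, D != 0 & exists2 S : seq 'X_{1..n}, {subset msupp D <= S} &
  forall w, cspan iotaF ws w -> exists2 A : Kz, {subset msupp A <= S} & w = A%:F / D%:F.
Proof.
have [D D0 [A AE]] := common_den ws; exists D => //.
exists (msupp D ++ flatten [seq msupp (A i) | i <- iota 0 (size ws)]).
  by move=> a aD; rewrite mem_cat aD.
move=> w [c ->]; exists (\sum_(i < size ws) c i *: A i).
  move=> a /msupp_sum_le /flatten_mapP[i _ /msuppZ_le aA]; rewrite mem_cat; apply/orP; right.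
  by apply/flatten_mapP; exists (val i); first by rewrite mem_iota add0n ltn_ord.
rewrite raddf_sum mulr_suml; apply: eq_bigr => i _ /=.
by rewrite (AE _ (ltn_ord i)) -mul_mpolyC tofracM mulrA.
Qed.

Lemma cspan_mem (ws : seq F) w : w \in ws -> cspan iotaF ws w.
Proof.
move=> wws; have lt : (index w ws < size ws)%N by rewrite index_mem.
exists (fun i => (i == index w ws)%:R).
rewrite (bigD1 (Ordinal lt)) //= eqxx rmorph1 mul1r nth_index //.
rewrite big1 ?addr0 // => i ni; suff -> : (i == index w ws :> nat) = false.
  by rewrite rmorph0 mul0r.
by apply: contra_neqF ni => /eqP e; apply: val_inj.
Qed.

Variables (Ny Nu : nat) (phi : 'I_Ny -> nat -> K) (by_ : 'I_Ny -> K)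
  (my : 'I_Ny -> nat) (bu : 'I_Nu -> K) (B : nat -> 'I_Ny -> 'I_Ny -> K).
Hypotheses (bu_neq0 : forall u, bu u != 0) (bu_inj : injective bu)
 (by_roots : forall y, by_ y != 0 -> forall k, (0 < k)%N -> exists xi : K, xi ^+ k = (by_ y)^-1)
 (bu_roots : forall u k, (0 < k)%N -> exists xi : K, xi ^+ k = (bu u)^-1)
 (B_trig : forall d (y y' : 'I_Ny), B d y y' != 0 -> (y <= y')%N) (B_diag : forall d y, B d y y != 0)
 (B_type : forall d y y', B d y y' != 0 -> by_ y = by_ y' /\ my y = my y')
 (B_phi : forall d y j, \sum_y' B d y y' * phi y' (d + j)%N = phi y j).
(** The coefficient with which the combination [kap] has a pole of order m + 1 along 1 = beta z^(vv
    j); for beta = 0 it is the coefficient of z^((m + 1) vv j). *)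
Definition Cphi (kap : 'I_Ny -> K) beta m j := \sum_(y | (by_ y == beta) && (my y == m)) kap y * phi y j.
Hypothesis phi_ind : forall kap beta m, (exists y, [/\ by_ y = beta, my y = m & kap y != 0]) ->
  forall j0, exists2 j, (j0 <= j)%N & Cphi kap beta m j != 0.

Local Notation NN := (Ny + Nu)%N.
Local Notation yvar := (@yvar Ny Nu).
Local Notation uvar := (@uvar Ny Nu).

Definition bF d y : F := \sum_(j < d) iotaF (phi y j) * ('X_[vv j] : Kz)%:F ^+ (my y).+1 / (lin (by_ y) j)%:F ^+ (my y).+1.
Definition piF d u : F := \prod_(j < d) (lin (bu u) j)%:F.
Lemma piF_neq0 d u : piF d u != 0.
Proof. by apply/prodf_neq0 => j _; exact: linF_neq0. Qed.

(* At a point of the hypersurface [1 = b M_j] lying on no other hypersurface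
   [1 = b' M_j'], exactly one factor of [piF] vanishes. *)
Lemma indep1F (ws : seq F) (m0 m : 'X_{1..NN}) : (exists u, m (uvar u) != m0 (uvar u)) ->
  (forall d w, w \in ws -> exists2 w', cspan iotaF ws w' & sigF d w' = piu piF d m / piu piF d m0 * w) ->
  forall w, w \in ws -> w = 0.
Proof.
move=> [u0 mu0] H w wws.
have [D D0 [S DS span]] := common_den_span ws.
have [N few] := few_bad S.
pose d := N.+1.
have [|j] := few d (iota 0 d) (iota_uniq _ _); first by rewrite size_iota.
rewrite mem_iota add0n /= => jd good.
have [w' w's eq] := H d w wws.
have [A' A'S w'E] := span _ w's.
have [A AS wE] := span _ (cspan_mem wws).
pose L := [seq (bu u, k) | u <- enum 'I_Nu, k <- iota 0 d].
have [|z [z0 zv zQ zL]] := good_point (Qs := [:: D; A; A']) L good (bu_neq0 u0) (@bu_roots u0).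
  by move=> Q; rewrite !inE => /or3P[] /eqP ->.
have [Dz sDz] := zQ D (mem_head _ _) D0.
pose t := (lin (bu u0) j)%:F : F.
have tz : EV z t 0.
  by have := EV_poly z (lin (bu u0) j); rewrite meval_lin zv divff ?bu_neq0 // subrr.
have linz u k : (k < d)%N -> (u, k) != (u0, j) -> (lin (bu u) k).@[z] != 0.
  move=> kd ne; have [kj|kj] := eqVneq k j; last first.
    apply: zL => //; apply/allpairsP; exists (u, k).
    by rewrite mem_enum mem_iota.
  rewrite meval_lin kj zv subr_eq0 eq_sym; apply: contra ne => /eqP e.
  rewrite kj xpair_eqE eqxx andbT; apply/eqP/bu_inj.
  by apply: (mulIf (x := (bu u0)^-1)); rewrite ?invr_eq0 ?bu_neq0 // e divff ?bu_neq0.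
have piE (k : 'X_{1..NN}) : exists2 rho : F, piu piF d k = t ^+ k (uvar u0) * rho & exists2 c, EV z rho c & c != 0.
  exists ((\prod_(i < d | i != j :> nat) (lin (bu u0) i)%:F) ^+ k (uvar u0) * \prod_(u | u != u0) piF d u ^+ k (uvar u)).
    rewrite /piu (bigD1 u0) //= mulrA -exprMn; congr (_ ^+ _ * _).
    by rewrite /piF (bigD1 (Ordinal jd)).
  exists ((\prod_(i < d | i != j :> nat) (lin (bu u0) i).@[z]) ^+ k (uvar u0) *
    \prod_(u | u != u0) (\prod_(i < d) (lin (bu u) i).@[z]) ^+ k (uvar u)).
    apply: EVM; first by apply/EVX/EV_prod => i _; exact: EV_poly.
    by apply: EV_prod => u _; apply/EVX/EV_prod => i _; exact: EV_poly.
  rewrite mulf_neq0 // ?expf_neq0 //.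
    apply/prodf_neq0 => i ij; apply: linz => //.
    by rewrite xpair_eqE eqxx (negPf ij).
  apply/prodf_neq0 => u nu; rewrite expf_neq0 //; apply/prodf_neq0 => i _.
  by apply: linz => //; rewrite xpair_eqE (negPf nu).
have [r rE [c rc c0]] := piE m; have [r0 r0E [c' r0c c'0]] := piE m0.
have t0 : t != 0 by exact: linF_neq0.
have rn0 x y : EV z x y -> y != 0 -> x != 0.
  move=> e y0; apply: contraNneq y0 => x0.
  by rewrite x0 in e; rewrite (EV_inj e (EV0 z)).
have wz : EV z w (A.@[z] / D.@[z]) by rewrite wE; exact: EV_div.
have swz : EV z (sigF d w') ((sg d A').@[z] / (sg d D).@[z]).
  by rewrite w'E fmorph_div /= !sigF_tofrac; exact: EV_div.
(* A positive power of the vanishing factor t divides w in one case and [sigF d w'] in the other. So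
   the numerator vanishes at z, where by choice of z only the zero polynomial of the list
   vanishes. *)
case: (ltngtP (m (uvar u0)) (m0 (uvar u0))) => [lt|lt|e]; last by rewrite e eqxx in mu0.
- have wE2 : w = t ^+ (m0 (uvar u0) - m (uvar u0)) * (r0 / r * sigF d w').
    have tE : t ^+ m0 (uvar u0) = t ^+ (m0 (uvar u0) - m (uvar u0)) * t ^+ m (uvar u0).
      by rewrite -exprD subnK // ltnW.
    rewrite eq rE r0E tE; apply: ratio_down; rewrite ?expf_neq0 //.
      exact: rn0 rc c0.
    exact: rn0 r0c c'0.
  have : EV z w (0 ^+ (m0 (uvar u0) - m (uvar u0)) * (c' / c * ((sg d A').@[z] / (sg d D).@[z]))).
    rewrite wE2; apply: EVM; first exact: EVX tz.
    by apply: EVM swz; apply: EVM r0c _; exact: EVV rc c0.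
  rewrite expr0n subn_eq0 leqNgt lt mul0r => /(EV_inj wz)/eqP.
  rewrite mulf_eq0 invr_eq0 (negPf Dz) orbF => Az.
  have [A0|A0] := eqVneq A 0; first by rewrite wE A0 tofrac0 mul0r.
  by have [|] := zQ A _ A0; rewrite ?Az // !inE eqxx orbT.
- have sE : sigF d w' = t ^+ (m (uvar u0) - m0 (uvar u0)) * (r / r0 * w).
    have tE : t ^+ m (uvar u0) = t ^+ (m (uvar u0) - m0 (uvar u0)) * t ^+ m0 (uvar u0).
      by rewrite -exprD subnK // ltnW.
    rewrite eq rE r0E tE; apply: ratio_up; rewrite ?expf_neq0 //.
    exact: rn0 r0c c'0.
  have : EV z (sigF d w') (0 ^+ (m (uvar u0) - m0 (uvar u0)) * (c / c' * (A.@[z] / D.@[z]))).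
    rewrite sE; apply: EVM; first exact: EVX tz.
    by apply: EVM wz; apply: EVM rc _; exact: EVV r0c c'0.
  rewrite expr0n subn_eq0 leqNgt lt mul0r => /(EV_inj swz)/eqP.
  rewrite mulf_eq0 invr_eq0 (negPf sDz) orbF => Az.
  have [A0|A0] := eqVneq A' 0; last first.
    by have [|_] := zQ A' _ A0; rewrite ?Az // !inE eqxx !orbT.
  move: eq; rewrite w'E A0 tofrac0 mul0r rmorph0 => /esym/eqP.
  rewrite mulf_eq0 mulf_eq0 invr_eq0 (negPf (piu_neq0 (@piF_neq0) _ _)).
  by rewrite (negPf (piu_neq0 (@piF_neq0) _ _)) => /eqP.
Qed.

Lemma orb_seq (S T : seq 'X_{1..n}) : for_large d, forall a b s t, a \in S -> b \in S -> s \in T -> t \in T ->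
  (om d a + s = om d b + t)%MM -> a = b.
Proof.
have H (q : 'X_{1..n} * 'X_{1..n} * ('X_{1..n} * 'X_{1..n})) : exists d0, forall d,
    (d0 <= d)%N -> (om d q.1.1 + q.2.1 = om d q.1.2 + q.2.2)%MM -> q.1.1 = q.1.2.
  case: q => [[a b] [s t]] /=; have [->|ab] := eqVneq a b; first by exists 0%N.
  by have [d0 Hd] := orb s t ab; exists d0 => d /Hd/eqP.
have [f fP] := choice H.
exists (\sum_(q <- [seq (x, y) | x <- [seq (a, b) | a <- S, b <- S], y <- [seq (s, t) | s <- T, t <- T]]) f q)%N.
move=> d le a b s t aS bS sT tT e.
apply: (fP ((a, b), (s, t)) d _ e); apply: leq_trans le.
have inP : ((a, b), (s, t)) \in [seq (x, y) | x <- [seq (a, b) | a <- S, b <- S], y <- [seq (s, t) | s <- T, t <- T]].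
  by apply/allpairsP; exists ((a, b), (s, t)); split=> //=; apply/allpairsP; [exists (a, b)|exists (s, t)].
by rewrite (big_rem _ inP) leq_addr.
Qed.

Lemma mcoeffM_sg d p q a b : (forall a' b', a' \in msupp p -> b' \in msupp q -> (om d b' + a' = om d b + a)%MM -> b' = b) ->
  (p * sg d q)@_(om d b + a)%MM = p@_a * q@_b.
Proof.
move=> H; rewrite [p in p * _]mpolyE (sgE d q) mulr_suml raddf_sum /=.
have term a' b' : (p@_a' *: 'X_[a'] * (q@_b' *: 'X_[om d b']))@_(om d b + a)%MM
    = p@_a' * q@_b' * ((om d b' + a')%MM == (om d b + a)%MM)%:R.
  rewrite -scalerAl -scalerAr -mpolyXD !mcoeffZ mcoeffX mulrA addmC.
  by [].
rewrite (eq_big_seq (fun a' => p@_a' * q@_b * (a' == a)%:R)); last first.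
  move=> a' a'p; rewrite mulr_sumr raddf_sum /=.
  have [bq|bNq] := boolP (b \in msupp q).
    rewrite (bigD1_seq b) ?msupp_uniq //= term eqm_add2l big_seq_cond big1 ?addr0 //.
    move=> b' /andP[b'q nb]; rewrite term; case: eqP => [e|]; last by rewrite mulr0.
    by rewrite (H a' b' a'p b'q e) eqxx in nb.
  rewrite (memN_msupp_eq0 bNq) mulr0 mul0r big_seq big1 // => b' b'q.
  rewrite term; case: eqP => [e|]; last by rewrite mulr0.
  by rewrite -(H a' b' a'p b'q e) b'q in bNq.
have [ap|aNp] := boolP (a \in msupp p).
  rewrite (bigD1_seq a) ?msupp_uniq //= eqxx mulr1 big1 ?addr0 // => a' na.
  by rewrite (negPf na) mulr0.
rewrite (memN_msupp_eq0 aNp) mul0r big_seq big1 // => a' a'p.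
by case: eqP => [e|]; rewrite ?mulr0 // -e a'p in aNp *.
Qed.

(** Write w = A/D and w' = A'/D, so that A times sg D equals D times sg A'. For large d the
    exponents om d b + a with a, b in S determine b, so the coefficient at om d I + a reads A_a D_I
    = D_a A'_I. Hence A/D is the constant A'_I / D_I. *)
Lemma indep2F (ws : seq F) : (forall d w, w \in ws -> exists2 w', cspan iotaF ws w' & sigF d w' = w) ->
  forall w, w \in ws -> exists x, w = iotaF x.
Proof.
move=> H w wws.
have [D D0 [S DS span]] := common_den_span ws.
have [d0 sep] := orb_seq S S.
have [w' w's eq] := H d0 w wws.
have [A' A'S w'E] := span _ w's.
have [A AS wE] := span _ (cspan_mem wws).
have DF : D%:F != 0 by rewrite tofrac_eq0.
have sD0 : sg d0 D != 0 by rewrite sg_eq0.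
have polyE : A * sg d0 D = D * sg d0 A'.
  apply/eqP; rewrite -tofrac_eq !tofracM; move: eq.
  rewrite w'E wE fmorph_div /= !sigF_tofrac => /eqP.
  rewrite eqr_div ?tofrac_eq0 // => /eqP e.
  by rewrite [X in _ == X]mulrC e.
pose I := mlead D; have ID : I \in msupp D by exact: mlead_supp.
exists (A'@_I / D@_I); rewrite wE; apply: (canLR (mulfK DF)).
rewrite /iotaF /= -tofracM; congr (_%:F); apply/mpolyP => a; rewrite mcoeffCM.
have [aS|aNS] := boolP (a \in S); last first.
  rewrite (memN_msupp_eq0 (contra (@DS a) aNS)) (memN_msupp_eq0 (contra (@AS a) aNS)).
  by rewrite mulr0.
have e1 : (A * sg d0 D)@_(om d0 I + a)%MM = A@_a * D@_I.
  apply: mcoeffM_sg => a' b' /AS a'S /DS b'S; apply: (sep d0) => //; exact: DS.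
have e2 : (D * sg d0 A')@_(om d0 I + a)%MM = D@_a * A'@_I.
  apply: mcoeffM_sg => a' b' /DS a'S /A'S b'S; apply: (sep d0) => //; exact: DS.
rewrite polyE e2 in e1; rewrite mulrAC [A'@_I * _]mulrC e1 mulfK //.
by rewrite -mcoeff_msupp.
Qed.

Lemma cspan_cons (ws : seq F) u w : cspan iotaF ws w -> cspan iotaF (u :: ws) w.
Proof.
move=> [c ->]; exists (fun i => if i is i'.+1 then c i' else 0).
by rewrite /= big_ord_recl /= rmorph0 mul0r add0r.
Qed.

Lemma many_idx kap beta m N : (exists y, [/\ by_ y = beta, my y = m & kap y != 0]) ->
  exists js, [/\ uniq js, size js = N & forall j, j \in js -> Cphi kap beta m j != 0].
Proof.
move=> ex; elim: N => [|N [js [ujs sjs jsP]]]; first by exists [::].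
have [j lej Cj] := phi_ind ex (\sum_(i <- js) i.+1)%N.
exists (j :: js); split=> [/=||i]; last 1 first.
- by rewrite inE => /orP[/eqP->|/jsP].
- rewrite ujs andbT; apply/negP => jjs; move: lej.
  by rewrite (big_rem _ jjs) /= leqNgt ltnS leq_addr.
- by rewrite /= sjs.
Qed.

(** Let m + 1 be the largest pole order for this beta. Multiplied by the (m + 1)-st power of 1 -
    beta z^(vv j), the equation can be evaluated at a generic point of that hypersurface. The left
    side gives 0 and only the poles of top order survive on the right, with the coefficient [Cphi],
    which is nonzero for infinitely many j. *)
Lemma indep3F_pole (ws : seq F) u (kap : 'I_Ny -> K) : (forall d, exists2 u', cspan iotaF ws u' &
     sigF d u' = u + \sum_y iotaF (kap y) * bF d y) -> forall y, by_ y != 0 -> kap y = 0.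
Proof.
move=> H y1 b0; apply/eqP/negPn/negP => k0.
set beta := by_ y1 in b0.
have P1 : (by_ y1 == beta) && (kap y1 != 0) by rewrite eqxx.
pose y2 := [arg max_(y > y1 | (by_ y == beta) && (kap y != 0)) my y].
have [y2P y2max] : (by_ y2 == beta) && (kap y2 != 0) /\ (forall y, by_ y = beta -> kap y != 0 -> (my y <= my y2)%N).
  rewrite /y2; case: arg_maxnP => // y yP ymax; split=> // y' e' k'.
  by apply: ymax; rewrite e' eqxx.
move: y2P => /andP[/eqP by2 k2]; move: y2max; move m_def : (my y2) => m y2max.
have [D D0 [S DS span]] := common_den_span (u :: ws).
have [N few] := few_bad S.
have [|js [ujs sjs jsC]] := @many_idx kap beta m N.+1; first by exists y2.
pose d := (\sum_(i <- js) i.+1)%N.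
have [|j jjs good] := few d js ujs; first by rewrite sjs.
have jd : (j < d)%N by rewrite /d (big_rem _ jjs) leq_addr.
have Cj := jsC _ jjs.
have [u' u's eq] := H d.
have [A' A'S u'E] := span _ (cspan_cons u u's).
have [A AS uE] := span _ (cspan_mem (mem_head u ws)).
pose L := [seq (by_ y, k) | y <- enum 'I_Ny, k <- iota 0 d].
have rts k : (0 < k)%N -> exists xi : K, xi ^+ k = beta^-1 by move=> ?; apply: by_roots.
have [|z [z0 zv zQ zL]] := good_point (Qs := [:: D]) L good b0 rts.
  by move=> Q; rewrite !inE => /eqP ->.
have [Dz sDz] := zQ D (mem_head _ _) D0.
pose t : F := (lin beta j)%:F.
have tz : EV z t 0.
  by have := EV_poly z (lin beta j); rewrite meval_lin zv divff ?b0 // subrr.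
have Mz k : EV z ('X_[vv k] : Kz)%:F (\prod_i z i ^+ vv k i).
  by have := EV_poly z 'X_[vv k]; rewrite mevalX.
have linz y k : (k < d)%N -> (by_ y, k) != (beta, j) -> (lin (by_ y) k).@[z] != 0.
  move=> kd ne; have [kj|kj] := eqVneq k j; last first.
    apply: zL => //; apply/allpairsP; exists (y, k).
    by rewrite mem_enum mem_iota.
  rewrite meval_lin kj zv subr_eq0 eq_sym; apply: contra ne => /eqP e.
  rewrite kj xpair_eqE eqxx andbT; apply/eqP.
  by apply: (mulIf (x := beta^-1)); rewrite ?invr_eq0 // e divff.
have lhs : EV z (t ^+ m.+1 * (sigF d u' - u)) 0.
  have e1 : EV z (sigF d u') ((sg d A').@[z] / (sg d D).@[z]).
    by rewrite u'E fmorph_div /= !sigF_tofrac; exact: EV_div.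
  have e2 : EV z u (A.@[z] / D.@[z]) by rewrite uE; exact: EV_div.
  have := EVM (EVX m.+1 tz) (EVB e1 e2).
  by rewrite expr0n mul0r.
pose g y k := if [&& by_ y == beta, k == j & my y == m] then kap y * phi y j * (beta^-1) ^+ m.+1 else 0.
have rhs : EV z (t ^+ m.+1 * \sum_y iotaF (kap y) * bF d y) (\sum_y \sum_(k < d) g y k).
  rewrite mulr_sumr; apply: EV_sum => y _; rewrite /bF mulrA mulr_sumr.
  apply: EV_sum => k _; rewrite /g.
  have [ky0|ky0] := eqVneq (kap y) 0.
    rewrite ky0 rmorph0 mulr0 !mul0r; case: ifP => _; exact: EV0.
  have [/andP[/eqP yb /eqP kj]|ne] := boolP ((by_ y == beta) && (k == j :> nat)); last first.
    have lz : (lin (by_ y) k).@[z] != 0.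
      by apply: linz => //; rewrite xpair_eqE.
    rewrite andbA (negPf ne) /=.
    have := EVM (EVM (EVX m.+1 tz) (EV_iota z (kap y))) (EVM (EVM (EV_iota z (phi y k)) (EVX (my y).+1 (Mz k)))
         (EVV (EVX (my y).+1 (EV_poly z (lin (by_ y) k))) _)).
    by rewrite expr0n !mul0r; apply; rewrite expf_neq0.
  rewrite yb kj !eqxx /=; have le := y2max y yb ky0.
  have t0 : t != 0 by exact: linF_neq0.
  have -> : t ^+ m.+1 * iotaF (kap y) * (iotaF (phi y j) * ('X_[vv j] : Kz)%:F ^+ (my y).+1 /
      (lin beta j)%:F ^+ (my y).+1) =
      t ^+ (m - my y) * (iotaF (kap y) * iotaF (phi y j) * ('X_[vv j] : Kz)%:F ^+ (my y).+1).
    rewrite -/t -(subnK (_ : (my y).+1 <= m.+1)%N) // subSS exprD -!mulrA.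
    congr (_ * _); rewrite mulrCA; congr (_ * _); rewrite mulrCA; congr (_ * _).
    by rewrite mulrCA divff ?expf_neq0 // mulr1.
  have := EVM (EVX (m - my y) tz) (EVM (EVM (EV_iota z (kap y)) (EV_iota z (phi y j))) (EVX (my y).+1 (Mz j))).
  rewrite zv expr0n subn_eq0; have [->|ne] := eqVneq (my y) m.
    by rewrite leqnn mul1r.
  by rewrite leqNgt ltn_neqAle ne le mul0r.
have := EV_inj lhs; rewrite eq [u + _]addrC addrK => /(_ _ rhs)/esym/eqP.
have -> : \sum_y \sum_(k < d) g y k = Cphi kap beta m j * beta^-1 ^+ m.+1.
  rewrite /Cphi mulr_suml [RHS]big_mkcond; apply: eq_bigr => y _ /=.
  rewrite (bigD1 (Ordinal jd)) //= big1 ?addr0.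
    by rewrite /g eqxx.
  by move=> k nk; rewrite /g (_ : (k == j :> nat) = false) ?andbF //; apply/eqP => e; case/eqP: nk; apply: val_inj.
by rewrite mulf_eq0 (negPf Cj) expf_eq0 invr_eq0 (negPf b0) andbF.
Qed.

Variables (R : archiRealFieldType) (wt : 'X_{1..n} -> R) (rho : R).
Hypotheses (wtD : forall a b, wt (a + b)%MM = wt a + wt b) (wt_gt0 : forall a, a != 0%MM -> 0 < wt a)
 (wt_Om : forall a, wt (Om a) = rho * wt a) (rho_gt1 : 1 < rho).

Lemma wt_ge0 a : 0 <= wt a.
Proof.
have [->|a0] := eqVneq a 0%MM; last exact/ltW/wt_gt0.
by have /eqP := wtD 0%MM 0%MM; rewrite addm0 -subr_eq0 opprD addrA subrr sub0r oppr_eq0 => /eqP ->.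
Qed.

Lemma wt_om d a : wt (om d a) = rho ^+ d * wt a.
Proof. by elim: d => [|d IHd] /=; rewrite ?mul1r // wt_Om IHd exprS mulrA. Qed.

Lemma wtMn a k : wt (a *+ k)%MM = wt a *+ k.
Proof.
elim: k => [|k IHk]; last by rewrite mulmS wtD IHk mulrS.
by apply/eqP; rewrite mulm0n mulr0n; have /eqP := wtD 0%MM 0%MM; rewrite addm0 -subr_eq0 opprD addrA subrr sub0r oppr_eq0.
Qed.

Lemma wt_vv j : wt (vv j) = rho ^+ j * wt (vv 0%N).
Proof. by rewrite -[j in vv j]addn0 vvD wt_om. Qed.

Lemma rho_unbounded (x : R) : exists i0, forall i, rho ^+ i <= x -> (i <= i0)%N.
Proof.
have [i0 lt] : exists i0, x < rho ^+ i0.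
  have r1 : 0 < rho - 1 by rewrite subr_gt0.
  pose N := Num.bound (`|x| / (rho - 1)).
  have bern k : 1 + k%:R * (rho - 1) <= rho ^+ k.
    elim: k => [|k IHk]; first by rewrite mul0r addr0.
    rewrite exprS; apply: le_trans (ler_wpM2l _ IHk); last by rewrite ltW // (lt_trans ltr01).
    rewrite -natr1; have : 0 <= k%:R * (rho - 1) * (rho - 1) by rewrite !mulr_ge0 // ltW.
    lra.
  exists N; apply: lt_le_trans (bern N).
  have := archi_boundP (divr_ge0 (normr_ge0 x) (ltW r1)); rewrite -/N ltr_pdivrMr //.
  have := ler_norm x; lra.
exists i0 => i le; rewrite leqNgt; apply/negP => lt2.
have : rho ^+ i0 <= rho ^+ i by apply: ler_weXn2l; [exact: ltW|exact: ltnW].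
by rewrite leNgt (le_lt_trans le lt).
Qed.

Lemma vv_mulmn i k a b : (0 < a)%N -> (0 < b)%N -> (vv i *+ a)%MM = (vv k *+ b)%MM -> i = k /\ a = b.
Proof.
move=> a0 b0 e; have ik : i = k.
  apply/eqP/negPn/negP => /npar[x [y /eqP]]; apply.
  have ex := congr1 (fun m : 'X_{1..n} => m x) e.
  have ey := congr1 (fun m : 'X_{1..n} => m y) e.
  move: ex ey; rewrite /= !mulmnE => ex ey; apply/eqP.
  rewrite -(eqn_pmul2r a0); apply/eqP.
  rewrite mulnAC ex [RHS]mulnAC ey [LHS]mulnAC [RHS]mulnAC.
  by rewrite [(vv k x * _)%N]mulnC.
split=> //; subst k; apply/eqP.
have /eqP := congr1 (@mdeg n) e; rewrite !mdegMn eqn_pmul2l // lt0n mdeg_eq0.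
exact: monomial_neq0.
Qed.

(** Weights grow like rho^j along [vv], so an equality between such exponents bounds the difference
    of the two indices in terms of S and mu. The finitely many remaining shapes are pulled back to
    small indices, where [orb_seq] forces the multiples of [vv] to agree. *)
Lemma vv_sep (S : seq 'X_{1..n}) mu : for_large j, (forall m s t, (0 < m <= mu)%N -> s \in S -> t \in S -> (vv j *+ m + s != t)%MM) /\
  (forall k m1 m2 s1 s2, (0 < m1 <= mu)%N -> (0 < m2 <= mu)%N -> s1 \in S -> s2 \in S ->
     (vv k *+ m2 + s2 = vv j *+ m1 + s1)%MM -> [/\ k = j, m2 = m1 & s2 = s1]).
Proof.
pose w0 := wt (vv 0%N); have w0_gt0 : 0 < w0 by exact: wt_gt0.
pose W := \sum_(s <- S) wt s.
have W_ge s : s \in S -> wt s <= W.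
  by move=> sS; rewrite /W (big_rem _ sS) /= ler_wpDr // sumr_ge0 // => ? _; exact: wt_ge0.
have W0 : 0 <= W by apply: sumr_ge0 => ? _; exact: wt_ge0.
have [i0 Hi0] := rho_unbounded ((mu%:R * w0 + W) / w0).
have rp k : 0 < rho ^+ k by rewrite exprn_gt0 // (lt_trans ltr01).
have close k i m1 m2 s1 s2 : (0 < m1 <= mu)%N -> (0 < m2 <= mu)%N -> s1 \in S -> s2 \in S ->
    (vv (k + i) *+ m2 + s2 = vv k *+ m1 + s1)%MM -> (i <= i0)%N.
  move=> /andP[m10 m1m] /andP[m20 m2m] s1S s2S /(congr1 wt).
  rewrite !wtD !wtMn wt_vv (wt_vv k) -/w0 -(mulr_natl _ m2) -(mulr_natl _ m1) => e.
  apply: Hi0; rewrite ler_pdivlMr // -(ler_pM2l (rp k)) mulrA -exprD.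
  apply: (@le_trans _ _ (m2%:R * (rho ^+ (k + i) * w0))).
    by rewrite ler_peMl ?ler1n // mulr_ge0 ?ltW.
  have := wt_ge0 s2; have := W_ge s1 s1S.
  have : m1%:R * (rho ^+ k * w0) <= rho ^+ k * (mu%:R * w0).
    by rewrite mulrCA ler_pM2l // ler_pM2r // ler_nat.
  have : W <= rho ^+ k * W by rewrite ler_peMl // exprn_ege1 // ltW.
  lra.
pose S' := 0%MM :: [seq (vv i *+ m)%MM | i <- iota 0 i0.+1, m <- iota 0 mu.+1].
have inS' i m : (i <= i0)%N -> (m <= mu)%N -> (vv i *+ m)%MM \in S'.
  by move=> ii mm; rewrite inE; apply/orP; right; apply/allpairsP; exists (i, m); rewrite !mem_iota !add0n !ltnS ii mm.
have [d0 sep] := orb_seq S' S.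
exists (d0 + i0)%N => j lej; have d0j : (d0 <= j)%N by apply: leq_trans lej; exact: leq_addr.
split=> [m s t /andP[m0 mm] sS tS|k m1 m2 s1 s2 hm1 hm2 s1S s2S e].
  apply/eqP => e; have : (vv 0%N *+ m)%MM = 0%MM.
    apply: (sep j d0j _ _ s t) => //; [exact: inS'|exact: mem_head|].
    by rewrite omMn -vvD addn0 om0 add0m.
  by move/eqP; rewrite -mdeg_eq0 mdegMn muln_eq0 mdeg_eq0 (negPf vv0_neq0) /= eqn0Ngt m0.
have [/andP[m10 m1m] /andP[m20 m2m]] := (hm1, hm2).
have [kj|jk] := leqP j k.
  have ii : (k - j <= i0)%N by apply: (close j _ m1 m2 s1 s2) => //; rewrite subnKC.
  have : (vv (k - j) *+ m2)%MM = (vv 0%N *+ m1)%MM.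
    apply: (sep j d0j _ _ s2 s1) => //; [exact: inS'|exact: inS'|].
    by rewrite !omMn -!vvD subnKC // addn0.
  move=> /(vv_mulmn m20 m10)[kj0 m12]; have kjE : k = j by lia.
  by split=> //; move: e; rewrite kjE m12 => /addmI.
have ii : (j - k <= i0)%N by apply: (close k _ m2 m1 s2 s1) => //; rewrite subnKC // ltnW.
have d0k : (d0 <= k)%N by lia.
have : (vv 0%N *+ m2)%MM = (vv (j - k) *+ m1)%MM.
  apply: (sep k d0k _ _ s2 s1) => //; [exact: inS'|exact: inS'|].
  by rewrite !omMn -!vvD subnKC ?addn0 // ltnW.
by move=> /(vv_mulmn m20 m10)[kj0 m12]; lia.
Qed.

Lemma wt_argmin (S : seq 'X_{1..n}) a : a \in S -> exists2 I, I \in S & forall J, J \in S -> wt I <= wt J.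
Proof.
elim: S a => [//|b S IHS] a _; case: S IHS => [_|c S IHS].
  by exists b; rewrite ?mem_head // => J; rewrite inE => /eqP ->.
have [I IS Imin] := IHS c (mem_head _ _).
have [le|/ltW le] := leP (wt b) (wt I).
  exists b; first exact: mem_head.
  by move=> J; rewrite inE => /orP[/eqP->//|/Imin]; exact: le_trans.
exists I; first by rewrite inE IS orbT.
by move=> J; rewrite inE => /orP[/eqP->//|/Imin].
Qed.

Lemma msuppXM a (q : Kz) b : b \in msupp ('X_[a] * q) -> exists2 s, s \in msupp q & b = (a + s)%MM.
Proof.
move=> /msuppM_le/allpairsP[[x s] /= [/mem_msuppXP <- sq ->]]; by exists s.
Qed.

(* With no poles left, the coefficient of [z^(Om^d I + X)] isolates a single
   term when [I] has least weight in the denominator and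
   [X = (m + 1) vv j + s] with [j], and then [d], large. *)
Lemma indep3F (ws : seq F) u (kap : 'I_Ny -> K) : (forall d, exists2 u', cspan iotaF ws u' &
     sigF d u' = u + \sum_y iotaF (kap y) * bF d y) -> forall y, kap y = 0.
Proof.
move=> H y1; have [yb|] := eqVneq (by_ y1) 0; last exact: indep3F_pole H y1.
have poles y : kap y != 0 -> by_ y = 0.
  by move=> k0; apply/eqP; apply: contraR k0 => /(indep3F_pole H)->.
apply/eqP/negPn/negP => k1.
pose m := my y1; pose mu := (\sum_y (my y).+1)%N.
have my_mu y : (my y < mu)%N by rewrite /mu (bigD1 y) //= leq_addr.
have exy : exists y, [/\ by_ y = 0, my y = m & kap y != 0] by exists y1.
have [D D0 [S DS span]] := common_den_span (u :: ws).
have [A AS uE] := span _ (cspan_mem (mem_head u ws)).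
pose trm y k : Kz := (kap y * phi y k) *: 'X_[vv k *+ (my y).+1].
pose p d : Kz := \sum_y \sum_(k < d) trm y k.
have bE d : \sum_y iotaF (kap y) * bF d y = (p d)%:F.
  rewrite /p !raddf_sum; apply: eq_bigr => y _ /=.
  rewrite raddf_sum mulr_sumr; apply: eq_bigr => k _ /=.
  have [k0|k0] := eqVneq (kap y) 0.
    by rewrite /trm k0 rmorph0 !mul0r scale0r tofrac0.
  rewrite poles // /lin scale0r subr0 tofrac1 expr1n divr1 /trm -mul_mpolyC tofracM.
  by rewrite mulrA -(rmorphM iotaF); congr (_ * _); rewrite -rmorphXn mpolyXn.
have [I IS Imin] := wt_argmin (mlead_supp D0).
have [j0 Hj0] := vv_sep S mu.
have [j lej Cj] := phi_ind exy j0.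
have [sepX uniqX] := Hj0 j lej.
have ID : D@_I != 0 by rewrite -mcoeff_msupp.
pose X := (vv j *+ m.+1 + I)%MM.
have XS : X \notin S.
  apply/negP => XS; have := sepX m.+1 I X; rewrite eqxx => /(_ _ _ XS) HX.
  by suff : false; last (apply: HX; [rewrite my_mu|exact: DS]).
have [k0 Hk0] := rho_unbounded (wt X / wt (vv 0%N)).
pose d1 := [seq (s + x)%MM | s <- S, x <- [seq (vv k *+ m')%MM | k <- iota 0 k0.+1, m' <- iota 0 mu.+1]].
have [d0 sep] := orb_seq S (S ++ X :: d1).
pose d := (d0 + j.+1)%N.
have d0d : (d0 <= d)%N by exact: leq_addr.
have jd : (j < d)%N by exact: leq_addl.
have [u' u's eq] := H d; have [A' A'S u'E] := span _ (cspan_cons u u's).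
have DF : D%:F != 0 by rewrite tofrac_eq0.
have sDF : (sg d D)%:F != 0.
  by rewrite tofrac_eq0 sg_eq0.
have polyE : D * sg d A' = A * sg d D + (p d * D) * sg d D.
  apply: tf_inj; rewrite rmorphD !rmorphM /=; apply: clear_den => //.
  by move: eq; rewrite u'E uE fmorph_div /= !sigF_tofrac bE.
have XT : X \in S ++ X :: d1 by rewrite mem_cat mem_head orbT.
have ST s : s \in S -> s \in S ++ X :: d1 by move=> sS; rewrite mem_cat sS.
have e1 : (D * sg d A')@_(om d I + X)%MM = D@_X * A'@_I.
  apply: mcoeffM_sg => a b /DS aS /A'S bS; apply: (sep d d0d) => //; first exact: DS.
  exact: ST.
have e2 : (A * sg d D)@_(om d I + X)%MM = A@_X * D@_I.
  apply: mcoeffM_sg => a b /AS aS /DS bS; apply: (sep d d0d) => //; first exact: DS.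
  exact: ST.
have pD a : a \in msupp (p d * D) -> exists k m' s, [/\ (k < d)%N, (0 < m' <= mu)%N, s \in S & a = (vv k *+ m' + s)%MM].
  rewrite /p mulr_suml => /msupp_sum_le /flatten_mapP[y _].
  rewrite mulr_suml => /msupp_sum_le /flatten_mapP[k _].
  rewrite /trm -scalerAl => /msuppZ_le /msuppXM[s sD ->].
  by exists k, (my y).+1, s; split=> //; [rewrite my_mu|exact: DS].
have w0 : 0 < wt (vv 0%N) by exact: wt_gt0.
have e3 : ((p d * D) * sg d D)@_(om d I + X)%MM = (p d * D)@_X * D@_I.
  apply: mcoeffM_sg => a b /pD[k [m' [s [kd /andP[m'0 m'mu] sS ->]]]] bD e.
  apply: (sep d d0d _ _ (vv k *+ m' + s)%MM X) => //; [exact: DS|exact: DS|].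
  rewrite mem_cat inE; apply/or3P/Or33/allpairsP; exists (s, vv k *+ m')%MM.
  split; [exact: sS| |exact: addmC].
  apply/allpairsP; exists (k, m'); split; rewrite ?mem_iota ?add0n ?ltnS //.
  (* Since [I] has least weight in the support, comparing weights gives wt (vv k) <= wt X. So only
     indices k <= k0 occur, however large d is. *)
  apply: Hk0; rewrite ler_pdivlMr // -wt_vv.
  move: e => /(congr1 wt); rewrite !wtD !wt_om wtMn -mulr_natl => e.
  have le1 : rho ^+ d * wt I <= rho ^+ d * wt b.
    by rewrite ler_wpM2l ?Imin // exprn_ge0 // ltW // (lt_trans ltr01).
  have le2 : wt (vv k) <= m'%:R * wt (vv k) by rewrite ler_peMl ?wt_ge0 // ler1n.
  have := wt_ge0 s; lra.
have := congr1 (mcoeff (om d I + X)%MM) polyE; rewrite mcoeffD e1 e2 e3.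
rewrite !(memN_msupp_eq0 (contra (@DS X) XS)) !(memN_msupp_eq0 (contra (@AS X) XS)).
rewrite !mul0r add0r => /esym/eqP; rewrite mulf_eq0 (negPf ID) orbF.
have -> : (p d * D)@_X = Cphi kap 0 m j * D@_I.
  have -> : p d * D = \sum_y \sum_(k < d) trm y k * D.
    by rewrite mulr_suml; apply: eq_bigr => y _; rewrite mulr_suml.
  rewrite (raddf_sum (mcoeff X)) /Cphi mulr_suml [RHS]big_mkcond /=.
  apply: eq_bigr => y _; rewrite (raddf_sum (mcoeff X)) /=.
  have other k : (k, my y) != (j, m) -> (trm y k * D)@_X = 0.
    move=> ne; rewrite /trm -scalerAl mcoeffZ; apply/eqP; rewrite mulf_eq0; apply/orP; right.
    rewrite mcoeff_eq0; apply/negP => /msuppXM[s sD /esym e].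
    have [||||kj mm _] := uniqX k m.+1 (my y).+1 I s _ _ _ _ e; last first.
    - by case: mm => mm; rewrite kj mm eqxx in ne.
    - exact: DS.
    - exact: DS.
    - by rewrite my_mu.
    - by rewrite my_mu.
  have [k0'|k0'] := eqVneq (kap y) 0.
    rewrite big1; first by rewrite k0' !mul0r; case: ifP.
    by move=> k _; rewrite /trm k0' mul0r scale0r mul0r mcoeff0.
  rewrite poles // eqxx /=; have [mm|mm] := eqVneq (my y) m; last first.
    by rewrite big1 // => k _; apply: other; rewrite xpair_eqE (negPf mm) andbF.
  rewrite (bigD1 (Ordinal jd)) //= [X in _ + X]big1 ?addr0.
    by rewrite /trm mm -scalerAl mcoeffZ ['X_[_] * D]mulrC /X mcoeffMX.
  move=> k nk; apply: other; rewrite xpair_eqE negb_and; apply/orP; left.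
  by apply: contra nk => /eqP e; apply/eqP/val_inj.
by rewrite mulf_eq0 (negPf Cj) (negPf ID).
Qed.

Variable jb : nat -> nat.
Hypothesis jbP : forall J j, (jb J <= j)%N -> (J <= mdeg (vv j))%N.

(** Geometric series for the inverse of [lin beta k]; the omitted powers have order at least J
    because [vv k] is nonzero. *)
Definition geo beta k J : Kz := \sum_(e < J) (beta *: 'X_[vv k]) ^+ e.
Definition gM beta k J : Kz := 'X_[vv k] * geo beta k J.
Definition fser J y : Kz := \sum_(k < jb J) phi y k *: gM (by_ y) k J ^+ (my y).+1.
Definition user J u : Kz := \prod_(k < jb J) lin (bu u) k.
Definition vals J (v : 'I_NN) : Kz := match split v with inl y => fser J y | inr u => user J u end.

Lemma lin_geo J beta k : hcong J (lin beta k * geo beta k J) 1.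
Proof.
have -> : lin beta k * geo beta k J = 1 - (beta *: 'X_[vv k]) ^+ J.
  by rewrite -opprB subrX1 /lin -mulNr opprB.
rewrite /hcong addrC addKr; apply: hordN; rewrite exprZn mpolyXn; apply: hordZ.
apply: hord_leq (@hordX_mnm _ _ _); rewrite mdegMn leq_pmull // lt0n mdeg_eq0.
exact: monomial_neq0.
Qed.

Lemma hord_sg J d p : hord J p -> hord J (sg d p).
Proof. by move=> hp a /sg_supp/mapP[b /hp le ->]; apply: leq_trans (mdeg_om _ _). Qed.

Lemma sg_gM d beta k J : sg d (gM beta k J) = gM beta (d + k) J.
Proof.
rewrite /gM /geo rmorphM raddf_sum /= sgX -vvD; congr (_ * _).
by apply: eq_bigr => e _; rewrite rmorphXn /= sgZ sgX -vvD.
Qed.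

Lemma hord_gM J beta k i : (jb J <= k)%N -> hord J (gM beta k J ^+ i.+1).
Proof.
move=> le; rewrite exprS; apply: hordMr; apply: hordMr.
exact: hord_leq (jbP le) (@hordX_mnm _ _ _).
Qed.

Lemma fser_ext J y L : (jb J <= L)%N -> hcong J (\sum_(k < L) phi y k *: gM (by_ y) k J ^+ (my y).+1) (fser J y).
Proof.
move=> le; rewrite -(subnKC le); elim: (L - jb J)%N => [|i IHi].
  by rewrite addn0; exact: hcong_refl.
rewrite addnS big_ord_recr /= -[fser J y]addr0; apply: hcongD => //.
by apply/hcong0/hordZ/hord_gM; rewrite leq_addr.
Qed.

Lemma user_ext J u L : (jb J <= L)%N -> hcong J (\prod_(k < L) lin (bu u) k) (user J u).
Proof.
move=> le; rewrite -(subnKC le); elim: (L - jb J)%N => [|i IHi].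
  by rewrite addn0; exact: hcong_refl.
rewrite addnS big_ord_recr /= -[user J u]mulr1; apply: hcongM => //.
rewrite /hcong /lin addrC addKr; apply/hordN/hordZ.
by apply: hord_leq (jbP (_ : jb J <= _)%N) (@hordX_mnm _ _ _); rewrite leq_addr.
Qed.

Definition Den d : Kz := \prod_(k < d) ((\prod_y lin (by_ y) k ^+ (my y).+1) * \prod_u lin (bu u) k).

Lemma Den_neq0 d : Den d != 0.
Proof.
apply/prodf_neq0 => k _; rewrite mulf_neq0 //; apply/prodf_neq0 => i _; by rewrite ?expf_neq0 // lin_neq0.
Qed.

Lemma Den_y d y : exists NY : Kz, tf NY = tf (Den d) * bF d y /\
  forall J, hcong J NY (Den d * \sum_(k < d) phi y k *: gM (by_ y) k J ^+ (my y).+1).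
Proof.
have divk (k : 'I_d) : exists q, Den d = lin (by_ y) k ^+ (my y).+1 * q.
  by rewrite /Den (bigD1 k) //= (bigD1 y) //= -!mulrA; eexists.
have [q qE] := choice divk.
exists (\sum_(k < d) phi y k *: ('X_[vv k] ^+ (my y).+1 * q k)); split=> [|J].
  rewrite raddf_sum /bF mulr_sumr; apply: eq_bigr => k _ /=.
  rewrite -mul_mpolyC !rmorphM rmorphXn (qE k) rmorphM rmorphXn /=.
  have l0 : (lin (by_ y) k)%:F ^+ (my y).+1 != 0 by rewrite expf_neq0 // linF_neq0.
  rewrite /iotaF /= [RHS]mulrC -!mulrA; congr (_ * (_ * _)).
  by rewrite mulrA mulVf // mul1r.
rewrite mulr_sumr; apply: hcong_sum => k _.
rewrite -scalerAr; apply: hcongZ; rewrite (qE k) /gM exprMn.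
rewrite (_ : _ * (_ * _) = ('X_[vv k] ^+ (my y).+1 * q k) * (lin (by_ y) k * geo (by_ y) k J) ^+ (my y).+1); last first.
  by rewrite exprMn [_ * q k]mulrC mulrACA [q k * _]mulrC.
rewrite -[X in hcong _ X]mulr1; apply: hcongM; first exact: hcong_refl.
by rewrite -(expr1n _ (my y).+1); apply/hcongX/hcong_sym/lin_geo.
Qed.

Lemma Den_u d u : exists q, Den d = (\prod_(k < d) lin (bu u) k) * q.
Proof.
exists (\prod_(k < d) ((\prod_y lin (by_ y) k ^+ (my y).+1) * \prod_(u' | u' != u) lin (bu u') k)).
rewrite /Den -big_split; apply: eq_bigr => k _ /=.
by rewrite [in LHS](bigD1 u) //= mulrCA.
Qed.

(** P vanishes at the formal series, expressed as vanishing modulo every order. [rel] extends this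
    to coefficients in F by clearing denominators. *)
Definition rel0 (P : {mpoly Kz[NN]}) := forall J, hord J P.@[vals J].
Definition rel (p : {mpoly F[NN]}) := exists w P, [/\ w != 0, map_mpoly tf P = w%:F *: p & rel0 P].

Lemma relB p q : rel p -> rel q -> rel (p - q).
Proof.
move=> [w [P [w0 PE rP]]] [x [Q [x0 QE rQ]]].
exists (w * x), (x *: P - w *: Q); split; first by rewrite mulf_neq0.
  rewrite rmorphB /= !map_mpolyZ PE QE !scalerA scalerBr !rmorphM /=.
  by rewrite [x%:F * _]mulrC.
by move=> J; rewrite mevalB !mevalZ; apply: hordD; [exact/hordMl/rP|exact/hordN/hordMl/rQ].
Qed.

Lemma relZ c p : rel p -> rel (c *: p).
Proof.
move=> [w [P [w0 PE rP]]]; have [a [b [b0 ->]]] := tf_frac c.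
exists (w * b), (a *: P); split; first by rewrite mulf_neq0.
  rewrite map_mpolyZ PE !scalerA rmorphM /=; congr (_ *: _).
  by rewrite -[RHS]mulrA [b%:F * _]mulrC divfK ?tofrac_eq0 // mulrC.
by move=> J; rewrite mevalZ; exact/hordMl/rP.
Qed.

(** [Den d] times the substitution is polynomial, and modulo every order it sends the truncations to
    [Den d] times their images under [sg d]: this is the functional equation. Padding each monomial
    of P with a power of [Den d] up to the exponent E turns the shifted relation into Den^E times
    the image of the relation. *)
Lemma rel_shift d p : rel p -> rel (kshift iotaF sigF B bF piF d p).
Proof.
move=> [w [P [w0 PE rP]]].
have [NY NYP] := choice (Den_y d).
have [q qE] := choice (Den_u d).
pose V (v : 'I_NN) : {mpoly Kz[NN]} := match split v with
  | inl y => \sum_y' (B d y y')%:MP *: (Den d *: 'X_(yvar y') - (NY y')%:MP) | inr u => q u *: 'X_(uvar u) end.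
have VE v : map_mpoly tf (V v) = (Den d)%:F *: shiftvar iotaF B bF piF d v.
  rewrite /V /shiftvar; case: (split v) => [y|u].
    rewrite raddf_sum scaler_sumr; apply: eq_bigr => y' _ /=.
    rewrite map_mpolyZ rmorphB /= map_mpolyZ map_mpolyX map_mpolyC /=; have [-> _] := NYP y'.
    by rewrite mpolyCM mul_mpolyC -scalerBr scalerA mulrC -scalerA.
  rewrite map_mpolyZ map_mpolyX scalerA (qE u) rmorphM rmorph_prod /= -/(piF d u).
  by rewrite mulrAC divff ?mul1r // piF_neq0.
have VJ J v : hcong J (V v).@[vals J] (Den d * sg d (vals J v)).
  rewrite /V /vals; case: (split v) => [y|u].
    rewrite raddf_sum.
    have -> : sg d (fser J y) = \sum_y' (B d y y')%:MP *
       \sum_(k < jb J) phi y' (d + k)%N *: gM (by_ y) (d + k) J ^+ (my y).+1.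
      transitivity (\sum_(k < jb J) phi y k *: gM (by_ y) (d + k) J ^+ (my y).+1).
        rewrite /fser raddf_sum; apply: eq_bigr => k _ /=.
        by rewrite sgZ rmorphXn /= sg_gM.
      under [RHS]eq_bigr do rewrite mulr_sumr; rewrite exchange_big; apply: eq_bigr => k _.
      by rewrite -(B_phi d) scaler_suml; apply: eq_bigr => y' _; rewrite mul_mpolyC scalerA.
    rewrite mulr_sumr; apply: hcong_sum => y' _ /=.
    rewrite mevalZ mevalB mevalZ mevalC mevalXU (unsplitK (inl _ y')).
    have [-> |Bn0] := eqVneq (B d y y') 0; first by rewrite !mul0r mulr0; exact: hcong_refl.
    have [-> ->] := B_type Bn0.
    rewrite mulrCA; apply: hcongM; first exact: hcong_refl.
    apply: (@hcong_trans _ _ _ (Den d * \sum_(k < d + jb J) phi y' k *: gM (by_ y') k J ^+ (my y').+1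
        - Den d * \sum_(k < d) phi y' k *: gM (by_ y') k J ^+ (my y').+1)).
      apply: hcongB; last by have [_] := NYP y'; apply.
      apply: hcongM; first exact: hcong_refl.
      by apply/hcong_sym/fser_ext; exact: leq_addl.
    rewrite big_split_ord mulrDr addrC addKr; exact: hcong_refl.
  rewrite mevalZ mevalXU (unsplitK (inr _ u)) (qE u).
  apply: hcong_sym; rewrite -mulrA mulrCA; apply: hcongM; first exact: hcong_refl.
  rewrite {1}/user rmorph_prod; apply: (hcong_trans (q := \prod_(k < d + jb J) lin (bu u) k)); last by apply: user_ext; exact: leq_addl.
  rewrite big_split_ord; apply: hcongM; first exact: hcong_refl.
  by apply: hcong_prod => k _; rewrite /= sg_lin; exact: hcong_refl.
pose E := msize P.
exists (Den d ^+ E * sg d w), (\sum_(k <- msupp P) (sg d P@_k * Den d ^+ (E - mdeg k)) *: \prod_v V v ^+ k v); split.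
- rewrite mulf_neq0 ?expf_neq0 ?Den_neq0 //.
  by rewrite sg_eq0.
- transitivity ((Den d ^+ E)%:F *: kshift iotaF sigF B bF piF d (map_mpoly tf P)); last first.
    by rewrite PE kshiftZ scalerA rmorphM /= sigF_tofrac.
  have PEx : map_mpoly tf P = \sum_(k <- msupp P) tf P@_k *: 'X_[k].
    rewrite {1}(mpolyE P) raddf_sum; apply: eq_bigr => k _ /=.
    by rewrite map_mpolyZ map_mpolyX.
  rewrite PEx (raddf_sum (kshift iotaF sigF B bF piF d)) scaler_sumr.
  rewrite (raddf_sum (map_mpoly tf)); apply: eq_big_seq => k kP /=.
  rewrite map_mpolyZ kshiftZ scalerA kshiftXm sigF_tofrac rmorph_prod.
  rewrite (eq_bigr (fun v => ((Den d)%:F ^+ k v)%:MP * shiftvar iotaF B bF piF d v ^+ k v)).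
    rewrite big_split /= -rmorph_prod mul_mpolyC scalerA; congr (_ *: _).
    rewrite -expr_sum -mdegE -rmorphXn -!rmorphM; congr (_%:F).
    rewrite -mulrA -exprD (subnK (ltnW (msize_mdeg_lt kP))); exact: mulrC.
  by move=> v _; rewrite rmorphXn /= VE exprZn mul_mpolyC.
- move=> J; apply: (@hcong_hord _ _ _ _ (Den d ^+ E * sg d P.@[vals J])); last first.
    by apply/hordMl/hord_sg/rP.
  rewrite raddf_sum mevalE raddf_sum mulr_sumr.
  rewrite big_seq [X in hcong _ _ X]big_seq; apply: hcong_sum => k kP /=.
  rewrite mevalZ rmorphM rmorph_prod.
  rewrite (_ : Den d ^+ E * _ = sg d P@_k * Den d ^+ (E - mdeg k) * \prod_v (Den d * sg d (vals J v)) ^+ k v); last first.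
    under [in RHS]eq_bigr do rewrite exprMn.
    have {1}-> : Den d ^+ E = Den d ^+ (E - mdeg k) * Den d ^+ mdeg k.
      by rewrite -exprD (subnK (ltnW (msize_mdeg_lt kP))).
    rewrite big_split /= -expr_sum -mdegE mulrACA [Den d ^+ _ * sg d _]mulrC.
    rewrite rmorph_prod; congr (_ * (_ * _)).
    by apply: eq_bigr => v _; rewrite rmorphXn.
  apply: hcongM; first exact: hcong_refl.
  apply: hcong_prod => v _.
  by rewrite rmorphXn; apply: hcongX; exact: VJ.
Qed.

Lemma user_coef0 J u : (user J u)@_0%MM = 1.
Proof.
rewrite /user; elim: (jb J) => [|k IHk]; first by rewrite big_ord0 mcoeff1 eqxx.
have l0 : (lin (bu u) k)@_0%MM = 1.
  by rewrite mcoeffB mcoeff1 mcoeffZ mcoeffX eqxx (negPf (monomial_neq0 k)) mulr0 subr0.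
by rewrite big_ord_recr /= (rmorphM (mcoeff 0%MM)) /= IHk l0 mulr1.
Qed.

(** A product of powers of the infinite products has constant term 1. Multiplied by w it keeps the
    coefficient of w at the lowest monomial [mlast w], so it does not have arbitrarily large
    order. *)
Lemma relU (m : 'X_{1..NN}) : ypure m -> ~ rel 'X_[m].
Proof.
move=> pm [w [P [w0 PE rP]]].
have PE2 : P = w *: 'X_[m].
  apply/mpolyP => k; apply: tf_inj.
  have := congr1 (mcoeff k) PE; rewrite mcoeff_map_mpoly => ->.
  rewrite !mcoeffZ !mcoeffX; case: (m == k); first by rewrite !mulr1.
  by rewrite !mulr0 tofrac0.
have := rP (mdeg (mlast w)).+1; rewrite PE2 mevalZ mevalX => /hordP/(_ (mlast w) (ltnSn _)).
set U := \prod_ _ _; have U0 : U@_0%MM = 1.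
  rewrite /U (rmorph_prod (mcoeff 0%MM)) big_split_ord /= big1 ?mul1r.
    rewrite big1 // => u _; rewrite rmorphXn /vals (unsplitK (inr _ u)) /=.
    by rewrite user_coef0 expr1n.
  by move=> y _; rewrite pm expr0 mcoeff1 eqxx.
have -> : (w * U)@_(mlast w) = w@_(mlast w).
  rewrite -[U](subrK 1) mulrDr mulr1 mcoeffD [X in X + _](_ : _ = 0) ?add0r //.
  apply/eqP; rewrite mcoeff_eq0; apply/negP => /msuppM_le/allpairsP[[x y] /= [xw yU e]].
  have y0 : y != 0%MM.
    apply: contraTneq yU => ->; rewrite -mcoeff_eq0 mcoeffB U0 mcoeff1 eqxx.
    by rewrite subrr.
  have := mlast_lemc xw; rewrite e -{2}[x]addm0 lemc_add2r leNgt lt_neqAle eq_sym y0.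
  by rewrite le0m.
by move/eqP; rewrite mcoeff_eq0 mlast_supp.
Qed.

Theorem formal_indep (P : {mpoly Kz[NN]}) : (forall J, hord J P.@[vals J]) -> P = 0.
Proof.
move=> H; have r : rel (map_mpoly tf P).
  by exists 1, P; rewrite oner_eq0 tofrac1 scale1r.
have charF := charF.
have e := @kubota K F iotaF Ny Nu sigF sigF_iota B bF piF B_trig B_diag piF_neq0
  charF rel relB relZ rel_shift relU indep1F indep2F indep3F _ r.
apply/mpolyP => m; apply: tf_inj.
by have := congr1 (mcoeff m) e; rewrite mcoeff_map_mpoly !mcoeff0 tofrac0.
Qed.

End Formal.

(** * Linear recurrences with constant coefficients *)

Section Sequences.
Variable A : fieldType.
Implicit Types (p q : {poly A}) (h : nat -> A).

(** Sequences as a module over the polynomials, with X acting as the shift; [actM] is the module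
    law. *)
Definition act p h : nat -> A := fun k => \sum_(j < size p) p`_j * h (k + j)%N.

Lemma act_wide m p h k : (size p <= m)%N -> act p h k = \sum_(j < m) p`_j * h (k + j)%N.
Proof.
move=> le; rewrite /act (big_ord_widen _ (fun j => p`_j * h (k + j)%N) le).
rewrite big_mkcond; apply: eq_bigr => j _; case: ltnP => // lt.
by rewrite nth_default ?mul0r.
Qed.

Lemma actD p q h k : act (p + q) h k = act p h k + act q h k.
Proof.
rewrite !(@act_wide (maxn (size p) (size q))) ?leq_maxl ?leq_maxr ?size_polyD //.
by rewrite -big_split; apply: eq_bigr => j _; rewrite coefD mulrDl.
Qed.

Lemma actC c h k : act c%:P h k = c * h k.
Proof.
by rewrite (@act_wide 1) ?size_polyC_leq1 // big_ord1 coefC addn0.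
Qed.

Lemma actMX p h k : act (p * 'X) h k = act p h k.+1.
Proof.
rewrite (@act_wide (size p).+1); last first.
  have [->|p0] := eqVneq p 0; first by rewrite mul0r size_poly0.
  by rewrite size_mulX.
rewrite big_ord_recl coefMX mul0r add0r; apply: eq_bigr => j _.
by rewrite coefMX /= addnS addSn.
Qed.

Lemma act_ext p h h' : h =1 h' -> act p h =1 act p h'.
Proof. by move=> e k; apply: eq_bigr => j _; rewrite e. Qed.
Lemma act_shift p h d k : act p (fun i => h (d + i)%N) k = act p h (d + k)%N.
Proof. by apply: eq_bigr => j _; rewrite addnA. Qed.
Lemma actDh p h h' k : act p (fun i => h i + h' i) k = act p h k + act p h' k.
Proof. by rewrite -big_split; apply: eq_bigr => j _; rewrite mulrDr. Qed.
Lemma actZh p c h k : act p (fun i => c * h i) k = c * act p h k.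
Proof. by rewrite mulr_sumr; apply: eq_bigr => j _; rewrite mulrCA. Qed.
Lemma act0h p k : act p (fun=> 0) k = 0.
Proof. by rewrite /act big1 // => j _; rewrite mulr0. Qed.
Lemma act0 p h k : (forall i, h i = 0) -> act p h k = 0.
Proof. by move=> H; rewrite (@act_ext p h (fun=> 0)) // act0h. Qed.

Lemma actM p q h k : act (p * q) h k = act p (act q h) k.
Proof.
elim/poly_ind: p k => [|p c IHp] k.
  by rewrite mul0r -[0]polyC0 !actC !mul0r.
rewrite mulrDl actD [RHS]actD mulrAC !actMX IHp; congr (_ + _).
elim/poly_ind: q k {IHp} => [|q e IHq] k.
  by rewrite mulr0 -[0]polyC0 !actC mul0r mulr0.
rewrite mulrDr actD mulrA actMX IHq -rmorphM actC [in RHS]actC actD actMX actC mulrDr.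
by rewrite actC mulrA.
Qed.

Lemma actXn d h k : act 'X^d h k = h (k + d)%N.
Proof.
elim: d k => [|d IHd] k; first by rewrite expr0 -[1]polyC1 actC mul1r addn0.
by rewrite exprSr actMX IHd addSnnS.
Qed.

Lemma act_XsubC th h k : act ('X - th%:P) h k = h k.+1 - th * h k.
Proof. by rewrite actD -polyCN actC -['X]expr1 actXn addn1 mulNr. Qed.
Definition ann p h := forall k, act p h k = 0.
Lemma ann_mull p q h : ann q h -> ann (p * q) h.
Proof. by move=> H k; rewrite actM act0. Qed.
Lemma ann_dvd p q h : p %| q -> ann p h -> ann q h.
Proof. by move=> /dvdpP[g ->]; exact: ann_mull. Qed.

Lemma ann_coprime p q h : coprimep p q -> ann p h -> ann q h -> forall k, h k = 0.
Proof.
move=> /Bezout_eq1_coprimepP[[u v] /= e] Hp Hq k.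
have : act (u * p + v * q) h k = 0 by rewrite actD !(ann_mull _ _) // addr0.
by rewrite e -[1]polyC1 actC mul1r.
Qed.

Lemma ann_shift p h d : ann p h -> ann p (fun i => h (d + i)%N).
Proof. by move=> H k; rewrite act_shift H. Qed.
Lemma ann_act p q h : ann p h -> ann p (act q h).
Proof. by move=> H k; rewrite -actM mulrC actM act0. Qed.

(** A nonzero constant coefficient lets the recurrence run backwards, so a sequence that is
    eventually zero is zero. *)
Lemma ann_back p h d : p`_0 != 0 -> ann p h -> (forall k, (d <= k)%N -> h k = 0) -> forall k, h k = 0.
Proof.
move=> p0 H; elim: d => [|d IHd] Hd; first by move=> k; exact: Hd.
apply: IHd => k; rewrite leq_eqVlt => /orP[/eqP<-|]; last exact: Hd.
have sp : (0 < size p)%N.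
  by rewrite lt0n size_poly_eq0; apply: contraNneq p0 => ->; rewrite coef0.
have := H d; rewrite /act -(prednK sp) big_ord_recl addn0 big1 ?addr0.
  by move/eqP; rewrite mulf_eq0 (negPf p0) => /eqP.
by move=> i _; rewrite Hd ?mulr0 //= /bump /= add1n addnS ltnS leq_addr.
Qed.

Definition rootprod (s : seq A) : {poly A} := \prod_(th <- s) ('X - th%:P).
(** Distinct members have no root of unity as quotient. Repetitions in the list are allowed and
    stand for multiple roots. *)
Definition nondeg (s : seq A) := (forall th, th \in s -> th != 0) /\
  (forall th th' N, th \in s -> th' \in s -> th != th' -> (0 < N)%N -> th ^+ N != th' ^+ N).

Lemma rootprod_coef0 s : (forall th, th \in s -> th != 0) -> (rootprod s)`_0 != 0.
Proof.
move=> H; rewrite -horner_coef0 horner_prod prodf_seq_neq0; apply/allP => th /H.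
by rewrite hornerXsubC sub0r oppr_eq0.
Qed.

Lemma coprimep_rootprod p s : (forall z, z \in s -> ~~ root p z) -> coprimep p (rootprod s).
Proof.
rewrite /rootprod; elim: s => [|t s IHs] rt; first by rewrite big_nil coprimep1.
rewrite big_cons coprimepMr coprimep_XsubC rt ?mem_head // IHs // => z zs.
by apply: rt; rewrite inE zs orbT.
Qed.

Lemma ann_geom th h k : ann ('X - th%:P) h -> h k = th ^+ k * h 0%N.
Proof.
move=> H; elim: k => [|k IHk]; first by rewrite mul1r.
have /eqP := H k; rewrite act_XsubC subr_eq0 => /eqP ->.
by rewrite IHk exprS mulrA.
Qed.

(** The polynomial is (X^d - th^d) / (X - th). It takes the value d th^(d-1) at th, nonzero in
    characteristic 0, and a root of it other than th would have the same d-th power as th. *)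
Lemma coprime_quot s th d : [pchar A] =i pred0 -> nondeg (th :: s) -> (0 < d)%N ->
  coprimep (\sum_(i < d) 'X^(d.-1 - i) * th%:P ^+ i) (rootprod s).
Proof.
move=> charA [nz nd] d0.
have E : 'X^d - th%:P ^+ d = ('X - th%:P) * \sum_(i < d) 'X^(d.-1 - i) * th%:P ^+ i.
  by rewrite subrXX.
apply: coprimep_rootprod => th' ths; apply/negP => /rootP r0; have [e|ne] := eqVneq th' th.
  move: r0; rewrite e horner_sum (eq_bigr (fun=> th ^+ d.-1)).
    rewrite sumr_const card_ord -mulr_natr => /eqP.
    by rewrite mulf_eq0 expf_eq0 (negPf (nz _ (mem_head _ _))) andbF ((pcharf0P A).1 charA) eqn0Ngt d0.
  move=> i _; rewrite hornerM hornerXn -rmorphXn hornerC -exprD subnK //.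
  by rewrite -ltnS prednK.
have := congr1 (fun p => p.[th']) E; rewrite /= hornerM r0 mulr0.
rewrite hornerD hornerXn hornerN -rmorphXn hornerC => /eqP; rewrite subr_eq0.
by apply/negP; apply: nd => //; rewrite inE ?ths ?orbT ?eqxx.
Qed.

(** Induction step on the number of roots: the operator X^d - th^d removes one factor X - th from
    the annihilator, and a sequence that it kills is geometric of ratio th. *)
Lemma ann_elim s th d h : [pchar A] =i pred0 -> nondeg (th :: s) -> (0 < d)%N -> ann (rootprod (th :: s)) h ->
  ann (rootprod s) (act ('X^d - (th ^+ d)%:P) h) /\ ((forall k, act ('X^d - (th ^+ d)%:P) h k = 0) -> ann ('X - th%:P) h).
Proof.
move=> charA nd d0 H.
have E : 'X^d - (th ^+ d)%:P = (\sum_(i < d) 'X^(d.-1 - i) * th%:P ^+ i) * ('X - th%:P).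
  by rewrite rmorphXn subrXX mulrC.
split.
  move=> k; rewrite -actM E mulrCA -/(rootprod s).
  by apply: ann_mull => i; have := H i; rewrite /rootprod big_cons mulrC.
move=> H0 k.
have /ann_coprime := coprime_quot charA nd d0; apply.
  by move=> i; rewrite -actM -E.
by move=> i; rewrite -actM; have := H i; rewrite /rootprod big_cons mulrC.
Qed.

Lemma ann1 h : ann 1 h -> forall k, h k = 0.
Proof. by move=> H k; have := H k; rewrite -[1]polyC1 actC mul1r. Qed.
Lemma ann_nil h : ann (rootprod [::]) h -> h = fun=> 0.
Proof. by rewrite /rootprod big_nil => /ann1 H; apply: funext. Qed.

Lemma pairs_block (f : nat -> bool) n : (\sum_(j < n) f j <= 1 + \sum_(j < n) \sum_(1 <= d < n) (f j && f (j + d)))%N.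
Proof.
elim: n f => [|n IHn] f; first by rewrite big_ord0.
rewrite big_ord_recl [in X in (_ <= 1 + X)%N]big_ord_recl /=.
case f0: (f 0%N).
  rewrite leq_add2l; apply: leq_trans (leq_addr _ _).
  rewrite big_add1 /= big_mkord; apply: leq_sum => j _.
  by rewrite add0n /bump /= add1n.
rewrite add0n; apply: leq_trans (IHn (fun j => f j.+1)) _.
rewrite leq_add2l; apply: leq_trans (leq_addl _ _).
apply: leq_sum => j _; case: n {IHn} j => [|n] j; first by rewrite !big_geq.
rewrite [X in (_ <= X)%N](big_cat_nat _ (n := n.+1)) //=; apply: leq_trans (leq_addr _ _).
by apply: leq_sum => d _; rewrite /bump /= add1n addSn.
Qed.

Lemma sum_blocks (F : nat -> nat) m b : (\sum_(i < m * b) F i = \sum_(t < m) \sum_(j < b) F (t * b + j))%N.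
Proof.
elim: m => [|m IHm]; first by rewrite mul0n !big_ord0.
rewrite big_ord_recr -IHm mulSn addnC /= -(big_mkord xpredT) (big_cat_nat _ (n := (m * b)%N)) ?leq_addr //=.
rewrite big_mkord; congr addn.
rewrite -[X in (\sum_(X <= _ < _) _)%N]add0n big_addn addKn big_mkord.
by apply: eq_bigr => j _; rewrite addnC.
Qed.

(** The m blocks of length 2N contain at least 2m hits together, hence at least m pairs of hits
    within a common block. Their distances are below 2N, so one distance d occurs at least m/(2N)
    times, which is a proportion 1/(4 N^2) of the window. *)
Lemma pairs_dense (f : nat -> bool) N m : (0 < N)%N -> (0 < m)%N -> (m * (2 * N) <= N * \sum_(i < m * (2 * N)) f i)%N ->
  exists2 d, (0 < d)%N & (m * (2 * N) <= (4 * N ^ 2) * \sum_(i < m * (2 * N)) (f i && f (i + d)%N))%N.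
Proof.
move=> N0 m0 H.
apply: contrapT => nH.
have K d : (0 < d)%N -> (2 * N * \sum_(i < m * (2 * N)) (f i && f (i + d)%N) < m)%N.
  move=> d0; rewrite ltnNge; apply/negP => le; apply: nH; exists d => //.
  apply: leq_trans (_ : (2 * N) * (2 * N * \sum_(i < m * (2 * N)) (f i && f (i + d)%N)) <= _)%N.
    by rewrite [X in (X <= _)%N]mulnC leq_mul2l le orbT.
  by rewrite !mulnA; apply: leq_mul => //; lia.
have S : (\sum_(i < m * (2 * N)) f i <= m + \sum_(1 <= d < 2 * N) \sum_(i < m * (2 * N)) (f i && f (i + d)%N))%N.
  rewrite exchange_big /= (sum_blocks (fun i => nat_of_bool (f i))).
  rewrite (sum_blocks (fun i => \sum_(1 <= d < 2 * N) (f i && f (i + d)%N))%N).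
  rewrite -[X in (_ <= X + _)%N]muln1 -[X in (_ <= X * _ + _)%N](card_ord m) -sum_nat_const -big_split /=.
  apply: leq_sum => t _; have := pairs_block (fun j => f (t * (2 * N) + j)%N) (2 * N).
  by under [X in (_ <= _ + X)%N -> _]eq_bigr => j _ do under eq_bigr => d _ do rewrite addnA.
have S2 : (2 * N * \sum_(1 <= d < 2 * N) \sum_(i < m * (2 * N)) (f i && f (i + d)%N) <= (2 * N).-1 * (m.-1))%N.
  rewrite big_distrr /=.
  apply: leq_trans (_ : \sum_(1 <= d < 2 * N) m.-1 <= _)%N.
    rewrite big_nat_cond [X in (_ <= X)%N]big_nat_cond; apply: leq_sum => d /andP[/andP[d0 _] _].
    by rewrite -ltnS prednK //; apply: K.
  by rewrite sum_nat_const_nat subn1.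
have N2 : (0 < 2 * N)%N by lia.
move: S S2 H; move: (\sum_(i < _) _)%N (\sum_(1 <= d < _) _)%N => A1 A2.
move=> S S2 H.
have : (2 * m <= A1)%N by rewrite -(leq_pmul2l N0) mulnA [(N * 2)%N]mulnC mulnC.
move=> H1; have A2m : (m <= A2)%N by lia.
have : (2 * N * m <= (2 * N).-1 * m.-1)%N by apply: leq_trans S2; rewrite leq_pmul2l.
apply/negP; rewrite -ltnNge; apply: leq_ltn_trans (_ : (2 * N).-1 * m < _)%N.
  by rewrite leq_mul2l leq_pred orbT.
by rewrite ltn_pmul2r //; lia.
Qed.

(** Zeros of density 1/N produce, by [pairs_dense], a distance d such that h(k+d) - th^d h(k)
    vanishes with density 1/(4 N^2). That sequence has one root less, so it is zero by induction;
    then h is geometric and has a zero. The window length W serves all h at once. *)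
Lemma few_zeros s N : [pchar A] =i pred0 -> nondeg s -> (0 < N)%N ->
  exists2 W, (0 < W)%N & forall m (f : nat -> bool) h, (0 < m)%N ->
    ann (rootprod s) h -> (m * W <= N * \sum_(i < m * W) f i)%N ->
    (forall i, (i < m * W)%N -> f i -> h i = 0) -> forall k, h k = 0.
Proof.
move=> charA; elim: s N => [|th s IHs] N nd N0.
  by exists 1%N => // m f h _ /ann_nil->.
have nds : nondeg s.
  by case: nd => n1 n2; split=> [x xs|x y M xs ys]; [apply: n1|apply: n2]; rewrite inE ?xs ?ys orbT.
have [|W W0 HW] := IHs (4 * N ^ 2)%N nds; first by rewrite muln_gt0 expn_gt0 N0.
exists (W * (2 * N))%N => [|m f h m0 Hh dens Hf]; first by rewrite !muln_gt0 W0 N0.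
have mW0 : (0 < m * W)%N by rewrite muln_gt0 m0.
rewrite mulnA in dens Hf.
(* Hits are cut off at the end of the window, so that i + d also lies where [h] is known to
   vanish. *)
pose g i := f i && (i < m * W * (2 * N))%N.
have eg : (\sum_(i < m * W * (2 * N)) f i = \sum_(i < m * W * (2 * N)) g i)%N.
  by apply: eq_bigr => i _; rewrite /g ltn_ord andbT.
rewrite eg in dens.
have Hg i : g i -> h i = 0 by case/andP=> fi li; apply: Hf.
have [d d0 Hd] := pairs_dense N0 mW0 dens.
have [H1 H2] := ann_elim charA nd d0 Hh.
have ex0 : exists i, g i.
  apply: contrapT => nex; move: dens; rewrite big1 ?muln0.
    by rewrite leqn0 !muln_eq0 (gtn_eqF m0) (gtn_eqF W0) (gtn_eqF N0).
  by move=> i _; case fi: (g i) => //; case: nex; exists i.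
have Hz := HW (m * (2 * N))%N (fun i => g i && g (i + d)%N) _ _ H1.
have {Hz} Hz : forall k, act ('X^d - (th ^+ d)%:P) h k = 0.
  apply: Hz; rewrite ?muln_gt0 ?m0 ?N0 // mulnAC // => i _ /andP[gi gd].
  by rewrite actD actXn -polyCN actC !Hg // mulr0 addr0.
have K := H2 Hz; case: ex0 => i gi k.
have := Hg _ gi; rewrite (ann_geom i K) => /eqP; rewrite mulf_eq0 expf_eq0.
rewrite (negPf (nd.1 _ (mem_head _ _))) andbF /= => /eqP h0.
by rewrite (ann_geom k K) h0 mulr0.
Qed.

Section Recover.
Variables (p : {poly A}) (P : seq nat).
Hypotheses (p0 : p != 0) (det : forall h, ann p h -> (forall j, j \in P -> h j = 0) -> forall k, h k = 0).

Let m := (size p).-1.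
Let sp : size p = m.+1. Proof. by rewrite /m prednK // size_poly_gt0. Qed.

Lemma ann_modp q h : ann p h -> act q h 0 = \sum_(l < m) (q %% p)`_l * h l.
Proof.
move=> H; rewrite {1}(divp_eq q p) actD actM act0 => [|i]; last by rewrite H.
rewrite add0r (@act_wide m); first by apply: eq_bigr => l _; rewrite add0n.
by rewrite -ltnS -sp ltn_modp.
Qed.

Lemma ann_of_init (v : 'I_m -> A) : exists2 h, ann p h & forall q, act q h 0 = \sum_l v l * (q %% p)`_l.
Proof.
pose h i := \sum_l v l * ('X^i %% p)`_l.
have E q : act q h 0 = \sum_l v l * (q %% p)`_l.
  rewrite /act (eq_bigr (fun j : 'I_(size q) => \sum_l v l * (q`_j * ('X^j %% p)`_l))); last first.
    by move=> j _; rewrite add0n mulr_sumr; apply: eq_bigr => l _; rewrite mulrCA.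
  rewrite exchange_big; apply: eq_bigr => l _ /=; rewrite -mulr_sumr; congr (_ * _).
  rewrite -[in RHS](coefK q) poly_def (big_morph (fun x => x %% p) (fun x y => modpD p x y) (mod0p p)).
  by rewrite coef_sum; apply: eq_bigr => j _; rewrite modpZl coefZ.
exists h => // k; have := E ('X^k * p); rewrite modp_mull actM actXn add0n => ->.
by rewrite big1 // => l _; rewrite coef0 mulr0.
Qed.

(** The columns of [B] are the residues of X^j modulo p for j in P. A vector in the left kernel of
    [B] gives initial values of an annihilated sequence that vanishes on P, so [det] makes the rows
    free and a right inverse supplies the coefficients. *)
Lemma recover i : exists c : seq A, size c = size P /\ forall h, ann p h ->
  forall k, h (k + i)%N = \sum_(j < size P) c`_j * h (k + nth 0%N P j)%N.
Proof.
pose B := \matrix_(l < m, j < size P) ('X^(nth 0%N P j) %% p)`_l.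
have Bfree : row_free B.
  apply: inj_row_free => v vB0; have [h Hh E] := ann_of_init (fun l => v 0 l).
  have hz : forall k, h k = 0.
    apply: det => // j jP; have jl : (index j P < size P)%N by rewrite index_mem.
    move/matrixP: vB0 => /(_ 0 (Ordinal jl)); rewrite mxE [in RHS]mxE => e.
    have := E 'X^j; rewrite actXn => ->; apply: etrans e; apply: eq_bigr => l _.
    by rewrite mxE /= nth_index.
  apply/rowP => l; rewrite mxE.
  have := E 'X^l; rewrite actXn hz modp_small ?size_polyXn ?sp ?ltnS // => e.
  rewrite [RHS]e (bigD1 l) //= coefXn eqxx mulr1 big1 ?addr0 // => l' ne.
  by rewrite coefXn (negPf (_ : l' != l :> nat)) ?mulr0.
pose w := \col_(l < m) ('X^i %% p)`_l.
pose cc := pinvmx B *m w.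
exists (mkseq (fun j => if insub j is Some j' then cc j' 0 else 0) (size P)); split.
  by rewrite size_mkseq.
move=> h Hh k; pose h' i := h (k + i)%N; have Hh' : ann p h' by apply: ann_shift.
pose v := \row_(l < m) h' l.
have e1 t : h (k + t)%N = \sum_(l < m) v 0 l * ('X^t %% p)`_l.
  rewrite -/(h' t); have := ann_modp 'X^t Hh'; rewrite actXn add0n => ->.
  by apply: eq_bigr => l _; rewrite mxE mulrC.
have -> : h (k + i)%N = (v *m w) 0 0.
  by rewrite e1 mxE; apply: eq_bigr => l _; congr (_ * _); rewrite mxE.
have -> : v *m w = v *m B *m cc by rewrite mulmxA -[v *m B *m _]mulmxA (mulmxVp Bfree) mulmx1.
rewrite mxE; apply: eq_bigr => j _; rewrite nth_mkseq // valK mulrC; congr (_ * _).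
by rewrite e1; apply/esym; rewrite mxE; apply: eq_bigr => l _; congr (_ * _); rewrite mxE.
Qed.

End Recover.
End Sequences.

Section Bounds.
Variables (A : fieldType) (R : numDomainType) (ab : A -> R).
Hypotheses (ab_ge0 : nonneg ab) (ab0 : ab 0 = 0) (abM : multiplicative ab) (abD : subadditive ab).

Lemma ab_sum (I : Type) (r : seq I) (P : pred I) (F : I -> A) :
  ab (\sum_(i <- r | P i) F i) <= \sum_(i <- r | P i) ab (F i).
Proof.
elim/big_rec2: _ => [|i y x _ le]; first by rewrite ab0.
by apply: le_trans (abD _ _) _; rewrite lerD2l.
Qed.

Lemma act_bound (p : {poly A}) : exists2 C, 0 <= C & forall h k B,
  (forall j, (j < size p)%N -> ab (h (k + j)%N) <= B) -> ab (act p h k) <= C * B.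
Proof.
exists (\sum_(j < size p) ab p`_j) => [|h k B H]; first exact: sumr_ge0.
rewrite mulr_suml; apply: le_trans (ab_sum _ _ _) _; apply: ler_sum => j _.
by rewrite abM ler_wpM2l ?ab_ge0 // H.
Qed.

(** A window has finitely many subsets, so one constant serves all good ones. This turns a statement
    about zeros into one about small values. *)
Lemma recover_bound (p : {poly A}) W (good : {set 'I_W} -> Prop) i : p != 0 ->
  (forall X, good X -> forall h, ann p h -> (forall j : 'I_W, j \in X -> h j = 0) -> forall k, h k = 0) ->
  exists2 C, 0 <= C & forall X, good X -> forall h, ann p h -> forall k B, 0 <= B ->
    (forall j : 'I_W, j \in X -> ab (h (k + j)%N) <= B) -> ab (h (k + i)%N) <= C * B.
Proof.
move=> p0 det.
have H X : exists C, 0 <= C /\ (good X -> forall h, ann p h -> forall k B, 0 <= B ->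
    (forall j : 'I_W, j \in X -> ab (h (k + j)%N) <= B) -> ab (h (k + i)%N) <= C * B).
  have [gX|nX] := EM (good X); last by exists 0.
  have [|c [sc Hc]] := @recover A p [seq val j | j <- enum X] p0 _ i.
    move=> h Hh Hz; apply: (det X gX h Hh) => j jX; apply: Hz.
    by apply: map_f; rewrite mem_enum.
  exists (\sum_(j < size [seq val j | j <- enum X]) ab c`_j); split; first exact: sumr_ge0.
  move=> _ h Hh k B B0 HB; rewrite (Hc _ Hh) mulr_suml; apply: le_trans (ab_sum _ _ _) _.
  apply: ler_sum => j _; rewrite abM ler_wpM2l ?ab_ge0 //.
  have jl : (j < size (enum X))%N by rewrite -(size_map (val : 'I_W -> nat)) ltn_ord.
  have x0 : 'I_W by case: (enum X) (leq_ltn_trans (leq0n j) jl).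
  by rewrite (nth_map x0) //; apply: HB; rewrite -mem_enum mem_nth.
have [f Hf] := choice H.
exists (\sum_X f X) => [|X gX h Hh k B B0 HB]; first by apply: sumr_ge0 => X _; case: (Hf X).
apply: le_trans ((Hf X).2 gX h Hh k B B0 HB) _; apply: ler_wpM2r => //.
by rewrite (bigD1 X) //= lerDl; apply: sumr_ge0 => Y _; case: (Hf Y).
Qed.

End Bounds.

Section Field.
Variable A : fieldType.
Hypothesis charA : [pchar A] =i pred0.

Definition dense N W (X : {set 'I_W}) := (W <= N * #|X|)%N.

Lemma dense_det (s : seq A) N : nondeg s -> (0 < N)%N ->
  exists2 W, (0 < W)%N & forall m (X : {set 'I_(m * W)}) h, (0 < m)%N -> dense N X ->
   ann (rootprod s) h -> (forall j : 'I_(m * W), j \in X -> h j = 0) -> forall k, h k = 0.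
Proof.
move=> nd N0; have [W W0 HW] := few_zeros charA nd N0; exists W => // m X h m0 dX Hh Hz.
apply: (HW m (fun i => i \in [seq val j | j <- enum X]) h m0 Hh).
  apply: leq_trans dX _; rewrite leq_mul2l -sum1_card big_mkcond; apply/orP; right.
  apply: leq_sum => j _; case: ifP => // jX.
  by rewrite map_f // mem_enum.
by move=> i _ /mapP[j]; rewrite mem_enum => jX ->; apply: Hz.
Qed.

(** N is a common multiple of the exponents at which two roots get equal powers; after raising to
    the power N such roots coincide, and no other torsion quotient remains. *)
Lemma nondeg_power (s : seq A) : (forall th, th \in s -> th != 0) -> exists2 N, (0 < N)%N & nondeg [seq th ^+ N | th <- s].
Proof.
move=> nz.
have H (xy : A * A) : exists N, (0 < N)%N /\ ((exists2 M, (0 < M)%N & xy.1 ^+ M = xy.2 ^+ M) -> xy.1 ^+ N = xy.2 ^+ N).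
  have [[M M0 e]|ne] := EM (exists2 M, (0 < M)%N & xy.1 ^+ M = xy.2 ^+ M).
    by exists M.
  by exists 1%N.
have [f Hf] := choice H.
exists (\prod_(xy <- [seq (x, y) | x <- s, y <- s]) f xy)%N.
    by rewrite prodn_gt0 // => xy; case: (Hf xy).
  set N := (\prod_(_ <- _) _)%N.
  split=> [_ /mapP[th ths ->]|_ _ M /mapP[x xs ->] /mapP[y ys ->] ne M0].
    by rewrite expf_neq0 ?nz.
  apply: contraNneq ne; rewrite -!exprM => e.
  have d : (f (x, y) %| N)%N.
    rewrite /N (big_rem (x, y)) ?dvdn_mulr //=.
    by apply: allpairs_f.
  case/dvdnP: d => q ->; rewrite mulnC !exprM.
  have N0 : (0 < N * M)%N.
    by rewrite muln_gt0 M0 andbT prodn_gt0 // => xy; case: (Hf xy).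
  by have [_ /= -> //] := Hf (x, y); exists (N * M)%N.
Qed.

Lemma ann_subsample (s : seq A) N rho h : ann (rootprod s) h ->
  ann (rootprod [seq th ^+ N | th <- s]) (fun k => h (N * k + rho)%N).
Proof.
move=> H k.
have E p : act p (fun k => h (N * k + rho)%N) k = act (p \Po 'X^N) h (N * k + rho)%N.
  elim/poly_ind: p k {H} => [|p c IHp] k; first by rewrite comp_poly0 -[0]polyC0 !actC !mul0r.
  rewrite comp_polyD comp_polyM comp_polyX comp_polyC !actD !actC actMX IHp; congr (_ + _).
  by rewrite mulrC actM actXn; congr (act _ _ _) => //; rewrite mulnS; lia.
rewrite E; apply: (ann_dvd _ H).
rewrite /rootprod big_map rmorph_prod /=.
elim: s {H E} => [|th s IHs]; first by rewrite !big_nil dvd1p.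
rewrite !big_cons dvdp_mul // comp_polyB comp_polyX comp_polyC rmorphXn subrXX.
exact: dvdp_mulr.
Qed.

(** Exponential polynomials with nonzero bases in A; a base repeated in the list allows polynomial
    factors in k. *)
Definition expoly (h : nat -> A) := exists s, (forall th, th \in s -> th != 0) /\ ann (rootprod s) h.
Lemma expoly_ext h h' : h =1 h' -> expoly h -> expoly h'.
Proof. by move/funext->. Qed.
Lemma rootprod_cat s s' : rootprod (s ++ s') = rootprod s * rootprod s' :> {poly A}.
Proof. by rewrite /rootprod big_cat. Qed.

Lemma expolyD h h' : expoly h -> expoly h' -> expoly (fun k => h k + h' k).
Proof.
move=> [s [nz H]] [s' [nz' H']]; exists (s ++ s'); split.
  by move=> th; rewrite mem_cat => /orP[/nz|/nz'].
move=> k; rewrite rootprod_cat actDh (ann_mull _ H') addr0 mulrC.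
by rewrite ann_mull.
Qed.

(** Leibniz rule: X - th th' sends h h' to ((X - th) h)(k) h'(k+1) + th h(k) ((X - th') h')(k), and
    each summand has one root less in one of the factors. *)
Lemma expolyM h h' : expoly h -> expoly h' -> expoly (fun k => h k * h' k).
Proof.
move=> [s [nz H]] [s' [nz' H']].
have z : expoly (fun=> 0) by exists [::]; split=> // k; rewrite act0h.
have [m le] := ubnP (size s + size s').
elim: m => // m IHm in s s' h h' nz nz' H H' le *.
case: s s' nz nz' H H' le => [|th s] [|th' s'] nz nz' H H' le.
- by rewrite (ann_nil H); apply: expoly_ext z => k; rewrite mul0r.
- by rewrite (ann_nil H); apply: expoly_ext z => k; rewrite mul0r.
- by rewrite (ann_nil H'); apply: expoly_ext z => k; rewrite mulr0.
have K1 : expoly (fun k => act ('X - th%:P) h k * h' k.+1).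
  apply: (IHm s (th' :: s')) => [x xs|//|k|k|]; rewrite /= in le *; last by lia.
  - by apply: nz; rewrite inE xs orbT.
  - by rewrite -actM mulrC; have := H k; rewrite /rootprod big_cons.
  - by rewrite (act_shift _ h' 1 k) H'.
have K2 : expoly (fun k => th * h k * act ('X - th'%:P) h' k).
  apply: (IHm (th :: s) s') => [//|x xs|k|k|]; rewrite /= in le *; last by lia.
  - by apply: nz'; rewrite inE xs orbT.
  - by rewrite actZh H mulr0.
  - by rewrite -actM mulrC; have := H' k; rewrite /rootprod big_cons.
have [s2 [nz2 H2]] := expolyD K1 K2.
exists (th * th' :: s2); split.
  move=> x; rewrite inE => /orP[/eqP->|/nz2 //].
  by apply: mulf_neq0; [apply: nz|apply: nz']; rewrite mem_head.
move=> k; rewrite /rootprod big_cons mulrC actM -/(rootprod s2).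
have <- := H2 k; apply: act_ext => i; rewrite !act_XsubC; ring.
Qed.

Lemma expoly_geom th : th != 0 -> expoly (fun k => th ^+ k).
Proof.
move=> th0; exists [:: th]; split=> [x|k]; first by rewrite inE => /eqP->.
by rewrite /rootprod big_cons big_nil mulr1 act_XsubC exprS subrr.
Qed.

Lemma expoly_cst c : expoly (fun=> c).
Proof.
exists [:: 1]; split=> [x|k]; first by rewrite inE => /eqP->; rewrite oner_neq0.
by rewrite /rootprod big_cons big_nil mulr1 act_XsubC mul1r subrr.
Qed.

Lemma expoly_nat : expoly (fun k => k%:R).
Proof.
exists [:: 1; 1]; split=> [x|k]; first by rewrite !inE orbb => /eqP->; rewrite oner_neq0.
rewrite /rootprod !big_cons big_nil mulr1 actM !act_XsubC -!natr1; ring.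
Qed.

Lemma expoly_sum (I : Type) (r : seq I) (P : pred I) (F : I -> nat -> A) :
  (forall i, P i -> expoly (F i)) -> expoly (fun k => \sum_(i <- r | P i) F i k).
Proof. by move=> H; rewrite big_fun; elim/big_ind: _ => // *; [exact: expoly_cst|exact: expolyD]. Qed.

End Field.

Lemma exp_superlinear (F : archiNumFieldType) (t B : F) : 1 < t -> 0 <= B -> for_large k, B * k%:R <= t ^+ k.
Proof.
move=> t1 B0; have e0 : 0 < t - 1 by rewrite subr_gt0.
have bern k : k%:R * (t - 1) <= t ^+ k.
  elim: k => [|k IHk]; first by rewrite mul0r.
  have -> : t ^+ k.+1 = (t - 1) * t ^+ k + t ^+ k by rewrite exprS; ring.
  have -> : k.+1%:R * (t - 1) = (t - 1) + k%:R * (t - 1) by rewrite -natr1; ring.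
  by rewrite lerD // ler_peMr ?(ltW e0) // exprn_ege1 // ltW.
have quad k : k%:R * (k%:R - 1) * (t - 1) ^+ 2 <= 2 * t ^+ k.
  elim: k => [|k IHk]; first by rewrite !mul0r expr0 mulr1.
  have -> : 2 * t ^+ k.+1 = 2 * (t - 1) * t ^+ k + 2 * t ^+ k by rewrite exprS; ring.
  have -> : k.+1%:R * (k.+1%:R - 1) * (t - 1) ^+ 2 =
     2 * (t - 1) * (k%:R * (t - 1)) + k%:R * (k%:R - 1) * (t - 1) ^+ 2 by rewrite -natr1; ring.
  by rewrite lerD // ler_pM2l ?bern // mulr_gt0.
have q0 : 0 <= 2 * B / (t - 1) ^+ 2.
  by apply: divr_ge0; [rewrite mulr_ge0|apply/exprn_ge0/ltW].
exists (Num.bound (2 * B / (t - 1) ^+ 2)).+1 => k hk.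
have h1 : 2 * B <= (k%:R - 1) * (t - 1) ^+ 2.
  rewrite -ler_pdivrMr ?exprn_gt0 //.
  have := archi_boundP q0 => /ltW/le_trans; apply.
  by rewrite lerBrDr natr1 ler_nat.
rewrite -(ler_pM2l (x := 2)) //; apply: le_trans (quad k).
have -> : 2 * (B * k%:R) = 2 * B * k%:R by ring.
have -> : k%:R * (k%:R - 1) * (t - 1) ^+ 2 = (k%:R - 1) * (t - 1) ^+ 2 * k%:R by ring.
by rewrite ler_wpM2r.
Qed.

Section Growth.
Variable p : {poly rat}.
Hypotheses (p_neq0 : p != 0) (p0 : p`_0 != 0).
Hypothesis no_unity : forall z : algC, root (map_poly ratr p) z -> forall N, (0 < N)%N -> z ^+ N != 1.

(** For a proper factor q1 of q, either q1 kills y and replaces q, or [act q1 y] is nonzero and is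
    killed by the cofactor. In both cases the degree drops. *)
Lemma ann_irreducible (q : {poly rat}) y : q != 0 -> ann q y -> ~ (forall k, y k = 0) ->
  exists g pi, [/\ pi %| q, irreducible_poly pi, ann pi (act g y) & ~ (forall k, act g y k = 0)].
Proof.
have [m le] := ubnP (size q); elim: m => // m IHm in q y le *.
move=> q0 qy y0.
have sq : (1 < size q)%N.
  rewrite ltnNge; apply/negP => /size1_polyC qc; apply: y0 => k.
  have := qy k; rewrite qc actC => /eqP; rewrite mulf_eq0 => /orP[/eqP c0|/eqP //].
  by move: q0; rewrite qc c0 eqxx.
have [irr|] := EM (irreducible_poly q).
  exists 1, q; split=> //; first by move=> k; rewrite (act_ext _ (h' := y)) // => i; rewrite -[1]polyC1 actC mul1r.
  by move=> H; apply: y0 => k; have := H k; rewrite -[1]polyC1 actC mul1r.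
move=> nirr.
have [q1 [s1 d1 n1]] : exists q1 : {poly rat}, [/\ size q1 != 1%N, q1 %| q & ~~ (q1 %= q)].
  apply: contrapT => H; apply: nirr; split=> // q1 s1 d1.
  by apply/negPn/negP => n1; apply: H; exists q1.
have q10 : q1 != 0 by apply: contraNneq q0 => e; move: d1; rewrite e dvd0p.
have [q2 eq2] := dvdpP _ _ d1.
have q20 : q2 != 0 by apply: contraNneq q0 => e; rewrite eq2 e mul0r.
have ss : (size q1 < size q)%N.
  by rewrite ltn_neqAle dvdp_size_eqp // n1 dvdp_leq.
have ss2 : (size q2 < size q)%N.
  rewrite eq2 size_mul //; have z1 : (0 < size q1)%N by rewrite size_poly_gt0.
  have z2 : (0 < size q2)%N by rewrite size_poly_gt0.
  by move: (size q1) (size q2) s1 z1 z2 => a b /eqP; lia.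
have [H|H] := EM (forall k, act q1 y k = 0).
  have [|g [pi [d i a nz]]] := IHm q1 y _ q10 H y0; first by lia.
  by exists g, pi; split=> //; apply: dvdp_trans d1.
have [||g [pi [d i a nz]]] := IHm q2 (act q1 y) _ q20 _ H; first by rewrite -ltnS; apply: leq_trans le.
  by move=> k; rewrite -actM -eq2.
exists (g * q1), pi; split=> //.
- by apply: dvdp_trans d _; rewrite eq2 dvdp_mulr.
- by move=> k; rewrite -(a k); apply: act_ext => i'; rewrite actM.
by move=> H'; apply: nz => k; rewrite -actM.
Qed.

Lemma act_geom (A : fieldType) (q : {poly A}) e th k : act q (fun k => e * th ^+ k) k = e * q.[th] * th ^+ k.
Proof.
rewrite /act horner_coef -mulrA mulr_suml mulr_sumr; apply: eq_bigr => j _.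
rewrite exprD; ring.
Qed.

Lemma ann_sum_geom (A : fieldType) (s : seq A) h : uniq s -> ann (rootprod s) h ->
  exists e : A -> A, forall k, h k = \sum_(th <- s) e th * th ^+ k.
Proof.
elim: s h => [|th s IHs] h /=.
  by move=> _ /ann_nil->; exists (fun=> 0) => k; rewrite big_nil.
move=> /andP[ths us] H.
have cop : coprimep ('X - th%:P) (rootprod s).
  rewrite coprimep_sym coprimep_XsubC root_prod_XsubC //.
have [[u v] /= E] := Bezout_eq1_coprimepP _ _ cop.
have [|e1 He1] := IHs (act (u * ('X - th%:P)) h) us.
  move=> k; rewrite -actM mulrCA; apply: ann_mull => i.
  by have := H i; rewrite /rootprod big_cons mulrC.
have K2 : ann ('X - th%:P) (act (v * rootprod s) h).
  move=> k; rewrite -actM mulrCA; apply: ann_mull => i.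
  by have := H i; rewrite /rootprod big_cons.
exists (fun x => if x == th then act (v * rootprod s) h 0 else e1 x) => k.
rewrite big_cons eqxx [_ * th ^+ k]mulrC -(ann_geom k K2) -[LHS]mul1r -actC polyC1 -E actD addrC; congr (_ + _).
by rewrite He1; apply: eq_big_seq => x xs; case: eqP => // e; move: ths; rewrite -e xs.
Qed.

Lemma irreducible_coprime_deriv (q : {poly rat}) : irreducible_poly q -> coprimep q q^`().
Proof.
move=> [sq irr]; rewrite coprimep_def; apply: contraT => n1.
have := irr _ n1 (dvdp_gcdl _ _) => e.
have d : q %| q^`() by rewrite -(eqp_dvdl _ e) dvdp_gcdr.
have q'0 : q^`() != 0.
  apply/eqP => /(congr1 (fun u : {poly rat} => u`_((size q).-2))).
  rewrite coef0 coef_deriv => /eqP; rewrite mulrn_eq0.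
  have E : (size q).-2.+1 = (size q).-1 by case: (size q) sq => [|[|z]].
  by rewrite E -/(lead_coef q) lead_coef_eq0 -size_poly_eq0; case: (size q) sq => [|[|z]].
have q0 : q != 0 by rewrite -size_poly_gt0 ltnW.
by have := leq_ltn_trans (dvdp_leq q'0 d) (lt_size_deriv q0); rewrite ltnn.
Qed.

Lemma pigeon (T : finType) (f : nat -> T) : exists k1 k2, (k1 < k2)%N /\ f k1 = f k2.
Proof.
apply: contrapT => H.
have /leq_card : injective (fun k : 'I_(#|T|.+1) => f k).
  move=> k1 k2 e; case: (ltngtP (val k1) (val k2)) => [lt|lt|/val_inj //]; case: H.
    by exists (val k1), (val k2).
  by exists (val k2), (val k1).
by rewrite card_ord ltnn.
Qed.

(** A window of deg q consecutive values determines all later ones, and only finitely many windows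
    of bounded integers exist, so two of them agree. *)
Lemma bounded_periodic (A : fieldType) (q : {poly A}) (y : nat -> int) B :
  q != 0 -> q`_0 != 0 -> ann q (fun k => (y k)%:~R) -> injective (intr : int -> A) -> (forall k, `|y k| <= B)%N ->
  exists k1 T, (0 < T)%N /\ forall k, y (k1 + T + k)%N = y (k1 + k)%N.
Proof.
move=> q0 q00 Hy inj bnd.
pose d := (size q).-1.
pose f (k : nat) : {ffun 'I_d -> 'I_(B + B).+1} := [ffun i : 'I_d => inord `|(y (k + i)%N + B%:Z)%R|].
have [k1 [k2 [lt e]]] := pigeon f.
have ei i : (i < d)%N -> y (k1 + i)%N = y (k2 + i)%N.
  move=> id; move/ffunP: e => /(_ (Ordinal id)); rewrite !ffunE /= => /(congr1 val).
  have b1 := bnd (k1 + i)%N; have b2 := bnd (k2 + i)%N.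
  by rewrite /= !inordK; lia.
exists k1, (k2 - k1)%N; split; first by rewrite subn_gt0.
rewrite subnKC; last exact: ltnW.
pose h k : A := (y (k2 + k)%N - y (k1 + k)%N)%:~R.
have Hh : ann q h.
  move=> k; have := Hy (k2 + k)%N; have := Hy (k1 + k)%N.
  rewrite -!(act_shift _ (fun k => (y k)%:~R)) => e1 e2.
  rewrite (act_ext _ (h' := fun i => (y (k2 + i)%N)%:~R + (-1) * (y (k1 + i)%N)%:~R)).
    by rewrite actDh actZh e1 e2 mulr0 addr0.
  by move=> i; rewrite /h rmorphB mulN1r.
suff hz k : h k = 0.
  by move=> k; apply: inj; apply/eqP; rewrite -subr_eq0 -rmorphB; apply/eqP/hz.
have [m] := ubnP k; elim: m k => // m IHm k le.
have [kd|dk] := ltnP k d; first by rewrite /h ei // subrr.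
have := Hh (k - d)%N; have sq : size q = d.+1 by rewrite /d prednK // size_poly_gt0.
rewrite /act sq big_ord_recr /= big1 ?add0r => [/eqP|i _].
  rewrite mulf_eq0 subnK // => /orP[|/eqP //].
  by rewrite -[d]/(d.+1.-1) -sq -/(lead_coef q) lead_coef_eq0 (negPf q0).
by rewrite IHm ?mulr0 //; have := ltn_ord i; lia.
Qed.

(** Pass to an irreducible factor, where the sequence is a sum of e_th th^k over simple roots. If a
    root of modulus above 1 occurs, isolating its term gives exponential growth. Otherwise a
    multiple of the sequence is integral and bounded, hence eventually periodic and killed by some
    X^T - 1, which is coprime to the factor as no root is a root of unity. *)
Lemma growth (x : nat -> int) : ann p (fun k => (x k)%:~R) -> ~ (forall k, x k = 0) ->
  exists W, forall C, for_large k, exists2 i, (i < W)%N & (C * k <= `|x (k + i)%N|)%N.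
Proof.
move=> Hx x0.
have [|g [pi [dpi irr api nz]]] := ann_irreducible p_neq0 Hx.
  by move=> H; apply: x0 => k; apply/eqP; rewrite -(intr_eq0 rat) H.
pose x' := act g (fun k => (x k)%:~R).
have pi0 : pi != 0 by rewrite -size_poly_eq0; case: irr => [+ _]; lia.
have [s Es] := closed_field_poly_normal (map_poly ratr pi : {poly algC}).
rewrite lead_coef_map in Es.
have lc0 : (ratr (lead_coef pi) : algC) != 0 by rewrite fmorph_eq0 lead_coef_eq0.
have us : uniq s.
  rewrite -separable_prod_XsubC -/(rootprod s).
  have : separable_poly (map_poly ratr pi : {poly algC}).
    by rewrite separable_map unlock; apply: irreducible_coprime_deriv.
  rewrite Es; apply: dvdp_separable; by rewrite dvdpZr // dvdpp.
pose hC k : algC := ratr (x' k).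
have actC' (q : {poly rat}) (h : nat -> rat) k : act (map_poly ratr q) (fun k => ratr (h k) : algC) k = ratr (act q h k).
  rewrite (@act_wide _ (size q)) ?size_map_poly // rmorph_sum; apply: eq_bigr => j _.
  by rewrite coef_map rmorphM.
have HhC : ann (rootprod s) hC.
  move=> k; apply: (mulfI lc0); rewrite mulr0 -actC -actM mul_polyC -[_ *: _]Es actC' api rmorph0 //.
have [e He] := ann_sum_geom us HhC.
have [[th ths [e0 big]]|small] := EM (exists2 th, th \in s & e th != 0 /\ 1 < `|th|).
  (* Kills the terms of all other roots and leaves a nonzero multiple of th^k. *)
  pose q := \prod_(z <- rem th s) ('X - z%:P).
  have qth : q.[th] != 0.
    rewrite horner_prod prodf_seq_neq0; apply/allP => z; rewrite mem_rem_uniq // inE => /andP[ne _].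
    by rewrite hornerXsubC subr_eq0 eq_sym.
  have Eq k : act q hC k = e th * q.[th] * th ^+ k.
    have -> : act q hC k = \sum_(t <- s) act q (fun k => e t * t ^+ k) k.
      rewrite /act exchange_big; apply: eq_bigr => j _ /=.
      by rewrite He mulr_sumr.
    rewrite (big_rem th) //= act_geom big_seq big1 ?addr0 // => t ts.
    rewrite act_geom (_ : q.[t] = 0) ?mulr0 ?mul0r //; apply/rootP.
    by rewrite root_prod_XsubC.
  have [C1 C10 HC1] := act_bound (ab := fun z : algC => `|z|) (@normr_ge0 _ _) (normr0 _) (@normrM _) (@ler_normD _ _) q.
  have [C2 C20 HC2] := act_bound (ab := fun z : algC => `|z|) (@normr_ge0 _ _) (normr0 _) (@normrM _) (@ler_normD _ _) (map_poly ratr g).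
  exists (size q + size g)%N => C.
  have c0 : 0 < `|e th * q.[th]| by rewrite normr_gt0 mulf_neq0.
  set E := `|e th * q.[th]| in c0.
  have [|k0 Hk0] := @exp_superlinear algC `|th| (C1 * (C2 * C%:R) / E + 1) big.
    by rewrite addr_ge0 // divr_ge0 ?mulr_ge0 // ltW.
  exists k0.+1 => k hk; apply: contrapT => H.
  have small i : (i < size q + size g)%N -> (`|x (k + i)%N| < C * k)%N.
    by move=> il; rewrite ltnNge; apply/negP => le; apply: H; exists i.
  have := Hk0 k (ltnW hk).
  have B1 : `|act q hC k| <= C1 * (C2 * (C * k)%:R).
    apply: HC1 => j jq; rewrite /hC -actC'; apply: HC2 => i; rewrite size_map_poly => ig.
    rewrite ratr_int -intr_norm -abszE ler_nat -addnA ltnW //; apply: small.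
    by rewrite -addSn; apply: leq_add jq (ltnW ig).
  rewrite Eq normrM normrX -/E in B1 => B2.
  have B3 : `|th| ^+ k <= C1 * (C2 * C%:R) / E * k%:R.
    by rewrite mulrAC ler_pdivlMr // mulrC (le_trans B1) // natrM !mulrA.
  have := le_trans B2 B3; rewrite mulrDl mul1r gerDl lern0 => /eqP kz; by rewrite kz in hk.
have le1 th : th \in s -> e th != 0 -> `|th| <= 1.
  move=> ths e0; rewrite real_leNgt ?normr_real ?real1 //; apply/negP => lt.
  by apply: small; exists th.
have bnd k : `|hC k| <= \sum_(th <- s) `|e th|.
  rewrite He; apply: le_trans (ler_norm_sum _ _ _) _; rewrite big_seq [X in _ <= X]big_seq.
  apply: ler_sum => th ths; rewrite normrM normrX.
  have [->|e0] := eqVneq (e th) 0; first by rewrite normr0 mul0r.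
  by rewrite ler_piMr // exprn_ile1 // le1.
have [gz [a a0 Eg]] := rat_poly_scale g.
have Egj (j : nat) : g`_j = a%:~R^-1 * (gz`_j)%:~R by rewrite {1}Eg coefZ coef_map.
pose y k : int := \sum_(j < size g) gz`_j * x (k + j)%N.
have Ey k : (y k)%:~R = a%:~R * x' k :> rat.
  rewrite /x' /act mulr_sumr rmorph_sum; apply: eq_bigr => j _.
  by rewrite rmorphM Egj mulrA mulrA divff ?mul1r // intr_eq0.
have [B HB] : exists B, forall k, (`|y k| <= B)%N.
  exists (Num.bound (`|a%:~R : algC| * \sum_(th <- s) `|e th|)) => k.
  rewrite -(ler_nat algC) natr_absz intr_norm.
  apply: le_trans (ltW (archi_boundP _)); last by rewrite mulr_ge0 // sumr_ge0.
  have -> : (y k)%:~R = a%:~R * hC k :> algC by rewrite /hC -[LHS](ratr_int algC) Ey rmorphM /= ratr_int.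
  by rewrite normrM ler_wpM2l.
have pi00 : pi`_0 != 0.
  by apply: contraNneq p0 => e'; have [u ->] := dvdpP _ _ dpi; rewrite coef0M e' mulr0.
have Hy : ann pi (fun k => (y k)%:~R).
  by move=> k; rewrite (act_ext _ (h' := fun i => a%:~R * x' i)) // actZh api mulr0.
have [k1 [T [T0 per]]] := bounded_periodic pi0 pi00 Hy (@intr_inj _) HB.
have cop : coprimep ('X^T - 1) pi.
  rewrite -(coprimep_map (@ratr algC)) Es coprimepZr // rmorphB rmorph1 /= map_polyXn.
  apply: coprimep_rootprod => z zs; apply/negP => /rootP; rewrite hornerD hornerN hornerXn hornerC => /eqP.
  rewrite subr_eq0; apply/negP; apply: no_unity => //.
  have [u ->] := dvdpP _ _ dpi; rewrite rmorphM /= rootM Es rootZ // root_prod_XsubC zs orbT //.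
have z1 : forall k, (y (k1 + k)%N)%:~R = 0 :> rat.
  apply: (ann_coprime cop); last by apply: (ann_shift (h := fun k => (y k)%:~R)).
  move=> k; rewrite actD actXn -polyC1 -polyCN actC mulN1r -[(k1 + (k + T))%N](_ : (k1 + T + k)%N = _) ?per ?subrr //.
  by lia.
case: nz => k; have := ann_back pi00 Hy (d := k1) _ k.
rewrite Ey => H; have /eqP : a%:~R * x' k = 0.
  by apply: H => i le; rewrite -(subnKC le) z1.
by rewrite mulf_eq0 intr_eq0 (negPf a0) => /eqP.
Qed.

End Growth.

(** * Orbits of exponents *)

Lemma min_nat (P : nat -> Prop) : (exists d, P d) -> exists2 d, P d & forall e, P e -> (d <= e)%N.
Proof.
case=> d Pd; apply: contrapT => H.
have K : forall k e, (e < k)%N -> ~ P e.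
  elim=> // k IHk e; rewrite ltnS => le Pe; apply: H; exists e => // e' Pe'.
  by rewrite leqNgt; apply/negP => lt; apply: (IHk e') => //; apply: leq_trans le.
by apply: (K d.+1 d).
Qed.

(** The least positive d with t and t + d both in S divides every element of S, so d = 1. For k >=
    t^2 write k = q t + r with r < t <= q; then k = (q - r) t + r (t + 1). *)
Lemma semigroup_large (S : nat -> Prop) : S 0%N -> (forall s t, S s -> S t -> S (s + t)%N) ->
  (forall d, (1 < d)%N -> exists2 i, S i & ~~ (d %| i)%N) -> for_large t, S t.
Proof.
move=> S0 SD Sg.
have SM q s : S s -> S (q * s)%N by move=> Ss; elim: q => // q IHq; rewrite mulSn; apply: SD.
have [|d [d0 [t [St Std]]] dmin] := @min_nat (fun d => (0 < d)%N /\ exists t, S t /\ S (t + d)%N).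
  have [i Si ni] := Sg 2%N isT; exists i; split; first by case: i ni {Si}.
  by exists 0%N.
have dd a : S a -> (d %| a)%N.
  move=> Sa; rewrite /dvdn; apply/negPn/negP => r0; have : (d <= a %% d)%N.
    apply: dmin; split; first by rewrite lt0n.
    exists (a %/ d * (t + d))%N; split; first exact: SM.
    have -> : (a %/ d * (t + d) + a %% d = a %/ d * t + a)%N.
      by rewrite mulnDr -addnA -divn_eq.
    by apply: SD => //; apply: SM.
  by rewrite leqNgt ltn_mod d0.
have d1 : d = 1%N.
  apply/eqP; rewrite eqn_leq d0 andbT leqNgt; apply/negP => /Sg[i /dd di].
  by rewrite di.
rewrite d1 in Std; exists (t * t)%N => k le.
case: (posnP t) => [t0|t0]; first by rewrite -[k]muln1; apply: SM; rewrite t0 in Std.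
rewrite (divn_eq k t); have r := ltn_pmod k t0.
have q : (t <= k %/ t)%N by rewrite leq_divRL.
have -> : (k %/ t * t + k %% t = (k %/ t - k %% t) * t + k %% t * (t + 1))%N.
  rewrite mulnDr muln1 addnA -mulnDl subnK //; lia.
by apply: SD; apply: SM.
Qed.

Section Act.
Variable A : fieldType.
Lemma actZ (c : A) p h k : act (c *: p) h k = c * act p h k.
Proof. by rewrite -mul_polyC actM actC. Qed.
Lemma actN (p : {poly A}) h k : act (- p) h k = - act p h k.
Proof. by rewrite -scaleN1r actZ mulN1r. Qed.
Lemma act_sum (I : Type) (s : seq I) (F : I -> {poly A}) h k : act (\sum_(i <- s) F i) h k = \sum_(i <- s) act (F i) h k.
Proof. by apply: (big_morph (fun p => act p h k)) => [p q|]; rewrite ?actD // -[0]polyC0 actC mul0r. Qed.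
End Act.

Section Rec.
Import mpoly.
Variables (m : nat) (c : nat -> nat).
Notation n := m.+1.
Implicit Types a b : 'X_{1..n}.

Definition Om a : 'X_{1..n} := [multinom (if i == ord_max then \sum_(j < n) c (n - j) * a j else a (inord i.+1))%N | i < n].
(** The solution of the recurrence with initial values a; by [xsE] the coordinates of an iterate of
    [Om] are consecutive terms of it. *)
Definition xs a k : nat := iter k Om a ord0.
Lemma Om_max a : Om a ord_max = (\sum_(j < n) c (n - j) * a j)%N.
Proof. by rewrite /Om mnmE eqxx. Qed.

Lemma Om_lt a (i : nat) : (i < m)%N -> Om a (inord i) = a (inord i.+1).
Proof.
move=> im; have ii : (inord i : 'I_n) = i :> nat by rewrite inordK // ltnS ltnW.
rewrite /Om mnmE ifN ?ii //; apply/eqP => /(congr1 val) /=; rewrite ii => e.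
by rewrite e ltnn in im.
Qed.

Lemma xsE a k (i : 'I_n) : iter k Om a i = xs a (k + i).
Proof.
rewrite -[i]inord_val inordK //; case: i => i /=; elim: i k => [|i IHi] k ilt.
  by rewrite addn0 /xs; congr (iter k Om a _); apply/val_inj; rewrite /= inordK.
by rewrite -Om_lt // -iterS IHi ?addSnnS // ltnW.
Qed.

Lemma xs_rec a k : xs a (k + n) = (\sum_(j < n) c (n - j) * xs a (k + j))%N.
Proof.
by rewrite addnS -addSn -[m]/(val (@ord_max m)) -xsE iterS Om_max; apply: eq_bigr => j _; rewrite xsE.
Qed.

Lemma xs_init a (i : 'I_n) : xs a i = a i.
Proof. by rewrite -[val i]add0n -xsE. Qed.

Lemma OmD a b : Om (a + b)%MM = (Om a + Om b)%MM.
Proof.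
apply/mnmP => i; rewrite mnmDE !mnmE; case: ifP => _; last by rewrite ?mnmDE.
by rewrite -big_split; apply: eq_bigr => j _; rewrite ?mnmDE mulnDr.
Qed.

Lemma iter_OmD k a b : iter k Om (a + b)%MM = (iter k Om a + iter k Om b)%MM.
Proof. by elim: k => // k IHk; rewrite !iterS IHk OmD. Qed.
Lemma xsD a b k : xs (a + b)%MM k = (xs a k + xs b k)%N.
Proof. by rewrite /xs iter_OmD mnmDE. Qed.
Lemma xs_shift a d k : xs (iter d Om a) k = xs a (d + k).
Proof. by rewrite /xs -iterD addnC. Qed.

Lemma xs_uniq (r : nat -> nat) a : (forall k, r (k + n)%N = \sum_(j < n) c (n - j) * r (k + j))%N ->
  (forall i : 'I_n, r i = a i) -> forall k, r k = xs a k.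
Proof.
move=> rr ri k; have [b] := ubnP k; elim: b k => // b IHb k le.
have [kn|nk] := ltnP k n; first by rewrite -[k]/(val (Ordinal kn)) ri xs_init.
rewrite -(subnK nk) rr xs_rec; apply: eq_bigr => j _; rewrite IHb //.
by have := ltn_ord j; lia.
Qed.

Lemma xs_le a b k : (forall i, (a i <= b i)%N) -> (xs a k <= xs b k)%N.
Proof.
move=> le; have -> : b = (a + (b - a))%MM by apply/mnmP => i; rewrite mnmDE mnmBE subnKC.
by rewrite xsD leq_addr.
Qed.

Definition cpoly (A : nzRingType) : {poly A} := 'X^n - \sum_(i < n) (c (n - i))%:R *: 'X^i.

Lemma size_cpoly (A : nzRingType) : size (cpoly A) = n.+1.
Proof.
rewrite /cpoly size_polyDl size_polyXn // size_polyN ltnS.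
apply: leq_trans (size_sum _ _ _) _; apply/bigmax_leqP => i _.
by apply: leq_trans (size_scale_leq _ _) _; rewrite size_polyXn.
Qed.

Lemma cpoly_monic (A : nzRingType) : cpoly A \is monic.
Proof.
rewrite monicE lead_coefE size_cpoly /= coefB coefXn eqxx coef_sum big1 ?subr0 //.
by move=> i _; rewrite coefZ coefXn (gtn_eqF (ltn_ord i)) mulr0.
Qed.

Lemma cpoly0 (A : nzRingType) : (cpoly A)`_0 = - (c n)%:R.
Proof.
rewrite coefB coefXn coef_sum big_ord_recl coefZ coefXn mulr1 subn0 big1 ?addr0 ?sub0r //.
by move=> i _; rewrite coefZ coefXn mulr0.
Qed.

Lemma map_cpoly (A B : nzRingType) (f : {rmorphism A -> B}) : map_poly f (cpoly A) = cpoly B.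
Proof.
rewrite /cpoly rmorphB /= map_polyXn rmorph_sum; congr (_ - _); apply: eq_bigr => i _ /=.
by rewrite map_polyZ map_polyXn rmorph_nat.
Qed.

Lemma act_cpoly (A : fieldType) h k : act (cpoly A) h k = h (k + n)%N - \sum_(i < n) (c (n - i))%:R * h (k + i)%N.
Proof.
rewrite actD actN actXn act_sum; congr (_ - _); apply: eq_bigr => i _.
by rewrite actZ actXn.
Qed.

Lemma ann_rec (A : fieldType) (r : nat -> nat) :
  (forall k, r (k + n)%N = \sum_(j < n) c (n - j) * r (k + j))%N -> ann (cpoly A) (fun k => (r k)%:R).
Proof.
by move=> rr k; rewrite act_cpoly rr natr_sum; under eq_bigr do rewrite natrM; rewrite subrr.
Qed.

Definition dx a b k : int := (xs a k)%:Z - (xs b k)%:Z.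

Lemma ann_dx (A : fieldType) a b : ann (cpoly A) (fun k => (dx a b k)%:~R).
Proof.
move=> k; rewrite (@act_ext _ _ _ (fun k => (xs a k)%:R + (-1) * (xs b k)%:R)).
  by rewrite actDh actZh !(ann_rec A (xs_rec _)) mulr0 addr0.
by move=> i; rewrite rmorphB mulN1r.
Qed.

Lemma dx_neq0 a b : a != b -> ~ (forall k, dx a b k = 0).
Proof.
move=> ab H; case/eqP: ab; apply/mnmP => i; have := H i; rewrite /dx !xs_init => /eqP.
by rewrite subr_eq0 eqz_nat => /eqP.
Qed.

Hypothesis cn : c n != 0%N.

Lemma cpoly0_neq0 : (cpoly rat)`_0 != 0.
Proof. by rewrite cpoly0 oppr_eq0 pnatr_eq0. Qed.

Lemma Om_inj : injective Om.
Proof.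
move=> a b e.
have lt (i : nat) : (i < m)%N -> a (inord i.+1) = b (inord i.+1) by move=> im; rewrite -!Om_lt // e.
have s j : a (lift ord0 j) = b (lift ord0 j).
  have := lt j (ltn_ord j); congr (_ = _); [congr (a _)|congr (b _)]; apply/val_inj;
  by rewrite /= inordK // /bump /= ltnS ltn_ord.
have := Om_max a; rewrite e Om_max !big_ord_recl subn0.
rewrite (eq_bigr (fun j : 'I_m => (c (n - lift ord0 j) * a (lift ord0 j))%N)); last by move=> j _; rewrite s.
move/addIn/eqP; rewrite eqn_pmul2l ?lt0n // => /eqP e0.
by apply/mnmP => i; case: (unliftP ord0 i) => [j ->|->].
Qed.

Lemma mdeg_Om a : (mdeg a <= mdeg (Om a))%N.
Proof.
rewrite !mdegE big_ord_recl [X in (_ <= X)%N]big_ord_recr /= Om_max addnC leq_add //.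
  apply: leq_sum => i _; rewrite {1}(_ : lift ord0 i = inord i.+1) -?Om_lt //.
    by rewrite leq_eqVlt; apply/orP; left; apply/eqP; congr (Om a _); apply/val_inj; rewrite /= inordK // ltnS ltnW.
  by apply/val_inj; rewrite /= inordK // ltnS.
by rewrite big_ord_recl subn0; apply: leq_trans (leq_addr _ _); rewrite leq_pmull // lt0n.
Qed.

Variable rts : seq algC.
Hypotheses (rtsE : cpoly algC = rootprod rts) (nd : nondeg rts) (no_unity : no_root_of_unity rts).

Lemma cpoly_neq0 (A : nzRingType) : cpoly A != 0.
Proof. by rewrite monic_neq0 // cpoly_monic. Qed.

Lemma dx_growth a b : a != b -> exists W, forall C, for_large k, exists2 i, (i < W)%N & (C * k <= `|dx a b (k + i)%N|)%N.
Proof.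
move=> ab; apply: (growth (cpoly_neq0 rat) cpoly0_neq0 _ (@ann_dx rat a b) (dx_neq0 ab)).
by move=> z; rewrite map_cpoly rtsE root_prod_XsubC => zr N; apply: no_unity.
Qed.

(** Equality at step d would make the difference sequence at d + i equal to the fixed number
    [dx t s i], on a window where [dx_growth] makes it large. *)
Lemma orbits_diverge a b s t : a != b -> for_large d, (iter d Om a + s != iter d Om b + t)%MM.
Proof.
move=> ab; have [W HW] := dx_growth ab.
have [k0 Hk] := HW (\sum_(i < W) `|dx t s i|).+1%N.
exists k0.+1 => d le; apply/eqP => e.
have [i iW] := Hk d (ltnW le); apply/negP; rewrite -ltnNge.
have -> : dx a b (d + i) = dx t s i.
  have : xs (iter d Om a + s)%MM i = xs (iter d Om b + t)%MM i by rewrite e.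
  by rewrite !xsD !xs_shift /dx; lia.
apply: leq_trans (_ : (\sum_(i < W) `|dx t s i|).+1 <= _)%N.
  by rewrite ltnS -[i]/(val (Ordinal iW)) (bigD1 (Ordinal iW)) //= leq_addr.
by rewrite leq_pmulr //; lia.
Qed.

(** If the difference were small on a proportion 1/N of the progression, these indices would form a
    determining set in the full window, and [recover_bound] would bound it by a multiple of k
    throughout, against [dx_growth]. *)
Lemma dx_dense a b N N0 rho : a != b -> (0 < N)%N -> (rho < N0)%N ->
  exists2 W0, (0 < W0)%N & forall M, (0 < M)%N -> forall C, for_large k, (N * #|[set q : 'I_(M * W0) | (`|dx a b (N0 * (k + q) + rho)| < C * k)%N]| < M * W0)%N.
Proof.
move=> ab N_gt0 rN; have N0_gt0 : (0 < N0)%N by apply: leq_ltn_trans rN.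
have [|W0 W00 HW0] := @dense_det algC (pchar_num algC) rts (N0 * N) nd; first by rewrite muln_gt0 N0_gt0.
exists W0 => // M M0 C.
have [Wg Hg] := dx_growth ab.
pose V := (N0 * M * W0)%N.
have det X : @dense (N0 * N) V X -> forall h, ann (cpoly rat) h -> (forall j : 'I_V, j \in X -> h j = 0) -> forall k, h k = 0.
  move=> dX h Hh Hz k; have NM : (0 < N0 * M)%N by rewrite muln_gt0 N0_gt0.
  suff H : forall k, ratr (h k) = 0 :> algC.
    by apply: (fmorph_inj (@ratr algC)); rewrite rmorph0; apply: H.
  apply: (HW0 (N0 * M)%N X (fun k => ratr (h k)) NM dX) => [i|j jX]; last by rewrite Hz // rmorph0.
  transitivity (ratr (act (cpoly rat) h i) : algC); last by rewrite Hh rmorph0.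
  rewrite -rtsE -(map_cpoly (@ratr algC)) !(@act_wide _ n.+1) ?size_map_poly ?size_cpoly // rmorph_sum.
  by apply: eq_bigr => j _; rewrite coef_map rmorphM.
have K i : exists Ci : rat, 0 <= Ci /\ forall X, @dense (N0 * N) V X -> forall h, ann (cpoly rat) h -> forall k B, 0 <= B ->
    (forall j : 'I_V, j \in X -> `|h (k + j)%N| <= B) -> `|h (k + i)%N| <= Ci * B.
  have [Ci C0 HC] := recover_bound (ab := fun x : rat => `|x|) (@normr_ge0 _ _) (normr0 _) (@normrM _) (@ler_normD _ _) i (cpoly_neq0 rat) det.
  by exists Ci.
have [f Hf] := choice K.
pose C2 := Num.bound (\sum_(i < Wg) f i).
have [k0 Hk0] := Hg (C2 * C).+1%N.
exists k0.+1 => k le; rewrite ltnNge; apply/negP => big.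
set Bad := [set q | _] in big.
have gP (q : 'I_(M * W0)) : (N0 * q + rho < V)%N.
  rewrite /V -mulnA; apply: leq_trans (_ : N0 * q + N0 <= _)%N; first by rewrite ltn_add2l.
  by rewrite addnC -mulnS leq_mul2l ltn_ord orbT.
pose g (q : 'I_(M * W0)) : 'I_V := Ordinal (gP q).
have g_inj : injective g.
  move=> q q' /(congr1 val) /= /addIn/eqP; rewrite eqn_pmul2l // => /eqP e.
  exact/val_inj.
have dX : @dense (N0 * N) V (g @: Bad).
  rewrite /dense card_imset // /V -!mulnA leq_mul2l; apply/orP; right.
  by apply: leq_trans big _.
have bound i : (`|dx a b (N0 * k + i)|%N%:R : rat) <= f i * (C * k)%:R.
  have [_ Hfi] := Hf i.
  have := Hfi _ dX (fun k => (dx a b k)%:~R) (@ann_dx rat a b) (N0 * k)%N (C * k)%:R (ler0n _ _).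
  rewrite -intr_norm -abszE; apply=> j /imsetP[q]; rewrite inE => lt -> /=.
  by rewrite -intr_norm -abszE ler_nat ltnW // addnA -mulnDr.
have [|i iW] := Hk0 (N0 * k)%N; first by apply: leq_trans (leq_pmull _ N0_gt0); apply: ltnW.
apply/negP; rewrite -ltnNge -(ltr_nat rat); apply: le_lt_trans (bound i) _.
have fi : f i <= C2%:R.
  apply: le_trans (ltW (archi_boundP _)); last by apply: sumr_ge0 => z _; case: (Hf z).
  rewrite -[i]/(val (Ordinal iW)) (bigD1 (Ordinal iW)) //= lerDl.
  by apply: sumr_ge0 => z _; case: (Hf z).
apply: le_lt_trans (_ : (C2 * (C * k))%:R < _).
  by rewrite [X in _ <= X]natrM ler_wpM2r.
rewrite ltr_nat mulnA; apply: leq_trans (_ : (C2 * C).+1 * k <= _)%N.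
  by rewrite ltn_pmul2r //; apply: leq_ltn_trans le.
by rewrite leq_mul2l leq_pmull // orbT.
Qed.

Section Growth.

Definition one : 'X_{1..n} := [multinom 1%N | _ < n].
(** Common scale for exponents and heights: every nonzero solution with initial values in the
    naturals is comparable to it ([xs_dominates], [xs_upper]). *)
Definition E k := xs one k.
Definition csum := (\sum_(j < n) c (n - j))%N.

Lemma csum_gt0 : (0 < csum)%N.
Proof. by rewrite /csum big_ord_recl subn0 addn_gt0 lt0n cn. Qed.

Lemma csum_gt1 : (1 < csum)%N.
Proof.
rewrite ltn_neqAle csum_gt0 andbT; apply/eqP => c1.
have r1 : root (cpoly algC) 1.
  rewrite /root hornerD hornerN hornerXn expr1n horner_sum -[1 in X in X - _]/(1%:R) c1 natr_sum subr_eq0.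
  by apply/eqP; apply: eq_bigr => i _; rewrite hornerZ hornerXn expr1n mulr1.
have m1 : 1 \in rts by rewrite -root_prod_XsubC -/(rootprod rts) -rtsE.
by have := no_unity m1 (isT : (0 < 1)%N); rewrite expr1n eqxx.
Qed.

Lemma E_mono k k' : (k <= k')%N -> (E k <= E k')%N.
Proof.
move=> le; rewrite -(subnK le); elim: (k' - k)%N => // d IHd; apply: leq_trans IHd _.
have -> : E (d.+1 + k) = xs (Om one) (d + k).
  by rewrite /E -[Om one]/(iter 1 Om one) xs_shift add1n.
apply: xs_le => i; rewrite /Om /one !mnmE; case: ifP => _ //.
under eq_bigr do rewrite mnmE muln1; exact: csum_gt0.
Qed.

Lemma E_rec k : E (k + n) = (\sum_(j < n) c (n - j) * E (k + j))%N.
Proof. exact: xs_rec. Qed.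

Lemma E_double k : (2 * E k <= E (k + n))%N.
Proof.
rewrite E_rec; apply: leq_trans (_ : csum * E k <= _)%N; first by rewrite leq_mul2r csum_gt1 orbT.
by rewrite /csum big_distrl; apply: leq_sum => j _; rewrite leq_mul2l E_mono ?orbT // leq_addr.
Qed.

Lemma E_succ k : (E k.+1 <= csum * E k)%N.
Proof.
have [kn|nk] := ltnP k.+1 n.
  have -> : E k.+1 = 1%N by rewrite /E -[k.+1]/(val (Ordinal kn)) xs_init mnmE.
  have -> : E k = 1%N by rewrite /E -[k]/(val (Ordinal (ltnW kn))) xs_init mnmE.
  by rewrite muln1 csum_gt0.
rewrite -(subnK nk) E_rec /csum big_distrl; apply: leq_sum => j _; rewrite leq_mul2l.
by rewrite E_mono ?orbT //; have := ltn_ord j; lia.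
Qed.

Lemma E_gt0 k : (0 < E k)%N.
Proof. by apply: leq_trans (E_mono (leq0n k)); rewrite /E -[0%N]/(val (@ord0 m)) xs_init mnmE. Qed.

Lemma E_add d k : (E (d + k) <= csum ^ d * E k)%N.
Proof.
elim: d => [|d IHd]; first by rewrite mul1n.
by rewrite addSn; apply: leq_trans (E_succ _) _; rewrite expnS -mulnA leq_mul2l IHd orbT.
Qed.

(** E doubles at least every n steps, so the sum behaves like a geometric one. This keeps the
    heights of sums and products over j < k at the scale of E k. *)
Lemma E_sum k : (\sum_(j < k) E j <= 2 * n * E k)%N.
Proof.
have [b] := ubnP k; elim: b k => // b IHb k le.
have [kn|nk] := ltnP k n.
  apply: leq_trans (_ : \sum_(j < k) E k <= _)%N.
    by apply: leq_sum => j _; apply: E_mono; apply: ltnW.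
  by rewrite sum_nat_const card_ord leq_mul2r; apply/orP; right; lia.
rewrite -(subnK nk) -[in X in (X <= _)%N](big_mkord xpredT) (big_cat_nat _ (n := (k - n)%N)) ?leq_addr //=.
rewrite big_mkord; apply: leq_trans (_ : 2 * n * E (k - n) + n * E (k - n + n) <= _)%N.
  apply: leq_add; first by apply: IHb; lia.
  apply: leq_trans (_ : \sum_(k - n <= j < k - n + n) E (k - n + n) <= _)%N.
    rewrite big_nat_cond [X in (_ <= X)%N]big_nat_cond.
    by apply: leq_sum => j /andP[/andP[_ jl] _]; apply/E_mono/ltnW.
  by rewrite sum_nat_const_nat addKn.
have := E_double (k - n); move: (E (k - n)) (E (k - n + n)) => x y le2.
have : (n * (2 * x) <= n * y)%N by rewrite leq_mul2l le2 orbT.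
lia.
Qed.

Lemma E_linear B : for_large k, (B * k <= E k)%N.
Proof.
have [|k0 Hk0] := @exp_superlinear rat 2 (2 * B * n)%:R _ (ler0n _ _); first by [].
have pow q : (2 ^ q <= E (q * n))%N.
  elim: q => [|q IHq]; first by rewrite E_gt0.
  have -> : (q.+1 * n = q * n + n)%N by rewrite mulSn addnC.
  by rewrite expnS; apply: leq_trans (E_double _); rewrite leq_mul2l IHq orbT.
exists (k0.+1 * n)%N => k le.
have q0 : (k0 < k %/ n)%N by rewrite leq_divRL.
apply: leq_trans (_ : 2 ^ (k %/ n) <= _)%N.
  have := Hk0 _ (ltnW q0); rewrite -natrX -natrM ler_nat; apply: leq_trans.
  have := divn_eq k n; have := ltn_pmod k (ltn0Sn m).
  move: (k %% n)%N (k %/ n)%N q0 => r q q0 rn ->.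
  rewrite mulnDr; have : (B * r <= B * q * n)%N by rewrite -mulnA leq_mul2l; apply/orP; right; nia.
  lia.
by apply: leq_trans (pow _) _; apply: E_mono; rewrite leq_trunc_div.
Qed.

(** If d divided every index i with c_i > 0, multiplying a root by a primitive d-th root of unity
    would give another root, and the quotient of the two is torsion. *)
Lemma period1 d : (1 < d)%N -> exists2 i, (0 < c i)%N /\ (0 < i <= n)%N & ~~ (d %| i)%N.
Proof.
move=> d1; apply: contrapT => H.
have dv i : (0 < i <= n)%N -> (0 < c i)%N -> (d %| i)%N.
  by move=> il ci; apply/negPn/negP => nd'; apply: H; exists i.
have dn : (d %| n)%N by apply: dv; [rewrite ltn0Sn leqnn|rewrite lt0n].
have [zt ztP] := C_prim_root_exists (ltnW d1).
have [th thP] : exists th, th \in rts.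
  have : size (cpoly algC) = n.+1 by apply: size_cpoly.
  by rewrite rtsE /rootprod size_prod_XsubC; case: (rts) => // x l _; exists x; rewrite mem_head.
have thr : root (cpoly algC) th by rewrite rtsE root_prod_XsubC.
have ztn : zt ^+ n = 1 by apply/eqP; rewrite -(prim_order_dvd ztP).
have ztr : root (cpoly algC) (zt * th).
  move: thr; rewrite /root !(hornerD, hornerN, hornerXn, horner_sum) exprMn ztn mul1r.
  congr (_ - _ == 0); apply: eq_bigr => i _; rewrite !hornerZ !hornerXn.
  have [->|ci] := eqVneq (c (n - i)) 0%N; first by rewrite !mul0r.
  rewrite exprMn (_ : zt ^+ i = 1) ?mul1r //; apply/eqP; rewrite -(prim_order_dvd ztP).
  have di : (d %| n - i)%N by apply: dv; [rewrite subn_gt0 ltn_ord leq_subr|rewrite lt0n].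
  by have := dvdn_sub dn di; rewrite subKn // ltnW.
have zr : zt * th \in rts by rewrite -root_prod_XsubC -/(rootprod rts) -rtsE.
have ne : zt * th != th.
  apply/eqP => e; have th0 := nd.1 _ thP.
  have : zt ^+ 1 = 1 by apply: (mulIf th0); rewrite expr1 e mul1r.
  by move/eqP; rewrite -(prim_order_dvd ztP) dvdn1 => /eqP d1'; rewrite d1' in d1.
by have := nd.2 _ _ d zr thP ne (ltnW d1); rewrite exprMn (prim_expr_order ztP) mul1r eqxx.
Qed.

(** Primitivity of the companion matrix. Positivity at k passes to k + i whenever c_i > 0; the sums
    of such i form a semigroup that contains all large numbers by [period1]. *)
Lemma xs_pos : exists k0, forall (i : 'I_n) k, (k0 <= k)%N -> (0 < xs (U_(i))%MM k)%N.
Proof.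
pose S t := forall k, (n <= k)%N -> forall a, (0 < xs a k)%N -> (0 < xs a (k + t))%N.
have Sc i : (0 < c i)%N -> (0 < i <= n)%N -> S i.
  move=> ci il k nk a ak; rewrite -(subnK (leq_trans nk (leq_addr i k))) xs_rec.
  have jl : (n - i < n)%N by lia.
  rewrite (bigD1 (Ordinal jl)) //= addn_gt0 subKn ?(andP il).2 // muln_gt0 ci /=.
  by rewrite (_ : k + i - n + (n - i) = k)%N ?ak //; lia.
have [|s t Ss St k nk a ak|d d1|t0 Ht0] := @semigroup_large S.
- by move=> k _ a; rewrite addn0.
- by rewrite addnA; apply: St; [apply: leq_trans (leq_addr _ _)|apply: Ss].
- by have [i [ci il] ndi] := period1 d1; exists i => //; apply: Sc.
exists (n + n + t0)%N => i k le.
have base : (0 < xs (U_(i))%MM (i + n))%N.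
  rewrite xs_rec big_ord_recl subn0 addn_gt0 muln_gt0 lt0n cn /= addn0 xs_init.
  by rewrite mnm1E eqxx.
rewrite -(subnK (n := k) (m := i + n)); last by have := ltn_ord i; lia.
rewrite addnC; apply: Ht0 => //; first by have := ltn_ord i; lia.
by rewrite leq_addl.
Qed.

(** A nonzero a dominates a unit vector, whose orbit dominates the all-ones vector after k0 + n
    steps; going back these steps costs at most csum^(k0 + n). *)
Lemma xs_dominates : exists C k0, (0 < C)%N /\ forall a k, a != 0%MM -> (k0 <= k)%N -> (E k <= C * xs a k)%N.
Proof.
have [k0 Hk0] := xs_pos.
exists (csum ^ (k0 + n))%N, (k0 + n)%N; split; first by rewrite expn_gt0 csum_gt0.
move=> a k a0 le.
have [i ai] : exists i, (0 < a i)%N.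
  apply: contrapT => H; case/eqP: a0; apply/mnmP => i; rewrite mnm0E.
  by apply/eqP; rewrite -leqn0 leqNgt; apply/negP => ai; apply: H; exists i.
rewrite -(subnKC le); apply: leq_trans (E_add _ _) _; rewrite leq_mul2l; apply/orP; right.
apply: leq_trans (_ : xs (U_(i))%MM (k0 + n + (k - (k0 + n))) <= _)%N.
  rewrite -xs_shift; apply: xs_le => j; rewrite mnmE xsE; apply: Hk0.
  by rewrite -addnA leq_addr.
by apply: xs_le => j; rewrite mnm1E; case: eqP => // <-.
Qed.

Lemma xs_upper a k : (xs a k <= mdeg a * E k)%N.
Proof.
have -> : (mdeg a * E k = xs (one *+ mdeg a)%MM k)%N.
  elim: (mdeg a) => [|d IHd].
    rewrite mul0n mulm0n; have := xsD 0%MM 0%MM k; rewrite add0m; lia.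
  by rewrite mulSn mulmS xsD IHd.
apply: xs_le => i; rewrite mulmnE mnmE mul1n mdegE (bigD1 i) //= leq_addr //.
Qed.

End Growth.

Section Sequence.
Variable r : nat -> nat.
Hypotheses (r_rec : recurrence m c r) (r_neq0 : exists k, r k != 0%N)
 (r_ngeo : forall th : algC, exists k, (r k)%:R != th ^+ k * (r 0%N)%:R).

Definition vv j : 'X_{1..n} := [multinom r (j + i)%N | i < n].

Lemma xs_vv j k : xs (vv j) k = r (j + k).
Proof.
by apply/esym/(xs_uniq (r := fun k => r (j + k)%N)) => [i|i]; rewrite ?mnmE // addnA r_rec; apply: eq_bigr => l _; rewrite addnA.
Qed.

Lemma vvS j : vv j.+1 = Om (vv j).
Proof.
apply/mnmP => i; rewrite mnmE -[Om _]/(iter 1 Om (vv j)) xsE xs_vv.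
by rewrite addnA addn1.
Qed.

Lemma r_ann : ann (cpoly algC) (fun k => (r k)%:R).
Proof. exact: ann_rec. Qed.
Lemma cpoly0C : (cpoly algC)`_0 != 0.
Proof. by rewrite cpoly0 oppr_eq0 pnatr_eq0. Qed.

Lemma r_tail d : ~ (forall k, (d <= k)%N -> r k = 0%N).
Proof.
move=> H; case: r_neq0 => k /eqP; apply.
have /eqP := ann_back cpoly0C r_ann (d := d) (fun k le => congr1 (fun x => x%:R) (H k le)) k.
by rewrite pnatr_eq0 => /eqP.
Qed.

Lemma vv_neq0 j : vv j != 0%MM.
Proof.
apply/eqP => e; apply: (@r_tail j) => k le; rewrite -(subnKC le) -xs_vv e.
have := xsD 0%MM 0%MM (k - j); rewrite add0m; lia.
Qed.

Lemma rts_elim th d h : th \in rts -> (0 < d)%N -> ann (cpoly algC) h ->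
  (forall k, h (k + d)%N = th ^+ d * h k) -> ann ('X - th%:P) h.
Proof.
move=> thr d0 Hh Hd.
have nd' : nondeg (th :: rts).
  have mem x : x \in th :: rts -> x \in rts by rewrite inE => /orP[/eqP->|].
  by split=> [x /mem/nd.1|x y N /mem xr /mem yr] //; apply: nd.2.
have := coprime_quot (pchar_num algC) nd' d0; move=> /ann_coprime; apply.
  move=> k; rewrite -actM mulrC -subrXX -rmorphXn actD actXn -polyCN actC Hd mulNr subrr //.
by move=> k; rewrite -actM mulrC -rtsE actM act0.
Qed.

Lemma not_geometric (th : algC) j : ~ ann ('X - th%:P) (fun k => (r (j + k)%N)%:R).
Proof.
move=> H; have [k /eqP] := r_ngeo th; apply.
have /ann_geom : ann ('X - th%:P) (fun k => (r k)%:R : algC).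
  move=> i; apply: (ann_back (d := j) cpoly0C (ann_act _ r_ann)) => i' le.
  by rewrite -(subnKC le) -act_shift H.
exact.
Qed.

(** If vv j and vv k are parallel, r satisfies r(i + k - j) = q r(i) from j on. Either q is a (k -
    j)-th power of a characteristic root, and r is geometric, or X^(k-j) - q is coprime to the
    characteristic polynomial, and r is zero. *)
Lemma vv_nonparallel j k : j != k -> exists i i', (vv j i * vv k i' != vv j i' * vv k i)%N.
Proof.
wlog lt : j k / (j < k)%N.
  move=> W; rewrite neq_ltn => /orP[jk|kj]; first by apply: W => //; rewrite ltn_eqF.
  have [|i [i' ne]] := W k j kj; first by rewrite ltn_eqF.
  by exists i', i; rewrite [X in X != _]mulnC [X in _ != X]mulnC.
move=> _; apply: contrapT => H.
have par i i' : (vv j i * vv k i' = vv j i' * vv k i)%N.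
  by apply/eqP/negPn/negP => ne; apply: H; exists i, i'.
have [i0 i00] : exists i, vv j i != 0%N.
  apply: contrapT => H0; case/eqP: (vv_neq0 j); apply/mnmP => i; rewrite mnm0E.
  by apply/eqP/negPn/negP => ne; apply: H0; exists i.
pose q : algC := (vv k i0)%:R / (vv j i0)%:R.
have i0C : ((vv j i0)%:R : algC) != 0 by rewrite pnatr_eq0.
pose y t : algC := (r (j + t)%N)%:R.
have yann : ann (cpoly algC) y by apply: (ann_shift (h := fun k => (r k)%:R)); apply: r_ann.
have Hy t : y (t + (k - j))%N = q * y t.
  have hann : ann (cpoly algC) (fun t => y (t + (k - j))%N + (- q) * y t).
    move=> t'; rewrite actDh actZh yann mulr0 addr0 -(yann (k - j + t')%N) -act_shift.
    by apply: act_ext => z; rewrite addnC.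
  suff hz : forall t, y (t + (k - j))%N + (- q) * y t = 0.
    by have /eqP := hz t; rewrite mulNr subr_eq0 => /eqP.
  have jk t' : (j + (t' + (k - j)) = k + t')%N by lia.
  move=> t'; have [b] := ubnP t'; elim: b t' => // b IHb t' le.
  have [tn|nt] := ltnP t' n.
    apply/eqP; rewrite mulNr subr_eq0 /y jk; apply/eqP; apply: (mulfI i0C).
    rewrite /q mulrA mulrCA divff // mulr1; have := par i0 (Ordinal tn).
    by rewrite !mnmE /= => e; rewrite -!natrM mulnC [in RHS]mulnC -e mulnC.
  have := hann (t' - n)%N; rewrite act_cpoly subnK // big1 ?subr0 // => z _.
  by rewrite IHb ?mulr0 //; have := ltn_ord z; lia.
have d0 : (0 < k - j)%N by rewrite subn_gt0.
have [[th [thr e]]|no] := EM (exists th, th \in rts /\ th ^+ (k - j) = q).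
  by apply: (@not_geometric th j); apply: (rts_elim thr d0 yann) => t; rewrite Hy e.
have cop : coprimep ('X^(k - j) - q%:P) (cpoly algC).
  rewrite rtsE; apply: coprimep_rootprod => z zr; apply/negP => /rootP.
  rewrite hornerD hornerN hornerXn hornerC => /eqP; rewrite subr_eq0 => /eqP e.
  by apply: no; exists z.
apply: (@r_tail j) => t le; rewrite -(subnKC le).
have H0 : forall t, y t = 0.
  by apply: (ann_coprime cop) => // z; rewrite actD actXn -polyCN actC Hy mulNr subrr.
by have /eqP := H0 (t - j)%N; rewrite pnatr_eq0 => /eqP.
Qed.

Lemma r_upper : exists C, forall k, (r k <= C * E k)%N.
Proof. by exists (mdeg (vv 0)) => k; rewrite -[r k](xs_vv 0); apply: xs_upper. Qed.

End Sequence.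

Section Weight.
Variable R : rcfType.

(** A positive left eigenvector of the companion matrix. The eigenvalue rho lies between 1 and
    [csum] by the intermediate value theorem, as the characteristic polynomial is negative at 1. *)
Lemma weight_exists : exists (wt : 'X_{1..n} -> R) (rho : R),
  [/\ forall a b, wt (a + b)%MM = wt a + wt b, forall a, a != 0%MM -> 0 < wt a, forall a, wt (Om a) = rho * wt a & 1 < rho].
Proof.
have ev x : (cpoly R).[x] = x ^+ n - \sum_(i < n) (c (n - i))%:R * x ^+ i.
  by rewrite /cpoly hornerD hornerN hornerXn horner_sum; congr (_ - _); apply: eq_bigr => i _; rewrite hornerZ hornerXn.
have neg1 : (cpoly R).[1] < 0.
  rewrite ev expr1n subr_lt0 (eq_bigr (fun i : 'I_n => (c (n - i))%:R)) => [|i _]; last by rewrite expr1n mulr1.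
  by rewrite -natr_sum ltr1n csum_gt1.
have c1 : 1 <= csum%:R :> R by rewrite ler1n csum_gt0.
have pos : 0 <= (cpoly R).[csum%:R].
  have cs : csum%:R = \sum_(j < n) (c (n - j))%:R :> R by rewrite natr_sum.
  rewrite ev subr_ge0 exprS [X in _ <= X * _]cs mulr_suml; apply: ler_sum => i _.
  by apply: ler_wpM2l => //; apply: ler_weXn2l => //; rewrite -ltnS.
have [rho /andP[r1 r2] rr] := poly_ivt (p := cpoly R) c1 (introT andP (conj (ltW neg1) pos)).
have rho1 : 1 < rho.
  by rewrite lt_neqAle r1 andbT; apply/eqP => e; move: neg1; rewrite e (eqP rr) ltxx.
have rho0 : 0 < rho by apply: lt_trans rho1.
(* The eigenvector equation reads rho w_i = w_(i-1) + c_(n-i) when the last coordinate is 1; this is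
   its solution, and w_m = 1 holds because rho is a root. *)
pose w (i : nat) : R := (\sum_(j < i.+1) (c (n - j))%:R * rho ^+ j) / rho ^+ i.+1.
have rn i : rho ^+ i != 0 by rewrite expf_neq0 // gt_eqF.
have rw i x : rho * (x / rho ^+ i.+1) = x / rho ^+ i.
  by rewrite exprS invfM [x * _]mulrC !mulrA divff ?mul1r ?gt_eqF // mulrC.
have wS i : (0 < i)%N -> rho * w i = w i.-1 + (c (n - i))%:R.
  by case: i => // i _; rewrite /w rw big_ord_recr /= mulrDl mulfK.
have w0 : rho * w 0%N = (c n)%:R.
  by rewrite /w rw big_ord1 subn0 !expr0 divr1 mulr1.
have wm : w m = 1.
  by rewrite /w; move: rr; rewrite /root ev subr_eq0 => /eqP <-; rewrite divff.
have wpos i : 0 < w i.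
  rewrite /w divr_gt0 ?exprn_gt0 // big_ord_recl subn0; apply: ltr_pwDl.
    by rewrite mulr1 ltr0n lt0n.
  by apply: sumr_ge0 => j _; rewrite mulr_ge0 ?exprn_ge0 // ltW.
exists (fun a => \sum_(i < n) w i * (a i)%:R), rho; split=> //.
- move=> a b; rewrite -big_split; apply: eq_bigr => i _.
  by rewrite mnmDE natrD mulrDr.
- move=> a a0; rewrite lt_neqAle eq_sym; apply/andP; split; last by apply: sumr_ge0 => i _; rewrite mulr_ge0 // ltW.
  apply: contra a0; rewrite psumr_eq0 => [/allP H|i _]; last by rewrite mulr_ge0 // ltW.
  apply/eqP/mnmP => i; rewrite mnm0E; have := H i (mem_index_enum i).
  by rewrite mulf_eq0 gt_eqF //= pnatr_eq0 => /eqP.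
move=> a; rewrite big_ord_recr /= Om_max wm mul1r natr_sum mulr_sumr.
rewrite [X in _ + X]big_ord_recl [RHS]big_ord_recl subn0 addrCA; congr (_ + _).
  by rewrite mulrA w0 natrM.
rewrite -big_split; apply: eq_bigr => i _ /=.
have e1 : (widen_ord (leqnSn m) i) = inord i :> 'I_n by apply/val_inj; rewrite /= inordK // ltnS ltnW.
have e2 : lift ord0 i = inord i.+1 :> 'I_n by apply/val_inj; rewrite /= inordK // ltnS.
rewrite e1 Om_lt // e2 natrM mulrA -mulrDl; congr (_ * _).
by rewrite /bump leq0n add1n wS.
Qed.

End Weight.
End Rec.

Notation dominates m c C1 k1 :=
  (forall (a : mpoly.multinom m.+1) k, a != @mpoly.mnm0 m.+1 -> (k1 <= k)%N -> (@E m c k <= C1 * @xs m c a k)%N)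
  (only parsing).
Notation has_weight m c R := (exists (wt : mpoly.multinom m.+1 -> R) (rho : R),
  [/\ forall a b, wt (mpoly.mnm_add a b) = wt a + wt b, forall a, a != @mpoly.mnm0 m.+1 -> 0 < wt a,
      forall a, wt (@Om m c a) = rho * wt a & 1 < rho]) (only parsing).

(** * Heights and the Liouville inequality *)

Lemma absz_leD (a b : int) : (`|(a + b)%R| <= `|a| + `|b|)%N.
Proof. lia. Qed.

Lemma liouville_const (R : comRingType) (n f H k : nat) (x : R) :
  (n * (f * H ^ k))%:R * (H%:R * x) * (f * H ^ k)%:R = x * ((n * f * f)%:R * H%:R ^+ (k + (k + 1))).
Proof. rewrite !natrM !natrX !exprD expr1; ring. Qed.

Section Heights.
Variable L : fieldExtType rat.
Let d := \dim {:L}.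
Let bs : d.-tuple L := vbasis {:L}.

Definition regmx (x : L) : 'M[rat]_d := \matrix_(i, j) coord bs j (bs`_i * x).

Lemma regmxE x (i : 'I_d) : bs`_i * x = \sum_j regmx x i j *: bs`_j.
Proof.
rewrite {1}(coord_vbasis (memvf (bs`_i * x))); apply: eq_bigr => j _.
by rewrite mxE.
Qed.

Lemma regmxM x y : regmx (x * y) = regmx x *m regmx y.
Proof.
apply/matrixP => i j; rewrite [LHS]mxE mulrA regmxE mulr_suml raddf_sum [RHS]mxE; apply: eq_bigr => k _.
by rewrite /= -scalerAl linearZ /=; congr (_ * _); rewrite mxE.
Qed.

Lemma regmx_lin a x y : regmx (a *: x + y) = a *: regmx x + regmx y.
Proof. by apply/matrixP => i j; rewrite !mxE mulrDr -scalerAr linearP. Qed.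
Lemma regmxD x y : regmx (x + y) = regmx x + regmx y.
Proof. by rewrite -[x]scale1r regmx_lin scale1r scale1r. Qed.

Lemma regmx1 : regmx 1 = 1%:M.
Proof.
apply/matrixP => i j; rewrite !mxE mulr1.
have fb : free bs by apply: basis_free (vbasisP _).
by rewrite coord_free // eq_sym.
Qed.

Lemma regmx_rat (q : rat) : regmx (q *: 1) = q%:M.
Proof.
have r0 : regmx 0 = 0 by apply/matrixP => i j; rewrite !mxE mulr0 linear0.
by rewrite -[q *: 1]addr0 regmx_lin r0 addr0 regmx1 scalemx1.
Qed.

Lemma d_gt0 : (0 < d)%N.
Proof. by rewrite /d adim_gt0. Qed.
Definition rowle (H : nat) (Z : 'M[int]_d) := forall i, (\sum_j `|Z i j| <= H)%N.
(** Multiplication by x is an integer matrix of maximal row sum at most H. This norm is subadditive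
    and submultiplicative, so H plays the role of a height for integral elements. *)
Definition Int H x := exists2 Z : 'M[int]_d, regmx x = map_mx intr Z & rowle H Z.
Lemma Int_le H H' x : (H <= H')%N -> Int H x -> Int H' x.
Proof. by move=> le [Z e HZ]; exists Z => // i; apply: leq_trans (HZ i) le. Qed.

Lemma IntD H H' x y : Int H x -> Int H' y -> Int (H + H') (x + y).
Proof.
move=> [Z e HZ] [Z' e' HZ']; exists (Z + Z'); first by rewrite regmxD e e' map_mxD.
move=> i; apply: leq_trans (leq_add (HZ i) (HZ' i)); rewrite -big_split.
by apply: leq_sum => j _; rewrite mxE; apply: absz_leD.
Qed.

Lemma IntM H H' x y : Int H x -> Int H' y -> Int (H * H') (x * y).
Proof.
move=> [Z e HZ] [Z' e' HZ']; exists (Z *m Z'); first by rewrite regmxM e e' map_mxM.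
move=> i; apply: leq_trans (_ : \sum_j \sum_k `|Z i k| * `|Z' k j| <= _)%N.
  apply: leq_sum => j _; rewrite mxE; elim/big_rec2: _ => // k u v _ le.
  by apply: leq_trans (absz_leD _ _) _; rewrite abszM leq_add2l.
rewrite exchange_big; apply: leq_trans (_ : \sum_k `|Z i k| * H' <= _)%N.
  by apply: leq_sum => k _; rewrite -big_distrr leq_mul2l HZ' orbT.
by rewrite -big_distrl leq_mul2r HZ orbT.
Qed.

Lemma Int_nat (k : nat) : Int k k%:R.
Proof.
exists (k%:R)%:M.
  have -> : k%:R = (k%:R : rat) *: 1 :> L by rewrite scaler_nat.
  by rewrite regmx_rat map_scalar_mx rmorph_nat.
move=> i; rewrite (bigD1 i) //= big1 => [|j ne]; first by rewrite mxE eqxx addn0 mulr1n; lia.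
by rewrite mxE eq_sym (negPf ne).
Qed.

Lemma Int1 : Int 1 1. Proof. exact: (Int_nat 1). Qed.

Lemma IntX H x e : Int H x -> Int (H ^ e) (x ^+ e).
Proof.
move=> Hx; elim: e => [|e IHe]; first by rewrite expn0 expr0; apply: Int1.
by rewrite expnS exprS; apply: IntM.
Qed.

Lemma Int_den x : exists D H, (0 < D)%N /\ Int H (D%:R * x).
Proof.
pose D : nat := (\prod_i \prod_j `|denq (regmx x i j)|)%N.
have D0 : (0 < D)%N by rewrite prodn_gt0 // => i; rewrite prodn_gt0 // => j; rewrite absz_gt0 denq_neq0.
have zP i j : exists z : int, D%:R * regmx x i j = z%:~R.
  have dv : (`|denq (regmx x i j)| %| D)%N.
    by rewrite /D (bigD1 i) //= dvdn_mulr // (bigD1 j) //= dvdn_mulr.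
  case/dvdnP: dv => q ->; exists (q%:Z * numq (regmx x i j)).
  rewrite natrM -mulrA rmorphM; congr (_ * _).
  by rewrite /= numqE mulrC; congr (_ * _); rewrite -[in RHS]absz_denq.
have [f Hf] := choice (fun ij : 'I_d * 'I_d => zP ij.1 ij.2).
exists D, (\sum_i \sum_j `|f (i, j)|)%N; split=> //.
exists (\matrix_(i, j) f (i, j)).
  have -> : D%:R * x = D%:R *: x + 0 :> L by rewrite addr0 scaler_nat mulr_natl.
  rewrite regmx_lin; apply/matrixP => i j; rewrite !mxE mulr0 linear0 addr0.
  by have := Hf (i, j); rewrite /= mxE.
move=> i; rewrite [X in (_ <= X)%N](bigD1 i) //=; apply: leq_trans (leq_addr _ _).
by apply: leq_sum => j _; rewrite mxE.
Qed.

Lemma det_bound k (A : 'M[int]_k) H : (forall i j, `|A i j| <= H)%N -> (`|\det A| <= k`! * H ^ k)%N.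
Proof.
move=> HA; rewrite /determinant.
apply: leq_trans (_ : \sum_(s : 'S_k) H ^ k <= _)%N; last first.
  by rewrite sum_nat_const card_Sn.
have absz_sum (I : finType) (F : I -> int) : (`|(\sum_i F i)%R| <= \sum_i `|F i|)%N.
  elim/big_rec2: _ => // i u v _ le; apply: leq_trans (absz_leD _ _) _.
  by rewrite leq_add2l.
apply: leq_trans (absz_sum _ _) _; apply: leq_sum => s _.
rewrite abszM abszX /= exp1n mul1n.
have -> : (`|(\prod_i A i (s i))%R| = \prod_i `|A i (s i)|)%N.
  by elim/big_rec2: _ => // i u v _ <-; rewrite abszM.
apply: leq_trans (_ : \prod_(i < k) H <= _)%N; last by rewrite prod_nat_const card_ord.
by apply: leq_prod.
Qed.

(** D is the absolute value of the determinant of the matrix of x; D / x is given up to sign by the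
    adjugate matrix, whose entries are minors. *)
Lemma Int_inv H x : (0 < H)%N -> x != 0 -> Int H x ->
  exists D, (0 < D <= d`! * H ^ d)%N /\ Int (d * (d`! * H ^ d)) (D%:R * x^-1).
Proof.
move=> H0 x0 [Z e HZ].
have ent i j : (`|Z i j| <= H)%N.
  by apply: leq_trans (HZ i); rewrite (bigD1 j) //= leq_addr.
have dZ : \det Z != 0.
  apply/eqP => dz; have : \det (regmx x *m regmx x^-1) = 0.
    by rewrite det_mulmx e det_map_mx dz rmorph0 mul0r.
  by rewrite -regmxM divff // regmx1 det1 => /eqP; rewrite oner_eq0.
have adj : regmx ((\det Z)%:~R * x^-1) = map_mx intr (\adj Z).
  have -> : (\det Z)%:~R * x^-1 = (\det Z)%:~R *: x^-1 + 0 :> L.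
    by rewrite addr0 scaler_int mulrzl.
  have r0 : regmx 0 = 0 by apply/matrixP => i j; rewrite !mxE mulr0 linear0.
  rewrite regmx_lin r0 addr0 -[LHS]mul1mx.
  apply: (can_inj (mulmxK (_ : regmx x \in unitmx))); last first.
    rewrite -mulmxA -scalemxAl -regmxM mulVf // regmx1 mul1mx e -map_mxM mul_adj_mx map_scalar_mx.
    by rewrite scalemx1.
  by rewrite unitmxE e det_map_mx unitfE intr_eq0.
have adjb i j : (`|\adj Z i j| <= d`! * H ^ d)%N.
  rewrite mxE abszM abszX /= exp1n mul1n.
  apply: leq_trans (@det_bound _ _ H _) _; first by move=> i' j'; rewrite !mxE.
  apply: leq_mul; last by rewrite leq_pexp2l // leq_pred.
  by rewrite -[X in (_ <= X`!)%N](prednK d_gt0) factS leq_pmull.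
exists `|\det Z|%N; split; first by rewrite absz_gt0 dZ det_bound.
have [s Es] : exists s : bool, (`|\det Z|%N)%:R = (-1) ^+ s * (\det Z)%:~R :> L.
  by case: (\det Z) => k; [exists false|exists true]; rewrite ?expr0 ?mul1r // NegzE abszN mulrNz expr1 mulN1r opprK.
have rs : rowle (d * (d`! * H ^ d)) (\adj Z).
  move=> i; apply: leq_trans (_ : \sum_(j < d) d`! * H ^ d <= _)%N; last by rewrite sum_nat_const card_ord.
  by apply: leq_sum.
rewrite Es -mulrA; case: s Es => _; rewrite ?expr0 ?mul1r; last by exists (\adj Z).
exists (- \adj Z); last by move=> i; under eq_bigr do rewrite mxE abszN; apply: rs.
have -> : (-1) ^+ true * ((\det Z)%:~R / x) = (-1) *: ((\det Z)%:~R / x) + 0 :> L.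
  by rewrite addr0 expr1 mulN1r scaleN1r.
have r0 : regmx 0 = 0 by apply/matrixP => i j; rewrite !mxE mulr0 linear0.
by rewrite regmx_lin r0 addr0 adj scaleN1r map_mxN.
Qed.

Lemma natL_neq0 k : (0 < k)%N -> k%:R != 0 :> L.
Proof.
move=> k0; have -> : k%:R = (k%:R : rat) *: 1 :> L by rewrite scaler_nat.
by rewrite scaler_eq0 oner_eq0 orbF pnatr_eq0 -lt0n.
Qed.

Section Abs.
Variables (K : fieldType) (R : realFieldType) (ab : K -> R).
Hypotheses (ab_ge0 : nonneg ab) (ab_eq0 : definite ab) (abM : multiplicative ab) (abD : subadditive ab)
  (ab_nat : forall k, (0 < k)%N -> k%:R^-1 <= ab k%:R).
Variable emb : {rmorphism L -> K}.

Lemma ab1 : ab 1 = 1.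
Proof.
have a0 : ab 1 != 0 by apply/eqP => /ab_eq0/eqP; rewrite oner_eq0.
by apply: (mulfI a0); rewrite -abM !mulr1.
Qed.

Lemma ab_gt0 x : x != 0 -> 0 < ab x.
Proof. by move=> x0; rewrite lt_neqAle ab_ge0 andbT eq_sym; apply: contra x0 => /eqP/ab_eq0->. Qed.

Lemma abV x : ab x^-1 = (ab x)^-1.
Proof.
have [->|x0] := eqVneq x 0.
  by rewrite invr0; have /ab_eq0 -> : (0 : K) = 0 by []; rewrite invr0.
apply: (mulfI (lt0r_neq0 (ab_gt0 x0))); rewrite -abM !divff ?ab1 //.
exact: lt0r_neq0 (ab_gt0 x0).
Qed.

Lemma abN x : ab (- x) = ab x.
Proof.
have : ab (-1) ^+ 2 == 1 by rewrite expr2 -abM mulrNN mulr1 ab1.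
rewrite sqrf_eq1 => /orP[/eqP aN1|/eqP aN1]; first by rewrite -mulN1r abM aN1 mul1r.
by have := ab_ge0 (-1); rewrite aN1 lerNr oppr0 ler10.
Qed.

Lemma ab_nat_le k : ab k%:R <= k%:R.
Proof.
elim: k => [|k IHk]; first by rewrite (ab_eq0 0).2.
by rewrite -!natr1; apply: le_trans (abD _ _) _; rewrite ab1 lerD2r.
Qed.

Lemma ab_int_le (z : int) : ab z%:~R <= (`|z|%N)%:R.
Proof. by case: z => k; [exact: ab_nat_le|rewrite NegzE mulrNz abN abszN; exact: ab_nat_le]. Qed.

(** Apply the row of a basis element of largest absolute value; integers have absolute value at most
    their usual one, at every place. *)
Lemma Int_abs H x : Int H x -> ab (emb x) <= H%:R.
Proof.
move=> [Z e HZ].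
pose f (i : 'I_d) := ab (emb bs`_i).
pose i0 := [arg max_(i > Ordinal d_gt0) f i]%O.
have imax i : f i <= f i0 by rewrite /i0; case: arg_maxP => // j _; apply.
have fi0 : 0 < f i0.
  rewrite ab_gt0 // fmorph_eq0; apply: (free_not0 (basis_free (vbasisP {:L}))).
  by rewrite mem_nth // size_tuple.
have := regmxE x i0; rewrite e => /(congr1 (fun y => ab (emb y))).
rewrite rmorphM abM => E.
rewrite -(ler_pM2l fi0) [X in X <= _]E rmorph_sum.
have ab_sum (I : finType) (F : I -> K) : ab (\sum_i F i) <= \sum_i ab (F i).
  by elim/big_rec2: _ => [|i y z _ le]; [rewrite (ab_eq0 0).2|apply: le_trans (abD _ _) _; rewrite lerD2l].
apply: le_trans (ab_sum _ _) _.
apply: le_trans (_ : \sum_j (`|Z i0 j|%N)%:R * f i0 <= _).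
  apply: ler_sum => j _; rewrite mxE scaler_int rmorphMz -mulrzl abM.
  by apply: ler_pM; rewrite ?ab_ge0 ?imax ?ab_int_le.
rewrite -mulr_suml mulrC ler_pM2l // -natr_sum ler_nat; exact: HZ.
Qed.

(** The upper bound [Int_abs] applied to an integral multiple D' / (D x) of the inverse; [ab_nat]
    keeps the positive integer D' from being too small. *)
Lemma liouville : exists kap C, (0 < C)%N /\ forall H D x, (0 < D)%N -> (D <= H)%N -> x != 0 ->
  Int H (D%:R * x) -> (C%:R * H%:R ^+ kap)^-1 <= ab (emb x).
Proof.
exists (d + (d + 1))%N, (d * d`! * d`!)%N; split; first by rewrite !muln_gt0 d_gt0 fact_gt0.
move=> H D x D0 DH x0 Hx; have H0 := leq_trans D0 DH.
have Dx0 : D%:R * x != 0 by rewrite mulf_neq0 // natL_neq0.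
have [D' [/andP[D'0 D'le] HD']] := Int_inv H0 Dx0 Hx.
have := Int_abs HD'; rewrite rmorphM fmorphV abM abV rmorphM abM !rmorph_nat => le.
have D'R : 0 < ab (D'%:R) by apply: lt_le_trans (ab_nat D'0); rewrite invr_gt0 ltr0n.
have DR : 0 < ab (D%:R) by apply: lt_le_trans (ab_nat D0); rewrite invr_gt0 ltr0n.
have xp : 0 < ab (emb x) by rewrite ab_gt0 // fmorph_eq0.
rewrite ler_pdivrMr ?mulr_gt0 // in le.
have le2 := le_trans (ab_nat D'0) le.
have DH' : ab D%:R <= H%:R by apply: le_trans (ab_nat_le D) _; rewrite ler_nat.
have HR : 0 < H%:R :> R by rewrite ltr0n.
have cR : 0 < (d * (d`! * H ^ d))%:R :> R by rewrite ltr0n !muln_gt0 d_gt0 fact_gt0 expn_gt0 H0.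
have pR : 0 < (d`! * H ^ d)%:R :> R by rewrite ltr0n muln_gt0 fact_gt0 expn_gt0 H0.
have D'' : (d`! * H ^ d)%:R^-1 <= D'%:R^-1 :> R by rewrite lef_pV2 ?ler_nat // posrE ltr0n.
have le3 : (d`! * H ^ d)%:R^-1 <= (d * (d`! * H ^ d))%:R * (H%:R * ab (emb x)).
  apply: le_trans D'' (le_trans le2 _); rewrite ler_pM2l //.
  by rewrite ler_pM2r.
have cc : 0 < (d * d`! * d`!)%:R * H%:R ^+ (d + (d + 1)) :> R.
  by rewrite mulr_gt0 ?exprn_gt0 // ltr0n !muln_gt0 d_gt0 fact_gt0.
rewrite -[X in X <= _]mul1r ler_pdivrMr //.
rewrite -[X in X <= _]mul1r ler_pdivrMr // in le3.
by rewrite liouville_const in le3.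
Qed.

End Abs.
End Heights.

(** * Vanishing of exponential sums *)

Lemma pow_small (R : archiRealFieldType) (t e : R) : 0 < t -> t < 1 -> 0 < e -> for_large b, t ^+ b <= e.
Proof.
move=> t0 t1 e0; have ti : 1 < t^-1 by rewrite invf_gt1.
have ei : 0 <= e^-1 by rewrite invr_ge0 ltW.
have [k0 Hk] := exp_superlinear ti ei.
exists k0.+1 => b le; have := Hk b (ltnW le); rewrite exprVn => H.
have b1 : 1 <= b%:R :> R by rewrite ler1n; apply: leq_ltn_trans le.
have : e^-1 <= (t ^+ b)^-1 by apply: le_trans H; rewrite ler_peMr.
by rewrite lef_pV2 // posrE exprn_gt0.
Qed.

(** B is chosen so that t^B <= 1/(2D). It is used with exponents b such as [E k] and [mu k], which
    eventually exceed every multiple of k. *)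
Lemma pow_beats (R : archiRealFieldType) (t D e : R) : 0 < t -> t < 1 -> 0 < D -> 0 < e ->
  exists B k0, forall k b, (k0 <= k)%N -> (B * k <= b)%N -> D ^+ k * t ^+ b <= e.
Proof.
move=> t0 t1 D0 e0.
have [|B HB] := @pow_small R t (2 * D)^-1 t0 t1; first by rewrite invr_gt0 mulr_gt0.
have [||k0 Hk0] := @pow_small R 2^-1 e _ _ e0; [by rewrite invr_gt0|by rewrite invf_lt1 // ltr1n|].
exists B, k0 => k b kk le.
apply: le_trans (Hk0 k kk); apply: le_trans (_ : D ^+ k * t ^+ (B * k) <= _).
  by rewrite ler_pM2l ?exprn_gt0 // ler_wiXn2l // ltW.
rewrite exprM -exprMn lerXn2r ?nnegrE ?mulr_ge0 ?exprn_ge0 ?invr_ge0 ?(ltW t0) ?(ltW D0) //.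
apply: le_trans (_ : D * (2 * D)^-1 <= _); first by rewrite ler_pM2l ?HB.
by rewrite invfM mulrCA divff ?mulr1 // gt_eqF.
Qed.

Section SeqBounds.
Variables (K : fieldType) (R : realFieldType) (ab : K -> R).
Hypotheses (ab_ge0 : nonneg ab) (ab_eq0 : definite ab) (abM : multiplicative ab) (abD : subadditive ab).
Variables (p : {poly K}) (h : nat -> K).
Hypotheses (p_neq0 : p != 0) (Hh : ann p h).

Let ab0 : ab 0 = 0. Proof. by rewrite (ab_eq0 0).2. Qed.
Let sp : (size p).-1.+1 = size p. Proof. by rewrite prednK // size_poly_gt0. Qed.
Let spw : (size p <= (size p).-1.+1)%N. Proof. by rewrite sp. Qed.

Lemma ann_next k : h (k + (size p).-1) = - (lead_coef p)^-1 * \sum_(i < (size p).-1) p`_i * h (k + i)%N.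
Proof.
have := Hh k; rewrite (@act_wide _ _ p h k spw) big_ord_recr /= => /eqP; rewrite addr_eq0 => /eqP ->.
by rewrite mulNr mulrN opprK mulrA mulVf ?mul1r // lead_coef_eq0.
Qed.

Lemma ann_upper : exists2 D, 1 <= D & forall k, ab (h k) <= D ^+ k.+1.
Proof.
pose A := ab (- (lead_coef p)^-1) * \sum_(i < (size p).-1) ab p`_i.
pose D := 1 + A + \sum_(i < (size p).-1) ab (h i).
have A0 : 0 <= A by rewrite mulr_ge0 ?sumr_ge0.
have D1 : 1 <= D by rewrite /D -addrA lerDl addr_ge0 // sumr_ge0.
have D0 : 0 <= D by apply: le_trans D1.
exists D => // k; have [b] := ubnP k; elim: b k => // b IHb k le.
have [kn|nk] := ltnP k (size p).-1.
  apply: le_trans (_ : D <= _); last by rewrite exprS ler_peMr // exprn_ege1.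
  rewrite /D (bigD1 (Ordinal kn)) //=; apply: le_trans (_ : ab (h k) + (1 + A + \sum_(i < (size p).-1 | i != Ordinal kn) ab (h i)) <= _); last by lra.
  by rewrite lerDl !addr_ge0 // sumr_ge0.
rewrite -(subnK nk) ann_next abM; apply: le_trans (_ : A * D ^+ k <= _).
  rewrite -mulrA ler_wpM2l // mulr_suml; apply: le_trans (ab_sum ab0 abD _ _ _) _.
  apply: ler_sum => i _; rewrite abM ler_wpM2l //; have := ltn_ord i => il.
  apply: le_trans (IHb _ _) _; first by lia.
  by apply: ler_weXn2l => //; lia.
by rewrite subnK // exprS ler_wpM2r ?exprn_ge0 // /D; have := sumr_ge0; move=> _; rewrite -addrA addrCA lerDl addr_ge0 // sumr_ge0.
Qed.

(** One step backwards multiplies the bound on a window by at most 1 + A. If the window at k were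
    below e c^k with c = 1/(1 + A), going back k steps would give |h i1| <= |h i1| / 2 for a nonzero
    initial value. *)
Lemma ann_lower : p`_0 != 0 -> ~ (forall k, h k = 0) ->
  exists e c : R, [/\ 0 < e, 0 < c & forall k, exists2 i, (i < (size p).-1)%N & e * c ^+ k <= ab (h (k + i)%N)].
Proof.
move=> p0 h0.
have [i1 [i1l hi1]] : exists i, (i < (size p).-1)%N /\ h i != 0.
  apply: contrapT => H; apply: h0 => k; have [b] := ubnP k; elim: b k => // b IHb k le.
  have [kn|nk] := ltnP k (size p).-1; first by apply/eqP/negPn/negP => ne; apply: H; exists k.
  rewrite -(subnK nk) ann_next big1 ?mulr0 // => i _; rewrite IHb ?mulr0 //.
  by have := ltn_ord i => il; lia.
have hp : 0 < ab (h i1) by rewrite ab_gt0.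
pose A := ab (- (p`_0)^-1) * \sum_(i < (size p).-1) ab p`_i.+1.
have A0 : 0 <= A by rewrite mulr_ge0 ?sumr_ge0.
have A1 : 0 < 1 + A by rewrite ltr_pwDl.
exists (ab (h i1) / 2), (1 + A)^-1; split; rewrite ?invr_gt0 ?divr_gt0 //.
move=> k; apply: contrapT => H.
have small i : (i < (size p).-1)%N -> ab (h (k + i)%N) <= ab (h i1) / 2 * (1 + A)^-1 ^+ k.
  by move=> il; rewrite leNgt; apply/negP => lt; apply: H; exists i => //; apply: ltW.
have back d : (d <= k)%N -> forall i, (i < (size p).-1)%N ->
    ab (h (k - d + i)%N) <= (1 + A) ^+ d * (ab (h i1) / 2 * (1 + A)^-1 ^+ k).
  elim: d => [|d IHd] dk i il; first by rewrite subn0 mul1r small.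
  have B0 : 0 <= ab (h i1) / 2 * (1 + A)^-1 ^+ k.
    by rewrite !mulr_ge0 ?exprn_ge0 ?invr_ge0 // ltW.
  have mon : (1 + A) ^+ d * (ab (h i1) / 2 * (1 + A)^-1 ^+ k) <= (1 + A) ^+ d.+1 * (ab (h i1) / 2 * (1 + A)^-1 ^+ k).
    by rewrite ler_wpM2r // ler_weXn2l // lerDl.
  case: i il => [|i] il; last first.
    apply: le_trans mon; have := IHd (ltnW dk) i (ltnW il).
    by have -> : (k - d.+1 + i.+1 = k - d + i)%N by lia.
  rewrite addn0.
  have E0 : h (k - d.+1)%N = - (p`_0)^-1 * \sum_(i < (size p).-1) p`_i.+1 * h (k - d + i)%N.
    have := Hh (k - d.+1)%N; rewrite (@act_wide _ _ p h _ spw) big_ord_recl addn0 => /eqP; rewrite addr_eq0 => /eqP e.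
    apply: (mulfI p0); rewrite e mulrA mulrN divff // mulN1r; congr (- _); apply: eq_bigr => j _.
    have -> : lift ord0 j = j.+1 :> nat by [].
    by congr (_ * h _); rewrite addnS -addSn subnSK.
  rewrite E0 abM; apply: le_trans (_ : A * ((1 + A) ^+ d * (ab (h i1) / 2 * (1 + A)^-1 ^+ k)) <= _).
    rewrite /A -[X in _ <= X]mulrA ler_wpM2l // mulr_suml; apply: le_trans (ab_sum ab0 abD _ _ _) _.
    by apply: ler_sum => j _; rewrite abM ler_wpM2l // IHd // ltnW.
  rewrite exprS -[X in _ <= X]mulrA; apply: ler_wpM2r; last by rewrite lerDr.
  by rewrite mulr_ge0 ?exprn_ge0 ?(ltW A1).
have := back k (leqnn k) i1 i1l; rewrite subnn add0n mulrCA exprVn divff ?mulr1; last by rewrite expf_neq0 // gt_eqF.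
by apply/negP; rewrite -ltNge ltr_pdivrMr // ltr_pMr // ltr1n.
Qed.

End SeqBounds.

Lemma expoly_common (K : fieldType) (T : eqType) (s : seq T) (u : T -> nat -> K) :
  (forall i, i \in s -> expoly (u i)) -> exists S, (forall th, th \in S -> th != 0) /\
   forall i, i \in s -> ann (rootprod S) (u i).
Proof.
elim: s => [|i s IHs] H; first by exists [::].
have [|S [nz HS]] := IHs; first by move=> j js; apply: H; rewrite inE js orbT.
have [S' [nz' HS']] := H i (mem_head _ _).
exists (S' ++ S); split; first by move=> th; rewrite mem_cat => /orP[/nz'|/nz].
move=> j; rewrite inE rootprod_cat => /orP[/eqP->|/HS]; last exact: ann_mull.
by move: HS' => /(ann_mull (rootprod S)) H' k; rewrite mulrC.
Qed.

(** Union bound: fewer than the whole of T is covered by at most N sets each of proportion below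
    1/N. *)
Lemma avoid (T : finType) (I : eqType) (s : seq I) (X : I -> {set T}) N : (size s <= N)%N -> (0 < N)%N -> (0 < #|T|)%N ->
  (forall i, i \in s -> N * #|X i| < #|T|)%N -> exists j, forall i, i \in s -> j \notin X i.
Proof.
move=> sN N0 T0 H.
have le : (N * #|\bigcup_(i <- s) X i| <= size s * #|T|.-1)%N.
  elim: s H {sN} => [|i s IHs] H; first by rewrite big_nil cards0 muln0.
  rewrite big_cons /= mulSn; apply: leq_trans (_ : N * (#|X i| + #|\bigcup_(j <- s) X j|) <= _)%N.
    by rewrite leq_mul2l cardsU leq_subr orbT.
  rewrite mulnDr leq_add ?IHs // => [|j js]; last by rewrite H // inE js orbT.
  by rewrite -ltnS prednK // H ?mem_head.
have lt : (#|\bigcup_(i <- s) X i| < #|T|)%N.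
  rewrite -(ltn_pmul2l N0); apply: leq_ltn_trans le _.
  by apply: leq_ltn_trans (_ : N * #|T|.-1 < _)%N; rewrite ?leq_mul2r ?sN ?orbT // ltn_pmul2l // prednK.
have [j jn] : exists j, j \notin \bigcup_(i <- s) X i.
  apply: contrapT => nj; move: lt; rewrite ltnNge => /negP; apply.
  by apply/subset_leq_card/subsetP => j _; apply/negPn/negP => jn; apply: nj; exists j.
exists j => i si; apply: contra jn => jX; rewrite (big_rem i) //= inE jX //.
Qed.

Lemma dense_det_dvd (A : fieldType) (s : seq A) N : [pchar A] =i pred0 -> nondeg s -> (0 < N)%N ->
  exists2 W0, (0 < W0)%N & forall W (X : {set 'I_W}) h, (0 < W)%N -> (W0 %| W)%N -> dense N X ->
   ann (rootprod s) h -> (forall j : 'I_W, j \in X -> h j = 0) -> forall k, h k = 0.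
Proof.
move=> charA nd N0; have [W0 W00 H] := dense_det charA nd N0; exists W0 => // W X h Wp /dvdnP[M e].
by subst W; apply: H; move: Wp; rewrite muln_gt0 => /andP[].
Qed.

Lemma window_index k W j : (0 < k)%N -> (j < W)%N -> ((k + j).+1 <= (W + 2) * k)%N.
Proof. nia. Qed.
Lemma subseq_index_le N k j rho : (0 < N)%N -> (k <= N * (k + j) + rho)%N.
Proof. nia. Qed.
Lemma dist_le x y d : (x <= y)%N -> (d <= `|(x%:Z - y%:Z)%R|)%N -> (x + d <= y)%N.
Proof. lia. Qed.
Lemma le_of_half (R : realFieldType) (x y : R) : x <= y + x / 2 -> x <= 2 * y.
Proof. lra. Qed.
Lemma half_absurd (R : realFieldType) (x y : R) : 0 < x -> x <= 2 * y -> y <= x / 4 -> False.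
Proof. lra. Qed.
Lemma pad_le (R : realFieldType) (s x d : R) : 0 <= s -> 0 <= d * x -> s * (d * x) * 2 <= x * (2 * (s + 1) * d).
Proof. nra. Qed.

Section VL.
Import mpoly.
Variables (m : nat) (c : nat -> nat).
Notation n := m.+1.
Hypothesis cn : c n != 0%N.
Variable rts : seq algC.
Hypotheses (rtsE : cpoly m c algC = rootprod rts) (nd : nondeg rts) (no_unity : no_root_of_unity rts).
Notation Om := (@Om m c).
Notation xs := (@xs m c).
Notation E := (@E m c).
Notation dx := (@dx m c).

Variables (K : fieldType) (R : archiRealFieldType) (ab : K -> R).
Hypotheses (charK : [pchar K] =i pred0) (ab_ge0 : nonneg ab) (ab_eq0 : definite ab)
  (abM : multiplicative ab) (abD : subadditive ab).
Variable al : K.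
Hypotheses (al_gt0 : 0 < ab al) (al_lt1 : ab al < 1).

Let ab0 : ab 0 = 0. Proof. by rewrite (ab_eq0 0).2. Qed.

Lemma abX x e : ab (x ^+ e) = ab x ^+ e.
Proof.
elim: e => [|e IHe]; first by rewrite !expr0 (ab1 ab_eq0 abM).
by rewrite !exprS abM IHe.
Qed.

Definition zK k : 'I_n -> K := fun i => al ^+ xs (U_(i))%MM k.

Lemma xs_lin I k : xs I k = (\sum_(i < n) I i * xs (U_(i))%MM k)%N.
Proof.
have xs0 : xs 0%MM k = 0%N.
  by have := xsD c 0%MM (0%MM : 'X_{1..n}) k; rewrite add0m; move: (xs _ _) => x; clear; lia.
have xsM a e : xs (a *+ e)%MM k = (e * xs a k)%N.
  by elim: e => [|e IHe]; rewrite ?mulm0n // mulmS xsD IHe mulSn.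
rewrite [I in LHS](multinomUE_id) (big_morph (fun a => xs a k) (fun a b => xsD c a b k) xs0).
by apply: eq_bigr => i _; rewrite xsM.
Qed.

Lemma zK_mon k (I : 'X_{1..n}) : \prod_(i < n) zK k i ^+ I i = al ^+ xs I k.
Proof.
rewrite xs_lin expr_sum; apply: eq_bigr => i _.
by rewrite /zK -exprM mulnC.
Qed.

Lemma mevalzK k (q : {mpoly K[n]}) : q.@[zK k] = \sum_(I <- msupp q) q@_I * al ^+ xs I k.
Proof. by rewrite mevalE; apply: eq_bigr => I _; rewrite zK_mon. Qed.

Lemma dx_dense_dvd a b N N0 rho : a != b -> (0 < N)%N -> (rho < N0)%N ->
  exists2 W0, (0 < W0)%N & forall W, (0 < W)%N -> (W0 %| W)%N -> forall C, for_large k, (N * #|[set q : 'I_W | (`|dx a b (N0 * (k + q) + rho)| < C * k)%N]| < W)%N.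
Proof.
move=> ne N0_ rN; have [W0 W00 H] := dx_dense cn rtsE nd no_unity ne N0_ rN; exists W0 => // W Wp /dvdnP[M e].
by subst W; apply: H; move: Wp; rewrite muln_gt0 => /andP[].
Qed.

Variable C1 : nat.
Hypothesis C1_gt0 : (0 < C1)%N.
(** With the domination constant C1 every nonzero exponent a has xs a k >= mu k for large k, so a
    monomial of degree J is at most |al|^(J mu k) at z(k). *)
Definition mu k := (E k %/ C1)%N.

Lemma mu_bound M k : ((M + 1) * E k <= C1 * (M + 1) * mu k + (M + 1) * C1)%N.
Proof.
rewrite /mu; have := divn_eq (E k) C1; have := ltn_pmod (E k) C1_gt0.
move: (E k %/ C1)%N (E k %% C1)%N (E k) => q r e rl ->; nia.
Qed.

(* On a long window of indices most values of each coefficient are not too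
   small and most pairs of exponents are far apart, so that at some index a
   single monomial dominates. *)
Lemma vanishing_core (T : finType) (cf : T -> nat -> K) (P : T -> {mpoly K[n]}) I0 J k1 : (forall t, expoly (cf t)) ->
  \sum_t cf t k1 * (P t)@_I0 != 0 -> (C1 * (mdeg I0 + 1) <= J)%N ->
  ~ exists D : R, for_large k, ab (\sum_t cf t k * (P t).@[zK k]) <= D ^+ k * ab al ^+ (J * mu k).
Proof.
move=> Hexp nz0 leJ [D [k2 HD]].
pose u I k := \sum_t cf t k * (P t)@_I.
pose La : seq 'X_{1..n} := undup (flatten [seq msupp (P t) | t <- enum T]).
have inLa t I : (P t)@_I != 0 -> I \in La.
  move=> h; rewrite mem_undup; apply/flattenP; exists (msupp (P t)); last by rewrite mcoeff_msupp.
  by apply: map_f; rewrite mem_enum.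
have val k : \sum_t cf t k * (P t).@[zK k] = \sum_(I <- La) u I k * al ^+ xs I k.
  transitivity (\sum_t \sum_(I <- La) cf t k * (P t)@_I * al ^+ xs I k).
    apply: eq_bigr => t _; rewrite mevalzK mulr_sumr.
    rewrite [RHS](bigID (fun I => I \in msupp (P t))) /= [X in _ = _ + X]big1 ?addr0.
      rewrite -[RHS]big_filter; under [RHS]eq_bigr do rewrite -mulrA.
      apply: perm_big; apply: uniq_perm; rewrite ?msupp_uniq ?filter_uniq ?undup_uniq //.
      move=> I; rewrite mem_filter; case I1: (I \in msupp (P t)) => //=.
      by rewrite (inLa t) // -mcoeff_msupp.
    by move=> I /memN_msupp_eq0 ->; rewrite mulr0 mul0r.
  by rewrite exchange_big; apply: eq_bigr => I _; rewrite mulr_suml.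
have expu I : expoly (u I).
  by apply: expoly_sum => t _; apply: expolyM => //; apply: expoly_cst.
have [S [Snz HS]] := @expoly_common K _ La u (fun I _ => expu I).
have I0La : I0 \in La.
  apply: contraNT nz0 => nI; rewrite big1 // => t _.
  have [->|h] := eqVneq (P t)@_I0 0; first by rewrite mulr0.
  by move: nI; rewrite (inLa t).
have [N0 N0_gt0 ndS] := nondeg_power Snz.
set S0 := map _ S in ndS.
(* The residue class of k1: along it the coefficient of I0 is not identically zero, while the N0-th
   powers of the roots are nondegenerate. *)
pose rho := (k1 %% N0)%N; have rhoN : (rho < N0)%N by rewrite ltn_pmod.
pose u' I k := u I (N0 * k + rho)%N.
have annu I : I \in La -> ann (rootprod S0) (u' I) by move=> /HS; apply: ann_subsample.
have S0p : (rootprod S0)`_0 != 0 by apply: rootprod_coef0; apply: ndS.1.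
have S0nz : rootprod S0 != 0 by apply: contraNneq S0p => ->; rewrite coef0.
pose La' := [seq I <- La | ~~ boolp.asbool (forall k, u' I k = 0)].
have La'P I : I \in La' -> I \in La /\ ~ (forall k, u' I k = 0).
  by rewrite mem_filter => /andP[/boolp.asboolPn].
have I0La' : I0 \in La'.
  rewrite mem_filter I0La andbT; apply/boolp.asboolPn => /(_ (k1 %/ N0)%N).
  rewrite /u' mulnC -divn_eq => /eqP; by apply/negP.
pose prs := [seq q <- [seq (x, y) | x <- La', y <- La'] | q.1 != q.2].
have prsP I I' : I \in La' -> I' \in La' -> I' != I -> (I, I') \in prs.
  by move=> h h' ne; rewrite mem_filter /= eq_sym ne; apply: allpairs_f.
have prsN q : q \in prs -> q.1 != q.2 by rewrite mem_filter => /andP[].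
(* There is one set of bad indices for each surviving monomial and one for each pair of them. Each
   has proportion below 1/N, so some index of the window is bad for none. *)
pose N := (size La' + size prs).+1.
have [W1 W10 HW1] := dense_det_dvd charK ndS (ltn0Sn (size La' + size prs)).
have [w Hw] : exists w : 'X_{1..n} * 'X_{1..n} -> nat, forall q, (0 < w q)%N /\ (q \in prs ->
    forall W, (0 < W)%N -> (w q %| W)%N -> forall C, for_large k, (N * #|[set j : 'I_W | (`|dx q.1 q.2 (N0 * (k + j) + rho)| < C * k)%N]| < W)%N).
  suff H q : exists wq, (0 < wq)%N /\ (q \in prs ->
    forall W, (0 < W)%N -> (wq %| W)%N -> forall C, for_large k, (N * #|[set j : 'I_W | (`|dx q.1 q.2 (N0 * (k + j) + rho)| < C * k)%N]| < W)%N).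
    by have [w Hw] := choice H; exists w.
  case qp: (q \in prs); last by exists 1%N.
  have ne : q.1 != q.2 by apply: prsN.
  by have [wq wq0 Hq] := @dx_dense_dvd q.1 q.2 N N0 rho ne (ltn0Sn _) rhoN; exists wq.
pose W := (W1 * \prod_(q <- prs) w q)%N.
have Wp : (0 < W)%N.
  by rewrite muln_gt0 W10 prodn_gt0 // => q; case: (Hw q).
have W1d : (W1 %| W)%N by rewrite dvdn_mulr.
have wd q : q \in prs -> (w q %| W)%N.
  by move=> qp; rewrite dvdn_mull // (big_rem q) //= dvdn_mulr.
have card_W : #|'I_W| = W by rewrite card_ord.
have low : exists e cc : R, [/\ 0 < e, 0 < cc & forall I, I \in La' -> forall k,
    (N * #|[set j : 'I_W | (ab (u' I (k + j)%N) < e * cc ^+ k)%R]| < W)%N].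
  have one_low I : exists ec : R * R, [/\ 0 < ec.1, 0 < ec.2 & I \in La' -> forall k,
      (N * #|[set j : 'I_W | (ab (u' I (k + j)%N) < ec.1 * ec.2 ^+ k)%R]| < W)%N].
    case IL: (I \in La'); last by exists (1, 1).
    have [IL1 IL2] := La'P I IL.
    have [e [cc [e0 cc0 Hl]]] := ann_lower ab_ge0 ab_eq0 abM abD S0nz (annu I IL1) S0p IL2.
    have det X : @dense N W X -> forall h, ann (rootprod S0) h -> (forall j : 'I_W, j \in X -> h j = 0) -> forall k, h k = 0.
      by move=> dX h Hh Hz; apply: (HW1 W X h).
    have Kb i : exists Ci : R, 0 <= Ci /\ forall X, @dense N W X -> forall h, ann (rootprod S0) h -> forall k B, 0 <= B ->
        (forall j : 'I_W, j \in X -> ab (h (k + j)%N) <= B) -> ab (h (k + i)%N) <= Ci * B.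
      have [Ci Ci0 HCi] := recover_bound ab_ge0 ab0 abM abD i S0nz det.
      by exists Ci.
    have [f Hf] := choice Kb.
    pose C := 1 + \sum_(i < (size (rootprod S0)).-1) f i.
    have C0 : 0 < C by rewrite ltr_pwDl // sumr_ge0 // => i _; case: (Hf i).
    exists (e / C, cc); split; rewrite /= ?divr_gt0 // => _ k.
    rewrite ltnNge; apply/negP => big; have [i il] := Hl k.
    apply/negP; rewrite -ltNge.
    have Bp : 0 < e / C * cc ^+ k by rewrite mulr_gt0 ?divr_gt0 ?exprn_gt0.
    apply: le_lt_trans ((Hf i).2 _ big _ (annu I IL1) k _ (ltW Bp) _) _.
      by move=> j; rewrite inE => /ltW.
    have fC : f i < C.
      rewrite /C (bigD1 (Ordinal il)) //= addrCA ltrDl ltr_pwDl // sumr_ge0 // => z _.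
      by case: (Hf z).
    rewrite -[X in _ < X](_ : C * (e / C * cc ^+ k) = _) ?ltr_pM2r //.
    by rewrite !mulrA [C * e]mulrC mulfK // gt_eqF.
  have [f Hf] := choice one_low.
  have f0 I : 0 < (f I).1 by case: (Hf I).
  have f1 I : 0 < (f I).2 by case: (Hf I).
  have mn (g : 'X_{1..n} -> R) : (forall I, 0 < g I) -> exists2 e, 0 < e & forall I, I \in La' -> e <= g I.
    move=> g0; elim: (La') => [|I l [e e0 He]]; first by exists 1.
    exists (Num.min e (g I)); first by rewrite lt_min e0 g0.
    by move=> I'; rewrite inE => /orP[/eqP->|/He le]; rewrite ge_min ?lexx ?orbT ?le.
  have [e e0 He] := mn (fun I => (f I).1) f0.
  have [cc cc0 Hcc] := mn (fun I => (f I).2) f1.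
  exists e, cc; split=> // I IL k; case: (Hf I) => _ _ /(_ IL k); apply: leq_ltn_trans.
  rewrite leq_mul2l; apply/orP; right; apply/subset_leq_card/subsetP => j; rewrite !inE.
  move/lt_le_trans; apply; apply: ler_pM; rewrite ?exprn_ge0 ?(ltW e0) ?(ltW cc0) ?He //.
  by rewrite lerXn2r ?nnegrE ?(ltW cc0) ?(ltW (f1 I)) ?Hcc.
have [e [cc [e0 cc0 Hlow]]] := low.
have up : exists2 Du : R, 1 <= Du & forall I, I \in La -> forall k, ab (u I k) <= Du ^+ k.+1.
  have HS' : forall I, I \in La -> ann (rootprod S) (u I) by [].
  have Sp : rootprod S != 0 by apply: contraNneq (rootprod_coef0 Snz) => ->; rewrite coef0.
  elim: (La) HS' => [|I l IHl] HS'; first by exists 1.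
  have [|D1 D11 H1] := IHl; first by move=> I' l'; apply: HS'; rewrite inE l' orbT.
  have [D2 D21 H2] := ann_upper ab_ge0 ab_eq0 abM abD Sp (HS' I (mem_head _ _)).
  exists (Num.max D1 D2); first by rewrite le_max D11.
  move=> I'; rewrite inE => /orP[/eqP->|/H1 H] k.
    by apply: le_trans (H2 k) _; rewrite lerXn2r ?nnegrE ?le_max ?lexx ?orbT // (le_trans ler01) // ?le_max ?D11.
  by apply: le_trans (H k) _; rewrite lerXn2r ?nnegrE ?le_max ?lexx ?orbT // (le_trans ler01) // ?le_max ?D11.
have [Du Du1 Hup] := up.
have Du0 : 0 < Du by apply: lt_le_trans Du1.
pose kap := (N0 * (W + 2))%N.
have t0 : 0 < ab al by [].
(* C is the gap, in units of k, between exponents that makes all other terms together at most half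
   of the dominant one, given the bounds Du and cc on the coefficients. *)
have [C [K0 HC]] := @pow_beats R (ab al) (Du ^+ kap / cc) (e / (2 * ((size La)%:R + 1) * Du)) t0 al_lt1
   (divr_gt0 (exprn_gt0 _ Du0) cc0) (divr_gt0 e0 (mulr_gt0 (mulr_gt0 (ltr0n _ 2) (ltr_wpDl (ler0n _ _) ltr01)) Du0)).
pose M := mdeg I0.
pose D' := Num.max `|D| 1.
have D'1 : 1 <= D' by rewrite le_max lexx orbT.
have D'0 : 0 < D' by apply: lt_le_trans D'1.
pose al' := ab al ^+ ((M + 1) * C1).
have al'0 : 0 < al' by rewrite exprn_gt0.
(* For the end of the proof, where |al|^(E kk) has to beat all factors exponential in k. *)
have [B [K1 HB]] := @pow_beats R (ab al) (D' ^+ kap / cc) (e * al' / 4) t0 al_lt1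
   (divr_gt0 (exprn_gt0 _ D'0) cc0) (divr_gt0 (mulr_gt0 e0 al'0) (ltr0n _ 4)).
have [K2 HK2] := E_linear cn rtsE no_unity B.
have [K3 HK3] : exists K3, forall q, q \in prs -> forall k, (K3 <= k)%N ->
    (N * #|[set j : 'I_W | (`|dx q.1 q.2 (N0 * (k + j) + rho)| < C * k)%N]| < W)%N.
  elim: {1 3}prs (fun q (h : q \in prs) => h) => [|q l IHl] sub; first by exists 0%N.
  have [|K3 H3] := IHl; first by move=> q' h; apply: sub; rewrite inE h orbT.
  have qp := sub q (mem_head _ _).
  have [K4 H4] := (Hw q).2 qp W Wp (wd q qp) C.
  exists (maxn K3 K4) => q'; rewrite inE => /orP[/eqP->|/H3 H] k le.
    by apply: H4; apply: leq_trans le; rewrite leq_maxr.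
  by apply: H; apply: leq_trans le; rewrite leq_maxl.
pose k := (k2 + K0 + K1 + K2 + K3 + 1)%N.
have [kk2 kK0 kK1 kK2 [kK3 kp]] : [/\ k2 <= k, K0 <= k, K1 <= k, K2 <= k & (K3 <= k /\ 0 < k)]%N.
  by rewrite /k; clear; split; [lia|lia|lia|lia|split; lia].
have [j Hj] : exists j : 'I_W, (forall I, I \in La' -> e * cc ^+ k <= ab (u' I (k + j)%N)) /\
    (forall q, q \in prs -> (C * k <= `|dx q.1 q.2 (N0 * (k + j) + rho)|)%N).
  pose X (z : 'X_{1..n} + 'X_{1..n} * 'X_{1..n}) : {set 'I_W} := match z with
    | inl x => [set j : 'I_W | (ab (u' x (k + j)%N) < e * cc ^+ k)%R]
    | inr q => [set j : 'I_W | (`|dx q.1 q.2 (N0 * (k + j) + rho)| < C * k)%N] end.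
  have [|||z|j Hj] := @avoid 'I_W _ (map inl La' ++ map inr prs) X N.
  - by rewrite size_cat !size_map.
  - by [].
  - by rewrite card_W.
  - rewrite card_W mem_cat => /orP[/mapP[I IL ->]|/mapP[q qp ->]]; first exact: Hlow.
    by apply: HK3.
  exists j; split=> [I IL|q qp].
    have : j \notin X (inl I) by apply: Hj; rewrite mem_cat map_f.
    by rewrite inE -leNgt.
  have : j \notin X (inr q) by apply: Hj; rewrite mem_cat [X in _ || X]map_f ?orbT.
  by rewrite inE -leqNgt.
set kk := (N0 * (k + j) + rho)%N in Hj *.
have kkE I : u' I (k + j)%N = u I kk by [].
have kk_le : (kk <= kap * k)%N.
  rewrite /kk /kap -mulnA; apply: leq_trans (_ : N0 * (k + j) + N0 <= _)%N; first by rewrite leq_add2l ltnW.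
  by rewrite addnC -mulnS leq_mul2l window_index ?orbT.
have k_le : (k <= kk)%N by apply: subseq_index_le.
have [I1 I1L I1min] : exists2 I1, I1 \in La' & forall I, I \in La' -> (xs I1 kk <= xs I kk)%N.
  have [d [I1 [IL e1]] dmin] := @min_nat (fun d => exists I, I \in La' /\ xs I kk = d) (ex_intro _ _ (ex_intro _ I0 (conj I0La' erefl))).
  by exists I1 => // I h; rewrite e1; apply: dmin; exists I.
have far I : I \in La' -> I != I1 -> (xs I1 kk + C * k <= xs I kk)%N.
  by move=> h ne; apply: dist_le (I1min I h) (Hj.2 _ (prsP I1 I I1L h ne)).
have zero I : I \in La -> I \notin La' -> u I kk = 0.
  move=> h; rewrite mem_filter h andbT negbK => /boolp.asboolP H.
  by rewrite -kkE H.
have Evalue := HD kk (leq_trans kk2 k_le); rewrite val in Evalue.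
have a0 : 0 <= ab al by apply: ltW.
have ap z : 0 < ab al ^+ z by rewrite exprn_gt0.
have main : e * cc ^+ k * ab al ^+ xs I1 kk <= 2 * (D' ^+ kk * ab al ^+ (J * mu kk)).
  have E1 : \sum_(I <- La) u I kk * al ^+ xs I kk = u I1 kk * al ^+ xs I1 kk + \sum_(I <- rem I1 La) u I kk * al ^+ xs I kk.
    by rewrite (big_rem I1) //; case: (La'P I1 I1L).
  have rest : ab (\sum_(I <- rem I1 La) u I kk * al ^+ xs I kk) <= e * cc ^+ k * ab al ^+ xs I1 kk / 2.
    apply: le_trans (ab_sum ab0 abD _ _ _) _.
    apply: le_trans (_ : \sum_(I <- rem I1 La | I \in La') Du ^+ kk.+1 * (ab al ^+ xs I1 kk * ab al ^+ (C * k)) <= _).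
      rewrite big_seq [X in _ <= X]big_mkcond [X in _ <= X]big_seq; apply: ler_sum => I IL.
      have IL' := mem_rem IL; case: ifPn => h; last by rewrite zero // mul0r ab0.
      rewrite abM abX; apply: ler_pM; rewrite ?ab_ge0 ?exprn_ge0 // ?Hup //.
      rewrite -exprD ler_wiXn2l ?(ltW al_lt1) // far //.
      by apply: contraTneq IL => ->; rewrite mem_rem_uniq ?undup_uniq // inE eqxx.
    rewrite big_const_seq iter_addr_0.
    have := HC k (C * k)%N _ (leqnn _); rewrite exprMn -exprM exprVn => /(_ kK0) HC'.
    set X := Du ^+ (kap * k) * ab al ^+ (C * k).
    have X0 : 0 <= X by rewrite mulr_ge0 ?exprn_ge0 // ltW.
    have HX : X * (2 * ((size La)%:R + 1) * Du) <= e * cc ^+ k.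
      rewrite -ler_pdivlMr; last by rewrite !mulr_gt0 // ltr_wpDl.
      rewrite mulrAC -ler_pdivrMr ?exprn_gt0 //; apply: le_trans HC'.
      by rewrite /X mulrAC.
    have Du_le : Du ^+ kk.+1 <= Du * Du ^+ (kap * k) by rewrite exprS ler_pM2l // ler_weXn2l.
    have cnt : (count (fun I => I \in La') (rem I1 La))%:R <= (size La)%:R :> R.
      by rewrite ler_nat; apply: leq_trans (count_size _ _) _; rewrite size_rem ?leq_pred // (La'P I1 I1L).1.
    apply: le_trans (_ : (size La)%:R * (Du * X * ab al ^+ xs I1 kk) <= _).
      rewrite -[X in X <= _]mulr_natl; apply: ler_pM; rewrite ?mulr_ge0 ?exprn_ge0 ?(ltW Du0) //.
      rewrite /X mulrA -mulrA [ab al ^+ _ * _]mulrC mulrA; rewrite !mulrA.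
      by rewrite ler_wpM2r ?exprn_ge0 // ler_wpM2r ?exprn_ge0.
    rewrite mulrA [X in _ <= X]mulrAC ler_wpM2r ?exprn_ge0 //.
    rewrite ler_pdivlMr //; apply: le_trans HX.
    by apply: pad_le => //; rewrite mulr_ge0 // ltW.
  have D'k : D ^+ kk <= D' ^+ kk.
    apply: le_trans (ler_norm _) _; rewrite normrX lerXn2r ?nnegrE ?(ltW D'0) //.
    by rewrite le_max lexx.
  have up1 : ab (u I1 kk * al ^+ xs I1 kk) <= D' ^+ kk * ab al ^+ (J * mu kk) + e * cc ^+ k * ab al ^+ xs I1 kk / 2.
    have -> : u I1 kk * al ^+ xs I1 kk = \sum_(I <- La) u I kk * al ^+ xs I kk - \sum_(I <- rem I1 La) u I kk * al ^+ xs I kk.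
      by rewrite E1 addrK.
    apply: le_trans (abD _ _) _; rewrite (abN ab_ge0 ab_eq0 abM) lerD //.
    by apply: le_trans Evalue _; rewrite ler_wpM2r ?exprn_ge0.
  have lo1 : e * cc ^+ k * ab al ^+ xs I1 kk <= ab (u I1 kk * al ^+ xs I1 kk).
    by rewrite abM abX ler_wpM2r ?exprn_ge0 // Hj.1.
  exact: le_of_half (le_trans lo1 up1).
have x1le : (xs I1 kk <= M * E kk)%N.
  by apply: leq_trans (I1min I0 I0La') (xs_upper _ _ _).
have Ek : (B * k <= E kk)%N.
  apply: leq_trans (HK2 kk _); first by rewrite leq_mul2l k_le orbT.
  exact: leq_trans k_le.
(* The dominant exponent is at most M E(kk), while J mu(kk) is at least (M + 1) E(kk) up to the
   constant stored in [al']; a full factor |al|^(E kk) remains. *)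
have fin1 : e * cc ^+ k * al' <= 2 * (D' ^+ (kap * k) * ab al ^+ E kk).
  have pM : 0 < ab al ^+ (M * E kk) := ap _.
  rewrite -(ler_pM2r pM).
  apply: le_trans (_ : 2 * (D' ^+ kk * ab al ^+ (J * mu kk)) * al' <= _).
    rewrite mulrAC ler_wpM2r ?(ltW al'0) //; apply: le_trans main.
    by rewrite ler_wpM2l ?mulr_ge0 ?exprn_ge0 ?(ltW e0) ?(ltW cc0) // ler_wiXn2l // ltW.
  rewrite -!mulrA ler_pM2l // /al' -exprD -exprD; apply: ler_pM; rewrite ?exprn_ge0 ?(ltW D'0) //.
    by rewrite ler_weXn2l.
  rewrite ler_wiXn2l ?(ltW al_lt1) //; have := mu_bound M kk; rewrite mulnDl mul1n => l2.
  rewrite addnC; apply: leq_trans l2 _; rewrite leq_add2r leq_mul2r.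
  by apply/orP; right; rewrite /M.
have := HB k (E kk) kK1 Ek.
rewrite exprMn -exprM exprVn mulrAC ler_pdivrMr ?exprn_gt0 // => fin2.
have X0 : 0 < e * cc ^+ k * al' by rewrite !mulr_gt0 ?exprn_gt0.
apply: (half_absurd X0 fin1); apply: le_trans fin2 _.
by rewrite mulrAC [e * al' * _]mulrAC.
Qed.

End VL.

(** * Families over a finite index set, with coefficients that vary with k *)

Section Fam.
Variables (A : fieldType).
Implicit Types Sc : (nat -> A) -> Prop.

(** The vectors [p s] are fixed, so X stays in one finite-dimensional space; only the coefficients
    depend on k, within the class Sc. *)
Definition fam Sc (M : lmodType A) (X : nat -> M) := exists (S : finType) (c : S -> nat -> A) (p : S -> M),
    (forall s, Sc (c s)) /\ forall k, X k = \sum_s c s k *: p s.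
Lemma fam_ext Sc (M : lmodType A) (X Y : nat -> M) : X =1 Y -> fam Sc X -> fam Sc Y.
Proof. by move/funext->. Qed.
Lemma fam_le Sc Sc' (M : lmodType A) (X : nat -> M) : (forall x, Sc x -> Sc' x) -> fam Sc X -> fam Sc' X.
Proof. by move=> e [S [c [p [h E]]]]; exists S, c, p; split=> // s; apply: e. Qed.

Lemma famZ Sc (M : lmodType A) c (p : M) : Sc c -> fam Sc (fun k => c k *: p).
Proof.
by move=> h; exists 'I_1, (fun=> c), (fun=> p); split=> // k; rewrite big_ord1.
Qed.

Lemma famD Sc (M : lmodType A) (X Y : nat -> M) : fam Sc X -> fam Sc Y -> fam Sc (fun k => X k + Y k).
Proof.
move=> [S [c [p [h E]]]] [S' [c' [p' [h' E']]]].
exists (S + S')%type, (fun s => match s with inl s => c s | inr s => c' s end),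
  (fun s => match s with inl s => p s | inr s => p' s end); split; first by case.
by move=> k; rewrite big_sumType E E'.
Qed.

Lemma fam0 Sc (M : lmodType A) : fam Sc (fun=> 0 : M).
Proof.
exists 'I_0, (fun s _ => 0), (fun=> 0); split; first by case.
by move=> k; rewrite big_ord0.
Qed.

Lemma fam_sum Sc (M : lmodType A) (I : Type) (r : seq I) (F : I -> nat -> M) :
  (forall i, fam Sc (F i)) -> fam Sc (fun k => \sum_(i <- r) F i k).
Proof. by move=> H; rewrite big_fun; elim/big_ind: _ => // *; [exact: fam0|exact: famD]. Qed.

Variable M : algType A.

Lemma famM Sc1 Sc2 Sc3 (X Y : nat -> M) : (forall x y, Sc1 x -> Sc2 y -> Sc3 (fun k => x k * y k)) ->
  fam Sc1 X -> fam Sc2 Y -> fam Sc3 (fun k => X k * Y k).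
Proof.
move=> H [S [c [p [h E]]]] [S' [c' [p' [h' E']]]].
exists (S * S')%type, (fun s k => c s.1 k * c' s.2 k), (fun s => p s.1 * p' s.2); split.
  by move=> s; apply: H.
move=> k; rewrite E E' mulr_suml -(pair_bigA _ (fun s s' => (c s k * c' s' k) *: (p s * p' s'))) /=.
apply: eq_bigr => s _; rewrite mulr_sumr; apply: eq_bigr => s' _.
by rewrite -scalerAl -scalerAr scalerA.
Qed.

End Fam.

Lemma fam_cst (K : fieldType) (M : lmodType K) (p : M) : fam (@expoly K) (fun=> p).
Proof. by apply: fam_ext (famZ p (expoly_cst 1)) => k; rewrite scale1r. Qed.

Section Eventually.
Variables (m : nat) (c : nat -> nat).
Import mpoly.
Notation n := m.+1.
Variables (K : fieldType) (R : archiRealFieldType) (ab : K -> R).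
Hypotheses (ab_ge0 : nonneg ab) (ab_eq0 : definite ab) (abM : multiplicative ab) (abD : subadditive ab).
Variable al : K.
Hypotheses (al_gt0 : 0 < ab al) (al_lt1 : ab al < 1).
Variables (C1 k1 : nat).
Hypotheses (C1_gt0 : (0 < C1)%N) (C1P : dominates m c C1 k1).
Notation mu := (@mu m c C1).
Notation zK := (@zK m c K al).
Notation xs := (@xs m c).

Let ab0 : ab 0 = 0. Proof. by rewrite (ab_eq0 0).2. Qed.
Let pw e : 0 < ab al ^+ e. Proof. by rewrite exprn_gt0. Qed.
(** Vanishing to order J at the points z(k), up to an exponential factor. Exponential polynomials
    satisfy it with J = 0, polynomials of order J with J. *)
Definition egb J (x : nat -> K) := exists D, 0 <= D /\ for_large k, ab (x k) <= D ^+ k * ab al ^+ (J * mu k).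
Lemma egb_ext J x y : x =1 y -> egb J x -> egb J y.
Proof. by move/funext->. Qed.

Lemma egb_ev J k2 x y : (forall k, (k2 <= k)%N -> x k = y k) -> egb J x -> egb J y.
Proof.
move=> e [D [D0 [k0 H]]]; exists D; split=> //; exists (maxn k0 k2) => k le.
rewrite -e; last by apply: leq_trans le; rewrite leq_maxr.
by apply: H; apply: leq_trans le; rewrite leq_maxl.
Qed.

Lemma egb_le J J' x : (J' <= J)%N -> egb J x -> egb J' x.
Proof.
move=> le [D [D0 [k0 H]]]; exists D; split=> //; exists k0 => k /H h; apply: le_trans h _.
by rewrite ler_wpM2l ?exprn_ge0 // ler_wiXn2l ?leq_mul2r ?le ?orbT // ltW.
Qed.

Lemma egbD J x y : egb J x -> egb J y -> egb J (fun k => x k + y k).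
Proof.
move=> [D [D0 [k0 H]]] [D' [D0' [k0' H']]]; exists (D + D'); split; first exact: addr_ge0.
exists (maxn k0 k0').+1 => k le; apply: le_trans (abD _ _) _.
have h1 := H k (leq_trans (leq_maxl _ _) (ltnW le)).
have h2 := H' k (leq_trans (leq_maxr _ _) (ltnW le)).
apply: le_trans (lerD h1 h2) _; rewrite -mulrDl ler_wpM2r ?(ltW (pw _)) //.
case: k le {h1 h2} => // k _; rewrite !exprS mulrDl lerD // ler_wpM2l // lerXn2r ?nnegrE ?addr_ge0 //.
  by rewrite lerDl.
by rewrite lerDr.
Qed.

Lemma egb0 J : egb J (fun=> 0).
Proof.
by exists 0; split=> //; exists 0%N => k _; rewrite ab0 mulr_ge0 // ?exprn_ge0 // ltW.
Qed.

Lemma egbM J J' x y : egb J x -> egb J' y -> egb (J + J') (fun k => x k * y k).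
Proof.
move=> [D [D0 [k0 H]]] [D' [D0' [k0' H']]]; exists (D * D'); split; first exact: mulr_ge0.
exists (maxn k0 k0') => k le; rewrite abM exprMn mulnDl exprD mulrACA.
apply: ler_pM => //; first by apply: H; apply: leq_trans (leq_maxl _ _) le.
by apply: H'; apply: leq_trans (leq_maxr _ _) le.
Qed.

Lemma egbN J x : egb J x -> egb J (fun k => - x k).
Proof. by move=> [D [D0 [k0 H]]]; exists D; split=> //; exists k0 => k /H; rewrite (abN ab_ge0 ab_eq0 abM). Qed.

Lemma egb_cst x : egb 0 (fun=> x).
Proof.
exists (1 + ab x); split; first by rewrite addr_ge0.
exists 1%N => k k0; rewrite mul0n expr0 mulr1.
apply: le_trans (_ : 1 + ab x <= _); first by rewrite lerDr.
by case: k k0 => // k _; rewrite exprS ler_peMr ?addr_ge0 // exprn_ege1 // lerDl.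
Qed.

Lemma egb_sum J (I : Type) (s : seq I) (P : pred I) (F : I -> nat -> K) :
  (forall i, egb J (F i)) -> egb J (fun k => \sum_(i <- s | P i) F i k).
Proof. by move=> H; rewrite big_fun; elim/big_ind: _ => // *; [exact: egb0|exact: egbD]. Qed.

Lemma egb_prod (I : Type) (s : seq I) (F : I -> nat -> K) :
  (forall i, egb 0 (F i)) -> egb 0 (fun k => \prod_(i <- s) F i k).
Proof. by move=> H; rewrite big_fun; elim/big_ind: _ => // *; [exact: egb_cst|exact: (egbM (J := 0) (J' := 0))]. Qed.

Lemma egbX e x : egb 0 x -> egb 0 (fun k => x k ^+ e).
Proof.
move=> H; elim: e => [|e IHe]; first by apply: egb_ext (egb_cst 1) => k; rewrite expr0.
by apply: egb_ext (egbM H IHe) => k; rewrite exprS.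
Qed.

Lemma xs_ge_mu I k : (k1 <= k)%N -> (mdeg I * mu k <= xs I k)%N.
Proof.
move=> le; rewrite xs_lin mdegE big_distrl; apply: leq_sum => i _; rewrite leq_mul2l; apply/orP; right.
have := C1P (a := U_(i)%MM) (k := k) _ le; rewrite /mu => /(_ _)/leq_div2r => H.
apply: leq_trans (H C1 _) _; last by rewrite mulKn.
by apply/eqP => /mnmP/(_ i); rewrite mnm1E eqxx mnm0E.
Qed.

Lemma egb_mon I : egb (mdeg I) (fun k => al ^+ xs I k).
Proof.
exists 1; split=> //; exists k1 => k le; rewrite expr1n mul1r (abX ab_eq0 abM).
by rewrite ler_wiXn2l ?xs_ge_mu // ltW.
Qed.

Lemma egb_hord J (p : {mpoly K[n]}) : hord J p -> egb J (fun k => p.@[zK k]).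
Proof.
move=> Hp; apply: (@egb_ext _ (fun k => \sum_(I <- msupp p) (if I \in msupp p then p@_I * al ^+ xs I k else 0))).
  by move=> k; rewrite mevalzK [RHS]big_seq [LHS]big_seq; apply: eq_bigr => I ->.
apply: egb_sum => I; case IS: (I \in msupp p); last exact: egb0.
by apply: (egb_le (J := 0 + mdeg I)); [exact: Hp|apply: egbM (egb_cst _) (egb_mon _)].
Qed.

Lemma egb_poly (p : {mpoly K[n]}) : egb 0 (fun k => p.@[zK k]).
Proof. exact: egb_hord. Qed.

Lemma expoly_egb h : expoly h -> egb 0 h.
Proof.
move=> [s [nz H]]; have p0 : rootprod s != 0.
  by apply: contraNneq (rootprod_coef0 nz) => ->; rewrite coef0.
have [D D1 HD] := ann_upper ab_ge0 ab_eq0 abM abD p0 H.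
have D0 : 0 <= D by apply: le_trans D1.
exists (D ^+ 2); split; first exact: exprn_ge0.
exists 1%N => k k0; rewrite mul0n mulr1 -exprM; apply: le_trans (HD k) _.
by rewrite ler_weXn2l //; lia.
Qed.

Definition eqv J (x y : nat -> K) := [/\ egb 0 x, egb 0 y & egb J (fun k => x k - y k)].
Lemma eqv_refl J x : egb 0 x -> eqv J x x.
Proof. by move=> h; split=> //; apply: egb_ext (egb0 J) => k; rewrite subrr. Qed.

Lemma eqvM J x y x' y' : eqv J x x' -> eqv J y y' -> eqv J (fun k => x k * y k) (fun k => x' k * y' k).
Proof.
move=> [x0 x0' xx] [y0 y0' yy]; split; [exact: egbM x0 y0|exact: egbM x0' y0'|].
apply: egb_ext (egbD (egbM x0 yy : egb J _) (_ : egb J (fun k => (x k - x' k) * y' k))).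
  by move=> k /=; ring.
by have := egbM xx y0'; rewrite addn0.
Qed.

Lemma eqv_sum J (I : Type) (s : seq I) (F G : I -> nat -> K) :
  (forall i, eqv J (F i) (G i)) -> eqv J (fun k => \sum_(i <- s) F i k) (fun k => \sum_(i <- s) G i k).
Proof.
move=> H; split; try by apply: egb_sum => i; case: (H i).
apply: egb_ext (_ : egb J (fun k => \sum_(i <- s) (F i k - G i k))); first by move=> k; rewrite sumrB.
by apply: egb_sum => i; case: (H i).
Qed.

Lemma eqvX J e x y : eqv J x y -> eqv J (fun k => x k ^+ e) (fun k => y k ^+ e).
Proof.
move=> H; elim: e => [|e IHe]; first exact: (eqv_refl J (egb_cst 1)).
have E z : (fun k => z k ^+ e.+1) = (fun k => z k * z k ^+ e :> K) by apply: funext => k; rewrite exprS.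
by rewrite !E; exact: eqvM.
Qed.

Lemma eqv_prod J (I : Type) (s : seq I) (F G : I -> nat -> K) :
  (forall i, eqv J (F i) (G i)) -> eqv J (fun k => \prod_(i <- s) F i k) (fun k => \prod_(i <- s) G i k).
Proof. by move=> H; rewrite !big_fun; elim/big_ind2: _ => // *; [exact: (eqv_refl _ (egb_cst 1))|exact: eqvM]. Qed.

Section Approx.
Variables (Nv : nat) (vals : nat -> 'I_Nv -> {mpoly K[n]}) (w : nat -> 'I_Nv -> K).
Hypothesis w_approx : forall v J, egb J (fun k => w k v - (vals J v).@[zK k]).

Definition sub J (p : {mpoly K[Nv]}) : {mpoly K[n]} := \sum_(nu <- msupp p) p@_nu *: \prod_v vals J v ^+ nu v.

Lemma w_eqv v J : eqv J (fun k => w k v) (fun k => (vals J v).@[zK k]).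
Proof.
split; [|exact: egb_poly|exact: w_approx].
apply: egb_ext (egbD (egb_le (leq0n J) (w_approx v J)) (egb_poly (vals J v))) => k.
by rewrite subrK.
Qed.

Lemma sub_eval J p k : (sub J p).@[zK k] = \sum_(nu <- msupp p) p@_nu * \prod_v (vals J v).@[zK k] ^+ nu v.
Proof.
rewrite raddf_sum; apply: eq_bigr => nu _; rewrite /= mevalZ rmorph_prod; congr (_ * _).
by apply: eq_bigr => v _; rewrite rmorphXn.
Qed.

Lemma sub_eqv J (p : {mpoly K[Nv]}) : eqv J (fun k => p.@[w k]) (fun k => (sub J p).@[zK k]).
Proof.
have [a b c'] : eqv J (fun k => \sum_(nu <- msupp p) p@_nu * \prod_v w k v ^+ nu v)
    (fun k => \sum_(nu <- msupp p) p@_nu * \prod_v (vals J v).@[zK k] ^+ nu v).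
  apply: eqv_sum => nu; apply: eqvM; first by apply/eqv_refl/egb_cst.
  by apply: eqv_prod => v; apply: eqvX; apply: w_eqv.
split.
- by apply: egb_ext a => k; rewrite mevalE.
- by apply: egb_ext b => k; rewrite sub_eval.
by apply: egb_ext c' => k; rewrite mevalE sub_eval.
Qed.

End Approx.
End Eventually.

Section Independence.
Import mpoly.
Variables (m : nat) (c : nat -> nat).
Notation n := m.+1.
Hypothesis cn : c n != 0%N.
Variable rts : seq algC.
Hypotheses (rtsE : cpoly m c algC = rootprod rts) (nd : nondeg rts) (no_unity : no_root_of_unity rts).
Variables (K : fieldType) (R : archiRealFieldType) (ab : K -> R).
Hypotheses (charK : [pchar K] =i pred0) (ab_ge0 : nonneg ab) (ab_eq0 : definite ab)
  (abM : multiplicative ab) (abD : subadditive ab).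
Variable al : K.
Hypotheses (al_gt0 : 0 < ab al) (al_lt1 : ab al < 1).
Variables (C1 k1 : nat).
Hypotheses (C1_gt0 : (0 < C1)%N) (C1P : dominates m c C1 k1).
Notation mu := (@mu m c C1).
Notation zK := (@zK m c K al).
Notation xs := (@xs m c).
Notation egb := (@egb m c K R ab al C1).
Variables (Nv : nat) (vals : nat -> 'I_Nv -> {mpoly K[n]}) (w : nat -> 'I_Nv -> K).
Hypotheses (w_approx : forall v J, egb J (fun k => w k v - (vals J v).@[zK k]))
 (vals_cong : forall J J' v, (J <= J')%N -> hcong J (vals J v) (vals J' v))
 (formal_ind : forall P : {mpoly {mpoly K[n]}[Nv]}, (forall J, hord J P.@[vals J]) -> P = 0).

Definition lift0 (p : {mpoly K[Nv]}) : {mpoly {mpoly K[n]}[Nv]} := map_mpoly (@mpolyC n K) p.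

Lemma lift0_sub J p : (lift0 p).@[vals J] = sub vals J p.
Proof.
rewrite /lift0 /map_mpoly /mmap /sub raddf_sum; apply: eq_bigr => nu _ /=.
rewrite mevalM mevalC -mul_mpolyC; congr (_ * _); rewrite /mmap1 rmorph_prod.
by apply: eq_bigr => v _; rewrite rmorphXn /= mevalXU.
Qed.

Lemma sub_cong J J' p : (J <= J')%N -> hcong J (sub vals J p) (sub vals J' p).
Proof.
move=> le; apply: hcong_sum => nu _; apply: hcongZ; apply: hcong_prod => v _; apply: hcongX.
exact: vals_cong.
Qed.

Lemma hcong_coef J (p q : {mpoly K[n]}) I : hcong J p q -> (mdeg I < J)%N -> p@_I = q@_I.
Proof. by move=> /hordP H /H; rewrite mcoeffB => /eqP; rewrite subr_eq0 => /eqP. Qed.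

(* If the relation held, all coefficients of its expansion in powers of the
   point would vanish, so by formal independence the relation would be trivial. *)
Lemma fam_vanishing (T : finType) (lam : T -> 'X_{1..n}) (X : T -> nat -> {mpoly K[Nv]}) k2 :
  injective lam -> (forall t, fam (@expoly K) (X t)) ->
  (forall k, (k2 <= k)%N -> \sum_t al ^+ xs (lam t) k * (X t k).@[w k] = 0) -> forall t k, X t k = 0.
Proof.
move=> lam_inj HX H0.
have HX' t : exists d : {S : finType & ((S -> nat -> K) * (S -> {mpoly K[Nv]}))%type},
    (forall s, expoly ((tagged d).1 s)) /\ forall k, X t k = \sum_s (tagged d).1 s k *: (tagged d).2 s.
  by have [S [cf [p [h E]]]] := HX t; exists (existT _ S (cf, p)).
have [d Hd] := choice HX'.
pose S t : finType := tag (d t).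
pose cf t : S t -> nat -> K := (tagged (d t)).1.
pose p t : S t -> {mpoly K[Nv]} := (tagged (d t)).2.
pose TS := {t : T & S t}.
pose cc (ts : TS) := cf (tag ts) (tagged ts).
pose pp J (ts : TS) : {mpoly K[n]} := 'X_[lam (tag ts)] * sub vals J (p (tag ts) (tagged ts)).
have cc_exp ts : expoly (cc ts) by apply: (Hd (tag ts)).1.
pose Y k : {mpoly {mpoly K[n]}[Nv]} := \sum_t ('X_[lam t])%:MP * lift0 (X t k).
have sublin J t k : sub vals J (X t k) = \sum_(s : S t) cf t s k *: sub vals J (p t s).
  have liftZ a q : lift0 (a *: q) = a%:MP *: lift0 q.
    by rewrite -mul_mpolyC /lift0 rmorphM /= map_mpolyC mul_mpolyC.
  have liftS : lift0 (\sum_s cf t s k *: p t s) = \sum_s lift0 (cf t s k *: p t s).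
    exact: (raddf_sum (map_mpoly (@mpolyC n K))).
  rewrite -lift0_sub (Hd t).2 liftS raddf_sum; apply: eq_bigr => s _ /=.
  by rewrite liftZ mevalZ lift0_sub mul_mpolyC.
have Yval J k : (Y k).@[vals J] = \sum_ts cc ts k *: pp J ts.
  rewrite /Y raddf_sum (eq_bigr (fun t => \sum_(s : S t) cc (Tagged S s) k *: pp J (Tagged S s))).
    by rewrite sig_big_dep /=; apply: eq_bigr => -[t s].
  move=> t _; rewrite /= rmorphM /= mevalC lift0_sub sublin mulr_sumr; apply: eq_bigr => s _.
  by rewrite -scalerAr.
have small J : egb J (fun k => \sum_ts cc ts k * (pp J ts).@[zK k]).
  pose Z k := \sum_t \sum_(s : S t) al ^+ xs (lam t) k * (cf t s k * ((p t s).@[w k] - (sub vals J (p t s)).@[zK k])).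
  have HZ : egb J Z.
    apply: egb_sum => // t; apply: egb_sum => // s.
    have M1 : egb 0 (fun k => al ^+ xs (lam t) k).
      have Hm : egb (mdeg (lam t)) (fun k => al ^+ xs (lam t) k) by eapply egb_mon; eauto.
      by apply: egb_le (leq0n _) Hm.
    have M2 : egb 0 (cf t s) by apply: expoly_egb => //; apply: (Hd t).1.
    have M3 : egb J (fun k => (p t s).@[w k] - (sub vals J (p t s)).@[zK k]).
      by case: (@sub_eqv m c K R ab ab_ge0 ab_eq0 abM abD al al_gt0 al_lt1 C1 k1 C1_gt0 C1P Nv vals w w_approx J (p t s)).
    suff: egb (0 + (0 + J)) (fun k => al ^+ xs (lam t) k *
        (cf t s k * ((p t s).@[w k] - (sub vals J (p t s)).@[zK k]))) by [].
    by apply: egbM => //; apply: egbM.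
  apply: (egb_ev (k2 := k2)) (egbN ab_ge0 ab_eq0 abM HZ) => // k le.
  suff EZ : Z k = \sum_t al ^+ xs (lam t) k * (X t k).@[w k] - \sum_ts cc ts k * (pp J ts).@[zK k].
    by rewrite EZ H0 // sub0r opprK.
  have -> : \sum_ts cc ts k * (pp J ts).@[zK k] =
      \sum_t \sum_(s : S t) cf t s k * (al ^+ xs (lam t) k * (sub vals J (p t s)).@[zK k]).
    rewrite sig_big_dep /=; apply: eq_bigr => -[t s] _; rewrite /cc /pp /= mevalM; congr (_ * (_ * _)).
    by rewrite mevalE msuppX big_seq1 mcoeffX eqxx mul1r zK_mon.
  rewrite -sumrB; apply: eq_bigr => t _; rewrite (Hd t).2 raddf_sum mulr_sumr -sumrB.
  apply: eq_bigr => s _; rewrite /= mevalZ -/(cf t s k) -/(p t s).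
  by rewrite mulrBr mulrBr [cf t s k * (al ^+ _ * _)]mulrCA.
have Y0 k : Y k = 0.
  apply: formal_ind => Js; apply: contrapT => nh.
  have [I0 [I0l I0n]] : exists I0, (mdeg I0 < Js)%N /\ ((Y k).@[vals Js])@_I0 != 0.
    apply: contrapT => nI; apply: nh; apply/hordP => I lt; apply/eqP/negPn/negP => ne.
    by apply: nI; exists I.
  (* J is at least Js, so truncation at J does not change the coefficient of I0, and at least the
     threshold of [vanishing_core] for I0. *)
  pose J := (Js + C1 * (mdeg I0 + 1))%N.
  apply: (vanishing_core cn rtsE nd no_unity charK ab_ge0 ab_eq0 abM abD al_gt0 al_lt1 C1_gt0
    (P := pp J) (I0 := I0) (J := J) (k1 := k) cc_exp); last first.
  - have [D [_ [k0 Hk]]] := small J; by exists D, k0.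
  - exact: leq_addl.
  move: I0n; rewrite Yval raddf_sum /=; congr (_ != _); apply: eq_bigr => ts _.
  rewrite mcoeffZ; congr (_ * _); apply: (hcong_coef _ I0l).
  by apply: hcongM; [exact: hcong_refl|apply: sub_cong; exact: leq_addr].
move=> t k; apply/mpolyP => nu; rewrite mcoeff0.
have := congr1 (fun q => q@_nu@_(lam t)) (Y0 k); rewrite /= !mcoeff0 /Y raddf_sum raddf_sum /= => <-.
rewrite (bigD1 t) //= big1 ?addr0.
  by rewrite mul_mpolyC mcoeffZ /lift0 mcoeff_map_mpoly mulrC mul_mpolyC mcoeffZ mcoeffX eqxx mulr1.
move=> t' ne; rewrite mul_mpolyC mcoeffZ /lift0 mcoeff_map_mpoly mulrC mul_mpolyC mcoeffZ mcoeffX.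
by rewrite (inj_eq lam_inj) (negPf ne) mulr0.
Qed.

Variables (e : nat) (tau : 'I_e -> nat -> K) (num : 'I_e -> nat -> {mpoly K[Nv]}) (den : 'I_e -> {mpoly K[Nv]}).
Hypotheses (num_fam : forall i, fam (@expoly K) (num i)) (numE : forall i k, (num i k).@[w k] = tau i k * (den i).@[w k])
 (den_neq0 : forall i k, (den i).@[w k] != 0).

(** Zero test for sums of monomials in z(k) with coefficients polynomial in [tau]. The denominators
    [den i] do not vary with k; after multiplication by their Q-th powers the sum is a family in the
    values w(k), to which [fam_vanishing] applies. *)
Lemma tau_independent (T : finType) (lam : T -> 'X_{1..n}) (q : T -> {mpoly K[e]}) k2 : injective lam ->
  (forall k, (k2 <= k)%N -> \sum_t al ^+ xs (lam t) k * (q t).@[tau^~ k] = 0) -> forall t k, (q t).@[tau^~ k] = 0.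
Proof.
move=> lam_inj H0.
have [Q HQ] : exists Q, forall t nu, nu \in msupp (q t) -> forall i, (nu i <= Q)%N.
  exists (\sum_t \sum_(nu <- msupp (q t)) mdeg nu)%N => t nu ns i.
  rewrite (bigD1 t) //= (big_rem nu) //= mdegE (bigD1 i) //= -!addnA; exact: leq_addr.
pose X t k : {mpoly K[Nv]} := \sum_(nu <- msupp (q t)) (q t)@_nu *: \prod_i (num i k ^+ nu i * den i ^+ (Q - nu i)).
pose Del k := \prod_i (den i).@[w k] ^+ Q.
have Del0 k : Del k != 0 by apply/prodf_neq0 => i _; rewrite expf_neq0.
have XE t k : (X t k).@[w k] = (q t).@[tau^~ k] * Del k.
  rewrite raddf_sum mevalE mulr_suml big_seq [RHS]big_seq; apply: eq_bigr => nu ns /=.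
  rewrite mevalZ -mulrA rmorph_prod; congr (_ * _); rewrite -big_split; apply: eq_bigr => i _ /=.
  rewrite rmorphM /= !rmorphXn /= numE exprMn -mulrA -exprD subnKC //; exact: HQ ns i.
have Xfam t : fam (@expoly K) (X t).
  apply: fam_sum => nu.
  have mulE : forall x y : nat -> K, expoly x -> expoly y -> expoly (fun k => x k * y k) by move=> x y; apply: expolyM.
  have powf i d : fam (@expoly K) (fun k => num i k ^+ d).
    elim: d => [|d IHd]; first exact: (fam_cst 1).
    by apply: fam_ext (famM mulE (num_fam i) IHd) => k; rewrite exprS.
  apply: (fam_ext _ (famM mulE (famZ 1 (expoly_cst (q t)@_nu)) (_ : fam (@expoly K) (fun k => \prod_i (num i k ^+ nu i * den i ^+ (Q - nu i)))))).
    by move=> k; rewrite -scalerAl mul1r.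
  rewrite big_fun; elim/big_ind: _ => [|x y|i _]; [exact: (fam_cst 1)|exact: famM mulE|].
  exact: (famM mulE (powf i (nu i)) (fam_cst _)).
have X0 := @fam_vanishing T lam X k2 lam_inj Xfam _.
move=> t k; apply: (mulIf (Del0 k)); rewrite mul0r -XE X0 ?meval0 //.
move=> k' le; rewrite (eq_bigr (fun t => al ^+ xs (lam t) k' * (q t).@[tau^~ k'] * Del k')).
  by rewrite -mulr_suml H0 ?mul0r.
by move=> t' _; rewrite XE mulrA.
Qed.

End Independence.

(** * Auxiliary polynomials *)

Lemma le_trans2_eq (R : realDomainType) (x y x' y' : R) : x = x' -> y = y' -> x <= y -> x' <= y'.
Proof. by move=> -> ->. Qed.

Section LinearAlgebra.
Variable A : fieldType.

Lemma nontrivial_solution (X Y : finType) (M : X -> Y -> A) : (#|Y| < #|X|)%N ->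
  exists x : X -> A, (exists a, x a != 0) /\ forall b, \sum_a x a * M a b = 0.
Proof.
move=> lt; pose B := \matrix_(i < #|X|, j < #|Y|) M (enum_val i) (enum_val j).
have : kermx B != 0.
  rewrite -mxrank_eq0 mxrank_ker subn_eq0 -ltnNge.
  by apply: leq_ltn_trans (rank_leq_col _) lt.
case/matrix0Pn=> i [j ij].
exists (fun a => kermx B i (enum_rank a)); split; first by exists (enum_val j); rewrite enum_valK.
move=> b; have /matrixP/(_ i (enum_rank b)) := mulmx_ker B; rewrite !mxE => H; apply: etrans H.
rewrite (reindex (@enum_val X predT)) /=; last by apply: onW_bij; apply: enum_val_bij.
by apply: eq_bigr => a _; rewrite enum_valK; congr (_ * _); rewrite mxE enum_rankK.
Qed.

Lemma basis_exists (I : finType) (b : I -> nat -> A) :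
  exists s (f : 'I_s -> I), (forall x : 'I_s -> A, (forall k, \sum_i x i * b (f i) k = 0) -> forall i, x i = 0) /\
   forall j, exists x : 'I_s -> A, forall k, b j k = \sum_i x i * b (f i) k.
Proof.
suff H (l : seq I) : exists s (f : 'I_s -> I), (forall x : 'I_s -> A, (forall k, \sum_i x i * b (f i) k = 0) -> forall i, x i = 0) /\
   forall j, j \in l -> exists x : 'I_s -> A, forall k, b j k = \sum_i x i * b (f i) k.
  by have [s [f [h1 h2]]] := H (enum I); exists s, f; split=> // j; apply: h2; rewrite mem_enum.
elim: l => [|j l [s [f [h1 h2]]]].
  by exists 0%N, (fun i : 'I_0 => match i with Ordinal _ lt => False_rect _ (notF lt) end); split=> // x _ [].
have [[x Hx]|no] := EM (exists x : 'I_s -> A, forall k, b j k = \sum_i x i * b (f i) k).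
  exists s, f; split=> // j'; rewrite inE => /orP[/eqP->|/h2 //]; by exists x.
exists s.+1, (fun i => if unlift ord0 i is Some i' then f i' else j); split.
  move=> x Hx; have x0 : x ord0 = 0.
    apply/eqP/negPn/negP => nz; apply: no; exists (fun i => - (x ord0)^-1 * x (lift ord0 i)) => k.
    have := Hx k; rewrite big_ord_recl unlift_none => /eqP; rewrite addr_eq0 => /eqP e.
    apply: (mulfI nz); rewrite e mulr_sumr -sumrN; apply: eq_bigr => i _.
    by rewrite liftK !mulrA mulrN divff // mulN1r mulNr.
  have xl : forall i, x (lift ord0 i) = 0.
    apply: (h1 (fun i => x (lift ord0 i))) => k; have := Hx k; rewrite big_ord_recl x0 mul0r add0r => e.
    by rewrite -[RHS]e; apply: eq_bigr => i _; rewrite liftK.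
  by move=> i; case: (unliftP ord0 i) => [i' ->|->].
move=> j'; rewrite inE => /orP[/eqP->|/h2 [x Hx]].
  exists (fun i => if i == ord0 then 1 else 0) => k; rewrite big_ord_recl eqxx unlift_none mul1r big1 ?addr0 // => i _.
  by rewrite mul0r.
exists (fun i => if unlift ord0 i is Some i' then x i' else 0) => k.
by rewrite Hx big_ord_recl unlift_none mul0r add0r; apply: eq_bigr => i _; rewrite liftK.
Qed.

End LinearAlgebra.

Section Order.
Import mpoly.
Variables (A : idomainType) (n : nat).
Implicit Types p q : {mpoly A[n]}.

Definition lowpart d p : {mpoly A[n]} := \sum_(I <- msupp p | mdeg I == d) p@_I *: 'X_[I].

Lemma lowpart_coef d p I : (lowpart d p)@_I = if mdeg I == d then p@_I else 0.
Proof.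
rewrite /lowpart raddf_sum /=; under eq_bigr do rewrite mcoeffZ mcoeffX.
have [Ip|Ip] := boolP (I \in msupp p); last first.
  rewrite (memN_msupp_eq0 Ip) if_same big_seq_cond big1 // => I' /andP[I'p _].
  by case: eqP => [e|]; rewrite ?mulr0 //; move: Ip; rewrite -e I'p.
case: eqP => [e|ne].
  rewrite big_mkcond (bigD1_seq I) ?msupp_uniq //= e !eqxx mulr1 big1 ?addr0 // => I' ne.
  by rewrite (negPf ne) mulr0 if_same.
by rewrite big1 // => I' /eqP e; case: eqP => [e'|]; rewrite ?mulr0 //; move: ne; rewrite -e' e.
Qed.

(** The order is a valuation: over a domain the product of the two lowest homogeneous parts is
    nonzero. *)
Lemma hord_cancel J N p q : ~ hord N p -> hord J (p * q) -> hord (J - N) q.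
Proof.
move=> nN HJ; apply: contrapT => nq.
have minP (f : {mpoly A[n]}) k : ~ hord k f -> exists d, [/\ (d < k)%N, hord d f & lowpart d f != 0].
  move=> nk.
  have [d [I [Ip e]] dmin] : exists2 d, (exists I, I \in msupp f /\ mdeg I = d) & forall d', (exists I, I \in msupp f /\ mdeg I = d') -> (d <= d')%N.
    apply: min_nat; apply: contrapT => H; apply: nk => I Ip; exfalso; apply: H.
    by exists (mdeg I), I.
  exists d; split.
  - rewrite ltnNge; apply/negP => le; apply: nk => I' I'p; apply: leq_trans le _.
    by apply: dmin; exists I'.
  - by move=> I' I'p; apply: dmin; exists I'.
  apply/eqP => /(congr1 (fun g => g@_I)); rewrite lowpart_coef mcoeff0 e eqxx => /eqP.
  by rewrite mcoeff_eq0 Ip.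
have [d [dN pd lp]] := minP _ _ nN; have [d' [d'J qd' lq]] := minP _ _ nq.
have low f k : hord k f -> hcong k.+1 f (lowpart k f).
  move=> fk; apply/hordP => I lt; rewrite mcoeffB lowpart_coef.
  case: eqP => [_|ne]; first by rewrite subrr.
  rewrite subr0; apply: ((hordP k f).1 fk).
  by rewrite ltn_neqAle -ltnS lt andbT; apply/eqP.
have lowh f k : hord k (lowpart k f).
  by apply/hordP => I lt; rewrite lowpart_coef ltn_eqF.
have c1 : hord (d + d').+1 (p * q - lowpart d p * lowpart d' q).
  have -> : p * q - lowpart d p * lowpart d' q = (p - lowpart d p) * q + lowpart d p * (q - lowpart d' q) by ring.
  apply: hordD; first by rewrite -addSn; apply: hordM => //; apply: low.
  by rewrite -addnS; apply: hordM => //; apply: low.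
have c2 : hord (d + d').+1 (lowpart d p * lowpart d' q).
  have -> : lowpart d p * lowpart d' q = p * q - (p * q - lowpart d p * lowpart d' q) by ring.
  apply: hordD; last by apply: hordN.
  by apply: hord_leq HJ; lia.
have : lowpart d p * lowpart d' q != 0 by rewrite mulf_neq0.
apply/negP/negPn/eqP/mpolyP => I; rewrite mcoeff0.
have [lt|ge] := ltnP (mdeg I) (d + d').+1; first exact: ((hordP _ _).1 c2 I lt).
apply/eqP; rewrite mcoeff_eq0; apply/negP => /msuppM_le/allpairsP[[I1 I2] /= [h1 h2 e]].
have dI1 : mdeg I1 = d by move: h1; rewrite mcoeff_msupp lowpart_coef; case: (mdeg I1 =P d) => // _; rewrite eqxx.
have dI2 : mdeg I2 = d' by move: h2; rewrite mcoeff_msupp lowpart_coef; case: (mdeg I2 =P d') => // _; rewrite eqxx.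
by move: ge; rewrite e mdegD dI1 dI2 ltnn.
Qed.

Lemma hord_cancelX J N h p q : ~ hord N p -> hord J (p ^+ h * q) -> hord (J - h * N) q.
Proof.
move=> nN; elim: h J => [|h IHh] J; first by rewrite mul1r mul0n subn0.
rewrite exprS -mulrA => /(hord_cancel nN)/IHh.
by rewrite -subnDA -mulSn.
Qed.

End Order.

Section Mahler.
Import mpoly.
Variables (m : nat) (c : nat -> nat).
Notation n := m.+1.
Variables (K : fieldType) (R : archiRealFieldType) (ab : K -> R).
Hypotheses (ab_ge0 : nonneg ab) (ab_eq0 : definite ab) (abM : multiplicative ab) (abD : subadditive ab)
  (ab_nat : forall k, (0 < k)%N -> k%:R^-1 <= ab k%:R).
Variables (L : fieldExtType rat) (emb : {rmorphism L -> K}) (a : L).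
Hypotheses (al_gt0 : 0 < ab (emb a)) (al_lt1 : ab (emb a) < 1).
Variables (C1 k1 : nat).
Hypotheses (C1_gt0 : (0 < C1)%N) (C1P : dominates m c C1 k1) (E_lin : forall B, for_large k, (B * k <= @E m c k)%N).
Notation E := (@E m c).
Notation mu := (@mu m c C1).
Notation xs := (@xs m c).
Notation egb := (@egb m c K R ab (emb a) C1).
Definition zL k : 'I_n -> L := fun i => a ^+ xs U_(i)%MM k.

Variables (e : nat) (tau : 'I_e -> nat -> L).
Variables (dn Bf : nat -> nat) (D0 H1 : nat).
Hypotheses (dn_gt0 : forall k, (0 < dn k)%N) (dn_le : forall k, (dn k <= Bf k)%N)
 (Bf_le : forall k, (Bf k <= D0 ^ k.+1 * H1 ^ E k)%N) (tau_ht : forall i k, Int (Bf k) ((dn k)%:R * tau i k))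
 (z_ht : forall i k, Int (Bf k) ((dn k)%:R * zL k i)) (tau_egb : forall i, egb 0 (fun k => emb (tau i k)))
 (tau_ind : forall (T : finType) (lam : T -> 'X_{1..n}) (q : T -> {mpoly L[e]}) k2,
  injective lam -> (forall k, (k2 <= k)%N -> \sum_t a ^+ xs (lam t) k * (q t).@[tau^~ k] = 0) ->
  forall t k, (q t).@[tau^~ k] = 0).

(** The degree is bounded in each variable separately, which suits the box of exponents used in
    [box_product]. *)
Definition cls Q (x : nat -> L) := exists q : {mpoly L[e]},
  (forall nu, nu \in msupp q -> forall i, (nu i <= Q)%N) /\ forall k, x k = q.@[tau^~ k].
Lemma cls_ext Q x y : x =1 y -> cls Q x -> cls Q y.
Proof. by move/funext->. Qed.
Lemma cls_le Q Q' x : (Q <= Q')%N -> cls Q x -> cls Q' x.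
Proof. by move=> le [q [h1 h2]]; exists q; split=> // nu h i; apply: leq_trans (h1 nu h i) le. Qed.

Lemma clsD Q x y : cls Q x -> cls Q y -> cls Q (fun k => x k + y k).
Proof.
move=> [q [h1 h2]] [q' [h1' h2']]; exists (q + q'); split; last by move=> k; rewrite raddfD h2 h2'.
by move=> nu /msuppD_le; rewrite mem_cat => /orP[/h1|/h1'].
Qed.

Lemma clsM Q Q' x y : cls Q x -> cls Q' y -> cls (Q + Q') (fun k => x k * y k).
Proof.
move=> [q [h1 h2]] [q' [h1' h2']]; exists (q * q'); split; last by move=> k; rewrite rmorphM h2 h2'.
move=> nu /msuppM_le/allpairsP[[n1 n2] /= [s1 s2 ->]] i; rewrite mnmDE leq_add //; [exact: h1|exact: h1'].
Qed.

Lemma cls_cst Q x : cls Q (fun=> x).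
Proof.
exists x%:MP; split; last by move=> k; rewrite mevalC.
move=> nu; rewrite msuppC; case: ifP => //; rewrite inE => _ /eqP-> i.
by rewrite mnm0E.
Qed.

Lemma cls_tau i : cls 1 (tau i).
Proof.
exists 'X_i; split; last by move=> k; rewrite mevalXU.
move=> nu; rewrite msuppX inE => /eqP-> j; rewrite mnm1E; by case: eqP.
Qed.

Lemma cls_sum Q (I : Type) (s : seq I) (F : I -> nat -> L) :
  (forall i, cls Q (F i)) -> cls Q (fun k => \sum_(i <- s) F i k).
Proof. by move=> H; rewrite big_fun; elim/big_ind: _ => // *; [exact: (cls_cst Q 0)|exact: clsD]. Qed.

Lemma cls_egb Q x : cls Q x -> egb 0 (fun k => emb (x k)).
Proof.
move=> [q [_ h]].
have H : egb 0 (fun k => \sum_(nu <- msupp q) emb q@_nu * \prod_i emb (tau i k) ^+ nu i).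
  apply: egb_sum => // nu; suff: egb (0 + 0) (fun k => emb q@_nu * \prod_i emb (tau i k) ^+ nu i) by [].
  apply: egbM => //; first exact: egb_cst.
  by apply: egb_prod => // i; apply: egbX.
apply: egb_ext H => k; rewrite h mevalE rmorph_sum; apply: eq_bigr => nu _.
rewrite rmorphM rmorph_prod; congr (_ * _); apply: eq_bigr => i _; by rewrite rmorphXn.
Qed.

(** Height at most a constant times Bf^Q, with a denominator that is a constant times dn^Q; additive
    in Q under products. *)
Definition Ht Q (x : nat -> L) := exists C D, (0 < D)%N /\ forall k, Int (C * Bf k ^ Q) ((D * dn k ^ Q)%:R * x k).
Lemma Ht_ext Q x y : x =1 y -> Ht Q x -> Ht Q y.
Proof. by move/funext->. Qed.
Lemma Bf_gt0 k : (0 < Bf k)%N. Proof. exact: leq_trans (dn_gt0 k) (dn_le k). Qed.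

Lemma Ht_le Q Q' x : (Q <= Q')%N -> Ht Q x -> Ht Q' x.
Proof.
move=> le [C [D [D0' H]]]; exists C, D; split=> // k.
rewrite -(subnK le) !expnD mulnCA [in X in Int _ X]mulnCA natrM -mulrA.
apply: IntM (H k); apply: Int_le (Int_nat _ _).
by case: (Q' - Q)%N => [|z] //; rewrite leq_exp2r ?dn_le.
Qed.

Lemma HtD Q x y : Ht Q x -> Ht Q y -> Ht Q (fun k => x k + y k).
Proof.
move=> [C [D [Dp H]]] [C' [D' [Dp' H']]]; exists (D' * C + D * C')%N, (D * D')%N; split; first by rewrite muln_gt0 Dp.
move=> k; rewrite mulrDr mulnDl; apply: IntD.
  by rewrite -!mulnA [(D * _)%N]mulnCA natrM -mulrA; apply: IntM (Int_nat _ _) (H k).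
by rewrite -!mulnA natrM -mulrA; apply: IntM (Int_nat _ _) (H' k).
Qed.

Lemma HtM Q Q' x y : Ht Q x -> Ht Q' y -> Ht (Q + Q') (fun k => x k * y k).
Proof.
move=> [C [D [Dp H]]] [C' [D' [Dp' H']]]; exists (C * C')%N, (D * D')%N; split; first by rewrite muln_gt0 Dp.
move=> k; rewrite !expnD [X in Int X _]mulnACA [X in X%:R * _]mulnACA natrM mulrACA.
by apply: IntM.
Qed.

Lemma Ht_cst x : Ht 0 (fun=> x).
Proof.
have [D [H [Dp h]]] := Int_den x; exists H, D; split=> // k.
by rewrite !expn0 !muln1.
Qed.

Lemma Ht_tau i : Ht 1 (tau i).
Proof. by exists 1%N, 1%N; split=> // k; rewrite !mul1n !expn1. Qed.

Lemma HtX Q x d : Ht Q x -> Ht (d * Q) (fun k => x k ^+ d).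
Proof.
move=> H; elim: d => [|d IHd]; first by apply: Ht_ext (Ht_cst 1) => k; rewrite expr0.
by rewrite mulSn; apply: Ht_ext (HtM H IHd) => k; rewrite exprS.
Qed.

Lemma Ht_sum Q (I : Type) (s : seq I) (F : I -> nat -> L) : (forall i, Ht Q (F i)) -> Ht Q (fun k => \sum_(i <- s) F i k).
Proof. by move=> H; rewrite big_fun; elim/big_ind: _ => // *; [exact: (Ht_le (leq0n Q) (Ht_cst 0))|exact: HtD]. Qed.

Lemma Ht_prod Q (I : Type) (s : seq I) (F : I -> nat -> L) :
  (forall i, Ht Q (F i)) -> Ht (size s * Q) (fun k => \prod_(i <- s) F i k).
Proof.
move=> H; elim: s => [|i s IHs].
  by apply: Ht_ext (Ht_cst 1) => k; rewrite big_nil.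
by rewrite mulSn; apply: Ht_ext (HtM (H i) IHs) => k; rewrite big_cons.
Qed.

Lemma Ht_cls Q x : cls Q x -> Ht (e * Q) x.
Proof.
move=> [q [h1 h2]].
apply: (@Ht_ext _ (fun k => \sum_(nu <- msupp q) (if nu \in msupp q then q@_nu * \prod_i tau i k ^+ nu i else 0))).
  by move=> k; rewrite h2 mevalE [RHS]big_seq [LHS]big_seq; apply: eq_bigr => nu ->.
apply: Ht_sum => nu; case ns: (nu \in msupp q); last exact: Ht_le (Ht_cst 0).
apply: (@Ht_ext _ (fun k => q@_nu * \prod_i tau i k ^+ nu i)) => //.
suff: Ht (0 + e * Q) (fun k => q@_nu * \prod_i tau i k ^+ nu i) by [].
apply: HtM (Ht_cst _) _.
have -> : (e * Q = size (index_enum 'I_e) * Q)%N by rewrite -[index_enum _]/(index_enum _) /index_enum -enumT size_enum_ord.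
apply: Ht_prod => i; apply: (Ht_le (Q := nu i * 1)); first by rewrite muln1 h1.
exact: HtX (Ht_tau i).
Qed.

Lemma Ht_mon (lam : 'X_{1..n}) Q : (forall i : 'I_n, (lam i <= Q)%N) -> Ht (n * Q) (fun k => a ^+ xs lam k).
Proof.
move=> le; apply: (@Ht_ext _ (fun k => \prod_(i < n) zL k i ^+ lam i)).
  move=> k; rewrite xs_lin expr_sum; apply: eq_bigr => i _; by rewrite /zL -exprM mulnC.
have -> : (n * Q = size (index_enum 'I_n) * Q)%N by rewrite /index_enum -enumT size_enum_ord.
apply: Ht_prod => i; apply: (Ht_le (Q := lam i * 1)); first by rewrite muln1.
by apply: HtX; exists 1%N, 1%N; split=> // k; rewrite !mul1n !expn1.
Qed.

Lemma emb_mevalg N (q : {mpoly L[N]}) (v : 'I_N -> L) : emb q.@[v] = (map_mpoly emb q).@[emb \o v].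
Proof.
rewrite mevalE rmorph_sum [RHS]mevalE [RHS](perm_big _ (msupp_map_mpoly q (fmorph_inj emb))) /=.
apply: eq_bigr => I _; rewrite mcoeff_map_mpoly rmorphM rmorph_prod; congr (_ * _).
by apply: eq_bigr => i _; rewrite !rmorphXn.
Qed.

Lemma emb_meval (q : {mpoly L[n]}) k : emb q.@[zL k] = (map_mpoly emb q).@[zK c (emb a) k].
Proof. by rewrite emb_mevalg; apply: meval_eq => i; rewrite /zL /zK /= rmorphXn. Qed.
Definition highpart J (q : {mpoly L[n]}) := \sum_(I <- msupp q | (J <= mdeg I)%N) q@_I *: 'X_[I].

Lemma highpart_coef J q I : (highpart J q)@_I = if (J <= mdeg I)%N then q@_I else 0.
Proof.
rewrite /highpart raddf_sum /= big_mkcond /=.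
have [Ip|Ip] := boolP (I \in msupp q).
  rewrite (bigD1_seq I) ?msupp_uniq //= mcoeffZ mcoeffX eqxx mulr1 big1 ?addr0 // => I' ne.
  by rewrite mcoeffZ mcoeffX (negPf ne) mulr0 if_same.
rewrite (memN_msupp_eq0 Ip) if_same big_seq big1 // => I' Ip'.
rewrite mcoeffZ mcoeffX; case: (I' =P I) => [e'|_]; last by rewrite mulr0 if_same.
by move: Ip; rewrite -e' Ip'.
Qed.

(** The monomials of degree below J cancel only in the sum. Deleting them from every [p s] leaves X
    unchanged and expresses it through fixed polynomials of order J. *)
Lemma fam_hord_egb J (X : nat -> {mpoly L[n]}) Q : fam (cls Q) X -> (forall k, hord J (X k)) ->
  egb J (fun k => emb (X k).@[zL k]).
Proof.
move=> [S [cf [p [Hc HX]]]] HJ.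
have Xhi k : X k = \sum_s cf s k *: highpart J (p s).
  apply/mpolyP => I; rewrite raddf_sum /=.
  have [le|lt] := leqP J (mdeg I).
    by rewrite HX raddf_sum; apply: eq_bigr => s _; rewrite /= !mcoeffZ highpart_coef le.
  rewrite ((hordP _ _).1 (HJ k) _ lt) big1 // => s _.
  by rewrite mcoeffZ highpart_coef leqNgt lt mulr0.
have Ev k : emb (X k).@[zL k] = \sum_s emb (cf s k) * (map_mpoly emb (highpart J (p s))).@[zK c (emb a) k].
  rewrite Xhi (raddf_sum (meval (zL k))) /= (rmorph_sum emb); apply: eq_bigr => s _ /=.
  by rewrite mevalZ rmorphM emb_meval.
have HH : egb J (fun k => \sum_s emb (cf s k) * (map_mpoly emb (highpart J (p s))).@[zK c (emb a) k]).
  apply: egb_sum => // s; suff: egb (0 + J) (fun k => emb (cf s k) * (map_mpoly emb (highpart J (p s))).@[zK c (emb a) k]) by [].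
  apply: egbM => //; first exact: cls_egb (Hc s).
  eapply egb_hord; eauto; apply/hordP => I lt.
  by rewrite mcoeff_map_mpoly highpart_coef leqNgt lt /= rmorph0.
by apply: egb_ext HH => k; rewrite Ev.
Qed.

Variables (Dt ND : nat) (F : nat -> nat -> {mpoly L[n]}).
Hypotheses (F_fam : forall J, fam (cls Dt) (F J)) (F_ord : forall J k, (ND <= J)%N -> ~ hord ND (F J k))
 (F_small : forall J, egb J (fun k => emb (F J k).@[zL k])).

Definition bmon Q (f : {ffun 'I_e -> 'I_Q.+1}) k := \prod_i tau i k ^+ f i.

Lemma cls_box Q x : cls Q x -> exists w : {ffun 'I_e -> 'I_Q.+1} -> L, forall k, x k = \sum_f w f * bmon f k.
Proof.
move=> [q [Hq Hx]]; pose h (f : {ffun 'I_e -> 'I_Q.+1}) : 'X_{1..e} := [multinom (f i : nat) | i < e].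
exists (fun f => q@_(h f)) => k; rewrite Hx.
pose Fn (nu : 'X_{1..e}) := q@_nu * \prod_i tau i k ^+ nu i.
transitivity (\sum_(nu <- map h (enum {ffun 'I_e -> 'I_Q.+1})) Fn nu); last first.
  rewrite big_map big_enum; apply: eq_bigr => f _; rewrite /Fn /bmon; congr (_ * _).
  by apply: eq_bigr => i _; rewrite mnmE.
rewrite mevalE [RHS](bigID (fun nu => nu \in msupp q)) /= [X in _ = _ + X]big1 ?addr0; last first.
  by move=> nu ns; rewrite /Fn (memN_msupp_eq0 ns) mul0r.
rewrite -[RHS]big_filter; apply: perm_big; apply: uniq_perm; rewrite ?msupp_uniq ?filter_uniq //.
  rewrite map_inj_uniq ?enum_uniq // => f f' /mnmP eh; apply/ffunP => i; apply/val_inj.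
  by have := eh i; rewrite !mnmE.
move=> nu; rewrite mem_filter; case ns: (nu \in msupp q) => //=; apply/esym/mapP.
exists [ffun i => inord (nu i)]; first by rewrite mem_enum.
by apply/mnmP => i; rewrite mnmE ffunE inordK // ltnS; apply: Hq.
Qed.

(** A sum of two exponents at most Q is either at most Q or Q plus such an exponent. So products of
    two box monomials lie in 2^e translates of the box, and the box is spanned by the basis f. *)
Lemma box_product Q (s : nat) (f : 'I_s -> {ffun 'I_e -> 'I_Q.+1}) x t :
  (forall j : {ffun 'I_e -> 'I_Q.+1}, exists y : 'I_s -> L, forall k, bmon j k = \sum_t y t * bmon (f t) k) ->
  cls Q x -> exists M : {ffun 'I_e -> bool} * 'I_s -> L, forall k,
   bmon (f t) k * x k = \sum_es M es * ((\prod_i tau i k ^+ (es.1 i * Q)) * bmon (f es.2) k).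
Proof.
move=> /choice[y Hy] /cls_box[w Hw].
pose ep (j : {ffun 'I_e -> 'I_Q.+1}) : {ffun 'I_e -> bool} := [ffun i => (Q < f t i + j i)%N].
pose rs (j : {ffun 'I_e -> 'I_Q.+1}) : {ffun 'I_e -> 'I_Q.+1} := [ffun i => inord (f t i + j i - ep j i * Q)].
have split j k : bmon (f t) k * bmon j k = (\prod_i tau i k ^+ (ep j i * Q)) * bmon (rs j) k.
  rewrite /bmon -!big_split; apply: eq_bigr => i _ /=; rewrite -!exprD; congr (_ ^+ _).
  rewrite [rs j i]ffunE inordK; rewrite [ep j i]ffunE; have := ltn_ord (f t i); have := ltn_ord (j i);
  by move: (nat_of_ord (f t i)) (nat_of_ord (j i)) => u v; clear; case: (ltnP Q (u + v)) => /=; lia.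
exists (fun es => \sum_j w j * ((es.1 == ep j)%:R * y (rs j) es.2)) => k.
rewrite Hw mulr_sumr (eq_bigr (fun j => w j * \sum_(es : {ffun 'I_e -> bool} * 'I_s) ((es.1 == ep j)%:R * y (rs j) es.2) *
   ((\prod_i tau i k ^+ (es.1 i * Q)) * bmon (f es.2) k))); last first.
  move=> j _; rewrite mulrCA split Hy; congr (_ * _).
  rewrite -(pair_bigA _ (fun eps t' => (eps == ep j)%:R * y (rs j) t' * ((\prod_i tau i k ^+ (eps i * Q)) * bmon (f t') k))) /=.
  rewrite (bigD1 (ep j)) //= [X in _ = _ + X]big1 ?addr0.
    by rewrite mulr_sumr; apply: eq_bigr => t' _; rewrite eqxx mul1r mulrCA.
  by move=> eps ne; rewrite big1 // => t' _; rewrite (negPf ne) !mul0r.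
under eq_bigr do rewrite mulr_sumr.
rewrite exchange_big; apply: eq_bigr => es _ /=; rewrite mulr_suml; apply: eq_bigr => j _.
by rewrite !mulrA.
Qed.

Lemma fam_F_pow J h : fam (cls (Dt * h)) (fun k => F J k ^+ h).
Proof.
elim: h => [|h IHh].
  rewrite muln0; apply: fam_ext (famZ 1 (cls_cst 0 1)) => k; by rewrite scale1r expr0.
rewrite mulnS; apply: (fam_ext _ (famM _ (F_fam J) IHh)) => [k|x y]; first by rewrite exprS.
exact: clsM.
Qed.

Lemma fam_coef Q (X : nat -> {mpoly L[n]}) (mo : {mpoly L[n]}) I : fam (cls Q) X -> cls Q (fun k => (mo * X k)@_I).
Proof.
move=> [S [cf [p [Hc HX]]]].
apply: (@cls_ext _ (fun k => \sum_s cf s k * (mo * p s)@_I)).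
  by move=> k; rewrite HX mulr_sumr raddf_sum; apply: eq_bigr => s _; rewrite /= -scalerAr mcoeffZ.
apply: cls_sum => s; rewrite -[Q]addn0; exact: clsM (Hc s) (cls_cst 0 _).
Qed.

Definition bx p (la : {ffun 'I_n -> 'I_p}) : 'X_{1..n} := [multinom (la i : nat) | i < n].

(** The unknowns are constants on a basis of s box functions, one set for each pair (h, la). By
    [box_product] the vanishing of the J^n relevant coefficients at all k at once follows from J^n
    2^e s linear equations. The dimension s cancels in the count, and independence of the basis
    keeps the solution nonzero as a family of functions. *)
Lemma auxiliary_function p J : (J ^ n * 2 ^ e < p.+1 * p.+1 ^ n)%N ->
  exists (x : 'I_p.+1 -> {ffun 'I_n -> 'I_p.+1} -> nat -> L),
   [/\ forall h la, cls (Dt * p) (x h la), exists h la k, x h la k != 0 &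
     forall k, hord J (\sum_h (\sum_la x h la k *: 'X_[bx la]) * F J k ^+ h)].
Proof.
move=> lt; pose Q := (Dt * p)%N.
have [s [f [indep span]]] := basis_exists (@bmon Q).
have s0 : (0 < s)%N.
  rewrite lt0n; apply/eqP => s0; have [y Hy] := span [ffun=> ord0].
  have := Hy 0%N; rewrite /bmon big1 => [|i _]; last by rewrite ffunE expr0.
  by rewrite big1 => [/eqP|[i lti]]; [rewrite oner_eq0|exfalso; move: lti; rewrite s0].
pose X := (('I_p.+1 * {ffun 'I_n -> 'I_p.+1}) * 'I_s)%type.
pose Y := ({ffun 'I_n -> 'I_J} * ({ffun 'I_e -> bool} * 'I_s))%type.
pose W (ch : 'I_p.+1 * {ffun 'I_n -> 'I_p.+1}) I k := ('X_[bx ch.2] * F J k ^+ ch.1)@_I.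
have Wcls ch I : cls Q (W ch I).
  apply: cls_le (fam_coef _ _ (fam_F_pow J ch.1)); rewrite leq_mul2l -ltnS ltn_ord orbT //.
have HM (xI : X * {ffun 'I_n -> 'I_J}) : exists M : {ffun 'I_e -> bool} * 'I_s -> L, forall k,
   bmon (f xI.1.2) k * W xI.1.1 (bx xI.2) k = \sum_es M es * ((\prod_i tau i k ^+ (es.1 i * Q)) * bmon (f es.2) k).
  exact: box_product span (Wcls _ _).
have [M HMM] := choice HM.
have card : (#|{: Y}| < #|{: X}|)%N.
  by rewrite !card_prod !card_ffun !card_ord card_bool mulnA ltn_pmul2r.
have [x [[[ch0 t0] x0] Hx]] := nontrivial_solution (fun (xx : X) (y : Y) => M (xx, y.1) y.2) card.
exists (fun h la k => \sum_t x ((h, la), t) * bmon (f t) k); split.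
- move=> h la; apply: cls_sum => t; suff: cls (0 + Q) (fun k => x ((h, la), t) * bmon (f t) k) by [].
  apply: clsM (cls_cst 0 _) _.
  pose nu : 'X_{1..e} := [multinom (f t i : nat) | i < e].
  exists 'X_[nu]; split=> [nu'|k].
    by rewrite msuppX inE => /eqP-> i; rewrite mnmE -ltnS.
  rewrite mevalE msuppX big_seq1 mcoeffX eqxx mul1r; apply: eq_bigr => i _; by rewrite mnmE.
- apply: contrapT => H; move/eqP: x0; apply; case: ch0 => h la in H *.
  apply: (indep (fun t => x ((h, la), t))) => k; apply/eqP/negPn/negP => nz.
  by apply: H; exists h, la, k.
move=> k; apply/hordP => I ltI; rewrite raddf_sum /=.
have IJ i : (I i < J)%N by apply: leq_ltn_trans ltI; rewrite mdegE (bigD1 i) //= leq_addr.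
pose I' : {ffun 'I_n -> 'I_J} := [ffun i => Ordinal (IJ i)].
have bI : bx I' = I by apply/mnmP => i; rewrite mnmE ffunE.
transitivity (\sum_(xx : X) x xx * (bmon (f xx.2) k * W xx.1 I k)).
  have PB (Fx : X -> L) : \sum_(xx : X) Fx xx = \sum_h \sum_la \sum_t Fx ((h, la), t).
    rewrite (pair_bigA _ (fun h la => \sum_t Fx ((h, la), t))) /=.
    rewrite (pair_bigA _ (fun (ch : 'I_p.+1 * {ffun 'I_n -> 'I_p.+1}) t => Fx ((ch.1, ch.2), t))) /=.
    by apply: eq_bigr => -[[h la] t] _.
  rewrite PB.
  apply: eq_bigr => h _; rewrite mulr_suml raddf_sum; apply: eq_bigr => la _ /=.
  rewrite -scalerAl mcoeffZ mulr_suml; apply: eq_bigr => t _; by rewrite mulrA.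
transitivity (\sum_(es : {ffun 'I_e -> bool} * 'I_s) (\sum_(xx : X) x xx * M (xx, I') es) * ((\prod_i tau i k ^+ (es.1 i * Q)) * bmon (f es.2) k)).
  under [RHS]eq_bigr do rewrite mulr_suml.
  rewrite exchange_big; apply: eq_bigr => xx _ /=; have := HMM (xx, I') k; rewrite bI /= => ->.
  by rewrite big_distrr /=; apply: eq_bigr => es _; exact: mulrA.
by rewrite big1 // => es _; have := Hx (I', es); rewrite /= => ->; rewrite mul0r.
Qed.

Lemma zL_mon (I : 'X_{1..n}) k : \prod_(i < n) zL k i ^+ I i = a ^+ xs I k.
Proof. by rewrite xs_lin expr_sum; apply: eq_bigr => i _; rewrite /zL -exprM mulnC. Qed.
Lemma mevalX_zL (I : 'X_{1..n}) k : ('X_[I] : {mpoly L[n]}).@[zL k] = a ^+ xs I k.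
Proof. by rewrite mevalE msuppX big_seq1 mcoeffX eqxx mul1r zL_mon. Qed.

Lemma bx_inj p : injective (@bx p).
Proof.
move=> f f' /mnmP eh; apply/ffunP => i; apply/val_inj; by have := eh i; rewrite !mnmE.
Qed.

Lemma base_gt0 : (0 < D0)%N /\ (0 < H1)%N.
Proof.
have [k0 H] := E_lin 1; have Ek : (0 < E k0.+1)%N by have := H k0.+1 (leqnSn _); rewrite mul1n; apply: leq_trans.
have := leq_trans (Bf_gt0 k0.+1) (Bf_le k0.+1); rewrite muln_gt0 => /andP[h1 h2]; split.
  by move: h1; rewrite expn_gt0 orbF.
by move: h2; rewrite expn_gt0 (gtn_eqF Ek) orbF.
Qed.

(** The value y(k) of the lowest nonzero coefficient polynomial is at most |al|^(J' mu k) up to an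
    exponential factor, because F nearly vanishes at z(k). It is nonzero for infinitely many k, and
    Liouville bounds it below by about H1^(-C1 C3 kap p mu k). As J' is at least p C4, the choice of
    C4 makes the two incompatible. *)
Theorem mahler_contradiction : False.
Proof.
have [kap [C0 [C00 HL]]] := liouville ab_ge0 ab_eq0 abM abD ab_nat emb.
have [D00 H10] := base_gt0.
pose t := ab (emb a); have t0 : 0 < t by []; have t1 : t < 1 by [].
pose C3 := (e * Dt + n)%N.
have HH0 : 0 < (H1%:R : R) ^+ (C1 * C3 * kap) by rewrite exprn_gt0 // ltr0n.
(* H1^(C1 C3 kap) is the loss in Liouville's inequality per unit of p mu(k); t^C4 beats it and
   leaves a factor t. *)
have [C4 HC4] := pow_small t0 t1 (divr_gt0 t0 HH0).
(* ND covers the order lost when a power of F is divided out, C4 the Liouville loss. With p = C2^n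
   2^e and J = C2 p one has J^n 2^e = p^(n+1), just below the number (p+1)^(n+1) of unknowns. *)
pose C2 := (ND + C4 + 1)%N.
pose p := (C2 ^ n * 2 ^ e)%N.
pose J := (C2 * p)%N.
have C2p : (0 < C2)%N by rewrite /C2 addn1.
have p0 : (0 < p)%N by rewrite muln_gt0 !expn_gt0 C2p.
have cnt : (J ^ n * 2 ^ e < p.+1 * p.+1 ^ n)%N.
  by rewrite /J expnMn mulnAC -/p -expnS -expnS ltn_exp2r.
have NDJ : (ND <= J)%N.
  by apply: leq_trans (leq_pmulr _ p0); rewrite /C2 -addnA leq_addr.
have [x [xcls [h1 [la1 [k1' x1]]] Hx]] := auxiliary_function cnt.
(* The least power of F that occurs. Dividing it out costs at most h0 ND in order and leaves the
   polynomial at h0 free of F. *)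
have [h0 [hx hmin]] : exists h0 : 'I_p.+1, (exists la k, x h0 la k != 0) /\ forall h : 'I_p.+1, (h < h0)%N -> forall la k, x h la k = 0.
  have [d [h0 [e0 hx]] dmin] := @min_nat (fun d => exists h0 : 'I_p.+1, h0 = d :> nat /\ exists la k, x h0 la k != 0)
     (ex_intro _ _ (ex_intro _ h1 (conj erefl (ex_intro _ la1 (ex_intro _ k1' x1))))).
  exists h0; split=> // h lt la k; apply/eqP/negPn/negP => nz.
  have := dmin h (ex_intro _ h (conj erefl (ex_intro _ la (ex_intro _ k nz)))).
  by rewrite leqNgt -e0 lt.
pose Ph h k : {mpoly L[n]} := \sum_la x h la k *: 'X_[bx la].
pose E' k := \sum_(h < p.+1 | (h0 <= h)%N) Ph h k * F J k ^+ (h - h0).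
pose J' := (J - h0 * ND)%N.
have E'ord k : hord J' (E' k).
  apply: (@hord_cancelX _ _ J ND h0 (F J k)); first exact: F_ord.
  have := Hx k; congr (hord _ _); rewrite (bigID (fun h : 'I_p.+1 => (h0 <= h)%N)) /= [X in _ + X]big1 ?addr0.
    by rewrite /E' mulr_sumr; apply: eq_bigr => h le; rewrite mulrCA -exprD subnKC.
  move=> h; rewrite -ltnNge => lt; rewrite big1 ?mul0r // => la _.
  by rewrite (hmin h lt) scale0r.
have Phfam h : fam (cls (Dt * p)) (Ph h).
  by apply: fam_sum => la; apply: famZ; apply: xcls.
pose Q := (Dt * p + Dt * p)%N.
have PFfam (h : 'I_p.+1) d : (d <= p)%N -> fam (cls Q) (fun k => Ph h k * F J k ^+ d).
  move=> dp; apply: (famM _ (Phfam h) (fam_F_pow J d)) => x1' y1 hx1 hy1.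
  by apply: clsM hx1 (cls_le _ hy1); rewrite leq_mul2l dp orbT.
have sumfam (P : pred 'I_p.+1) (d : 'I_p.+1 -> nat) : (forall h, d h <= p)%N ->
    fam (cls Q) (fun k => \sum_(h < p.+1 | P h) Ph h k * F J k ^+ d h).
  move=> dp; apply: (fam_ext (X := fun k => \sum_(h < p.+1) (if P h then Ph h k * F J k ^+ d h else 0))).
    by move=> k; rewrite -big_mkcond.
  by apply: fam_sum => h; case: (P h); [apply: PFfam|apply: fam0].
have E'fam : fam (cls Q) E'.
  by apply: (sumfam _ (fun h : 'I_p.+1 => (h - h0)%N)) => h; apply: leq_trans (leq_subr _ _) _; rewrite -ltnS.
have E'small := fam_hord_egb E'fam E'ord.
pose G k := \sum_(h < p.+1 | (h0 < h)%N) Ph h k * F J k ^+ (h - h0).-1.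
have Gfam : fam (cls Q) G.
  apply: (sumfam _ (fun h : 'I_p.+1 => (h - h0).-1)%N) => h.
  by apply: leq_trans (leq_pred _) (leq_trans (leq_subr _ _) _); rewrite -ltnS.
have Gsmall := fam_hord_egb Gfam (fun k => @hord_any _ _ (G k)).
pose y k := (Ph h0 k).@[zL k].
have yE k : E' k = Ph h0 k + F J k * G k.
  rewrite /E' (bigD1 h0) //= subnn expr0 mulr1; congr (_ + _); rewrite /G mulr_sumr.
  apply: eq_big => [h|h lt]; first by rewrite ltn_neqAle eq_sym andbC.
  rewrite mulrCA -exprS prednK // subn_gt0 ltn_neqAle eq_sym.
  by case/andP: lt => -> ->; rewrite andbT.
have ysmall : egb J' (fun k => emb (y k)).
  have T1 : egb (J + 0) (fun k => emb (F J k).@[zL k] * emb (G k).@[zL k]) by apply: egbM.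
  have T2 : egb J' (fun k => emb (F J k).@[zL k] * emb (G k).@[zL k]).
    by apply: egb_le T1 => //; rewrite addn0 leq_subr.
  apply: (egb_ext _ (egbD abD al_gt0 E'small (egbN ab_ge0 ab_eq0 abM T2))) => // k.
  by rewrite yE mevalD mevalM rmorphD rmorphM addrK.
have yval k : y k = \sum_la x h0 la k * a ^+ xs (bx la) k.
  by rewrite /y raddf_sum; apply: eq_bigr => la _; rewrite /= mevalZ mevalX_zL.
have yht : Ht (C3 * p) y.
  apply: (@Ht_ext _ (fun k => \sum_la x h0 la k * a ^+ xs (bx la) k)) => [k|]; first by rewrite yval.
  apply: Ht_sum => la; rewrite /C3 mulnDl -mulnA; apply: HtM (Ht_cls (xcls h0 la)) (Ht_mon _).
  by move=> i; rewrite mnmE -ltnS.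
(* If y vanished from some k2 on, the zero test would make every coefficient at h0 vanish at all
   k. *)
have ynz k2 : exists k, (k2 <= k)%N /\ y k != 0.
  apply: contrapT => H; have [la [k nz]] := hx.
  have [q Hq] := choice (fun la => xcls h0 la).
  have := tau_ind (lam := @bx p.+1) (q := q) (k2 := k2) (@bx_inj p.+1) _ la k.
  rewrite -(Hq la).2 => H'; move/eqP: nz; apply; apply: H' => k' le.
  have : y k' = 0 by apply/eqP/negPn/negP => nz; apply: H; exists k'.
  by rewrite yval => H0; apply: etrans H0; apply: eq_bigr => la' _; rewrite -(Hq la').2 mulrC.
have [D [Dp [k3 HD]]] := ysmall.
have [Cy [Dy [Dy0 Hy]]] := yht.
pose Qp := (C3 * p)%N.
have Cy0 : (0 < Cy + Dy)%N by rewrite addn_gt0 Dy0 orbT.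
pose D' := 1 + D; have D'0 : 0 < D' by rewrite ltr_pwDl.
pose G' := D' * D0%:R ^+ (Qp * kap).
have G'0 : 0 < G' by rewrite mulr_gt0 ?exprn_gt0 // ltr0n.
pose Cst : R := C0%:R * (Cy + Dy)%:R ^+ kap * D0%:R ^+ (Qp * kap) * H1%:R ^+ (C1 * Qp * kap).
have Cst0 : 0 < Cst by rewrite !mulr_gt0 ?exprn_gt0 ?ltr0n.
have e0 : 0 < (2 * Cst)^-1 by rewrite invr_gt0 mulr_gt0.
have [B [k4 HB]] := pow_beats t0 t1 G'0 e0.
have [k5 HE] := E_lin (B * C1).
have [k [kle yk]] := ynz (k3 + k4 + k5)%N.
have [kk3 kk4 kk5] : [/\ k3 <= k, k4 <= k & k5 <= k]%N.
  by split; apply: leq_trans kle; rewrite ?leq_addl // -addnA ?leq_addr // addnCA leq_addr.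
have Bmu : (B * k <= mu k)%N by rewrite /mu leq_divRL // mulnAC HE.
pose H := ((Cy + Dy) * Bf k ^ Qp)%N.
have dB z : (dn k ^ z <= Bf k ^ z)%N by elim: z => // z IHz; rewrite !expnS leq_mul.
have low : (C0%:R * H%:R ^+ kap)^-1 <= ab (emb (y k)).
  apply: (HL H (Dy * dn k ^ Qp)%N) => //.
  - by rewrite muln_gt0 Dy0 expn_gt0 dn_gt0.
  - by apply: leq_mul => //; rewrite leq_addl.
  by apply: Int_le (Hy k); rewrite leq_mul2r leq_addr orbT.
have HR : 0 < C0%:R * H%:R ^+ kap :> R.
  by rewrite mulr_gt0 ?exprn_gt0 ?ltr0n // muln_gt0 Cy0 expn_gt0 Bf_gt0.
have up := le_trans low (HD k kk3).
rewrite -[X in X <= _]mul1r ler_pdivrMr // in up.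
have D'k : D ^+ k <= D' ^+ k by rewrite lerXn2r ?nnegrE ?(ltW D'0) // lerDr.
have pC4 : (p * C4 <= J')%N.
  have h0p : (h0 <= p)%N by rewrite -ltnS.
  have hle : (h0 * ND <= p * ND)%N by rewrite leq_mul2r h0p orbT.
  apply: leq_trans (leq_sub2l _ hle).
  have -> : (J - p * ND = p * (C2 - ND))%N by rewrite /J mulnC mulnBr.
  rewrite leq_mul2l.
  by rewrite /C2 -addnA addKn leq_addr orbT.
have Elem : (E k <= C1 * mu k + C1)%N.
  by rewrite /mu {1}(divn_eq (E k) C1) mulnC leq_add2l ltnW // ltn_pmod.
have HkR : (H%:R : R) ^+ kap <= (Cy + Dy)%:R ^+ kap * (D0%:R ^+ (Qp * kap) * (D0%:R ^+ (Qp * kap)) ^+ k *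
    (H1%:R ^+ (C1 * Qp * kap) * H1%:R ^+ (C1 * C3 * kap * (p * mu k)))).
  rewrite /H natrM exprMn ler_pM2l ?exprn_gt0 ?ltr0n // natrX -exprM.
  apply: le_trans (_ : (D0 ^ k.+1 * H1 ^ E k)%:R ^+ (Qp * kap) <= _).
    by rewrite -exprM lerXn2r ?nnegrE // ler_nat.
  rewrite natrM !natrX exprMn -!exprM -!exprD.
  apply: ler_pM; rewrite ?exprn_ge0 //.
    by rewrite mulSn [(k * _)%N]mulnC.
  apply: ler_weXn2l; first by rewrite ler1n.
  apply: leq_trans (_ : (C1 * mu k + C1) * (Qp * kap) <= _)%N; first by rewrite leq_mul2r Elem orbT.
  by rewrite /Qp; clear; nia.
(* The surviving factor t^(mu k) finally beats the exponential G'^k, since mu k exceeds every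
   multiple of k. *)
have key : t ^+ (J' * mu k) * H1%:R ^+ (C1 * C3 * kap * (p * mu k)) <= t ^+ mu k.
  apply: le_trans (_ : t ^+ (C4 * (p * mu k)) * H1%:R ^+ (C1 * C3 * kap * (p * mu k)) <= _).
    rewrite ler_wpM2r ?exprn_ge0 // ler_wiXn2l ?(ltW t0) ?(ltW t1) //.
    by rewrite mulnA leq_mul2r mulnC pC4 orbT.
  have -> : t ^+ (C4 * (p * mu k)) * H1%:R ^+ (C1 * C3 * kap * (p * mu k)) =
      (t ^+ C4 * H1%:R ^+ (C1 * C3 * kap)) ^+ (p * mu k) by rewrite exprMn -!exprM.
  apply: le_trans (_ : t ^+ (p * mu k) <= _).
    rewrite lerXn2r ?nnegrE ?mulr_ge0 ?exprn_ge0 ?(ltW t0) //.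
    by rewrite -ler_pdivlMr // HC4.
  by rewrite ler_wiXn2l ?(ltW t0) ?(ltW t1) // leq_pmull.
have fin := HB k (mu k) kk4 Bmu.
have : D ^+ k * t ^+ (J' * mu k) * (C0%:R * H%:R ^+ kap) <= Cst * (G' ^+ k * t ^+ mu k).
  apply: le_trans (_ : D' ^+ k * t ^+ (J' * mu k) * (C0%:R * ((Cy + Dy)%:R ^+ kap * (D0%:R ^+ (Qp * kap) * (D0%:R ^+ (Qp * kap)) ^+ k *
    (H1%:R ^+ (C1 * Qp * kap) * H1%:R ^+ (C1 * C3 * kap * (p * mu k)))))) <= _).
    apply: ler_pM; rewrite ?mulr_ge0 ?exprn_ge0 ?(ltW t0) //.
      by rewrite ler_wpM2r ?exprn_ge0 ?(ltW t0).
    by rewrite ler_wpM2l.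
  move: key; rewrite /Cst /G' exprMn.
  move: (t ^+ (J' * mu k)) (H1%:R ^+ (C1 * C3 * kap * (p * mu k))) (t ^+ mu k) => X1 X2 X3 key.
  have P0 : 0 <= C0%:R * (Cy + Dy)%:R ^+ kap * D0%:R ^+ (Qp * kap) * H1%:R ^+ (C1 * Qp * kap) * (D' ^+ k * D0%:R ^+ (Qp * kap) ^+ k) :> R.
    by rewrite !mulr_ge0 ?exprn_ge0 // ltW.
  have := ler_wpM2l P0 key; by apply: le_trans2_eq; ring.
move=> fin2; have := le_trans up fin2; apply/negP; rewrite -ltNge.
apply: le_lt_trans (_ : Cst * (2 * Cst)^-1 < _); first by rewrite ler_pM2l.
by rewrite invfM mulrCA divff ?gt_eqF // mulr1 invf_lt1 // ltr1n.
Qed.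

End Mahler.

(** * From a relation to a contradiction *)

(** Induction on the number of functions: if the points found for the others leave a nonzero
    solution, it is unique up to a factor, and one more point where it does not vanish excludes
    it. *)
Lemma indep_points (A : fieldType) (T : Type) s (b : 'I_s -> T -> A) :
  (forall x : 'I_s -> A, (forall t, \sum_i x i * b i t = 0) -> forall i, x i = 0) ->
  exists l : seq T, forall x : 'I_s -> A, (forall t, List.In t l -> \sum_i x i * b i t = 0) -> forall i, x i = 0.
Proof.
elim: s b => [|s IHs] b ind; first by exists [::] => x _ [].
have [|l Hl] := IHs (fun i => b (lift ord0 i)).
  move=> x Hx i; pose x' (j : 'I_s.+1) := if unlift ord0 j is Some j' then x j' else 0.
  have := ind x' _ (lift ord0 i); rewrite /x' liftK; apply=> t.
  rewrite big_ord_recl unlift_none mul0r add0r -[RHS](Hx t); apply: eq_bigr => j _.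
  by rewrite liftK.
have [[x [Hx x0]]|no] := EM (exists x : 'I_s.+1 -> A, (forall t, List.In t l -> \sum_i x i * b i t = 0) /\ x ord0 != 0); last first.
  exists l => x Hx; have x0 : x ord0 = 0 by apply/eqP/negPn/negP => nz; apply: no; exists x.
  have xl : forall i, x (lift ord0 i) = 0.
    apply: (Hl (fun i => x (lift ord0 i))) => t tl; have := Hx t tl.
    by rewrite big_ord_recl x0 mul0r add0r.
  by move=> i; case: (unliftP ord0 i) => [i' ->|->].
have [t0 ht0] : exists t, \sum_i x i * b i t != 0.
  apply: contrapT => H; move/eqP: x0; apply; apply: ind => t.
  by apply/eqP/negPn/negP => nz; apply: H; exists t.
exists (t0 :: l) => y Hy.
pose cc := y ord0 / x ord0.
have e0 : y ord0 = cc * x ord0 by rewrite divfK.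
have el i : y (lift ord0 i) = cc * x (lift ord0 i).
  apply/eqP; rewrite -subr_eq0; apply/eqP; move: i.
  apply: (Hl (fun i => y (lift ord0 i) - cc * x (lift ord0 i))) => t tl.
  have := Hy t (or_intror tl); have := Hx t tl; rewrite !big_ord_recl => h1 h2.
  under eq_bigr do rewrite mulrBl -mulrA.
  rewrite sumrB -mulr_sumr; apply: (addrI (y ord0 * b ord0 t)); rewrite addrA h2 addr0 add0r.
  rewrite e0 -mulrA -[RHS]opprK; congr (- _); rewrite -mulrN; congr (_ * _).
  by apply/eqP; rewrite -addr_eq0 addrC h1.
have ey i : y i = cc * x i by case: (unliftP ord0 i) => [i' ->|->].
have cc0 : cc = 0.
  have := Hy t0 (or_introl erefl); under eq_bigr do rewrite ey -mulrA.
  by rewrite -mulr_sumr => /eqP; rewrite mulf_eq0 (negPf ht0) orbF => /eqP.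
by move=> i; rewrite ey cc0 mul0r.
Qed.

Section Relation.
Import mpoly.
Variables (m : nat) (c : nat -> nat).
Notation n := m.+1.
Hypothesis cn : c n != 0%N.
Variable rts : seq algC.
Hypotheses (rtsE : cpoly m c algC = rootprod rts) (nd : nondeg rts) (no_unity : no_root_of_unity rts).
Variables (K : fieldType) (R : archiRealFieldType) (ab : K -> R).
Hypotheses (charK : [pchar K] =i pred0) (ab_ge0 : nonneg ab) (ab_eq0 : definite ab)
  (abM : multiplicative ab) (abD : subadditive ab) (ab_nat : forall k, (0 < k)%N -> k%:R^-1 <= ab k%:R).
Variables (L : fieldExtType rat) (emb : {rmorphism L -> K}) (a : L).
Hypotheses (al_gt0 : 0 < ab (emb a)) (al_lt1 : ab (emb a) < 1).
Variables (C1 k1 : nat).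
Hypotheses (C1_gt0 : (0 < C1)%N) (C1P : dominates m c C1 k1).
Notation E := (@E m c).
Notation mu := (@mu m c C1).
Notation xs := (@xs m c).
Notation egb := (@egb m c K R ab (emb a) C1).
Notation zK := (@zK m c K (emb a)).
Notation zL := (@zL m c L a).

Variables (Ny Nu : nat).
Notation Nv := (Ny + Nu)%N.
Variables (s : 'I_Ny -> nat -> L) (pi : 'I_Nu -> nat -> L) (A B : nat -> 'I_Ny -> 'I_Ny -> L).
Variables (valsL : nat -> 'I_Nv -> {mpoly L[n]}).
Variables (fv : 'I_Ny -> nat -> K) (uv : 'I_Nu -> nat -> K).
Definition wv k (v : 'I_Nv) := match split v with inl y => fv y k | inr u => uv u k end.
Definition valsK J v : {mpoly K[n]} := map_mpoly emb (valsL J v).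
Hypotheses (fvE : forall y k, fv y 0%N = emb (s y k) + \sum_y' emb (A k y y') * fv y' k)
 (uvE : forall u k, uv u 0%N = emb (pi u k) * uv u k) (uv_neq0 : forall u k, uv u k != 0)
 (pi_neq0 : forall u k, pi u k != 0) (AB : forall k y y'', \sum_y' A k y y' * B k y' y'' = (y == y'')%:R)
 (tgen_egb : forall y, egb 0 (fun k => emb (s y k))) (pi_egb : forall u, egb 0 (fun k => emb (pi u k)))
 (A_expoly : forall y y', expoly (fun k => emb (A k y y')))
 (w_approx : forall v J, egb J (fun k => wv k v - (valsK J v).@[zK k]))
 (vals_cong : forall J J' v, (J <= J')%N -> hcong J (valsL J v) (valsL J' v))
 (formal_ind : forall P : {mpoly {mpoly K[n]}[Nv]}, (forall J, hord J P.@[valsK J]) -> P = 0).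

Lemma hord_map J (p : {mpoly L[n]}) : hord J (map_mpoly emb p) <-> hord J p.
Proof.
split=> /hordP H; apply/hordP => I lt; have := H I lt; rewrite mcoeff_map_mpoly.
  by move/eqP; rewrite fmorph_eq0 => /eqP.
by move=> ->; exact: rmorph0.
Qed.

Lemma valsK_cong J J' v : (J <= J')%N -> hcong J (valsK J v) (valsK J' v).
Proof. move=> le; have H := @vals_cong J J' v le; rewrite /hcong /valsK -rmorphB; exact/hord_map. Qed.

Definition gen := ('I_Ny + 'I_Nu + 'I_Ny * 'I_Ny)%type.
Definition tgen (g : gen) k : L := match g with
  | inl (inl y) => s y k | inl (inr u) => pi u k | inr yy => A k yy.1 yy.2 end.
Definition ngen := #|{: gen}|.
Definition tau (i : 'I_ngen) k := tgen (enum_val i) k.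

Lemma tau_gen g k : tgen g k = tau (enum_rank g) k.
Proof. by rewrite /tau enum_rankK. Qed.

(** Read backwards, the functional equations express the partial sums and products at step k as
    rational functions of the values w(k), the values at step 0 being constants and the coefficients
    exponential polynomials. So the zero test for w also applies to [tau]. *)
Definition numg (g : gen) k : {mpoly K[Nv]} := match g with
  | inl (inl y) => (fv y 0%N)%:MP - \sum_y' emb (A k y y') *: 'X_(lshift Nu y') | inl (inr u) => (uv u 0%N)%:MP
  | inr yy => (emb (A k yy.1 yy.2))%:MP end.
Definition deng (g : gen) : {mpoly K[Nv]} := match g with inl (inr u) => 'X_(rshift Ny u) | _ => 1 end.

Lemma wv_l k y : wv k (lshift Nu y) = fv y k.
Proof. by rewrite /wv -[lshift Nu y]/(unsplit (inl y)) unsplitK. Qed.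
Lemma wv_r k u : wv k (rshift Ny u) = uv u k.
Proof. by rewrite /wv -[rshift Ny u]/(unsplit (inr u)) unsplitK. Qed.

Lemma numgE g k : (numg g k).@[wv k] = emb (tgen g k) * (deng g).@[wv k].
Proof.
case: g => [[y|u]|[y y']] /=.
- rewrite meval1 mulr1 mevalB mevalC (raddf_sum (meval (wv k))) (fvE y k) /=.
  by under [X in _ - X]eq_bigr do rewrite mevalZ mevalXU wv_l; rewrite addrK.
- by rewrite mevalC mevalXU wv_r (uvE u k).
by rewrite mevalC meval1 mulr1.
Qed.

Lemma deng_neq0 g k : (deng g).@[wv k] != 0.
Proof. by case: g => [[y|u]|yy] /=; rewrite ?meval1 ?oner_neq0 // mevalXU wv_r. Qed.

Lemma numg_fam g : fam (@expoly K) (numg g).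
Proof.
case: g => [[y|u]|[y y']] /=; last first.
- apply: (fam_ext _ (famZ 1 (A_expoly y y'))) => k; by rewrite -mul_mpolyC mulr1.
- exact: fam_cst.
apply: (fam_ext (X := fun k => (fv y 0%N)%:MP + \sum_y' ((-1) * emb (A k y y')) *: 'X_(lshift Nu y'))).
  by move=> k; congr (_ + _); rewrite -sumrN; apply: eq_bigr => y' _; rewrite mulN1r scaleNr.
apply: famD; first exact: fam_cst.
apply: fam_sum => y'; apply: famZ; apply: expolyM (expoly_cst _) (A_expoly _ _).
Qed.

Lemma tau_indL (T : finType) (lam : T -> 'X_{1..n}) (q : T -> {mpoly L[ngen]}) k2 :
  injective lam -> (forall k, (k2 <= k)%N -> \sum_t a ^+ xs (lam t) k * (q t).@[tau^~ k] = 0) ->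
  forall t k, (q t).@[tau^~ k] = 0.
Proof.
move=> li H t k; apply: (fmorph_inj emb); rewrite rmorph0 emb_mevalg.
have := @tau_independent m c cn rts rtsE nd no_unity K R ab charK ab_ge0 ab_eq0 abM abD (emb a) al_gt0 al_lt1
  C1 k1 C1_gt0 C1P Nv valsK wv w_approx valsK_cong formal_ind ngen (fun i k => emb (tau i k))
  (fun i => numg (enum_val i)) (fun i => deng (enum_val i)) (fun i => numg_fam (enum_val i))
  (fun i k => numgE (enum_val i) k) (fun i k => deng_neq0 (enum_val i) k) T lam (fun t => map_mpoly emb (q t)) k2 li.
apply=> k' le; have := H k' le => /(congr1 emb); rewrite rmorph0 rmorph_sum => H0; apply: etrans H0.
by apply: eq_bigr => t' _; rewrite rmorphM rmorphXn emb_mevalg.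
Qed.

Variable P : {mpoly L[Nv]}.
Hypotheses (P_neq0 : P != 0) (P_root : (map_mpoly emb P).@[wv 0%N] = 0).

Definition lform k (v : 'I_Nv) : {mpoly L[Nv]} := match split v with
  | inl y => (s y k)%:MP + \sum_y' A k y y' *: 'X_(lshift Nu y') | inr u => pi u k *: 'X_(rshift Ny u) end.
(** The relation P between the values at step 0, rewritten by the functional equations as a relation
    between the values at step k. *)
Definition Pk k : {mpoly L[Nv]} := \sum_(nu <- msupp P) P@_nu *: \prod_v lform k v ^+ nu v.

Lemma lform_eval (M : comNzRingType) (f : {rmorphism L -> M}) k v (x : 'I_Nv -> M) :
  (map_mpoly f (lform k v)).@[x] = match split v with
  | inl y => f (s y k) + \sum_y' f (A k y y') * x (lshift Nu y') | inr u => f (pi u k) * x (rshift Ny u) end.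
Proof.
rewrite /lform; case: (split v) => [y|u]; last by rewrite map_mpolyZ map_mpolyX mevalZ mevalXU.
rewrite rmorphD /= map_mpolyC mevalD mevalC (raddf_sum (map_mpoly f)) (raddf_sum (meval x)).
by congr (_ + _); apply: eq_bigr => y' _; rewrite /= map_mpolyZ map_mpolyX mevalZ mevalXU.
Qed.

Lemma Pk_meval (M : comNzRingType) (f : {rmorphism L -> M}) k (x : 'I_Nv -> M) :
  (map_mpoly f (Pk k)).@[x] = \sum_(nu <- msupp P) f P@_nu * \prod_v (map_mpoly f (lform k v)).@[x] ^+ nu v.
Proof.
rewrite /Pk (raddf_sum (map_mpoly f)) (raddf_sum (meval x)); apply: eq_bigr => nu _.
rewrite /= map_mpolyZ mevalZ rmorph_prod rmorph_prod; congr (_ * _).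
by apply: eq_bigr => v _; rewrite !rmorphXn.
Qed.

Lemma Pk_root k : (map_mpoly emb (Pk k)).@[wv k] = 0.
Proof.
rewrite Pk_meval; have := P_root; rewrite mevalE (perm_big _ (msupp_map_mpoly P (fmorph_inj emb))) /= => H; apply: etrans H.
apply: eq_bigr => nu _; rewrite mcoeff_map_mpoly; congr (_ * _); apply: eq_bigr => v _; congr (_ ^+ _).
rewrite lform_eval -{2}[v]splitK; case: (split v) => [y|u] /=; rewrite ?wv_l ?wv_r.
  by rewrite (fvE y k); congr (_ + _); apply: eq_bigr => y' _; rewrite wv_l.
by rewrite (uvE u k).
Qed.

(** The affine substitution is invertible, with inverse built from [B] and the inverses of [pi], and
    the inverse recovers P. *)
Lemma Pk_neq0 k : Pk k != 0.
Proof.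
pose x' (v : 'I_Nv) : {mpoly L[Nv]} := match split v with
  | inl y => \sum_y' (B k y y')%:MP * ('X_(lshift Nu y') - (s y' k)%:MP) | inr u => (pi u k)^-1%:MP * 'X_v end.
apply: contraNneq P_neq0 => Pk0.
have := Pk_meval (@mpolyC Nv L) k x'; rewrite Pk0 rmorph0 meval0 => /esym H.
rewrite [P]mpolyE; apply/eqP; apply: etrans H; apply: eq_bigr => nu _.
rewrite -mul_mpolyC mpolyXE_id; congr (_ * _); apply: eq_bigr => v _; congr (_ ^+ _).
rewrite lform_eval -{1}[v]splitK; case: (split v) => [y|u] /=.
  have -> : \sum_y' (A k y y')%:MP * x' (lshift Nu y') =
     \sum_y'' (\sum_y' A k y y' * B k y' y'')%:MP * ('X_(lshift Nu y'') - (s y'' k)%:MP).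
    under eq_bigr => y' _.
      rewrite /x' -[lshift Nu y']/(unsplit (inl y')) unsplitK mulr_sumr; over.
    rewrite exchange_big; apply: eq_bigr => y'' _ /=; rewrite raddf_sum mulr_suml.
    by apply: eq_bigr => y' _; rewrite mulrA -mpolyCM.
  rewrite (bigD1 y) //= AB eqxx mul1r big1 ?addr0; first by rewrite addrC subrK.
  by move=> y'' ne; rewrite AB eq_sym (negPf ne) mul0r.
rewrite /x' -[rshift Ny u]/(unsplit (inr u)) unsplitK mulrA -mpolyCM divff ?mul1r //.
Qed.

Lemma Pk_fam : exists Dt, fam (@cls L ngen tau Dt) Pk.
Proof.
have clsT g : cls tau 1 (tgen g).
  by apply: (cls_ext _ (cls_tau tau (enum_rank g))) => k; rewrite tau_gen.
have mulE Q Q' (x y : nat -> L) : cls tau Q x -> cls tau Q' y -> cls tau (Q + Q') (fun k => x k * y k) by apply: clsM.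
have cst Q (p : {mpoly L[Nv]}) : fam (cls tau Q) (fun=> p).
  by apply: fam_ext (famZ p (cls_cst tau Q 1)) => k; rewrite scale1r.
have lfam v : fam (cls tau 1) (fun k => lform k v).
  rewrite /lform; case: (split v) => [y|u]; last exact: famZ (clsT (inl (inr u))).
  apply: famD; first by apply: (fam_ext _ (famZ 1 (clsT (inl (inl y))))) => k; rewrite -mul_mpolyC mulr1.
  by apply: fam_sum => y'; apply: famZ; exact: (clsT (inr (y, y'))).
have pfam v d : fam (cls tau d) (fun k => lform k v ^+ d).
  elim: d => [|d IHd]; first exact: (cst 0%N 1).
  by apply: (fam_ext _ (famM (@mulE 1%N d) (lfam v) IHd)) => k; rewrite exprS.
have prodfam (nu : 'X_{1..Nv}) : fam (cls tau (mdeg nu)) (fun k => \prod_v lform k v ^+ nu v).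
  rewrite mdegE; elim: (index_enum _) => [|v l IHl].
    by rewrite big_nil; apply: fam_ext (cst 0%N 1) => k; rewrite big_nil.
  rewrite big_cons; apply: (fam_ext _ (famM (@mulE _ _) (pfam v (nu v)) IHl)) => k.
  by rewrite big_cons.
exists (\sum_(nu <- msupp P) mdeg nu)%N.
apply: (fam_ext (X := fun k => \sum_(nu <- msupp P) (if nu \in msupp P then P@_nu *: \prod_v lform k v ^+ nu v else 0))).
  by move=> k; rewrite /Pk [RHS]big_seq [LHS]big_seq; apply: eq_bigr => nu ->.
apply: fam_sum => nu; case ns: (nu \in msupp P); last exact: fam0.
apply: (fam_le (Sc := cls tau (mdeg nu))) => [x|].
  by apply: cls_le; rewrite (big_rem nu) //= leq_addr.
apply: (fam_ext _ (famM (@mulE 0%N _) (cst 0%N (P@_nu)%:MP) (prodfam nu))) => k.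
by rewrite mul_mpolyC.
Qed.

Definition FJ J k : {mpoly L[n]} := sub valsL J (Pk k).

Lemma sub_lin J (S : finType) (cf : S -> L) (p : S -> {mpoly L[Nv]}) :
  sub valsL J (\sum_t cf t *: p t) = \sum_t cf t *: sub valsL J (p t).
Proof.
have liftZ (b : L) (q : {mpoly L[Nv]}) : lift0 m (b *: q) = b%:MP *: lift0 m q.
  by rewrite -mul_mpolyC /lift0 rmorphM /= map_mpolyC mul_mpolyC.
have liftS : lift0 m (\sum_t cf t *: p t) = \sum_t lift0 m (cf t *: p t).
  exact: (raddf_sum (map_mpoly (@mpolyC n L))).
rewrite -lift0_sub liftS raddf_sum; apply: eq_bigr => t _ /=.
by rewrite liftZ mevalZ lift0_sub mul_mpolyC.
Qed.

Lemma FJ_fam Dt J : fam (cls tau Dt) Pk -> fam (cls tau Dt) (FJ J).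
Proof.
move=> [S [cf [p [h HX]]]]; exists S, cf, (fun t => sub valsL J (p t)); split=> // k.
by rewrite /FJ HX sub_lin.
Qed.

Lemma map_sub J (q : {mpoly L[Nv]}) : map_mpoly emb (sub valsL J q) = sub valsK J (map_mpoly emb q).
Proof.
rewrite /sub (raddf_sum (map_mpoly emb)) [RHS](perm_big _ (msupp_map_mpoly q (fmorph_inj emb))) /=.
apply: eq_bigr => nu _; rewrite map_mpolyZ mcoeff_map_mpoly rmorph_prod; congr (_ *: _).
by apply: eq_bigr => v _; rewrite rmorphXn.
Qed.

Lemma tau_egb i : egb 0 (fun k => emb (tau i k)).
Proof.
rewrite /tau; case: (enum_val i) => [[y|u]|yy] /=; [exact: tgen_egb|exact: pi_egb|].
exact: expoly_egb (A_expoly _ _).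
Qed.

(** [Pk k] vanishes exactly at [wv k], so the value at z(k) is only the error of replacing the
    values by their truncations. *)
Lemma FJ_small J : egb J (fun k => emb (FJ J k).@[zL k]).
Proof.
have [Dt [S [cf [p [Hc HX]]]]] := Pk_fam.
have tau_egb := tau_egb.
have H : egb J (fun k => \sum_t emb (cf t k) * ((sub valsK J (map_mpoly emb (p t))).@[zK k] - (map_mpoly emb (p t)).@[wv k])).
  apply: egb_sum => // t.
  suff: egb (0 + J) (fun k => emb (cf t k) * ((sub valsK J (map_mpoly emb (p t))).@[zK k] - (map_mpoly emb (p t)).@[wv k])) by [].
  apply: egbM => //; first by eapply cls_egb; eauto.
  have [_ _ H] : eqv m c ab (emb a) C1 J (fun k => (map_mpoly emb (p t)).@[wv k]) (fun k => (sub valsK J (map_mpoly emb (p t))).@[zK k]).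
    by eapply sub_eqv; eauto.
  by apply: egb_ext (egbN ab_ge0 ab_eq0 abM H) => k; rewrite opprB.
apply: egb_ext H => k.
have r0 : \sum_t emb (cf t k) * (map_mpoly emb (p t)).@[wv k] = 0.
  have := Pk_root k; rewrite HX (raddf_sum (map_mpoly emb)) (raddf_sum (meval (wv k))) => H0; apply: etrans H0.
  by apply: eq_bigr => t _; rewrite /= map_mpolyZ mevalZ.
have -> : emb (FJ J k).@[zL k] = \sum_t emb (cf t k) * (sub valsK J (map_mpoly emb (p t))).@[zK k].
  rewrite /FJ HX sub_lin (raddf_sum (meval (zL k))) (rmorph_sum emb); apply: eq_bigr => t _.
  by rewrite /= mevalZ rmorphM -map_sub emb_mevalg; congr (_ * _); apply: meval_eq => i; exact: rmorphXn.
by under eq_bigr do rewrite mulrBr; rewrite sumrB r0 subr0.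
Qed.

Lemma In_mem (T : eqType) (l : seq T) t : List.In t l -> t \in l.
Proof. by elim: l => //= x l IHl [->|/IHl]; rewrite inE ?eqxx // => ->; rewrite orbT. Qed.

(** All [Pk k] are combinations of one finite list of monomials in the values. By formal
    independence the truncated series of these monomials are linearly independent, so finitely many
    exponents detect a nonzero combination; this gives a bound valid for every k and J. *)
Lemma FJ_ord : exists ND, forall J k, (ND <= J)%N -> ~ hord ND (FJ J k).
Proof.
have [Dt [S [cf [p [Hc HX]]]]] := Pk_fam.
pose La : seq 'X_{1..Nv} := undup (flatten [seq msupp (p t) | t <- enum S]).
pose la (i : 'I_(size La)) := nth 0%MM La i.
have la_inj : injective la.
  by move=> i j /eqP; rewrite nth_uniq ?undup_uniq // => /eqP/val_inj.
have Pk_supp k nu : (Pk k)@_nu != 0 -> nu \in La.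
  move=> h; apply: contraNT h => nn; rewrite HX raddf_sum /= big1 // => t _.
  rewrite mcoeffZ; have [->|h] := eqVneq (p t)@_nu 0; first by rewrite mulr0.
  case/negP: nn; rewrite mem_undup; apply/flattenP; exists (msupp (p t)); last by rewrite mcoeff_msupp.
  by apply: map_f; rewrite mem_enum.
pose mon J (nu : 'X_{1..Nv}) : {mpoly L[n]} := \prod_v valsL J v ^+ nu v.
have subX J nu : sub valsL J 'X_[nu] = mon J nu.
  by rewrite /sub msuppX big_seq1 mcoeffX eqxx scale1r.
have expand (q : {mpoly L[Nv]}) : (forall nu, q@_nu != 0 -> nu \in La) -> q = \sum_i q@_(la i) *: 'X_[la i].
  move=> hq; apply/mpolyP => nu; rewrite raddf_sum /=.
  have [nuL|nuL] := boolP (nu \in La).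
    have il : (index nu La < size La)%N by rewrite index_mem.
    rewrite (bigD1 (Ordinal il)) //= mcoeffZ mcoeffX /la /= nth_index // eqxx mulr1 big1 ?addr0 // => j ne.
    rewrite mcoeffZ mcoeffX; case: eqP => [e'|]; last by rewrite mulr0.
    by case/eqP: ne; apply: la_inj; rewrite /la /= nth_index.
  rewrite big1; first by apply/eqP; apply: contraNT nuL; apply: hq.
  move=> j _; rewrite mcoeffZ mcoeffX; case: eqP => [e'|]; last by rewrite mulr0.
  by case/negP: nuL; rewrite -e' mem_nth.
have mon_cong J J' nu : (J <= J')%N -> hcong J (mon J nu) (mon J' nu).
  by move=> le; apply: hcong_prod => v _; apply: hcongX; exact: vals_cong.
pose b i (I : 'X_{1..n}) := (mon (mdeg I).+1 (la i))@_I.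
have bE J i I : (mdeg I < J)%N -> b i I = (mon J (la i))@_I.
  by move=> lt; apply: (hcong_coef (mon_cong _ _ _ lt)).
have ind (x : 'I_(size La) -> L) : (forall I, \sum_i x i * b i I = 0) -> forall i, x i = 0.
  move=> Hx; pose q : {mpoly L[Nv]} := \sum_i x i *: 'X_[la i].
  have qJ J : hord J (sub valsL J q).
    apply/hordP => I lt; rewrite /q sub_lin raddf_sum /= -[RHS](Hx I); apply: eq_bigr => i _.
    by rewrite mcoeffZ subX (bE J).
  have q0 : lift0 m (map_mpoly emb q) = 0.
    by apply: formal_ind => J; rewrite lift0_sub -map_sub; apply/hord_map.
  move=> i; apply: (fmorph_inj emb); rewrite rmorph0.
  have := congr1 (fun z : {mpoly {mpoly K[n]}[Nv]} => z@_(la i)@_0%MM) q0.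
  rewrite /= !mcoeff0 /lift0 !mcoeff_map_mpoly mcoeffC eqxx mulr1 /q raddf_sum (bigD1 i) //=.
  rewrite mcoeffZ mcoeffX eqxx mulr1 big1 ?addr0 // => j ne.
  by rewrite mcoeffZ mcoeffX (inj_eq la_inj) (negPf ne) mulr0.
have [l Hl] := indep_points ind.
exists (\sum_(I <- l) (mdeg I).+1)%N => J k le HJ.
have /eqP := Pk_neq0 k; apply; rewrite (expand (Pk k) (Pk_supp k)) big1 // => i _.
suff -> : (Pk k)@_(la i) = 0 by rewrite scale0r.
move: i; apply: Hl => I /In_mem Il.
have lt : (mdeg I < \sum_(I <- l) (mdeg I).+1)%N by rewrite (big_rem I) //= leq_addr.
have := (hordP _ _).1 HJ I lt; rewrite /FJ [X in sub _ _ X](expand (Pk k) (Pk_supp k)) sub_lin raddf_sum /= => H0.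
apply: etrans H0; apply: eq_bigr => i _; rewrite mcoeffZ subX (bE J) //.
exact: leq_trans lt le.
Qed.

Variables (dn Bf : nat -> nat) (D0 H1 : nat).
Hypotheses (dn_gt0 : forall k, (0 < dn k)%N) (dn_le : forall k, (dn k <= Bf k)%N)
 (Bf_le : forall k, (Bf k <= D0 ^ k.+1 * H1 ^ E k)%N) (tgen_ht : forall g k, Int (Bf k) ((dn k)%:R * tgen g k))
 (z_ht : forall i k, Int (Bf k) ((dn k)%:R * zL k i)).

Theorem no_relation : False.
Proof.
have [Dt HDt] := Pk_fam; have [ND HND] := FJ_ord.
have Elin : forall B, for_large k, (B * k <= E k)%N.
  exact: (E_linear cn rtsE no_unity).
apply: (@mahler_contradiction m c K R ab ab_ge0 ab_eq0 abM abD ab_nat L emb a al_gt0 al_lt1 C1 k1 C1_gt0 C1P Elin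
  ngen tau dn Bf D0 H1 dn_gt0 dn_le Bf_le (fun i k => tgen_ht (enum_val i) k) z_ht tau_egb (@tau_indL) Dt ND FJ
  (fun J => FJ_fam J HDt) HND FJ_small).
Qed.

End Relation.

(** * The sequences binomial(j, l) alpha^j and their shift matrices *)

Section Blocks.
Variables (A : fieldType) (q N : nat) (al : 'I_q -> A).
Hypothesis al_neq0 : forall i, al i != 0.
Notation W := N.+1.
Notation I_ := 'I_(q * W).

Lemma block_lt (y : I_) : (y %/ W < q)%N.
Proof. by rewrite ltn_divLR. Qed.
Definition blk (y : I_) : 'I_q := Ordinal (block_lt y).
Definition lev (y : I_) : nat := (y %% W)%N.
Lemma elt_lt (i : 'I_q) (l : 'I_W) : (i * W + l < q * W)%N.
Proof. by apply: (@leq_trans (i.+1 * W)); rewrite ?leq_pmul2r // mulSn addnC ltn_add2r. Qed.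
Definition elt i l : I_ := Ordinal (elt_lt i l).

Lemma blk_elt i l : blk (elt i l) = i.
Proof. by apply: val_inj; rewrite /= divnMDl // divn_small ?addn0. Qed.
Lemma lev_elt i l : lev (elt i l) = l.
Proof. by rewrite /lev /= modnMDl modn_small. Qed.
Lemma eltK y : elt (blk y) (inord (lev y)) = y.
Proof. by apply: val_inj; rewrite /= inordK ?ltn_mod // -divn_eq. Qed.
Lemma lev_lt y : (lev y < W)%N. Proof. exact: ltn_mod. Qed.
Lemma leq_block y y' : blk y = blk y' -> (lev y <= lev y')%N -> (y <= y')%N.
Proof. by move=> /(congr1 val) /= e le; rewrite (divn_eq y W) (divn_eq y' W) e leq_add2l. Qed.
Lemma block_inj y y' : blk y = blk y' -> lev y = lev y' -> y = y'.
Proof. by move=> e e'; rewrite -(eltK y) -(eltK y') e e'. Qed.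

Lemma sum_block i (G : nat -> A) : \sum_(y : I_ | blk y == i) G (lev y) = \sum_(l < W) G l.
Proof.
rewrite (reindex_onto (elt i) (fun y => inord (lev y))) => [|y /eqP <-]; last exact: eltK.
by apply: eq_big => [l|l _]; rewrite ?blk_elt ?lev_elt ?inord_val ?eqxx.
Qed.

(** On each block, multiplication by p in the ring of polynomials modulo X^W; hence matrix products
    correspond to products of polynomials. *)
Definition toeplitz (p : {poly A}) y y' := if (blk y == blk y') && (lev y <= lev y')%N then p`_(lev y' - lev y) else 0.

Lemma toeplitz_mul p p' y y' : \sum_z toeplitz p y z * toeplitz p' z y' = toeplitz (p * p') y y'.
Proof.
rewrite (bigID (fun z => blk z == blk y)) /= [X in _ + X]big1 ?addr0 => [|z ne]; last first.
  by rewrite /toeplitz eq_sym (negPf ne) mul0r.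
transitivity (\sum_(z : I_ | blk z == blk y)
   (if (blk y == blk y') && (lev y <= lev z <= lev y')%N then p`_(lev z - lev y) * p'`_(lev y' - lev z) else 0)).
  apply: eq_bigr => z /eqP e; rewrite /toeplitz e eqxx /=.
  by case: (blk y == blk y'); case: (lev y <= lev z)%N; case: (lev z <= lev y')%N; rewrite ?mul0r ?mulr0.
rewrite (sum_block _ (fun l => if (blk y == blk y') && (lev y <= l <= lev y')%N then p`_(l - lev y) * p'`_(lev y' - l) else 0)).
rewrite /toeplitz; case: eqP => //= _; last by rewrite big1.
case: leqP => [le|lt]; last first.
  by rewrite big1 // => l _; case: ifP => // /andP[h1 h2]; have := leq_trans h1 h2; rewrite leqNgt lt.
rewrite coefM -(big_mkord xpredT (fun l => if (lev y <= l <= lev y')%N then p`_(l - lev y) * p'`_(lev y' - l) else 0)).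
have ly := lev_lt y'.
rewrite (@big_cat_nat _ _ _ (lev y)) //=; last by apply: leq_trans le (ltnW ly).
rewrite (@big_cat_nat _ _ _ (lev y').+1 (lev y)) //=; last exact: leqW.
rewrite big_nat_cond big1 ?add0r => [|l /andP[/andP[_ h] _]]; last by rewrite leqNgt h.
rewrite [X in _ + X]big_nat_cond [X in _ + X]big1 ?addr0 => [|l /andP[/andP[h _] _]]; last first.
  by rewrite [(l <= _)%N]leqNgt h andbF.
rewrite -{1}[lev y]add0n big_addn -subSn ?(leq_trans le) // big_mkord ?subSn //.
apply: eq_bigr => l _; have := ltn_ord l; rewrite ltnS => h.
rewrite leq_addl addnK /=; have -> : (l + lev y <= lev y')%N by rewrite addnC -leq_subRL.
by congr (_ * p'`_ _); rewrite addnC subnDA.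
Qed.

Lemma toeplitz1 (p : {poly A}) y y' : (forall s, (s < W)%N -> p`_s = (s == 0%N)%:R) -> toeplitz p y y' = (y == y')%:R.
Proof.
move=> H; rewrite /toeplitz; case: (eqVneq y y') => [->|ne]; first by rewrite eqxx leqnn subnn H.
case: ifP => // /andP[/eqP e le]; rewrite H; last exact: leq_ltn_trans (leq_subr _ _) (lev_lt _).
by case: eqP => // /eqP h; case/eqP: ne; apply: block_inj e _; apply/eqP; rewrite eqn_leq le -subn_eq0.
Qed.

Definition pw k : {poly A} := (1 + 'X) ^+ k.

Lemma pwE k s : (pw k)`_s = 'C(k, s)%:R.
Proof.
elim: k s => [|k IHk] s; first by rewrite /pw expr0 coef1 bin0n.
by rewrite /pw exprSr mulrDr mulr1 coefD coefMX -/(pw k) !IHk; case: s => [|s]; rewrite ?bin0 ?addr0 // binS natrD.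
Qed.

Lemma pw_inv k : exists u, forall s, (s < W)%N -> (pw k * u)`_s = (s == 0%N)%:R.
Proof.
have cop : coprimep (pw k) 'X^W.
  have -> : pw k = ('X - (-1)%:P) ^+ k by rewrite /pw polyCN opprK polyC1 addrC.
  rewrite coprimep_expl // coprimep_expr // coprimep_sym coprimep_XsubC.
  by rewrite rootX oppr_eq0 oner_eq0.
have /Bezout_eq1_coprimepP[[u v] /= e] := cop.
exists u => s lt; have -> : pw k * u = 1 - v * 'X^W by rewrite -e addrK mulrC.
by rewrite coefB coef1 coefMXn lt subr0.
Qed.

(** Level [lev y] stands for the binomial of degree N - lev y. The reversal makes the shift matrices
    upper triangular, as [kubota] wants them. *)
Definition phi y j : A := 'C(j, N - lev y)%:R * al (blk y) ^+ j.
Lemma phiE y j : phi y j = 'C(j, N - lev y)%:R * al (blk y) ^+ j.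
Proof. by []. Qed.
Definition Am k y y' : A := al (blk y) ^+ k * toeplitz (pw k) y y'.

Lemma phi_toeplitz y j : phi y j = al (blk y) ^+ j * toeplitz (pw j) y (elt (blk y) ord_max).
Proof. by rewrite /phi /toeplitz blk_elt eqxx lev_elt -ltnS lev_lt pwE mulrC. Qed.
Lemma toeplitz_blk p y y' : toeplitz p y y' != 0 -> blk y = blk y' /\ (lev y <= lev y')%N.
Proof. by rewrite /toeplitz; case: ifP => [/andP[/eqP-> ->]|]; rewrite ?eqxx. Qed.

Lemma phi_shift y k j : phi y (k + j) = \sum_y' Am k y y' * phi y' j.
Proof.
have pwD : pw (k + j) = pw k * pw j by exact: exprD.
rewrite phi_toeplitz pwD -toeplitz_mul mulr_sumr; apply: eq_bigr => y' _.
rewrite /Am; have [->|h] := eqVneq (toeplitz (pw k) y y') 0; first by rewrite !(mul0r, mulr0).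
by have [e _] := toeplitz_blk h; rewrite phi_toeplitz e exprD; ring.
Qed.

(** The inverse of (1 + X)^k modulo X^W gives the inverse matrix; by [phi_shift] this undoes a shift
    by d. *)
Lemma Am_inv : exists B : nat -> I_ -> I_ -> A, [/\ forall d y y', B d y y' != 0 -> blk y = blk y' /\ (lev y <= lev y')%N,
     forall d y, B d y y != 0, forall d y j, \sum_y' B d y y' * phi y' (d + j)%N = phi y j
   & forall k y y'', \sum_y' Am k y y' * B k y' y'' = (y == y'')%:R].
Proof.
have [u Hu] := choice pw_inv.
pose B k y y' := (al (blk y))^-1 ^+ k * toeplitz (u k) y y'.
have can k y : al (blk y) ^+ k * (al (blk y))^-1 ^+ k = 1 by rewrite -exprMn divff // expr1n.
have alT p p' y y' z k : al (blk y) ^+ k * toeplitz p y z * ((al (blk z))^-1 ^+ k * toeplitz p' z y') = toeplitz p y z * toeplitz p' z y'.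
  have [->|h] := eqVneq (toeplitz p y z) 0; first by rewrite !(mul0r, mulr0).
  by have [e _] := toeplitz_blk h; rewrite mulrACA e can mul1r.
have alT' p p' y y' z k : (al (blk y))^-1 ^+ k * toeplitz p y z * (al (blk z) ^+ k * toeplitz p' z y') = toeplitz p y z * toeplitz p' z y'.
  have [->|h] := eqVneq (toeplitz p y z) 0; first by rewrite !(mul0r, mulr0).
  by have [e _] := toeplitz_blk h; rewrite mulrACA e [_^-1 ^+ _ * _]mulrC can mul1r.
exists B; split.
- by move=> d y y'; rewrite /B mulf_eq0 negb_or => /andP[_ /toeplitz_blk].
- move=> d y; rewrite /B mulf_neq0 ?expf_neq0 ?invr_eq0 // /toeplitz eqxx leqnn subnn.
  have := Hu d 0%N isT; rewrite coef0M pwE bin0 mul1r => ->; exact: oner_neq0.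
- move=> d y j; under eq_bigr do rewrite phi_shift mulr_sumr.
  rewrite exchange_big (bigD1 y) //= [X in _ + X]big1 ?addr0 => [|y' ne].
    under eq_bigr do rewrite mulrA alT'.
    by rewrite -mulr_suml toeplitz_mul mulrC (toeplitz1 _ _ (p := u d * pw d)) ?eqxx ?mulr1 // => s lt; rewrite mulrC Hu.
  under eq_bigr do rewrite mulrA alT'.
  by rewrite -mulr_suml toeplitz_mul (toeplitz1 _ _ (p := u d * pw d)) 1?eq_sym ?(negPf ne) ?mul0r // => s lt; rewrite mulrC Hu.
move=> k y y''; under eq_bigr do rewrite alT.
by rewrite toeplitz_mul (toeplitz1 _ _ (Hu k)).
Qed.

Lemma act_bigsum (I : Type) (s : seq I) (P : pred I) (F : I -> nat -> A) p k :
  act p (fun j => \sum_(i <- s | P i) F i j) k = \sum_(i <- s | P i) act p (F i) k.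
Proof. by rewrite /act exchange_big /=; apply: eq_bigr => j _; rewrite mulr_sumr. Qed.

Lemma act_powers p (th : A) k : act p (fun j => th ^+ j) k = p.[th] * th ^+ k.
Proof. by rewrite horner_coef mulr_suml; apply: eq_bigr => j _; rewrite exprD mulrA mulrAC. Qed.
Definition bg (th : A) l j : A := 'C(j, l)%:R * th ^+ j.
Lemma act_bgS th l k : act ('X - th%:P) (bg th l.+1) k = th * bg th l k.
Proof. by rewrite act_XsubC /bg binS natrD exprS; ring. Qed.

Lemma act_bg th l k : act (('X - th%:P) ^+ l) (bg th l) k = th ^+ l * th ^+ k.
Proof.
elim: l k => [|l IHl] k; first by rewrite expr0 -[1]polyC1 actC /bg bin0 !mul1r.
by rewrite exprSr actM (act_ext _ (act_bgS th l)) actZh IHl exprS mulrA.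
Qed.

Lemma ann_bg th l s : (l < s)%N -> ann (('X - th%:P) ^+ s) (bg th l).
Proof.
move=> lt; rewrite -(subnK lt) exprD; apply: ann_mull => k.
rewrite exprS actM (act_ext _ (act_bg th l)) act_XsubC exprS mulrCA subrr //.
Qed.

(** In one block take the highest binomial degree l0 that occurs. The factors for the other alpha
    kill the other blocks, and (X - alpha)^l0 kills the lower binomials and turns the top one into a
    nonzero multiple of alpha^j. The operator looks only forward, so a tail of zeros suffices for a
    contradiction. *)
Lemma phi_independent (P : pred 'I_q) (kap : I_ -> A) : {in P &, injective al} -> (exists2 y, P (blk y) & kap y != 0) ->
  forall j0, exists2 j, (j0 <= j)%N & \sum_(y | P (blk y)) kap y * phi y j != 0.
Proof.
move=> inj [y1 Py1 k1] j0; apply: contrapT => H.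
have h0 j : (j0 <= j)%N -> \sum_(y | P (blk y)) kap y * phi y j = 0.
  by move=> le; apply/eqP/negPn/negP => nz; apply: H; exists j.
pose i := blk y1.
have [y0 /andP[/eqP b0 ky0] ymin] := @arg_minnP _ y1 (fun y => (blk y == i) && (kap y != 0)) lev (introT andP (conj (eqxx _) k1)).
pose l0 := (N - lev y0)%N.
pose Rp := \prod_(i' | P i' && (i' != i)) ('X - (al i')%:P) ^+ W.
pose Q := Rp * ('X - (al i)%:P) ^+ l0.
have lt y : (N - lev y < W)%N by rewrite ltnS leq_subr.
have E j : act Q (fun j => \sum_(y | P (blk y)) kap y * phi y j) j = kap y0 * (al i ^+ l0 * (Rp.[al i] * al i ^+ j)).
  rewrite act_bigsum (bigD1 y0) ?b0 //= big1 ?addr0 => [|y /andP[Py ne]].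
    rewrite actZh /Q actM (@act_ext _ _ _ (fun k => al i ^+ l0 * al i ^+ k)); last first.
      by move=> k; rewrite -act_bg; apply: act_ext => k'; rewrite /phi b0.
    by rewrite actZh act_powers.
  rewrite actZh; have [e|nb] := eqVneq (blk y) i; last first.
    rewrite /Q mulrC /Rp (bigD1 (blk y)) ?Py //= -mulrA mulrC mulrCA mulrA -mulrA ann_mull ?mulr0 //.
    by rewrite mulrC; apply: ann_mull; exact: ann_bg.
  have [->|ky] := eqVneq (kap y) 0; first by rewrite mul0r.
  have le := ymin y; rewrite e eqxx ky in le; have {}le := le isT.
  have lt' : (lev y0 < lev y)%N.
    by rewrite ltn_neqAle le andbT; apply: contraNneq ne => e'; rewrite (block_inj (y := y) (y' := y0)) ?e ?b0.
  rewrite /Q ann_mull ?mulr0 //; rewrite -e; apply: ann_bg.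
  by have := lev_lt y; rewrite /l0; clear -lt' ; lia.
have : act Q (fun j => \sum_(y | P (blk y)) kap y * phi y j) j0 = 0.
  by rewrite /act big1 // => j _; rewrite h0 ?mulr0 // leq_addr.
rewrite E => /eqP; rewrite !mulf_eq0 (negPf ky0) !expf_eq0 (negPf (al_neq0 i)) !andbF orbF /=.
rewrite /Rp horner_prod prodf_seq_eq0 => /hasP[i' _ /andP[/andP[Pi' ne]]].
rewrite horner_exp hornerXsubC expf_eq0 subr_eq0 /= => /eqP e.
by case/eqP: ne; apply: inj => //; rewrite ?e.
Qed.

Hypothesis charA : [pchar A] =i pred0.

Lemma Am_expoly y y' : expoly (fun k => Am k y y').
Proof.
have binP s : expoly (fun k => 'C(k, s)%:R : A).
  elim: s => [|s IHs]; first by apply: expoly_ext (expoly_cst (1 : A)) => k; rewrite bin0.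
  apply: (expoly_ext _ (expolyM (expolyM (expolyD (expoly_nat A) (expoly_cst (- s%:R))) IHs) (expoly_cst (s.+1%:R^-1)))) => k.
  have s0 : (s.+1%:R : A) != 0 by rewrite ((pcharf0P A).1 charA).
  apply: (mulIf s0); rewrite divfK // -natrM mulnC mul_bin_left natrM.
  have [le|lt] := leqP s k; first by rewrite natrB.
  by rewrite bin_small // !mulr0.
have geo : expoly (fun k => al (blk y) ^+ k) := expoly_geom (al_neq0 _).
case h : ((blk y == blk y') && (lev y <= lev y')%N).
  by apply: (expoly_ext _ (expolyM geo (binP (lev y' - lev y)%N))) => k; rewrite /Am /toeplitz h pwE.
by apply: (expoly_ext _ (expoly_cst 0)) => k; rewrite /Am /toeplitz h mulr0.
Qed.

End Blocks.

(** * The series and products and their truncations *)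

Lemma sum_half (R : realFieldType) M N : \sum_(M <= j < N) (2^-1 : R) ^+ j <= 2.
Proof.
have S n : \sum_(j < n) (2^-1 : R) ^+ j = 2 - 2 * 2^-1 ^+ n.
  elim: n => [|n IHn]; first by rewrite big_ord0 expr0 mulr1 subrr.
  by rewrite big_ord_recr /= IHn exprS; set x := _ ^+ n; field.
apply: (@le_trans _ _ (\sum_(0 <= j < N) (2^-1 : R) ^+ j)).
  have [le|lt] := leqP M N; last by rewrite big_geq ?(ltnW lt) // sumr_ge0 // => j _; rewrite exprn_ge0 // invr_ge0.
  by rewrite [leRHS](@big_cat_nat _ _ _ M) //= lerDr sumr_ge0 // => j _; rewrite exprn_ge0 // invr_ge0.
by rewrite big_mkord S gerBl mulr_ge0 // exprn_ge0 // invr_ge0.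
Qed.

Lemma pos_lower (R : realDomainType) (f : nat -> R) k0 d : 0 < d -> (forall k, 0 < f k) ->
  (forall k, (k0 <= k)%N -> d <= f k) -> exists2 d, 0 < d & forall k, d <= f k.
Proof.
move=> d0 f0; elim: k0 d d0 => [|k0 IH] d d0 far; first by exists d => // k; exact: far.
apply: (IH (Num.min d (f k0))) => [|k]; first by rewrite lt_min d0 f0.
by rewrite leq_eqVlt ge_min => /orP[/eqP <-|/far ->]; rewrite ?lexx ?orbT.
Qed.

Section Limits.
Variables (K : fieldType) (R : archiRealFieldType) (ab : K -> R).
Hypotheses (ab_ge0 : nonneg ab) (ab_eq0 : definite ab) (abM : multiplicative ab) (abD : subadditive ab).

Definition islim (S : nat -> K) l := forall e, 0 < e -> for_large j, ab (S j - l) <= e.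
Let abN := abN ab_ge0 ab_eq0 abM.
Lemma abB_sym x y : ab (x - y) = ab (y - x).
Proof. by rewrite -abN opprB. Qed.

Lemma islim_bound S l x M N0 : islim S l -> (forall j, (N0 <= j)%N -> ab (S j - x) <= M) -> ab (l - x) <= M.
Proof.
move=> Sl H; apply/ler_addgt0Pr => e e0; have [N HN] := Sl e e0.
have := HN (maxn N N0) (leq_maxl _ _); have := H (maxn N N0) (leq_maxr _ _).
set s := S _ => h1 h2; have -> : l - x = (s - x) + (l - s) by ring.
by apply: le_trans (abD _ _) _; rewrite lerD // abB_sym.
Qed.

Lemma islim_uniq S l l' : islim S l -> islim S l' -> l = l'.
Proof.
move=> H H'; apply/eqP; rewrite -subr_eq0; apply/eqP/ab_eq0/le_anti; rewrite ab_ge0 andbT.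
apply/ler_addgt0Pr => e e0; rewrite add0r; have [N HN] := H' e e0; exact: islim_bound H HN.
Qed.

Lemma islim_ext S S' l : S =1 S' -> islim S l -> islim S' l.
Proof. by move/funext->. Qed.
Lemma islim_shift S l k : islim S l -> islim (fun j => S (k + j)%N) l.
Proof. by move=> H e /H[N HN]; exists N => j le; apply: HN; rewrite (leq_trans le) ?leq_addl. Qed.
Lemma islim_cst x : islim (fun=> x) x.
Proof. by move=> e e0; exists 0%N => j _; rewrite subrr (ab_eq0 0).2 // ltW. Qed.

Lemma islimD S S' l l' : islim S l -> islim S' l' -> islim (fun j => S j + S' j) (l + l').
Proof.
move=> H H' e e0; have e2 : 0 < e / 2 by rewrite divr_gt0.
have [N HN] := H _ e2; have [N' HN'] := H' _ e2; exists (maxn N N') => j le.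
rewrite opprD addrACA; apply: le_trans (abD _ _) _; rewrite [e]splitr.
by apply: lerD; [apply: HN|apply: HN']; apply: leq_trans le; rewrite ?leq_maxl ?leq_maxr.
Qed.

Lemma islimZ x S l : islim S l -> islim (fun j => x * S j) (x * l).
Proof.
move=> H e e0; have c0 : 0 < ab x + 1 by rewrite ltr_wpDl.
have [N HN] := H (e / (ab x + 1)) (divr_gt0 e0 c0); exists N => j /HN h.
rewrite -mulrBr abM; apply: le_trans (ler_pM _ _ (_ : ab x <= ab x + 1) h) _ => //; first by rewrite lerDl.
by rewrite mulrC divfK // gt_eqF.
Qed.

Lemma islim_sum (I : Type) (s : seq I) (P : pred I) (S : I -> nat -> K) l :
  (forall i, islim (S i) (l i)) -> islim (fun j => \sum_(i <- s | P i) S i j) (\sum_(i <- s | P i) l i).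
Proof.
move=> H; elim: s => [|i s IHs]; first by rewrite big_nil; apply: islim_ext (islim_cst 0) => j; rewrite big_nil.
rewrite big_cons; case Pi: (P i); last by apply: islim_ext IHs => j; rewrite big_cons Pi.
by apply: islim_ext (islimD (H i) IHs) => j; rewrite big_cons Pi.
Qed.

Lemma prod_near1 (e : nat -> K) M N s : s <= 2^-1 -> \sum_(M <= j < N) ab (e j) <= s ->
  ab (\prod_(M <= j < N) (1 - e j) - 1) <= 2 * s.
Proof.
move=> s2; have [lt|le] := ltnP N M.
  move=> h; have := h; rewrite !big_geq ?(ltnW lt) // subrr (ab_eq0 0).2 // => s0; exact: mulr_ge0.
rewrite -(subnKC le); elim: (N - M)%N s s2 => [|d IHd] s s2.
  by rewrite addn0 !big_geq // subrr (ab_eq0 0).2 // => s0; exact: mulr_ge0.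
rewrite addnS !big_nat_recr ?leq_addr //= => h.
set P := \prod_(_ <= j < _) _; set S := \sum_(_ <= j < _) _ in h *.
have ee : 0 <= ab (e (M + d)%N) by [].
have IH : ab (P - 1) <= 2 * S by apply: IHd => //; lra.
have P2 : ab P <= 2.
  have -> : P = (P - 1) + 1 by ring.
  by apply: le_trans (abD _ _) _; rewrite (ab1 ab_eq0 abM); lra.
have -> : P * (1 - e (M + d)%N) - 1 = (P - 1) - P * e (M + d)%N by ring.
apply: le_trans (abD _ _) _; rewrite abN abM.
have : ab P * ab (e (M + d)%N) <= 2 * ab (e (M + d)%N) by rewrite ler_wpM2r.
by lra.
Qed.

Lemma away_from_0 (e : nat -> K) y : (forall d, 0 < d -> for_large k, ab (e k) <= d) ->
  (forall k, 1 - y * e k != 0) -> exists2 d, 0 < d & forall k, d <= ab (1 - y * e k).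
Proof.
move=> small H; have c0 : 0 < ab y + 1 by rewrite ltr_wpDl.
have e0 : 0 < 2^-1 / (ab y + 1) :> R by rewrite divr_gt0 // invr_gt0.
have [k0 Hk0] := small _ e0.
apply: (@pos_lower R (fun k => ab (1 - y * e k)) k0 2^-1); first by rewrite invr_gt0.
  by move=> k; apply: ab_gt0.
move=> k /Hk0 h.
have h1 : ab (y * e k) <= 2^-1.
  rewrite abM; apply: le_trans (ler_pM _ _ (_ : ab y <= ab y + 1) h) _; rewrite ?lerDl //.
  by rewrite mulrC divfK // gt_eqF.
have : ab 1 <= ab (1 - y * e k) + ab (y * e k) by apply: le_trans (abD _ _); rewrite subrK.
by rewrite (ab1 ab_eq0 abM); lra.
Qed.
End Limits.

Lemma expr_bound (R : realFieldType) (C x : R) k : 0 <= C -> (0 < k)%N -> 0 <= x -> C * x <= (C + 1) ^+ k * x.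
Proof.
move=> C0 k0 x0; rewrite ler_wpM2r //; apply: le_trans (_ : C + 1 <= _); first by rewrite lerDl.
by rewrite ler_eXnr // lerDr.
Qed.

Section Data.
Import mpoly.
Variables (m : nat) (c : nat -> nat).
Notation n := m.+1.
Hypothesis cn : c n != 0%N.
Variable rts : seq algC.
Hypotheses (rtsE : cpoly m c algC = rootprod rts) (nd : nondeg rts) (no_unity : no_root_of_unity rts).
Variable r : nat -> nat.
Hypotheses (r_rec : recurrence m c r) (r_neq0 : exists k, r k != 0%N).
Variables (K : fieldType) (R : archiRealFieldType) (ab : K -> R).
Hypotheses (charK : [pchar K] =i pred0) (ab_ge0 : nonneg ab) (ab_eq0 : definite ab)
  (abM : multiplicative ab) (abD : subadditive ab).
Variables (L : fieldExtType rat) (emb : {rmorphism L -> K}) (a : L).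
Hypotheses (al_gt0 : 0 < ab (emb a)) (al_lt1 : ab (emb a) < 1).
Notation E := (@E m c).
Notation xs := (@xs m c).
Notation vv := (vv m r).
Notation t := (ab (emb a)).
Let t_ge0 : 0 <= t. Proof. exact: ltW. Qed.
Let ab1 := ab1 ab_eq0 abM.
Let ab0 : ab 0 = 0. Proof. exact: (ab_eq0 0).2. Qed.
Let abN := abN ab_ge0 ab_eq0 abM.
Let abX := abX ab_eq0 abM.
Let abV := abV ab_ge0 ab_eq0 abM.

Lemma r_growth B : for_large k, (B * k <= r k)%N.
Proof.
have [C [k0 [C0 H]]] := xs_dominates cn rtsE nd.
have [k1 H1] := E_linear cn rtsE no_unity (C * B).
exists (maxn k0 k1) => k; rewrite geq_max => /andP[le0 le1].
have := H _ _ (vv_neq0 cn r_rec r_neq0 0) le0; rewrite (xs_vv r_rec) add0n => h.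
by rewrite -(leq_pmul2l C0) mulnA; apply: leq_trans (H1 k le1) h.
Qed.

Lemma r_small e : 0 < e -> for_large k, t ^+ r k <= e.
Proof.
move=> e0; have [B HB] := pow_small al_gt0 al_lt1 e0; have [k0 Hk] := r_growth 1.
exists (maxn k0 B) => k; rewrite geq_max => /andP[le0 le1]; apply: HB.
by apply: leq_trans le1 _; have := Hk k le0; rewrite mul1n.
Qed.

Lemma adm_lower (be : K) : (forall k, 1 - be * emb a ^+ r k != 0) ->
  exists2 d, 0 < d & forall k, d <= ab (1 - be * emb a ^+ r k).
Proof.
apply: away_from_0 => // d /r_small[k0 H]; exists k0 => k /H h; by rewrite abX.
Qed.

Variables (q N : nat) (al be : 'I_q -> L) (mm : 'I_q -> nat) (Nu : nat) (bu : 'I_Nu -> L).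
Hypotheses (al_neq0 : forall i, al i != 0)
  (be_adm : forall i k, 1 - be i * a ^+ r k != 0) (bu_adm : forall u k, 1 - bu u * a ^+ r k != 0).
Notation Ny := (q * N.+1)%N.
Notation phi := (phi (N := N) al).
Notation A := (Am (N := N) al).

Definition ps i (x : L) : L := (x / (1 - be i * x)) ^+ (mm i).+1.
Definition SL (y : 'I_Ny) k M : L := \sum_(j < M) phi y j * ps (blk y) (a ^+ r (k + j)).
Definition PL (u : 'I_Nu) k M : L := \prod_(j < M) (1 - bu u * a ^+ r (k + j)).
Definition s y k := SL y 0 k.
Definition pi u k := PL u 0 k.

Lemma SL_shift y k M : SL y 0 (k + M) = s y k + \sum_y' A k y y' * SL y' k M.
Proof.
rewrite /SL big_split_ord; congr (_ + _).
under [RHS]eq_bigr do rewrite mulr_sumr; rewrite exchange_big; apply: eq_bigr => j _ /=.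
rewrite phi_shift mulr_suml; apply: eq_bigr => y' _; rewrite mulrA.
have [->|h] := eqVneq (A k y y') 0; first by rewrite !mul0r.
by have [-> _] : blk y = blk y' /\ (lev y <= lev y')%N by apply: (toeplitz_blk (p := pw L k)); apply: contraNneq h => h; rewrite /Am h mulr0.
Qed.

Lemma PL_shift u k M : PL u 0 (k + M) = pi u k * PL u k M.
Proof. by rewrite /pi /PL big_split_ord. Qed.
Lemma pi_neq0 u k : pi u k != 0.
Proof. by rewrite /pi /PL; apply/prodf_neq0 => j _; exact: bu_adm. Qed.

Variable B : nat -> 'I_Ny -> 'I_Ny -> L.
Hypothesis AB : forall k y y'', \sum_y' A k y y' * B k y' y'' = (y == y'')%:R.

Lemma BA k y y'' : \sum_y' B k y y' * A k y' y'' = (y == y'')%:R.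
Proof.
pose MA := \matrix_(i, j) A k i j; pose MB := \matrix_(i, j) B k i j.
have /mulmx1C : MA *m MB = 1%:M by apply/matrixP => i j; rewrite !mxE -(AB k); apply: eq_bigr => l _; rewrite !mxE.
by move=> /matrixP/(_ y y''); rewrite !mxE => <-; apply: eq_bigr => l _; rewrite !mxE.
Qed.

Variables (F0 : 'I_Ny -> K) (U0 : 'I_Nu -> K).
Hypotheses (F0P : forall y, islim ab (fun M => emb (SL y 0 M)) (F0 y))
  (U0P : forall u, islim ab (fun M => emb (PL u 0 M)) (U0 u)).

(** Defined by solving the functional equation for the values at step k, so that [fvE] holds by
    construction; [fv_lim] then identifies it with the shifted series. *)
Definition fv y k : K := \sum_y' emb (B k y y') * (F0 y' - emb (s y' k)).
Definition uv u k : K := (emb (pi u k))^-1 * U0 u.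

Lemma B0 y y' : B 0 y y' = (y == y')%:R.
Proof.
rewrite -(AB 0) (bigD1 y) //= {1}/Am expr0 mul1r toeplitz1 ?eqxx ?mul1r ?big1 ?addr0 //.
  by move=> y'' ne; rewrite /Am toeplitz1 1?eq_sym ?(negPf ne) ?mulr0 ?mul0r // => j _; rewrite pwE bin0n.
by move=> j _; rewrite pwE bin0n.
Qed.

Lemma fv0 y : fv y 0 = F0 y.
Proof.
rewrite /fv (bigD1 y) //= B0 eqxx rmorph1 mul1r /s /SL big_ord0 rmorph0 subr0 big1 ?addr0 // => y' ne.
by rewrite B0 eq_sym (negPf ne) rmorph0 mul0r.
Qed.

Lemma uv0 u : uv u 0 = U0 u.
Proof. by rewrite /uv /pi /PL big_ord0 rmorph1 invr1 mul1r. Qed.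

Lemma fvE y k : fv y 0 = emb (s y k) + \sum_y' emb (A k y y') * fv y' k.
Proof.
rewrite fv0 /fv; under eq_bigr do rewrite mulr_sumr.
rewrite exchange_big; under eq_bigr do (under eq_bigr do rewrite mulrA -rmorphM; rewrite -mulr_suml -rmorph_sum AB).
rewrite (bigD1 y) //= eqxx rmorph1 mul1r big1 ?addr0 => [|y' ne]; first by rewrite addrC subrK.
by rewrite eq_sym (negPf ne) rmorph0 mul0r.
Qed.

Lemma uvE u k : uv u 0 = emb (pi u k) * uv u k.
Proof. by rewrite uv0 /uv mulrA divff ?mul1r // fmorph_eq0 pi_neq0. Qed.

Lemma fv_lim y k : islim ab (fun M => emb (SL y k M)) (fv y k).
Proof.
apply: (islim_ext (S := fun M => \sum_y' emb (B k y y') * (emb (SL y' 0 (k + M)) + - emb (s y' k)))).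
  move=> M; under eq_bigr do rewrite -rmorphN -rmorphD -rmorphM SL_shift addrAC subrr add0r mulr_sumr.
  rewrite -rmorph_sum exchange_big /=; congr (emb _).
  under eq_bigr do (under eq_bigr do rewrite mulrA; rewrite -mulr_suml BA).
  by rewrite (bigD1 y) //= eqxx mul1r big1 ?addr0 // => y' ne; rewrite eq_sym (negPf ne) mul0r.
apply: islim_sum => // y'; apply: islimZ => //; apply: islimD => //; last exact: islim_cst.
exact: (islim_shift (S := fun M => emb (SL y' 0 M))).
Qed.

Lemma uv_lim u k : islim ab (fun M => emb (PL u k M)) (uv u k).
Proof.
apply: (islim_ext (S := fun M => (emb (pi u k))^-1 * emb (PL u 0 (k + M)))).
  by move=> M; rewrite PL_shift rmorphM mulrA mulVf ?mul1r // fmorph_eq0 pi_neq0.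
by apply: islimZ => //; exact: (islim_shift (S := fun M => emb (PL u 0 M))).
Qed.

Definition Sb : R := 1 + \sum_i ab (emb (be i)) + \sum_u ab (emb (bu u)).
Lemma Sb_ge1 : 1 <= Sb.
Proof. by rewrite /Sb -addrA lerDl addr_ge0 // sumr_ge0. Qed.
Lemma be_Sb i : ab (emb (be i)) <= Sb.
Proof.
rewrite /Sb (bigD1 i) //= addrAC addrCA lerDl.
by rewrite !addr_ge0 // sumr_ge0.
Qed.
Lemma bu_Sb u : ab (emb (bu u)) <= Sb.
Proof.
rewrite /Sb [X in _ + X](bigD1 u) //= addrCA lerDl.
by rewrite !addr_ge0 // sumr_ge0.
Qed.

(** The factor 2 bounds binomial(j, l) by 2^j, the sum bounds every alpha. *)
Definition Dg : R := 2 * (1 + \sum_i ab (emb (al i))).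
Lemma Dg_ge1 : 1 <= Dg.
Proof. by have : 0 <= \sum_i ab (emb (al i)) by [rewrite sumr_ge0]; rewrite /Dg; lra. Qed.
Lemma phi_Dg y j : ab (emb (phi y j)) <= Dg ^+ j.
Proof.
rewrite rmorphM rmorphXn rmorph_nat abM abX exprMn; apply: ler_pM; rewrite ?exprn_ge0 //.
  apply: le_trans (ab_nat_le ab_eq0 abM abD _) _; rewrite -natrX ler_nat.
  have := expnDn 1 1 j; rewrite addn1 => ->.
  have [le|lt] := leqP (N - lev y) j; last by rewrite bin_small.
  rewrite (bigD1 (Ordinal (le : (N - lev y < j.+1)%N))) //= !exp1n !muln1; exact: leq_addr.
apply: lerXn2r; rewrite ?nnegrE ?addr_ge0 ?sumr_ge0 //.
by rewrite (bigD1 (blk y)) //= addrCA lerDl addr_ge0 // sumr_ge0.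
Qed.

Definition Mm := (\max_i mm i).+1%N.

Lemma ps_bound i (x : L) : ab (emb x) <= 1 -> ab (emb (be i * x)) <= 2^-1 -> ab (emb (ps i x)) <= 2 ^+ Mm * ab (emb x).
Proof.
move=> x1 h; rewrite /ps rmorphXn abX rmorphM fmorphV abM abV rmorphB rmorph1.
have d2 : 2^-1 <= ab (1 - emb (be i * x)).
  have : ab 1 <= ab (1 - emb (be i * x)) + ab (emb (be i * x)) by apply: le_trans (abD _ _); rewrite subrK.
  by rewrite ab1; lra.
have d0 : 0 < ab (1 - emb (be i * x)) by apply: lt_le_trans d2; rewrite invr_gt0.
have v2 : (ab (1 - emb (be i * x)))^-1 <= 2 by rewrite invf_ple ?posrE.
rewrite exprMn mulrC; apply: ler_pM; rewrite ?exprn_ge0 ?invr_ge0 //.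
  apply: (@le_trans _ _ (2 ^+ (mm i).+1)); first by rewrite lerXn2r ?nnegrE ?invr_ge0.
  by rewrite ler_weXn2l ?ler1n // ltnS leq_bigmax.
by rewrite exprS ler_piMr // exprn_ile1.
Qed.

Lemma s_bound y : exists2 D, 1 <= D & forall k, ab (emb (s y k)) <= D ^+ k.
Proof.
have [d d0 Hd] : exists2 d, 0 < d & forall k, d <= ab (1 - emb (be (blk y)) * emb a ^+ r k).
  apply: adm_lower => k; rewrite -rmorphXn -rmorphM -(rmorph1 emb) -rmorphB fmorph_eq0; exact: be_adm.
have a1 k : ab (emb (a ^+ r k)) <= 1 by rewrite rmorphXn abX exprn_ile1 // ltW.
pose Cp := (1 + d^-1) ^+ (mm (blk y)).+1.
have d1 : 0 <= d^-1 by rewrite invr_ge0 ltW.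
have Cp1 : 1 <= Cp by rewrite exprn_ege1 // lerDl.
have ps_le k : ab (emb (ps (blk y) (a ^+ r k))) <= Cp.
  rewrite /ps rmorphXn abX lerXn2r ?nnegrE ?addr_ge0 // rmorphM fmorphV abM abV.
  apply: le_trans (ler_piMl _ (a1 k)) _; first by rewrite invr_ge0.
  rewrite -[leLHS]add0r lerD // lef_pV2 ?posrE //; first by rewrite rmorphB rmorph1 rmorphM rmorphXn.
  by rewrite (ab_gt0 ab_ge0 ab_eq0) // fmorph_eq0 be_adm.
have Dg1 := Dg_ge1; have Dg0 : 0 <= Dg := le_trans ler01 Dg1.
have D0 : 0 <= Cp * Dg by rewrite mulr_ge0 // (le_trans ler01).
have D1 : 1 <= Cp * Dg by rewrite -[1]mulr1 ler_pM.
exists (2 * (Cp * Dg)) => [|k]; first by lra.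
elim: k => [|k IHk]; first by rewrite /s /SL big_ord0 rmorph0 ab0.
rewrite /s /SL big_ord_recr /= rmorphD exprS; apply: le_trans (abD _ _) _.
have h : ab (emb (phi y k * ps (blk y) (a ^+ r (0 + k)))) <= (Cp * Dg) * (2 * (Cp * Dg)) ^+ k.
  rewrite rmorphM abM add0n mulrC -mulrA; apply: ler_pM => //.
  have g1 : 0 <= 2 * (Cp * Dg) by rewrite mulr_ge0.
  apply: le_trans (phi_Dg _ _) _; apply: (@le_trans _ _ ((2 * (Cp * Dg)) ^+ k)).
    apply: lerXn2r; rewrite ?nnegrE //.
    have : 1 * Dg <= Cp * Dg by rewrite ler_wpM2r // (le_trans ler01).
    by lra.
  by rewrite ler_peMl // exprn_ge0.
have g0 : 0 <= (2 * (Cp * Dg)) ^+ k by rewrite exprn_ge0 // mulr_ge0.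
apply: le_trans (lerD IHk h) _; have := ler_peMl g0 D1; set X := (_ ^+ k); set Y := Cp * Dg; lra.
Qed.

Lemma pi_bound u : exists2 D, 1 <= D & forall k, ab (emb (pi u k)) <= D ^+ k.
Proof.
exists (1 + ab (emb (bu u))) => [|k]; first by rewrite lerDl.
elim: k => [|k IHk]; first by rewrite /pi /PL big_ord0 rmorph1 ab1.
rewrite /pi /PL big_ord_recr rmorphM abM exprSr; apply: ler_pM => //.
rewrite rmorphB rmorph1 rmorphM rmorphXn; apply: le_trans (abD _ _) _; rewrite ab1 abN lerD2l abM abX.
by rewrite ler_piMr // exprn_ile1 // ltW.
Qed.

Variables (C1 k1 : nat).
Hypotheses (C1_gt0 : (0 < C1)%N) (C1P : dominates m c C1 k1).
Notation mu := (@mu m c C1).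
Notation egb := (@egb m c K R ab (emb a) C1).
Notation zL := (@zL m c L a).
Notation zK := (@zK m c K (emb a)).

Lemma mu_large B' : for_large k, (B' <= mu k)%N.
Proof.
have [k0 H] := E_linear cn rtsE no_unity (C1 * B'); exists (maxn k0 1) => k; rewrite geq_max => /andP[le k0'].
by rewrite -[mu k]/(E k %/ C1)%N leq_divRL // mulnC; apply: leq_trans (H k le); rewrite leq_pmulr.
Qed.

(** r(k + j) is the exponent of [vv j] at step k, hence at least mdeg (vv j) mu(k), and for j >= jb
    J that degree is at least J + 1 + B' j. The part B' j pays for the growth Dg^j of [phi] and for
    summability; the additional factor t^(mu k) beyond order J absorbs constants in the estimate for
    the products. *)
Lemma tail_exponent : exists jb : nat -> nat, [/\ forall J J', (J <= J')%N -> (jb J <= jb J')%N,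
      forall J j, (jb J <= j)%N -> (J <= mdeg (vv j))%N & forall J, exists k0, forall k j, (k0 <= k)%N -> (jb J <= j)%N ->
      t ^+ r (k + j) <= t ^+ (J.+1 * mu k) * (Dg^-1 * 2^-1) ^+ j].
Proof.
have D0 : 0 < Dg := lt_le_trans ltr01 Dg_ge1.
have e0 : 0 < Dg^-1 * 2^-1 by rewrite mulr_gt0 ?invr_gt0.
have [B' HB'] := pow_small al_gt0 al_lt1 e0.
have [j0 Hj0] := r_growth (B' + 1).
have deg_r j : (r j <= mdeg (vv j))%N.
  by rewrite mdegE (bigD1 ord0) //= mnmE addn0 leq_addr.
exists (fun J => maxn j0 J.+1); split.
- by move=> J J' le; rewrite geq_max leq_maxl /= leq_max ltnS le orbT.
- move=> J j; rewrite geq_max => /andP[le0 le1]; apply: leq_trans (deg_r j); apply: leq_trans (Hj0 j le0).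
  by rewrite mulnDl mul1n (leq_trans (ltnW le1)) ?leq_addl.
move=> J; have [k2 Hk2] := mu_large 1; exists (maxn k1 k2) => k j.
rewrite !geq_max => /andP[le1 le2] /andP[le0 leJ].
have mu1 := Hk2 k le2.
have xsE : r (k + j) = xs (vv j) k by rewrite (xs_vv r_rec) addnC.
have le : (mdeg (vv j) * mu k <= r (k + j))%N by rewrite xsE; apply: (xs_ge_mu C1_gt0 C1P).
have le' : (J.+1 * mu k + B' * j <= r (k + j))%N.
  apply: leq_trans le; apply: (@leq_trans ((J.+1 + B' * j) * mu k)).
    by rewrite mulnDl leq_add2l leq_pmulr.
  rewrite leq_pmul2r //; apply: leq_trans (deg_r j); apply: leq_trans (Hj0 j le0).
  by rewrite mulnDl mul1n addnC leq_add2l.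
apply: (@le_trans _ _ (t ^+ (J.+1 * mu k + B' * j))); first by rewrite ler_wiXn2l ?ltW.
rewrite exprD ler_wpM2l ?exprn_ge0 // exprM lerXn2r ?nnegrE ?exprn_ge0 //; first exact: ltW.
exact: HB'.
Qed.

Variable jb : nat -> nat.
Hypotheses (jb_mono : forall J J', (J <= J')%N -> (jb J <= jb J')%N)
 (jbP : forall J j, (jb J <= j)%N -> (J <= mdeg (vv j))%N)
 (jb_tail : forall J, exists k0, forall k j, (k0 <= k)%N -> (jb J <= j)%N ->
      t ^+ r (k + j) <= t ^+ (J.+1 * mu k) * (Dg^-1 * 2^-1) ^+ j).

Notation fserL := (@fser L n vv Ny phi (fun y => be (blk y)) (fun y => mm (blk y)) jb).
Notation userL := (@user L n vv Nu bu jb).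

Lemma near_half : for_large k, forall j i, ab (emb (be i * a ^+ r (k + j))) <= 2^-1.
Proof.
have S0 : 0 < Sb := lt_le_trans ltr01 Sb_ge1.
have e0 : 0 < 2^-1 / Sb :> R by rewrite divr_gt0 // invr_gt0.
have [k0 Hk] := r_small e0; exists k0 => k le j i.
rewrite rmorphM rmorphXn abM abX; have h := Hk (k + j)%N (leq_trans le (leq_addr _ _)).
apply: le_trans (ler_pM _ _ (be_Sb i) h) _; rewrite ?exprn_ge0 //.
by rewrite mulrC divfK // gt_eqF.
Qed.

Lemma a_le1 k : ab (emb (a ^+ r k)) <= 1.
Proof. by rewrite rmorphXn abX exprn_ile1 // ltW. Qed.

Lemma fv_tail y J : egb J (fun k => fv y k - emb (SL y k (jb J))).
Proof.
have [k0 H0] := jb_tail J; have [k2 H2] := near_half.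
pose C := 2 ^+ Mm * 2 : R; have C0 : 0 <= C by rewrite mulr_ge0 ?exprn_ge0.
exists (C + 1); split; first exact: addr_ge0.
have D0 : 0 < Dg := lt_le_trans ltr01 Dg_ge1.
exists (maxn 1 (maxn k0 k2)) => k; rewrite !geq_max => /andP[k_gt0 /andP[le0 le2]].
apply: le_trans (expr_bound C0 k_gt0 (exprn_ge0 _ t_ge0)).
apply: (islim_bound ab_ge0 ab_eq0 abM abD (fv_lim y k) (N0 := jb J)) => M le.
rewrite -rmorphB /SL -!(big_mkord xpredT (fun j => phi y j * ps (blk y) (a ^+ r (k + j)))).
rewrite (@big_cat_nat _ _ _ (jb J) 0 M) //= addrAC subrr add0r rmorph_sum.
apply: le_trans (ab_sum ab0 abD _ _ _) _.
have bnd j : (jb J <= j)%N -> ab (emb (phi y j * ps (blk y) (a ^+ r (k + j)))) <= 2 ^+ Mm * t ^+ (J * mu k) * 2^-1 ^+ j.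
  move=> lej; rewrite rmorphM abM mulrC.
  apply: le_trans (ler_pM _ _ (ps_bound (a_le1 _) (H2 k le2 j (blk y))) (phi_Dg y j)) _ => //.
  rewrite -!mulrA ler_wpM2l ?exprn_ge0 // rmorphXn abX.
  have h := H0 k j le0 lej.
  have tJ : t ^+ (J.+1 * mu k) <= t ^+ (J * mu k) by rewrite ler_wiXn2l ?(ltW al_lt1) // leq_mul2r leqnSn orbT.
  have De0 : 0 <= (Dg^-1 * 2^-1) ^+ j by rewrite exprn_ge0 // mulr_ge0 ?invr_ge0 // ltW.
  apply: le_trans (ler_wpM2r (exprn_ge0 j (ltW D0)) (le_trans h (ler_wpM2r De0 tJ))) _.
  by rewrite -mulrA -exprMn mulrAC mulVf ?mul1r // gt_eqF.
apply: le_trans (ler_sum_nat (fun j (h : (jb J <= j < M)%N) => bnd j (proj1 (andP h)))) _.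
rewrite -mulr_sumr.
apply: (@le_trans _ _ (2 ^+ Mm * t ^+ (J * mu k) * 2)); last by rewrite mulrAC.
by rewrite ler_wpM2l ?sum_half // mulr_ge0 ?exprn_ge0.
Qed.

Lemma uv_tail u J : exists k0, forall k M, (k0 <= k)%N -> (jb J <= M)%N ->
  ab (emb (\prod_(jb J <= j < M) (1 - bu u * a ^+ r (k + j))) - 1) <= 4 * Sb * t ^+ (J * mu k) /\
  ab (emb (\prod_(jb J <= j < M) (1 - bu u * a ^+ r (k + j))) - 1) <= 2^-1.
Proof.
have [k0 H0] := jb_tail J.
have S0 : 0 < Sb := lt_le_trans ltr01 Sb_ge1.
have e0 : 0 < 2^-1 / (4 * Sb) :> R by rewrite divr_gt0 ?invr_gt0 // mulr_gt0.
have [B' HB'] := pow_small al_gt0 al_lt1 e0; have [k2 H2] := mu_large B'.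
have D0 : 0 < Dg := lt_le_trans ltr01 Dg_ge1.
exists (maxn k0 k2) => k M; rewrite geq_max => /andP[le0 le2] leM.
have tm : t ^+ mu k <= 2^-1 / (4 * Sb) by apply: HB'; exact: H2.
have small : 4 * Sb * t ^+ mu k <= 2^-1 by rewrite mulrC -ler_pdivlMr ?mulr_gt0.
have tJ : t ^+ (J.+1 * mu k) = t ^+ mu k * t ^+ (J * mu k) by rewrite mulSn exprD.
have tJ1 : t ^+ (J * mu k) <= 1 by rewrite exprn_ile1 // ltW.
have tJ0 : 0 <= t ^+ (J * mu k) by rewrite exprn_ge0.
have tm0 : 0 <= t ^+ mu k by rewrite exprn_ge0.
have SS0 : 0 <= 2 * Sb by rewrite mulr_ge0 // ltW.
have tm1 : t ^+ mu k <= 1 by rewrite exprn_ile1 // ltW.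
pose ss := 2 * Sb * t ^+ (J.+1 * mu k).
have ssle : ss <= 2 * Sb * t ^+ mu k by rewrite /ss ler_wpM2l // tJ ler_piMr.
have ssle' : ss <= 2 * Sb * t ^+ (J * mu k) by rewrite /ss ler_wpM2l // tJ ler_piMl.
have s2 : ss <= 2^-1 by lra.
have key : ab (emb (\prod_(jb J <= j < M) (1 - bu u * a ^+ r (k + j))) - 1) <= 2 * ss.
  rewrite rmorph_prod.
  under eq_bigr do rewrite rmorphB rmorph1.
  apply: (prod_near1 ab_ge0 ab_eq0 abM abD s2).
  have bnd j : (jb J <= j)%N -> ab (emb (bu u * a ^+ r (k + j))) <= Sb * t ^+ (J.+1 * mu k) * 2^-1 ^+ j.
    move=> lej; rewrite rmorphM rmorphXn abM abX; have h := H0 k j le0 lej.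
    apply: le_trans (ler_pM _ _ (bu_Sb u) h) _; rewrite ?exprn_ge0 // mulrA.
    rewrite ler_wpM2l ?mulr_ge0 ?exprn_ge0 ?(ltW S0) // exprMn ler_piMl ?exprn_ge0 ?invr_ge0 //.
    by rewrite exprn_ile1 ?invr_ge0 ?(ltW D0) // invf_le1 // Dg_ge1.
  apply: le_trans (ler_sum_nat (fun j (h : (jb J <= j < M)%N) => bnd j (proj1 (andP h)))) _.
  rewrite -mulr_sumr /ss.
  apply: (@le_trans _ _ (Sb * t ^+ (J.+1 * mu k) * 2)); last by rewrite mulrC mulrA.
  by rewrite ler_wpM2l ?sum_half // mulr_ge0 ?exprn_ge0 // ltW.
split; first by apply: le_trans key _; lra.
by apply: le_trans key _; lra.
Qed.

(** At a late step k2 the tail of the product is within 1/2 of 1, and the finitely many factors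
    split off are nonzero. *)
Lemma uv_neq0 u k : uv u k != 0.
Proof.
have [k0 H0] := uv_tail u 0; have [k2 Hk2] : exists k2, (k0 <= k2)%N /\ (jb 0 <= k2)%N.
  by exists (maxn k0 (jb 0)); rewrite leq_maxl leq_maxr.
suff U : uv u 0 != 0 by move: U; rewrite (uvE u k); apply: contraNneq => ->; rewrite mulr0.
pose Q := emb (PL u k2 (jb 0)).
have Q0 : Q != 0 by rewrite fmorph_eq0 /PL; apply/prodf_neq0 => j _; exact: bu_adm.
have close : ab (Q^-1 * uv u k2 - 1) <= 2^-1.
  apply: (islim_bound ab_ge0 ab_eq0 abM abD (islimZ ab_ge0 abM Q^-1 (uv_lim u k2)) (N0 := jb 0)) => M le.
  have [_ h] := H0 k2 M Hk2.1 le; apply: le_trans h.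
  rewrite le_eqVlt; apply/orP; left; apply/eqP; congr (ab (_ - 1)).
  apply: (mulfI Q0); rewrite mulrA divff // mul1r /Q -rmorphM; congr (emb _).
  by rewrite /PL -!(big_mkord xpredT (fun j => 1 - bu u * a ^+ r (k2 + j))) -big_cat_nat.
rewrite (uvE u k2) mulf_neq0 ?fmorph_eq0 ?pi_neq0 //.
apply: contraTneq close => ->; rewrite mulr0 sub0r abN ab1 -ltNge; lra.
Qed.

Lemma zL_vv j k : \prod_(i < n) zL k i ^+ (vv j) i = a ^+ r (k + j).
Proof. by rewrite (zK_mon c a k (vv j)) (xs_vv r_rec) addnC. Qed.
Lemma meval_vv j k : ('X_[vv j] : {mpoly L[n]}).@[zL k] = a ^+ r (k + j).
Proof. by rewrite mevalX zL_vv. Qed.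

Lemma x_egb j e : egb e (fun k => emb (a ^+ r (k + j)) ^+ e).
Proof.
have H := egb_mon ab_ge0 ab_eq0 abM al_lt1 C1_gt0 C1P (vv j *+ e)%MM.
apply: (egb_le ab_ge0 al_lt1 _ (egb_ext _ H)).
  by rewrite mdegMn leq_pmull // lt0n mdeg_eq0; exact: (vv_neq0 cn r_rec r_neq0).
move=> k; rewrite -!(zK_mon c (emb a) k) rmorphXn; have /= := zL_vv j k.
rewrite addnC -(xs_vv r_rec) -(zK_mon c (emb a) k (vv j)) => _.
by rewrite -prodrXl; apply: eq_bigr => i _; rewrite mulmnE exprM.
Qed.

Lemma inv_egb i j : egb 0 (fun k => (emb (1 - be i * a ^+ r (k + j)))^-1).
Proof.
have [k2 H2] := near_half; exists 2; split=> //; exists (maxn 1 k2) => k.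
rewrite geq_max mul0n mulr1 => /andP[k0 le]; have h := H2 k le j i; rewrite abV rmorphB rmorph1.
have d2 : 2^-1 <= ab (1 - emb (be i * a ^+ r (k + j))).
  have : ab 1 <= ab (1 - emb (be i * a ^+ r (k + j))) + ab (emb (be i * a ^+ r (k + j))) by apply: le_trans (abD _ _); rewrite subrK.
  by rewrite ab1; lra.
have d0 : 0 < ab (1 - emb (be i * a ^+ r (k + j))) by apply: lt_le_trans d2; rewrite invr_gt0.
apply: (@le_trans _ _ 2); last by rewrite ler_eXnr // ler1n.
by rewrite invf_ple ?posrE.
Qed.

(** With x = a^(r(k+j)) the quotient x / (1 - b x) differs from its geometric truncation by (b x)^J
    times the quotient; powers are handled by factoring a difference of powers. *)
Lemma fser_close y J : egb J (fun k => emb (SL y k (jb J)) - emb (fserL J y).@[zL k]).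
Proof.
pose x j k := emb (a ^+ r (k + j)); pose b := emb (be (blk y)).
pose p j k := x j k * (emb (1 - be (blk y) * a ^+ r (k + j)))^-1.
pose qq j k := x j k * \sum_(e < J) (b * x j k) ^+ e.
have xe j : egb 0 (x j).
  by apply: (egb_le ab_ge0 al_lt1 (leq0n 1)); apply: egb_ext (x_egb j 1) => k; rewrite expr1.
have pe j : egb 0 (p j) by exact: (egbM ab_ge0 abM (xe j) (inv_egb _ _)).
have bxe j : egb 0 (fun k => b * x j k) by exact: (egbM ab_ge0 abM (egb_cst m c ab_ge0 (emb a) C1 b) (xe j)).
have qe j : egb 0 (qq j).
  by apply: (egbM ab_ge0 abM (xe j)); apply: egb_sum => // e; exact: (egbX ab_ge0 abM).
have pq j : egb J (fun k => p j k - qq j k).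
  have H := egbM ab_ge0 abM (x_egb j J) (egbM ab_ge0 abM (egb_cst m c ab_ge0 (emb a) C1 (b ^+ J)) (pe j)).
  rewrite !addn0 in H; apply: egb_ext H => k; rewrite /p /qq -mulrBr.
  set D := emb (1 - _); have D0 : D != 0 by rewrite fmorph_eq0 be_adm.
  have Dx : D = 1 - b * x j k by rewrite /D rmorphB rmorph1 rmorphM.
  have gs : D * \sum_(e < J) (b * x j k) ^+ e = 1 - (b * x j k) ^+ J by rewrite Dx -[LHS]opprK -mulNr opprB -subrX1 opprB.
  have -> : \sum_(e < J) (b * x j k) ^+ e = D^-1 * (1 - (b * x j k) ^+ J) by rewrite -gs mulrA mulVf ?mul1r.
  rewrite exprMn -/(x j k); set v := D^-1; ring.
have pow j e : egb J (fun k => p j k ^+ e - qq j k ^+ e).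
  apply: (egb_ext (x := fun k => (p j k - qq j k) * \sum_(i < e) p j k ^+ (e.-1 - i) * qq j k ^+ i)).
    by move=> k; rewrite subrXX.
  rewrite -[J]addn0; apply: (egbM ab_ge0 abM (pq j)); apply: egb_sum => // i.
  by rewrite -[0%N]addn0; apply: (egbM ab_ge0 abM); exact: (egbX ab_ge0 abM).
apply: (egb_ext (x := fun k => \sum_(j < jb J) emb (phi y j) * (p j k ^+ (mm (blk y)).+1 - qq j k ^+ (mm (blk y)).+1))).
  move=> k; rewrite -rmorphB /SL /fser (raddf_sum (meval (zL k))) -sumrB rmorph_sum; apply: eq_bigr => j _.
  rewrite /= mevalZ -mulrBr rmorphM; congr (_ * _); rewrite rmorphB /ps !rmorphXn rmorphM fmorphV; congr (_ - _ ^+ _).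
  rewrite /gM /geo rmorphM /= meval_vv rmorphM (raddf_sum (meval (zL k))) rmorph_sum; congr (_ * _).
  by apply: eq_bigr => e _; rewrite /= !rmorphXn /= mevalZ meval_vv rmorphM.
apply: egb_sum => // j.
exact: (egbM ab_ge0 abM (egb_cst m c ab_ge0 (emb a) C1 (emb (phi y j))) (pow j (mm (blk y)).+1)).
Qed.

Lemma fv_approx y J : egb J (fun k => fv y k - emb (fserL J y).@[zL k]).
Proof.
apply: egb_ext (egbD abD al_gt0 (fv_tail y J) (fser_close y J)) => k.
by rewrite addrA subrK.
Qed.

Lemma uv_approx u J : egb J (fun k => uv u k - emb (userL J u).@[zL k]).
Proof.
have [k0 H0] := uv_tail u J.
have uE k : (userL J u).@[zL k] = PL u k (jb J).
  rewrite /user rmorph_prod; apply: eq_bigr => j _.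
  by rewrite rmorphB rmorph1 /= mevalZ meval_vv.
pose C := (1 + ab (emb (bu u))) ^+ jb J * (4 * Sb).
have S0 : 0 <= Sb := le_trans ler01 Sb_ge1.
have C0 : 0 <= C by rewrite mulr_ge0 ?exprn_ge0 ?addr_ge0 ?mulr_ge0.
exists (C + 1); split; first exact: addr_ge0.
exists (maxn 1 k0) => k; rewrite geq_max => /andP[k_gt0 le0].
apply: le_trans (expr_bound C0 k_gt0 (exprn_ge0 _ t_ge0)).
apply: (islim_bound ab_ge0 ab_eq0 abM abD (uv_lim u k) (N0 := jb J)) => M le.
rewrite uE -rmorphB; have [h _] := H0 k M le0 le.
have -> : PL u k M - PL u k (jb J) = PL u k (jb J) * (\prod_(jb J <= j < M) (1 - bu u * a ^+ r (k + j)) - 1).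
  by rewrite mulrBr mulr1 /PL -!(big_mkord xpredT (fun j => 1 - bu u * a ^+ r (k + j))) -big_cat_nat.
rewrite rmorphM abM rmorphB rmorph1 /C -!mulrA; apply: ler_pM => //; last by rewrite mulrA.
rewrite /PL rmorph_prod; elim: (jb J) => [|d IHd]; first by rewrite big_ord0 ab1.
rewrite big_ord_recr abM exprSr; apply: ler_pM => //.
rewrite rmorphB rmorph1 rmorphM; apply: le_trans (abD _ _) _; rewrite ab1 abN lerD2l abM.
by rewrite ler_piMr // a_le1.
Qed.

End Data.

(** * Compatibility of the truncations at different orders *)

Section Truncation.
Import mpoly.
Variables (L : fieldType) (n : nat) (vv : nat -> 'X_{1..n}) (vv_neq0 : forall j, vv j != 0%MM).
Variables (Ny Nu : nat) (phi : 'I_Ny -> nat -> L) (be : 'I_Ny -> L) (mm : 'I_Ny -> nat) (bu : 'I_Nu -> L).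
Variable jb : nat -> nat.
Hypotheses (jb_mono : forall J J', (J <= J')%N -> (jb J <= jb J')%N)
 (jbP : forall J j, (jb J <= j)%N -> (J <= mdeg (vv j))%N).

Lemma hord_vv j e : hord e ((('X_[vv j] : {mpoly L[n]})) ^+ e).
Proof.
rewrite mpolyXn; apply: hord_leq (@hordX_mnm _ _ _).
by rewrite mdegMn leq_pmull // lt0n mdeg_eq0.
Qed.

Lemma gM_cong J J' b k : (J <= J')%N -> hcong J (@gM L n vv b k J) (@gM L n vv b k J').
Proof.
move=> le; rewrite /gM /geo /hcong -mulrBr mulrC; apply: hordMr.
rewrite -(subnKC le) big_split_ord opprD addrA subrr add0r; apply/hordN.
elim/big_rec: _ => [|i x _ H]; first exact: hord0.
apply: hordD H; rewrite exprZn; apply: hordZ.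
by apply: hord_leq (@hord_vv k _); rewrite leq_addr.
Qed.

Lemma trunc_cong J J' v : (J <= J')%N ->
  hcong J (@vals L n vv Ny Nu phi be mm bu jb J v) (@vals L n vv Ny Nu phi be mm bu jb J' v).
Proof.
move=> le; rewrite /vals; case: (split v) => [y|u].
  have H := @fser_ext L n vv Ny phi be mm jb jbP J y (jb J') (jb_mono le).
  have H' : hcong J (\sum_(k < jb J') phi y k *: @gM L n vv (be y) k J ^+ (mm y).+1) (@fser L n vv Ny phi be mm jb J' y).
    rewrite /fser; elim/big_rec2: _ => [|k x z _ IH]; first exact: hcong_refl.
    have h : hcong J (@gM L n vv (be y) k J ^+ (mm y).+1) (@gM L n vv (be y) k J' ^+ (mm y).+1).
      by apply: hcongX; exact: gM_cong.
    by apply: hcongD IH; rewrite /hcong -scalerBr; apply: hordZ.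
  move: H H'; rewrite /hcong; set x := \sum_(k < _) _ => H H'.
  have -> : @fser L n vv Ny phi be mm jb J y - @fser L n vv Ny phi be mm jb J' y = (x - @fser L n vv Ny phi be mm jb J' y) - (x - @fser L n vv Ny phi be mm jb J y) by ring.
  by apply: hordD H' _; exact: hordN.
have H := @user_ext L n vv Nu bu jb jbP J u (jb J') (jb_mono le).
by move: H; rewrite /hcong -/(@user L n vv Nu bu jb J' u) -opprB => /hordN; rewrite opprK.
Qed.
End Truncation.

Lemma expn_prod (I : Type) (s : seq I) (P : pred I) (F : I -> nat) e :
  ((\prod_(i <- s | P i) F i) ^ e = \prod_(i <- s | P i) F i ^ e)%N.
Proof. by apply: (big_morph (fun x => x ^ e)%N (fun x y => expnMn x y e)); rewrite exp1n. Qed.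

(** * Heights of the sequences in the functional equations *)

Section Heights.
Variables (m : nat) (c : nat -> nat).
Notation n := m.+1.
Hypothesis cn : c n != 0%N.
Variable rts : seq algC.
Hypotheses (rtsE : cpoly m c algC = rootprod rts) (no_unity : no_root_of_unity rts).
Notation E := (@E m c).
Variable L : fieldExtType rat.

(** Height and denominator at step k at most H^(E k). Since E k is bounded below by a multiple of k,
    this class contains the geometric sequences as well as a^(r k). *)
Definition gh (x : nat -> L) := exists2 H, (0 < H)%N & forall k, exists d,
  (0 < d <= H ^ E k)%N /\ Int (H ^ E k) (d%:R * x k).
Let Egt0 := E_gt0 cn.
Lemma gh_ext x y : x =1 y -> gh x -> gh y.
Proof. by move/funext->. Qed.

Lemma ghM x y : gh x -> gh y -> gh (fun k => x k * y k).
Proof.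
move=> [H H0 Hx] [H' H0' Hy]; exists (H * H')%N; first by rewrite muln_gt0 H0.
move=> k; have [d [/andP[d0 dl] Id]] := Hx k; have [d' [/andP[d0' dl'] Id']] := Hy k.
exists (d * d')%N; rewrite muln_gt0 d0 d0' expnMn leq_mul //; split=> //.
by rewrite natrM mulrACA; apply: IntM.
Qed.

Lemma ghD x y : gh x -> gh y -> gh (fun k => x k + y k).
Proof.
move=> [H H0 Hx] [H' H0' Hy]; exists (2 * H * H')%N; first by rewrite !muln_gt0 H0 H0'.
move=> k; have [d [/andP[d0 dl] Id]] := Hx k; have [d' [/andP[d0' dl'] Id']] := Hy k.
have e2 : (2 <= 2 ^ E k)%N by rewrite -{1}(expn1 2) leq_exp2l.
exists (d * d')%N; rewrite muln_gt0 d0 d0' !expnMn; split.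
  by rewrite leq_mul // (leq_trans dl) // leq_pmull // expn_gt0.
rewrite natrM mulrDr -mulrA [d'%:R * _]mulrC mulrA -[X in _ + X]mulrA.
apply: (Int_le (H := H ^ E k * H' ^ E k + H ^ E k * H' ^ E k)).
  by rewrite addnn -mul2n -mulnA leq_mul2r e2 orbT.
apply: IntD; last by apply: IntM => //; exact: Int_le dl (Int_nat _ _).
by apply: IntM => //; exact: Int_le dl' (Int_nat _ _).
Qed.

Lemma gh_int_pow H x f : (0 < H)%N -> (exists C, forall k, (f k <= C * E k)%N) -> Int H x -> gh (fun k => x ^+ f k).
Proof.
move=> H0 [C HC] Ix; exists (H ^ C)%N; first by rewrite expn_gt0 H0.
move=> k; exists 1%N; rewrite expn_gt0 expn_gt0 H0 mul1r; split=> //.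
by rewrite -expnM; apply: Int_le (IntX (f k) Ix); rewrite leq_pexp2l.
Qed.

Lemma gh_inv x : (forall k, x k != 0) -> gh x -> gh (fun k => (x k)^-1).
Proof.
move=> x0 [H H0 Hx]; set d := \dim (fullv : {vspace L}).
exists (d.+1 * d`! * H ^ d * H)%N; first by rewrite !muln_gt0 fact_gt0 expn_gt0 H0.
move=> k; have [e [/andP[e0 el] Ie]] := Hx k.
have HE : (0 < H ^ E k)%N by rewrite expn_gt0 H0.
have ex0 : e%:R * x k != 0 by rewrite mulf_neq0 // natL_neq0.
have [D [/andP[D0 Dl] ID]] := Int_inv HE ex0 Ie.
have big z : (0 < z)%N -> (z <= z ^ E k)%N by move=> z0; rewrite -{1}(expn1 z) leq_pexp2l.
have pk : (d`! * (H ^ E k) ^ d <= (d`! * H ^ d) ^ E k)%N.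
  by rewrite expnMn -!expnM [(d * _)%N]mulnC leq_mul // big // fact_gt0.
exists D; split.
  rewrite D0 /=; apply: leq_trans Dl _; apply: leq_trans pk _; rewrite leq_exp2r //.
  apply: (@leq_trans (d.+1 * d`! * H ^ d)); last exact: leq_pmulr.
  by rewrite -mulnA leq_pmull.
have -> : D%:R / x k = e%:R * (D%:R / (e%:R * x k)).
  by rewrite mulrA [_%:R * _%:R]mulrC -mulrA invfM [X in _ = _ * X]mulrA divff ?natL_neq0 // mul1r.
apply: (Int_le (H := H ^ E k * (d * (d`! * (H ^ E k) ^ d)))); last first.
  by apply: IntM => //; exact: Int_le el (Int_nat _ _).
have d1 : (d <= d.+1 ^ E k)%N by apply: leq_trans (leqnSn d) (big _ _).
rewrite mulnC !mulnA !expnMn -[((H ^ d) ^ E k)%N]expnM [(d * E k)%N]mulnC expnM.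
by rewrite leq_mul // leq_mul // leq_mul // big // fact_gt0.
Qed.

Lemma gh_cst x : gh (fun=> x).
Proof.
have [D [H [D0 HI]]] := Int_den x; exists (D + H)%N; first by rewrite addn_gt0 D0.
have big k : (D + H <= (D + H) ^ E k)%N by rewrite -{1}(expn1 (D + H)) leq_pexp2l // addn_gt0 D0.
move=> k; exists D; rewrite D0 (leq_trans _ (big k)) ?leq_addr //; split=> //.
by apply: Int_le HI; apply: leq_trans (big k); rewrite leq_addl.
Qed.

Lemma ghX x e : gh x -> gh (fun k => x k ^+ e).
Proof.
move=> H; elim: e => [|e IH]; first by apply: gh_ext (gh_cst 1) => k; rewrite expr0.
by apply: gh_ext (ghM H IH) => k; rewrite exprS.
Qed.

Lemma gh_pow x f : (exists C, forall k, (f k <= C * E k)%N) -> gh (fun k => x ^+ f k).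
Proof.
move=> fE; have [D [H [D0 HI]]] := Int_den x.
have D1 : (0 < D + H)%N by rewrite addn_gt0 D0.
have h1 : gh (fun k => (D%:R * x) ^+ f k) by apply: gh_int_pow D1 fE _; apply: Int_le HI; rewrite leq_addl.
have h2 : gh (fun k => (D%:R : L) ^+ f k) by apply: gh_int_pow D1 fE _; apply: Int_le (Int_nat _ _); rewrite leq_addr.
have D0' k : (D%:R : L) ^+ f k != 0 by rewrite expf_neq0 // natL_neq0.
apply: gh_ext (ghM h1 (gh_inv D0' h2)) => k.
by rewrite exprMn mulrAC divff ?mul1r.
Qed.

Let Esum := E_sum cn rtsE no_unity.

Lemma k_le_E k : (k <= 2 * n * E k)%N.
Proof.
apply: leq_trans (Esum k); rewrite -{1}[k]card_ord -sum1_card; apply: leq_sum => j _; exact: Egt0.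
Qed.

Lemma gh_natpow x : gh (fun k => x ^+ k).
Proof. by apply: gh_pow; exists (2 * n)%N => k; exact: k_le_E. Qed.

Lemma gh_nat f C : (forall k, (f k <= C ^ k)%N) -> gh (fun k => (f k)%:R).
Proof.
move=> Hf; exists (C.+1 ^ (2 * n))%N; first by rewrite expn_gt0.
move=> k; exists 1%N; rewrite expn_gt0 expn_gt0 mul1r; split=> //.
apply: Int_le (Int_nat _ _); apply: leq_trans (Hf k) _.
rewrite -expnM; apply: (@leq_trans (C.+1 ^ k)); first by case: (posnP k) => [->|k0]; rewrite ?expn0 ?leq_exp2r.
by rewrite leq_pexp2l // k_le_E.
Qed.

Lemma prod_pow_E H k : (0 < H)%N -> (\prod_(j < k) H ^ E j <= (H ^ (2 * n)) ^ E k)%N.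
Proof. by move=> H0; rewrite -expn_sum -expnM leq_pexp2l. Qed.

(** The heights multiply to H raised to the sum of E j over j < k, which [E_sum] bounds by 2 n E
    k. *)
Lemma gh_prod x : gh x -> gh (fun k => \prod_(j < k) x j).
Proof.
move=> [H H0 Hx]; have [d Hd] := choice Hx.
exists (H ^ (2 * n))%N; first by rewrite expn_gt0 H0.
move=> k; exists (\prod_(j < k) d j)%N; split.
  rewrite prodn_gt0 => [|j]; last by have [/andP[]] := Hd j.
  apply: leq_trans (prod_pow_E k H0); apply: leq_prod => j _; by have [/andP[]] := Hd j.
apply: (Int_le (prod_pow_E k H0)).
elim: k => [|k IHk]; first by rewrite !big_ord0 mul1r; exact: Int1.
rewrite !big_ord_recr /= natrM mulrACA; apply: IntM IHk _; by have [] := Hd k.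
Qed.

Lemma gh_sum x : gh x -> gh (fun k => \sum_(j < k) x j).
Proof.
move=> [H H0 Hx]; have [d Hd] := choice Hx.
exists (2 ^ (2 * n) * H ^ (2 * n))%N; first by rewrite muln_gt0 !expn_gt0 H0.
move=> k; exists (\prod_(j < k) d j)%N; split.
  rewrite prodn_gt0 => [|j]; last by have [/andP[]] := Hd j.
  apply: leq_trans (_ : (H ^ (2 * n)) ^ E k <= _)%N; last by rewrite expnMn leq_pmull // expn_gt0 expn_gt0.
  apply: leq_trans (prod_pow_E k H0); apply: leq_prod => j _; by have [/andP[]] := Hd j.
have Hs : Int (k * \prod_(j < k) H ^ E j) ((\prod_(j < k) d j)%:R * \sum_(j < k) x j).
  elim: k => [|k IHk]; first by rewrite !big_ord0 mulr0 mul0n; exact: (Int_nat L 0).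
  have Ip : (\prod_(j < k) d j <= \prod_(j < k) H ^ E j)%N.
    by apply: leq_prod => j _; have [/andP[]] := Hd j.
  have [/andP[dk0 dkl] Idk] := Hd k.
  rewrite !big_ord_recr /= natrM mulrDr -mulrA [(d k)%:R * _]mulrC mulrA -[X in _ + X]mulrA.
  apply: (Int_le (H := k * (\prod_(j < k) H ^ E j) * H ^ E k + (\prod_(j < k) H ^ E j) * H ^ E k)).
    by rewrite mulSn -mulnA addnC.
  apply: IntD; first by apply: IntM IHk _; exact: Int_le dkl (Int_nat _ _).
  by apply: IntM Idk; exact: Int_le Ip (Int_nat _ _).
apply: Int_le Hs; rewrite expnMn leq_mul ?prod_pow_E //.
apply: leq_trans (k_le_E k) _; rewrite -expnM; exact: (ltnW (ltn_expl _ _)).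
Qed.

Lemma gh_common (G : finType) (x : G -> nat -> L) : (forall g, gh (x g)) -> exists (dn Bf : nat -> nat) (H1 : nat),
  [/\ forall k, (0 < dn k)%N, forall k, (dn k <= Bf k)%N, forall k, (Bf k <= H1 ^ E k)%N
    & forall g k, Int (Bf k) ((dn k)%:R * x g k)].
Proof.
move=> Hx.
have [H HH] := choice (fun g => let: ex_intro2 H H0 P := Hx g in ex_intro _ H (conj H0 P)).
have [d Hd] := choice (fun gk : G * nat => (HH gk.1).2 gk.2).
pose H1 := (\prod_g H g)%N.
have H10 : (0 < H1)%N by rewrite prodn_gt0 // => g; have [] := HH g.
exists (fun k => \prod_g d (g, k))%N, (fun k => H1 ^ E k)%N, H1; split=> //.
- by move=> k; rewrite prodn_gt0 // => g; have [/andP[]] := Hd (g, k).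
- by move=> k; rewrite /H1 expn_prod; apply: leq_prod => g _; have [/andP[]] := Hd (g, k).
move=> g k; rewrite (bigD1 g) //= natrM [_%:R * _]mulrC -mulrA /H1 expn_prod (bigD1 g) //= mulnC.
apply: IntM; last by have [] := Hd (g, k).
by apply: Int_le (Int_nat _ _); apply: leq_prod => g' _; have [/andP[]] := Hd (g', k).
Qed.
End Heights.

(** * Independence over a number field for a finite set of parameters *)

Section Independence.
Import mpoly.
Variables (m : nat) (c : nat -> nat).
Notation n := m.+1.
Hypothesis cn : c n != 0%N.
Variable rts : seq algC.
Hypotheses (rtsE : cpoly m c algC = rootprod rts) (nd : nondeg rts) (no_unity : no_root_of_unity rts).
Variable r : nat -> nat.
Hypotheses (r_rec : recurrence m c r) (r_neq0 : exists k, r k != 0%N)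
 (r_ngeo : forall th : algC, exists k, (r k)%:R != th ^+ k * (r 0%N)%:R).
Variables (K : fieldType) (R : archiRealFieldType) (ab : K -> R).
Hypotheses (charK : [pchar K] =i pred0) (ab_ge0 : nonneg ab) (ab_eq0 : definite ab)
  (abM : multiplicative ab) (abD : subadditive ab) (ab_nat : forall k, (0 < k)%N -> k%:R^-1 <= ab k%:R).
Hypothesis weight : has_weight m c R.
Variables (L : fieldExtType rat) (emb : {rmorphism L -> K}) (a : L).
Hypotheses (al_gt0 : 0 < ab (emb a)) (al_lt1 : ab (emb a) < 1).
Hypothesis roots : forall x : L, x != 0 -> forall k, (0 < k)%N -> exists xi : K, xi ^+ k = emb x.
Variables (q N : nat) (al be : 'I_q -> L) (mm : 'I_q -> nat) (Nu : nat) (bu : 'I_Nu -> L).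
Hypotheses (al_neq0 : forall i, al i != 0)
  (be_adm : forall i k, 1 - be i * a ^+ r k != 0) (bu_adm : forall u k, 1 - bu u * a ^+ r k != 0)
  (data_inj : forall i j, al i = al j -> be i = be j -> mm i = mm j -> i = j)
  (bu_neq0 : forall u, bu u != 0) (bu_inj : injective bu).
Notation Ny := (q * N.+1)%N.
Notation phi := (phi (N := N) al).
Variables (F0 : 'I_Ny -> K) (U0 : 'I_Nu -> K).
Hypotheses (F0P : forall y, islim ab (fun M => emb (SL r a al be mm y 0 M)) (F0 y))
  (U0P : forall u, islim ab (fun M => emb (PL r a bu u 0 M)) (U0 u)).

Notation beY := (fun y : 'I_Ny => be (blk y)).
Notation mmY := (fun y : 'I_Ny => mm (blk y)).
Notation valsL := (@vals L n (vv m r) Ny Nu phi beY mmY bu).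
Notation phiK := (fun y j => emb (phi y j)).
Notation valsK := (@vals K n (vv m r) Ny Nu phiK (fun y => emb (beY y)) mmY (fun u => emb (bu u))).

Lemma map_vals jb J v : map_mpoly emb (valsL jb J v) = valsK jb J v.
Proof.
rewrite /vals; case: (split v) => [y|u].
  rewrite /fser (raddf_sum (map_mpoly emb)); apply: eq_bigr => k _.
  rewrite /= map_mpolyZ rmorphXn; congr (_ *: _ ^+ _).
  rewrite /gM /geo rmorphM /= map_mpolyX (raddf_sum (map_mpoly emb)); congr (_ * _).
  by apply: eq_bigr => e _; rewrite /= rmorphXn /= map_mpolyZ map_mpolyX.
rewrite /user rmorph_prod; apply: eq_bigr => k _.
by rewrite rmorphB rmorph1 /= map_mpolyZ map_mpolyX.
Qed.

Lemma roots_inv x k : x != 0 -> (0 < k)%N -> exists xi : K, xi ^+ k = (emb x)^-1.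
Proof.
move=> x0 k0; have [|xi e] := @roots x^-1 _ k k0; first by rewrite invr_eq0.
by exists xi; rewrite e fmorphV.
Qed.

(** Instance of [formal_indep] with the fraction field of K[z]. Within one class of equal beta and
    mm the alpha are distinct by [data_inj], so [phi_independent] supplies the nonvanishing of
    [Cphi]. *)
Lemma formal_ind jb (jbP : forall J j, (jb J <= j)%N -> (J <= mdeg (vv m r j))%N) (P : {mpoly {mpoly K[n]}[Ny + Nu]}) :
  (forall J, hord J P.@[fun v => map_mpoly emb (valsL jb J v)]) -> P = 0.
Proof.
have [wt [rho [wtD wt_gt0 wt_Om rho_gt1]]] := weight.
have [sigF HsigF] := choice (fun d => @frac_extension _ _ (@sg K n (Om c) d) (@sg_inj K n (Om c) (OmD c) (Om_inj cn) d)).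
have [B [Bblk Bdiag Bphi AB]] := Am_inv N al_neq0.
have tf_inj : injective (@tofrac {mpoly K[n]}) by move=> x y /eqP; rewrite tofrac_eq => /eqP.
have tf_frac (x : {fraction {mpoly K[n]}}) : exists a b, b != 0 /\ x = tofrac a / tofrac b.
  by exists (\n_(repr x)), (\d_(repr x)); split; [exact: denom_ratioP|exact: fracE].
have eb_neq0 x : (emb x != 0) = (x != 0) by rewrite fmorph_eq0.
have H1 u : emb (bu u) != 0 by rewrite eb_neq0.
have H2 : injective (fun u => emb (bu u)) by move=> u u' /fmorph_inj/bu_inj.
have H3 y : emb (beY y) != 0 -> forall k, (0 < k)%N -> exists xi : K, xi ^+ k = (emb (beY y))^-1.
  by rewrite eb_neq0 => y0 k; exact: roots_inv.
have H4 u k : (0 < k)%N -> exists xi : K, xi ^+ k = (emb (bu u))^-1 by apply: roots_inv.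
have H5 d (y y' : 'I_Ny) : emb (B d y y') != 0 -> (y <= y')%N.
  by rewrite eb_neq0 => /Bblk[]; exact: leq_block.
have H6 d (y : 'I_Ny) : emb (B d y y) != 0 by rewrite eb_neq0.
have H7 d (y y' : 'I_Ny) : emb (B d y y') != 0 -> emb (beY y) = emb (beY y') /\ mmY y = mmY y'.
  by rewrite eb_neq0 => /Bblk[-> _].
have H8 d (y : 'I_Ny) j : \sum_y' emb (B d y y') * emb (phi y' (d + j)%N) = emb (phi y j).
  transitivity (emb (\sum_y' B d y y' * phi y' (d + j)%N)); last by congr (emb _); exact: Bphi.
  rewrite (rmorph_sum emb); apply: eq_bigr => y' _; exact/esym/(rmorphM emb).
have H9 (kap : 'I_Ny -> K) beta mu : (exists y, [/\ emb (beY y) = beta, mmY y = mu & kap y != 0]) ->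
  forall j0, exists2 j, (j0 <= j)%N & Cphi phiK (fun y => emb (beY y)) mmY kap beta mu j != 0.
  move=> [y0 [e1 e2 k0]] j0.
  pose Pq i := (emb (be i) == beta) && (mm i == mu).
  have alK i : emb (al i) != 0 by rewrite eb_neq0.
  have [||j le nz] := @phi_independent K q N (emb \o al) alK Pq kap _ _ j0.
  - move=> i i' /andP[/eqP b1 /eqP m1] /andP[/eqP b2 /eqP m2] /= /fmorph_inj e.
    by apply: data_inj => //; [apply: (fmorph_inj emb); rewrite b1 b2|rewrite m1 m2].
  - by exists y0; rewrite // /Pq e1 e2 !eqxx.
  exists j => //; apply: contraNneq nz => H; apply/eqP; apply: etrans H; apply: eq_bigr => y _.
  by rewrite !phiE /= rmorphM rmorph_nat rmorphXn.
move=> HP; apply: (@formal_indep K n charK _ (@tofrac {mpoly K[n]}) tf_inj tf_frac (Om c) (OmD c) (Om_inj cn) (mdeg_Om cn)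
  sigF HsigF (vv m r) (vvS r_rec) (vv_neq0 cn r_rec r_neq0 0) (vv_nonparallel cn rtsE nd r_rec r_neq0 r_ngeo)
  (orbits_diverge cn rtsE no_unity) Ny Nu phiK (fun y => emb (beY y)) mmY (fun u => emb (bu u))
  (fun d y y' => emb (B d y y')) H1 H2 H3 H4 H5 H6 H7 H8 H9 R wt rho wtD wt_gt0 wt_Om rho_gt1 jb jbP).
move=> J; have := HP J; rewrite (_ : P.@[_] = P.@[valsK jb J]) //.
by apply: meval_eq => v; rewrite map_vals.
Qed.

Definition value (v : 'I_(Ny + Nu)) : K := match split v with inl y => F0 y | inr u => U0 u end.

(** What [no_relation] asks of the values is collected here: functional equations, growth,
    approximation by truncations, and heights of all generators together with the coordinates of
    z(k). *)
Theorem families_independent (P : {mpoly L[Ny + Nu]}) : (map_mpoly emb P).@[value] = 0 -> P = 0.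
Proof.
move=> Proot; apply/eqP/negPn/negP => P0.
have [C1 [k1 [C1_gt0 C1P]]] := xs_dominates cn rtsE nd.
have [B [Bblk Bdiag Bphi AB]] := Am_inv N al_neq0.
have [jb [jb_mono jbP jb_tail]] := tail_exponent cn rtsE nd no_unity r_rec r_neq0 ab_ge0 al_gt0 al_lt1 al C1_gt0 C1P.
pose s : 'I_Ny -> nat -> L := s r a al be mm; pose pi := pi r a bu; pose A := Am (N := N) al.
pose fv := fv r emb a al be mm B F0; pose uv := uv r emb a bu U0.
have fvE := fvE r emb a be mm AB F0 : forall y k, fv y 0%N = _.
have uvE := uvE emb bu_adm U0 : forall u k, uv u 0%N = _.
have uvN0 := uv_neq0 cn rtsE no_unity ab_ge0 ab_eq0 abM abD al_gt0 al_lt1 be bu_adm U0P C1_gt0 jb_tail.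
have small (x : nat -> L) : (exists2 D, 1 <= D & forall k, ab (emb (x k)) <= D ^+ k) -> egb m c ab (emb a) C1 0 (fun k => emb (x k)).
  by move=> [D D1 H]; exists D; split; [exact: le_trans D1|exists 0%N => k _; rewrite mul0n mulr1].
have s_egb (y : 'I_Ny) := small _ (s_bound cn rtsE nd no_unity r_rec r_neq0 ab_ge0 ab_eq0 abM abD al_gt0 al_lt1 al mm be_adm y).
have pi_egb u := small _ (pi_bound r ab_ge0 ab_eq0 abM abD al_gt0 al_lt1 bu u).
have charL : [pchar L] =i pred0.
  by move=> p; rewrite -(fmorph_pchar emb) charK.
have A_exp y y' : expoly (fun k => emb (A k y y')).
  have alK i : (emb \o al) i != 0 by rewrite /= fmorph_eq0.
  apply: expoly_ext (Am_expoly alK charK y y') => k; rewrite /A /Am /toeplitz rmorphM rmorphXn; congr (_ * _).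
  by case: ifP => _; rewrite ?rmorph0 // !pwE rmorph_nat.
have approx v J : egb m c ab (emb a) C1 J (fun k => wv fv uv k v - (map_mpoly emb (valsL jb J v)).@[zK c (emb a) k]).
  rewrite /wv /vals; case: (split v) => [y|u].
    have H := fv_approx cn rtsE nd no_unity r_rec r_neq0 ab_ge0 ab_eq0 abM abD al_gt0 al_lt1 bu be_adm AB F0P C1_gt0 C1P jb_tail y J.
    by apply: egb_ext H => k; rewrite emb_meval.
  have H := uv_approx cn rtsE no_unity r_rec ab_ge0 ab_eq0 abM abD al_gt0 al_lt1 be bu_adm U0P C1_gt0 jb_tail u J.
  by apply: egb_ext H => k; rewrite emb_meval.
have cong J J' v (le : (J <= J')%N) := @trunc_cong L n (vv m r) (vv_neq0 cn r_rec r_neq0) Ny Nu phi beY mmY bu jb jb_mono jbP J J' v le.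
have Proot' : (map_mpoly emb P).@[wv fv uv 0] = 0.
  rewrite -[RHS]Proot; apply: meval_eq => v; rewrite /wv /value; case: (split v) => [y|u]; [exact: fv0|exact: uv0].
have ghE := @gh_ext m c L; have ghM := @ghM m c L; have ghc := gh_cst cn (L := L).
have gsum := gh_sum cn rtsE no_unity (L := L); have gprod := gh_prod cn rtsE no_unity (L := L).
have g_ar : gh m c (fun j => a ^+ r j) by apply: (gh_pow cn); exact: (r_upper cn r_rec).
have g_pow x : gh m c (fun j => x ^+ j : L) := gh_natpow cn rtsE no_unity x.
have g_lin b : gh m c (fun j => 1 - b * a ^+ r j).
  apply: ghE (ghD cn (ghc 1) (ghM _ _ (ghc (- b)) g_ar)) => j; by rewrite mulNr.
have g_bin l : gh m c (fun j => 'C(j, l)%:R : L).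
  apply: (@gh_nat m c cn rts rtsE no_unity L (fun j => 'C(j, l)) 2) => j.
  have [le|lt] := leqP l j; last by rewrite bin_small.
  have := expnDn 1 1 j; rewrite addn1 => ->.
  rewrite (bigD1 (Ordinal (le : (l < j.+1)%N))) //= !exp1n !muln1; exact: leq_addr.
have g_gen (g : gen Ny Nu + 'I_n) : gh m c (match g with inl g' => @tgen L Ny Nu s pi A g' | inr i => fun k => a ^+ xs c U_(i)%MM k end).
  case: g => [[[y|u]|[y y']]|i] /=.
  - have h : gh m c (fun j => phi y j * ps be mm (blk y) (a ^+ r (0 + j))).
      apply: (ghM _ _ (ghM _ _ (g_bin _) (g_pow _))); apply: (ghX cn).
      by apply: (ghM _ _ g_ar); apply: (gh_inv cn) => // k; exact: be_adm.
    exact: (gsum _ h).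
  - exact: (gprod _ (g_lin (bu u))).
  - have h : gh m c (fun k => toeplitz (pw L k) y y').
      case h : ((blk y == blk y') && (lev y <= lev y')%N).
        by apply: ghE (g_bin (lev y' - lev y)%N) => k; rewrite /toeplitz h pwE.
      by apply: ghE (ghc 0) => k; rewrite /toeplitz h.
    exact: (ghM _ _ (g_pow (al (blk y))) h).
  by apply: (gh_pow cn); exists (mdeg U_(i)%MM) => k; exact: (xs_upper cn).
have [dn [Bf [H1 [dn_gt0 dn_le Bf_le Hht]]]] := gh_common g_gen.
(* [gh] has already put exponential factors into H1^(E k), so the base D0 is 1. *)
have Bf_le' k : (Bf k <= 1 ^ k.+1 * H1 ^ E m c k)%N by rewrite exp1n mul1n.
have ht1 g k : Int (Bf k) ((dn k)%:R * tgen s pi A g k) by exact: (Hht (inl g)).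
have ht2 (i : 'I_n) k : Int (Bf k) ((dn k)%:R * zL c a k i) by exact: (Hht (inr i)).
refine (no_relation cn rtsE nd no_unity charK ab_ge0 ab_eq0 abM abD ab_nat al_gt0 al_lt1
  C1_gt0 C1P fvE uvE uvN0 (pi_neq0 bu_adm) AB s_egb pi_egb A_exp approx cong
  (formal_ind jbP) P0 Proot' dn_gt0 dn_le Bf_le' ht1 ht2).
Qed.

End Independence.

Lemma irreducible_dvd (p g : {poly rat}) (z : algC) : irreducible_poly p ->
  root (map_poly ratr p) z -> root (map_poly ratr g) z -> p %| g.
Proof.
move=> irr rp rg; have [//|ndv] := boolP (p %| g).
have cop : coprimep p g by rewrite irreducible_poly_coprime.
have : coprimep (map_poly (@ratr algC) p) (map_poly ratr g) by rewrite coprimep_map.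
by move/coprimep_root => /(_ _ rp); rewrite -/(root _ _) rg.
Qed.

Lemma irreducible_norat (p : {poly rat}) (x : rat) : irreducible_poly p -> (2 < size p)%N -> ~~ root p x.
Proof.
move=> [_ irr] sp; apply/negP; rewrite -dvdp_XsubCl => /irr.
rewrite size_XsubC => /(_ isT) /eqp_size; rewrite size_XsubC => e; by rewrite -e in sp.
Qed.

(** * Nondegeneracy of the characteristic roots under condition (R) *)

Section Dominant.
Variables (p : {poly rat}) (rho1 : algC) (rhos : seq algC).
Hypotheses (irr : irreducible_poly p) (pE : map_poly ratr p = \prod_(z <- rho1 :: rhos) ('X - z%:P))
  (dom : {in rhos, forall z, `|z| < rho1}).

(* Over Q(rho1^N), the polynomials p and X^N - rho1^N have only the root rho1 in common. *)
Lemma root_from_power N : (0 < N)%N -> exists t : {poly rat},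
  forall z, z \in rho1 :: rhos -> z = (map_poly ratr t).[z ^+ N].
Proof.
move=> N0.
have rootE z : root (map_poly ratr p) z = (z \in rho1 :: rhos) by rewrite pE root_prod_XsubC.
have [Qs [QsC [s1 e1 _]]] := num_field_exists (rho1 :: rhos).
case: s1 e1 => [|q1 qs] //= [q1E qsE].
pose w := q1 ^+ N; pose K1 := <<1%AS; w>>%AS.
have pQ : map_poly (in_alg Qs) p = \prod_(z <- q1 :: qs) ('X - z%:P).
  apply: (map_poly_inj QsC); rewrite -map_poly_comp (@eq_map_poly _ _ _ (@ratr algC)); last first.
    by move=> x /=; rewrite rmorphZ_num rmorph1 mulr1.
  rewrite pE -q1E -qsE -map_cons big_map rmorph_prod; apply: eq_bigr => z _.
  by rewrite rmorphB /= map_polyX map_polyC.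
have mdvd1 : minPoly K1 q1 %| \prod_(z <- q1 :: qs) ('X - z%:P).
  apply: minPoly_dvdp; last by rewrite root_prod_XsubC mem_head.
  rewrite -pQ; apply: (polyOverSv (sub1v _)); apply/polyOver1P; by exists p.
have mdvd2 : minPoly K1 q1 %| 'X^N - w%:P.
  apply: minPoly_dvdp; last by rewrite /root !hornerE subrr.
  by rewrite rpredB ?rpredX ?polyOverX // polyOverC; exact: memv_adjoin.
(* The minimal polynomial of q1 over Q(w) divides both p and X^N - w. A second root of it would be
   some z among [rhos] with z^N = rho1^N, so |z| = rho1, which dominance excludes; the degree is
   1. *)
have qK : q1 \in K1.
  rewrite -adjoin_deg_eq1 eqn_leq [(0 < _)%N]isT andbT -ltnS -size_minPoly.
  have [mk e] := dvdp_prod_XsubC mdvd1; rewrite (eqp_size e) size_prod_XsubC.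
  have mem z : z \in mask mk (q1 :: qs) -> z ^+ N = w.
    move=> zm; have : root (minPoly K1 q1) z by rewrite (eqp_root e) root_prod_XsubC.
    by rewrite -dvdp_XsubCl => /dvdp_trans/(_ mdvd2); rewrite dvdp_XsubCl /root !hornerE subr_eq0 => /eqP.
  case: mk mem {e} => [|b mk] mem; first by case: (q1 :: qs).
  have nil : mask mk qs = [::].
    case mq : (mask mk qs) => [//|z zs].
    have zq : z \in qs by apply: (@mem_mask _ _ mk); rewrite mq mem_head.
    have /mem zw : z \in mask (b :: mk) (q1 :: qs) by rewrite mask_cons mem_cat mq mem_head orbT.
    have zr : QsC z \in rhos by rewrite -qsE map_f.
    have := dom zr; have : `|QsC z| ^+ N = `|rho1| ^+ N by rewrite -!normrX -q1E -!rmorphXn zw.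
    have r0 : 0 <= rho1 by apply: le_trans (ltW (dom zr)).
    move/eqP; rewrite eqrXn2 // ?normr_ge0 // => /eqP ->; rewrite ger0_norm // ltxx //.
  by rewrite mask_cons nil cats0 size_nseq; case: b {mem}.
have [t tP /esym tE] := Fadjoin_polyP qK.
have /polyOver1P[t0 tE0] := tP; exists t0.
pose g : {poly rat} := 'X - (t0 \Po 'X^N).
have gE z : (map_poly (@ratr algC) g).[z] = z - (map_poly ratr t0).[z ^+ N].
  by rewrite /g rmorphB /= map_polyX map_comp_poly map_polyXn !hornerE horner_comp !hornerE.
have g0 : root (map_poly (@ratr algC) g) rho1.
  rewrite /root gE subr_eq0; apply/eqP; rewrite -q1E -{1}tE tE0 -rmorphXn -horner_map -map_poly_comp.
  congr (_.[_]); apply: eq_map_poly => x /=; by rewrite rmorphZ_num rmorph1 mulr1.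
move=> z zr; have pg : p %| g by apply: irreducible_dvd irr _ g0; rewrite rootE mem_head.
have : root (map_poly (@ratr algC) g) z.
  have [g' ->] := dvdpP _ _ pg; rewrite rmorphM rootM rootE zr orbT //.
by rewrite /root gE subr_eq0 => /eqP.
Qed.
End Dominant.

Section Facts.
Variables (m : nat) (c : nat -> nat).
Notation n := m.+1.
Hypotheses (cn : c n != 0%N) (m1 : (0 < m)%N).
Variable r : nat -> nat.
Hypotheses (r_rec : recurrence m c r) (r_neq0 : exists k, r k != 0%N).

Lemma rts_neq0 rts : cpoly m c algC = rootprod rts -> forall z, z \in rts -> z != 0.
Proof.
move=> e z zr; apply: contraTneq zr => ->; rewrite -root_prod_XsubC -/(rootprod rts) -e /root horner_coef0.
by rewrite cpoly0 oppr_eq0 pnatr_eq0.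
Qed.

Lemma geometric_root (th : algC) : (forall k, (r k)%:R = th ^+ k * (r 0%N)%:R) ->
  [/\ th != 0, (r 0%N) != 0%N & root (cpoly m c algC) th].
Proof.
move=> H; have r0 : r 0%N != 0%N.
  have [k rk] := r_neq0; apply: contraNneq rk => r0; have := H k; rewrite r0 mulr0 => /eqP.
  by rewrite pnatr_eq0.
have rt : root (cpoly m c algC) th.
  have := ann_rec algC r_rec 0; rewrite /act => h.
  have : (cpoly m c algC).[th] * (r 0%N)%:R = 0.
    rewrite horner_coef mulr_suml -[RHS]h; apply: eq_bigr => j _; by rewrite add0n [in RHS]H mulrA.
  by move/eqP; rewrite mulf_eq0 pnatr_eq0 (negPf r0) orbF.
split=> //; apply: contraTneq rt => ->; rewrite /root horner_coef0 cpoly0 oppr_eq0 pnatr_eq0 //.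
Qed.

(** The form in which condition (R) is used in the rest of the proof, the same for both kinds of
    place. *)
Definition good_roots rts := [/\ cpoly m c algC = rootprod rts, nondeg rts,
  forall z N, z \in rts -> (0 < N)%N -> z ^+ N != 1 & forall th : algC, exists k, (r k)%:R != th ^+ k * (r 0%N)%:R].

(** [root_from_power] recovers all roots from their N-th powers by a single rational polynomial, so
    equal powers come from equal roots. A root that is a root of unity would be rational, and so
    would be the ratio of a geometric r; an irreducible polynomial of degree at least 2 has no
    rational root. *)
Lemma good_roots_prime rho1 rhos : irreducible_poly (cpoly m c rat) ->
  cpoly m c algC = rootprod (rho1 :: rhos) -> {in rhos, forall z, `|z| < rho1} -> good_roots (rho1 :: rhos).
Proof.
move=> irr e dom.
have sp : (2 < size (cpoly m c rat))%N by rewrite size_cpoly !ltnS.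
have pE : map_poly ratr (cpoly m c rat) = \prod_(z <- rho1 :: rhos) ('X - z%:P) by rewrite map_cpoly.
have RF := root_from_power irr pE dom.
have norat x z : z \in rho1 :: rhos -> z != ratr x.
  move=> zr; apply: contraNneq (irreducible_norat x irr sp) => zx.
  by move: zr; rewrite zx -root_prod_XsubC -pE fmorph_root.
split=> //.
- split=> [|z z' N zr zr' ne N0]; first exact: rts_neq0.
  have [t Ht] := RF N N0; apply: contra ne => /eqP eN; by rewrite (Ht z zr) (Ht z' zr') eN.
- move=> z N zr N0; have [t Ht] := RF N N0; apply/eqP => z1.
  have /negP := norat t.[1] z zr; apply; by rewrite {1}(Ht z zr) z1 -(rmorph1 (@ratr algC)) horner_map.
move=> th; apply: contrapT => H.
have H' k : (r k)%:R = th ^+ k * (r 0%N)%:R by apply/eqP/negPn/negP => nz; apply: H; exists k.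
have [th0 r0 rt] := geometric_root H'; rewrite e root_prod_XsubC in rt.
have /negP := norat ((r 1%N)%:R / (r 0%N)%:R) th rt; apply.
by rewrite fmorph_div !rmorph_nat H' expr1 mulfK // pnatr_eq0.
Qed.

(** If a root z is a root of unity, its conjugate 1/z is a root too. When they differ, their
    quotient z^2 is torsion, against the hypothesis on quotients; when they agree, z is 1 or -1. *)
Lemma good_roots_infinite : (cpoly m c rat).[1] != 0 -> (cpoly m c rat).[-1] != 0 ->
  (forall z w, root (cpoly m c algC) z -> root (cpoly m c algC) w -> z != w -> forall N, (0 < N)%N -> (z / w) ^+ N != 1) ->
  ~ (r 1%N <> 0%N /\ forall k, (k <= n - 2)%N -> (r k * r k.+2 = r k.+1 ^ 2)%N) -> exists rts, good_roots rts.
Proof.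
move=> p1 pN1 ratio ngeo.
have [rts e] : exists rts, cpoly m c algC = rootprod rts.
  have [rts e] := closed_field_poly_normal (cpoly m c algC); exists rts; rewrite [LHS]e.
  rewrite lead_coefE size_cpoly /= coefB coefXn eqxx coef_sum big1 ?subr0 ?scale1r // => i _.
  by rewrite coefZ coefXn gtn_eqF ?mulr0.
exists rts; have rootE z : z \in rts = root (cpoly m c algC) z by rewrite e root_prod_XsubC.
have nz := rts_neq0 e.
have real z : root (cpoly m c algC) z -> root (cpoly m c algC) z^*.
  by move=> rz; rewrite -(map_cpoly m c (@Num.conj algC)) fmorph_root.
have n1 (x : rat) : (cpoly m c rat).[x] != 0 -> ratr x \notin rts.
  by rewrite rootE -(map_cpoly m c (@ratr algC)) fmorph_root /root.
split=> //.
- split=> [//|z w N]; rewrite !rootE => rz rw ne N0; have := ratio z w rz rw ne N N0; apply: contra => /eqP eN.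
  by rewrite expr_div_n eN divff // expf_neq0 // nz // rootE.
- move=> z N zr N0; apply/eqP => z1.
  have nz1 : `|z| = 1.
    by apply/eqP; rewrite -(@eqrXn2 _ N) ?normr_ge0 ?ler01 // -normrX z1 normr1 expr1n.
  have zz : z * z^* = 1 by rewrite -normCK nz1 expr1n.
  have z0 := nz z zr.
  have [ez|ne] := eqVneq z z^*; last first.
    have rz : root (cpoly m c algC) z by rewrite -rootE.
    have NN : (0 < N + N)%N by rewrite addn_gt0 N0.
    have /negP := ratio z z^* rz (real z rz) ne (N + N)%N NN; apply; apply/eqP.
    have -> : z / z^* = z ^+ 2 by apply: (mulIf (x := z^*)); rewrite ?conjC_eq0 // divfK ?conjC_eq0 // expr2 -mulrA zz mulr1.
    by rewrite -exprM mulnC exprM exprD z1 mulr1 expr1n.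
  have : z ^+ 2 == 1 by rewrite expr2 {2}ez zz.
  rewrite sqrf_eq1 => /orP[/eqP z1'|/eqP z1'].
    by have := n1 1 p1; rewrite rmorph1 -z1' zr.
  by have := n1 (-1) pN1; rewrite rmorphN rmorph1 -z1' zr.
move=> th; apply: contrapT => H.
have H' k : (r k)%:R = th ^+ k * (r 0%N)%:R by apply/eqP/negPn/negP => h; apply: H; exists k.
have [th0 r0 _] := geometric_root H'; apply: ngeo; split.
  by move=> r1; have /esym/eqP := H' 1%N; rewrite r1 mulf_eq0 expf_eq0 (negPf th0) pnatr_eq0 (negPf r0).
move=> k _; apply/eqP; rewrite -(eqr_nat algC) natrM natrX (H' k) (H' k.+1) (H' k.+2) !exprS.
by apply/eqP; ring.
Qed.
End Facts.

(** * Independence of the values *)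

Section Transfer.
Import mpoly.

Lemma mmap_ext (A B : comNzRingType) (h h' : A -> B) N (f f' : 'I_N -> B) (P : {mpoly A[N]}) :
  h =1 h' -> f =1 f' -> mmap h f P = mmap h' f' P.
Proof.
by move=> eh ef; apply: eq_bigr => nu _; rewrite eh; congr (_ * _); apply: eq_bigr => i _; rewrite ef.
Qed.

Lemma meval_mmap (A B : comNzRingType) (g : {rmorphism A -> B}) (C : comNzRingType) (h : {rmorphism C -> A}) N M
  (x : 'I_M -> B) (f : 'I_N -> {mpoly A[M]}) (P : {mpoly C[N]}) :
  (map_mpoly g (mmap (@mpolyC M A \o h) f P)).@[x] = mmap (g \o h) (fun i => (map_mpoly g (f i)).@[x]) P.
Proof.
rewrite /mmap (raddf_sum (map_mpoly g)) (raddf_sum (meval x)); apply: eq_bigr => nu _ /=.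
rewrite rmorphM /= map_mpolyC mevalM mevalC /mmap1 rmorph_prod rmorph_prod; congr (_ * _).
by apply: eq_bigr => i _; rewrite !rmorphXn.
Qed.

(** Rescaling by nonzero [la] and renaming by the injection [v] are undone by the substitution
    [back], so a rational relation between the scaled values gives a relation over L between the
    original ones. *)
Lemma independent_transfer (L : fieldExtType rat) (K : fieldType) (emb : {rmorphism L -> K}) N M
  (v : 'I_N -> 'I_M) (la : 'I_N -> L) (x : 'I_M -> K) (P : {mpoly rat[N]}) : injective v -> (forall i, la i != 0) ->
  (forall Q : {mpoly L[M]}, (map_mpoly emb Q).@[x] = 0 -> Q = 0) ->
  mmap (@ratr K) (fun i => emb (la i) * x (v i)) P = 0 -> P = 0.
Proof.
move=> v_inj la0 HQ HP.
pose Q : {mpoly L[M]} := mmap (@mpolyC M L \o in_alg L) (fun i => la i *: 'X_(v i)) P.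
have Q0 : Q = 0.
  apply: HQ; rewrite meval_mmap -[RHS]HP; apply: mmap_ext => [x0|i]; first exact: fmorph_eq_rat (emb \o in_alg L) x0.
  by rewrite map_mpolyZ map_mpolyX mevalZ mevalXU.
pose back (w : 'I_M) : {mpoly L[N]} := if [pick i | v i == w] is Some i then (la i)^-1 *: 'X_i else 0.
have backE i : back (v i) = (la i)^-1 *: 'X_i.
  rewrite /back; case: pickP => [j /eqP/v_inj -> //|/(_ i)]; by rewrite eqxx.
have := @meval_mmap L _ (@mpolyC N L) rat (in_alg L) N M back (fun i => la i *: 'X_(v i)) P.
rewrite -/Q Q0 rmorph0 meval0 => /esym H.
have PE : map_mpoly (in_alg L) P = 0.
  rewrite -[RHS]H; apply: mmap_ext => // i.
  by rewrite map_mpolyZ map_mpolyX mevalZ mevalXU backE mul_mpolyC scalerA divff ?scale1r.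
apply/mpolyP => nu; apply: (fmorph_inj (in_alg L)).
by have := congr1 (mcoeff nu) PE; rewrite mcoeff_map_mpoly !mcoeff0 => ->; rewrite rmorph0.
Qed.
End Transfer.

Lemma number_field (s : seq algC) : exists (Qs : fieldExtType rat) (QsC : {rmorphism Qs -> algC}),
  forall x, x \in s -> exists y, QsC y = x.
Proof.
have [Qs [QsC [s1 <- _]]] := num_field_exists s; exists Qs, QsC => x /mapP[y _ ->]; by exists y.
Qed.

Lemma factorial_cancel (F : fieldType) (x z p b w v u s : F) : x != 0 -> z != 0 ->
  p / (x * z) * (w * (s * x * b * (z * v * u))) = s * (b * p) * (w * v * u).
Proof. by move=> x0 z0; field; rewrite x0 z0. Qed.

Section IndexedValues.
Import mpoly.
Variables (m : nat) (c : nat -> nat).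
Notation n := m.+1.
Hypothesis cn : c n != 0%N.
Variables (rts : seq algC) (r : nat -> nat).
Hypotheses (rtsP : good_roots m c r rts) (r_rec : recurrence m c r) (r_neq0 : exists k, r k != 0%N).
Variables (K : fieldType) (R : archiRealFieldType) (ab : K -> R).
Hypotheses (charK : [pchar K] =i pred0) (ab_ge0 : nonneg ab) (ab_eq0 : definite ab)
  (abM : multiplicative ab) (abD : subadditive ab) (ab_nat : forall k, (0 < k)%N -> k%:R^-1 <= ab k%:R).
Hypothesis weight : has_weight m c R.
Variables (emb : {rmorphism algC -> K}) (a : algC).
Hypotheses (al_gt0 : 0 < ab (emb a)) (al_lt1 : ab (emb a) < 1).

(** The entries are alpha, beta, the order in y and the order in x; beta = 0 gives the values of the
    functions F. The right summand is the beta of a value of G. *)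
Definition Idx := ((algC * algC * nat) * nat + algC)%type.
Definition admC (be : algC) := forall k, 1 - be * a ^+ r k != 0.
Definition valid (i : Idx) := match i with | inl (al, be, _, _) => al != 0 /\ admC be | inr be => be != 0 /\ admC be end.
Variable val : Idx -> K.
Hypotheses (val_F : forall al be mm l, al != 0 -> admC be ->
  islim ab (fun M => emb (\sum_(k < M) a ^+ r k * (((k ^_ l)%:R * al ^+ (k - l)) *
    (mm`!%:R * (a ^+ r k) ^+ mm * (1 - a ^+ r k * be)^-1 ^+ mm.+1)))) (val (inl (al, be, mm, l))))
 (val_G : forall be, admC be -> islim ab (fun M => emb (\prod_(k < M) (1 - a ^+ r k * be))) (val (inr be))).

Theorem indexed_independent N (ix : 'I_N -> Idx) (P : {mpoly rat[N]}) : injective ix -> (forall i, valid (ix i)) ->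
  mmap (@ratr K) (fun i => val (ix i)) P = 0 -> P = 0.
Proof.
move=> ix_inj ix_valid HP.
have [rtsE nd no_unity r_ngeo] := rtsP.
pose fa i := if ix i is inl (al, _, _, _) then al else 1.
pose fb i := match ix i with inl (_, be, _, _) => be | inr be => be end.
pose fm i := if ix i is inl (_, _, mm, _) then mm else 0%N.
pose fl i := if ix i is inl (_, _, _, l) then l else 0%N.
pose isF i := if ix i is inl _ then true else false.
have [L [LC HLC]] := number_field (a :: [seq fa i | i : 'I_N] ++ [seq fb i | i : 'I_N]).
have [aL aLE] := HLC a (mem_head _ _).
have Ha i : exists y, LC y = fa i.
  by apply: HLC; rewrite inE mem_cat; apply/orP; right; apply/orP; left; apply: map_f; rewrite mem_enum.
have Hb i : exists y, LC y = fb i.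
  by apply: HLC; rewrite inE mem_cat; apply/orP; right; apply/orP; right; apply: map_f; rewrite mem_enum.
have [pa paE] := choice Ha; have [pb pbE] := choice Hb.
have faN0 i : fa i != 0.
  by have := ix_valid i; rewrite /fa; case: (ix i) => [[[[al be] mm] l] []//|be _]; exact: oner_neq0.
have fbadm i : admC (fb i).
  by have := ix_valid i; rewrite /fb; case: (ix i) => [[[[al be] mm] l] []//|be []].
(* Values that differ only in the order l of the x-derivative share a triple and become different
   levels of one block. *)
pose tr := undup [seq (pa i, pb i, fm i) | i <- enum 'I_N & isF i].
pose us := undup [seq pb i | i <- enum 'I_N & ~~ isF i].
pose q := size tr; pose Nu := size us; pose Nl := (\max_i fl i)%N.
pose tnth0 (j : 'I_q) := nth (0, 0, 0%N) tr j.
pose al j := (tnth0 j).1.1; pose be j := (tnth0 j).1.2; pose mm j := (tnth0 j).2.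
pose bu (u : 'I_Nu) := nth 0 us u.
have trP j : exists2 i, isF i & tnth0 j = (pa i, pb i, fm i).
  have : tnth0 j \in tr by rewrite mem_nth.
  by rewrite mem_undup => /mapP[i]; rewrite mem_filter => /andP[fi _] ->; exists i.
have usP u : exists2 i, ~~ isF i & bu u = pb i.
  have : bu u \in us by rewrite mem_nth.
  by rewrite mem_undup => /mapP[i]; rewrite mem_filter => /andP[fi _] ->; exists i.
have al0 j : al j != 0.
  by have [i _ e] := trP j; rewrite /al e -(fmorph_eq0 LC) paE faN0.
have admL x : admC (LC x) -> forall k, 1 - x * aL ^+ r k != 0.
  by move=> H k; rewrite -(fmorph_eq0 LC) rmorphB rmorph1 rmorphM rmorphXn /= aLE; exact: H.
have be_adm j k : 1 - be j * aL ^+ r k != 0.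
  by apply: admL; have [i _ e] := trP j; rewrite /be e /= pbE; exact: fbadm.
have bu_adm u k : 1 - bu u * aL ^+ r k != 0.
  by apply: admL; have [i _ ->] := usP u; rewrite pbE; exact: fbadm.
have bu0 u : bu u != 0.
  have [i nf ->] := usP u; rewrite -(fmorph_eq0 LC) pbE; have := ix_valid i; move: nf; rewrite /isF /fb.
  by case: (ix i) => // b _ [].
have bu_inj : injective bu.
  by move=> u u' /eqP; rewrite /bu nth_uniq ?undup_uniq // => /eqP/val_inj.
have data_inj i j : al i = al j -> be i = be j -> mm i = mm j -> i = j.
  move=> e1 e2 e3; apply: val_inj; apply/eqP; rewrite -(nth_uniq (0, 0, 0%N) (ltn_ord i) (ltn_ord j) (undup_uniq _)).
  rewrite -/(tnth0 i) -/(tnth0 j) [tnth0 i]surjective_pairing [(tnth0 i).1]surjective_pairing.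
  by rewrite [tnth0 j]surjective_pairing [(tnth0 j).1]surjective_pairing -/(al i) -/(be i) -/(mm i) e1 e2 e3.
pose embL : {rmorphism L -> K} := (emb \o LC)%FUN.
have roots (x : L) : x != 0 -> forall k, (0 < k)%N -> exists xi : K, xi ^+ k = embL x.
  by move=> _ k k0; exists (emb (k.-root (LC x))); rewrite -rmorphXn rootCK.
pose Ny := (q * Nl.+1)%N.
pose ll (y : 'I_Ny) := (Nl - lev y)%N.
(* The derivative carries the falling factorial of k times alpha^(k-l) and a factor mm!, whereas
   [phi] and [ps] use binomial(k, l) alpha^k without it. *)
pose sc (y : 'I_Ny) : L := al (blk y) ^+ ll y / ((ll y)`!%:R * (mm (blk y))`!%:R).
pose F0 (y : 'I_Ny) : K := embL (sc y) * val (inl (LC (al (blk y)), LC (be (blk y)), mm (blk y), ll y)).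
pose U0 (u : 'I_Nu) : K := val (inr (LC (bu u))).
have admB x (H : forall k, 1 - x * aL ^+ r k != 0) : admC (LC x).
  by move=> k; rewrite -aLE -rmorphXn -rmorphM -(rmorph1 LC) -rmorphB fmorph_eq0; exact: H.
have natL k : (0 < k)%N -> (k%:R : L) != 0 by exact: natL_neq0.
have F0P y : islim ab (fun M => embL (SL r aL al be mm y 0 M)) (F0 y).
  have alN0 : LC (al (blk y)) != 0 by rewrite fmorph_eq0.
  have h := islimZ ab_ge0 abM (embL (sc y)) (val_F (mm (blk y)) (ll y) alN0 (admB _ (be_adm (blk y)))).
  apply: islim_ext h => M; rewrite -[embL (sc y)]/(emb (LC (sc y))) -rmorphM; congr (emb _).
  rewrite mulr_sumr rmorph_sum; apply: eq_bigr => k _.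
  rewrite /phi /ps add0n -/(ll y) !rmorphM !rmorphXn fmorph_div rmorphB rmorph1 !rmorphM rmorphXn rmorph_nat /= aLE.
  rewrite fmorphV rmorphM !rmorph_nat.
  set A := LC (al _) in alN0 *; set b := LC (be _); set w := a ^+ r k; set l := ll y; set mu := mm _.
  have f0 j : (j`!%:R : algC) != 0 by rewrite pnatr_eq0 -lt0n fact_gt0.
  rewrite expr_div_n -exprVn [b * w]mulrC.
  have [le|lt] := leqP l k; last by rewrite ffact_small // bin_small // !(mul0r, mulr0).
  have Ak : A ^+ k = A ^+ (k - l) * A ^+ l by rewrite -exprD subnK.
  rewrite -bin_ffact natrM Ak [w ^+ mu.+1]exprS; move: (_^-1 ^+ mu.+1) => u.
  exact: factorial_cancel (f0 l) (f0 mu).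
have U0P u : islim ab (fun M => embL (PL r aL bu u 0 M)) (U0 u).
  apply: islim_ext (val_G (admB _ (bu_adm u))) => M; rewrite /embL /=; congr (emb _).
  by rewrite rmorph_prod; apply: eq_bigr => k _; rewrite rmorphB rmorph1 rmorphM rmorphXn aLE mulrC add0n.
have indep := @families_independent m c cn rts rtsE nd no_unity r r_rec r_neq0 r_ngeo K R ab charK ab_ge0 ab_eq0 abM abD
  ab_nat weight L embL aL.
have {}indep := indep _ _ roots q Nl al be mm Nu bu al0 be_adm bu_adm data_inj bu0 bu_inj F0 U0 F0P U0P.
have alL_gt0 : 0 < ab (embL aL) by rewrite /embL /= aLE.
have alL_lt1 : ab (embL aL) < 1 by rewrite /embL /= aLE.
have {}indep := indep alL_gt0 alL_lt1.
have memF i : isF i -> (index (pa i, pb i, fm i) tr < q)%N.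
  by move=> fi; rewrite index_mem mem_undup; apply/mapP; exists i; rewrite // mem_filter fi mem_enum.
have memG i : ~~ isF i -> (index (pb i) us < Nu)%N.
  by move=> fi; rewrite index_mem mem_undup; apply/mapP; exists i; rewrite // mem_filter fi mem_enum.
have valF i : isF i -> val (ix i) = val (inl (fa i, fb i, fm i, fl i)).
  by rewrite /isF /fa /fb /fm /fl; case: (ix i) => // [[[[? ?] ?] ?]].
have valG i : ~~ isF i -> val (ix i) = val (inr (fb i)).
  by rewrite /isF /fb; case: (ix i).
have Hv i : exists v : 'I_(Ny + Nu), exists2 la : L, la != 0 & val (ix i) = embL la * value F0 U0 v /\ match split v with
    | inl y => [/\ isF i, tnth0 (blk y) = (pa i, pb i, fm i) & ll y = fl i] | inr u => ~~ isF i /\ bu u = pb i end.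
  have [fi|nf] := boolP (isF i).
    pose y := elt (Ordinal (memF i fi)) (inord (Nl - fl i) : 'I_Nl.+1).
    have tE : tnth0 (blk y) = (pa i, pb i, fm i) by rewrite blk_elt /tnth0 /= nth_index // -index_mem memF.
    have le : (fl i <= Nl)%N by exact: leq_bigmax.
    have lE : ll y = fl i by rewrite /ll lev_elt inordK ?ltnS ?leq_subr // subKn.
    have sc0 : sc y != 0.
      by rewrite /sc mulf_neq0 ?expf_neq0 ?invr_eq0 // mulf_neq0 // natL ?fact_gt0.
    exists (lshift Nu y), (sc y)^-1; first by rewrite invr_eq0.
    have sE : split (lshift Nu y) = inl y by rewrite -[lshift Nu y]/(unsplit (inl y)) unsplitK.
    rewrite /value sE; split; last by [].
    rewrite /F0 mulrA -rmorphM mulVf // rmorph1 mul1r lE /al /be /mm tE /= paE pbE.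
    exact: valF.
  exists (rshift Ny (Ordinal (memG i nf))), 1; first exact: oner_neq0.
  have sE : split (rshift Ny (Ordinal (memG i nf))) = inr (Ordinal (memG i nf)).
    by rewrite -[rshift _ _]/(unsplit (inr (Ordinal (memG i nf)))) unsplitK.
  have bE : bu (Ordinal (memG i nf)) = pb i by rewrite /bu /= nth_index // -index_mem memG.
  rewrite /value sE rmorph1 mul1r /U0 bE pbE; split=> //.
  exact: valG.
have [v Hv'] := choice Hv.
have Hla i : exists la : L, la != 0 /\ val (ix i) = embL la * value F0 U0 (v i).
  by have [la la0 [e _]] := Hv' i; exists la.
have [la Hla'] := choice Hla.
have v_inj : injective v.
  move=> i j e; apply: ix_inj.
  have [_ _ [_ Hi]] := Hv' i; have [_ _ [_ Hj]] := Hv' j; rewrite e in Hi; move: Hi Hj.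
  case: (split (v j)) => [y|u].
    move=> [fi ti li] [fj tj lj]; move: fi fj ti li; rewrite tj lj => fi fj [ea eb em] el.
    have {}ea : fa j = fa i by rewrite -!paE ea.
    have {}eb : fb j = fb i by rewrite -!pbE eb.
    move: fi fj ea eb em el; rewrite /isF /fa /fb /fm /fl.
    by case: (ix i) => // [[[[? ?] ?] ?]]; case: (ix j) => // [[[[? ?] ?] ?]] _ _ /= -> -> -> ->.
  move=> [fi bi] [fj bj]; move: fi fj bi; rewrite bj => fi fj eb.
  have {}eb : fb j = fb i by rewrite -!pbE eb.
  by move: fi fj eb; rewrite /isF /fb; case: (ix i) => // ?; case: (ix j) => // ? _ _ ->.
apply: (independent_transfer (emb := embL) v_inj (fun i => (Hla' i).1) indep).
by rewrite -[RHS]HP; apply: mmap_ext => // i; rewrite (Hla' i).2.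
Qed.
(** Equal values at two indices would be a relation X_0 - X_1 = 0 between values at distinct
    indices. *)
Lemma indexed_injective i j : valid i -> valid j -> val i = val j -> i = j.
Proof.
move=> vi vj e; apply/eqP/negPn/negP => ne.
pose ix (b : 'I_2) := if b == ord0 then i else j.
have ix_inj : injective ix.
  move=> b b'; rewrite /ix; case: (eqVneq b ord0) => [->|b0]; case: (eqVneq b' ord0) => [->|b0'] //.
  - by move=> h; rewrite h eqxx in ne.
  - by move=> h; rewrite h eqxx in ne.
  by move=> _; apply: val_inj; case: b b0 => [[|[|b]] hb] //; case: b' b0' => [[|[|b']] hb'].
have ix_valid b : valid (ix b) by rewrite /ix; case: ifP.
pose P : {mpoly rat[2]} := 'X_ord0 - 'X_ord_max.
have P0 : P = 0.
  apply: (indexed_independent ix_inj ix_valid).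
  apply: etrans (mmap_ext P (fun x => esym (fmorph_eq_rat (emb \o @ratr algC) x)) (frefl _)) _.
  by rewrite /P mmapB !mmapX !mmap1U /ix eqxx /= e subrr.
have ne1 : (U_(ord_max) == U_(ord0) :> 'X_{1..2})%MM = false.
  by apply/negP => /eqP/(congr1 (fun b : 'X_{1..2} => b ord0)); rewrite !mnm1E.
have /eqP := congr1 (mcoeff U_(ord0)%MM) P0; rewrite mcoeffB !mcoeffX mcoeff0 eqxx ne1.
by rewrite subr0 oner_eq0.
Qed.
End IndexedValues.

(** * The functions H, F and G *)

Section SeriesDerivative.
Variables (K : fieldType) (R : archiRealFieldType) (ab : K -> R).
Hypotheses (ab_ge0 : nonneg ab) (ab_eq0 : definite ab) (abM : multiplicative ab) (abD : subadditive ab).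
Let ab0 : ab 0 = 0. Proof. exact: (ab_eq0 0).2. Qed.
Let ab1 := ab1 ab_eq0 abM.
Let abN := abN ab_ge0 ab_eq0 abM.
Let abX := abX ab_eq0 abM.
Let abV := abV ab_ge0 ab_eq0 abM.

Definition isder (f : K -> K) x l := forall e, 0 < e -> exists2 d, 0 < d &
  forall h, h != 0 -> ab h < d -> ab ((f (x + h) - f x) / h - l) <= e.

(** First-order expansion with a quadratic remainder, uniform near x and with constants growing at
    most exponentially in k. The class is closed under products, and the weights of [w_small] make
    such remainders summable. *)
Definition ud (x : K) (t : nat -> K -> K) (t' : nat -> K) := exists C d, [/\ 1 <= C, 0 < d, d <= 1 &
  forall k, ab (t' k) <= C ^+ k.+1 /\ forall h, ab h < d ->
    ab (t k (x + h)) <= C ^+ k.+1 /\ ab (t k (x + h) - t k x - h * t' k) <= C ^+ k.+1 * ab h ^+ 2].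

Lemma ud_ext x t t' s s' : (forall k y, t k y = s k y) -> t' =1 s' -> ud x t t' -> ud x s s'.
Proof.
move=> e e' [C [d [C1 d0 d1 H]]]; exists C, d; split=> // k; have [h1 h2] := H k.
by rewrite -e'; split=> // h /h2; rewrite !e.
Qed.

Lemma ud_cst x c C : 1 <= C -> (forall k, ab (c k) <= C ^+ k.+1) -> ud x (fun k _ => c k) (fun=> 0).
Proof.
move=> C1 H; exists C, 1; split=> // k; have C0 := exprn_ge0 k.+1 (le_trans ler01 C1).
split=> [|h _]; first by rewrite ab0.
split; first exact: H.
by rewrite mulr0 subr0 subrr ab0; exact: mulr_ge0 C0 (exprn_ge0 _ _).
Qed.

Lemma ud_mul x t t' s s' : ud x t t' -> ud x s s' -> ud x (fun k y => t k y * s k y) (fun k => t' k * s k x + t k x * s' k).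
Proof.
move=> [C [d [C1 d0 d1 H]]] [D [e [D1 e0 e1 G]]].
exists (4 * (C * D)), (Num.min d e).
have CD1 : 1 <= C * D by rewrite -[1]mulr1 ler_pM.
split; [lra|by rewrite lt_min d0|by rewrite ge_min d1|].
move=> k; have [H1 H2] := H k; have [G1 G2] := G k.
have ab00 : ab 0 < d by rewrite ab0.
have ab0e : ab 0 < e by rewrite ab0.
have [+ _] := H2 0 ab00; have [+ _] := G2 0 ab0e; rewrite !addr0 => Gx Hx.
set P := C ^+ k.+1 in H1 H2 Hx *; set Q := D ^+ k.+1 in G1 G2 Gx *.
have P0 : 0 <= P by rewrite exprn_ge0 // (le_trans ler01).
have Q0 : 0 <= Q by rewrite exprn_ge0 // (le_trans ler01).
have PQ0 : 0 <= P * Q by rewrite mulr_ge0.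
have four : 4 * (P * Q) <= (4 * (C * D)) ^+ k.+1.
  rewrite exprMn exprMn ler_wpM2r // exprS ler_peMr //.
  by rewrite exprn_ege1 // ler1n.
split.
  apply: le_trans four; apply: le_trans (abD _ _) _; rewrite !abM.
  have := ler_pM (ab_ge0 _) (ab_ge0 _) H1 Gx; have := ler_pM (ab_ge0 _) (ab_ge0 _) Hx G1; lra.
move=> h; rewrite lt_min => /andP[hd he]; have [A1 A2] := H2 h hd; have [B1 B2] := G2 h he.
have h1 : ab h <= 1 by rewrite (le_trans (ltW hd)).
have hh0 : 0 <= ab h ^+ 2 by rewrite exprn_ge0.
split.
  by apply: le_trans four; rewrite abM; have := ler_pM (ab_ge0 _) (ab_ge0 _) A1 B1; lra.
apply: (@le_trans _ _ (4 * (P * Q) * ab h ^+ 2)); last by rewrite ler_wpM2r.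
set r1 := t k (x + h) - t k x - h * t' k in A2; set r2 := s k (x + h) - s k x - h * s' k in B2.
have -> : t k (x + h) * s k (x + h) - t k x * s k x - h * (t' k * s k x + t k x * s' k) =
  (r1 * s k (x + h) + t k x * r2) + (h * t' k * r2 + h * h * (t' k * s' k)) by rewrite /r1 /r2; ring.
have E1 : ab (r1 * s k (x + h)) <= P * Q * ab h ^+ 2.
  by rewrite abM [P * Q * _]mulrAC; apply: ler_pM.
have E2 : ab (t k x * r2) <= P * Q * ab h ^+ 2.
  by rewrite abM -mulrA; apply: ler_pM.
have E3 : ab (h * t' k * r2) <= P * Q * ab h ^+ 2.
  rewrite !abM -mulrA; apply: le_trans (ler_piMl _ h1) _; first by rewrite mulr_ge0.
  by rewrite -mulrA; apply: ler_pM.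
have E4 : ab (h * h * (t' k * s' k)) <= P * Q * ab h ^+ 2.
  by rewrite !abM -expr2 mulrC ler_wpM2r //; apply: ler_pM.
apply: le_trans (abD _ _) _; apply: le_trans (lerD (abD _ _) (abD _ _)) _; lra.
Qed.

Lemma ud_pow x t t' s : ud x t t' -> ud x (fun k y => t k y ^+ s.+1) (fun k => s.+1%:R * t k x ^+ s * t' k).
Proof.
move=> H; elim: s => [|s IHs].
  by apply: ud_ext H => [k y|k]; rewrite ?expr1 // expr0 !mul1r.
apply: ud_ext (ud_mul H IHs) => [k y|k]; first by rewrite [RHS]exprS.
by rewrite -[s.+2%:R]natr1 !exprS; ring.
Qed.

Lemma ud_scale x c C t t' : 1 <= C -> (forall k, ab (c k) <= C ^+ k.+1) -> ud x t t' ->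
  ud x (fun k y => c k * t k y) (fun k => c k * t' k).
Proof.
by move=> C1 H T; apply: ud_ext (ud_mul (ud_cst x C1 H) T) => // k; rewrite mul0r add0r.
Qed.

Lemma ud_monomial x (f : nat -> nat) : (forall k, (f k <= k)%N) ->
  ud x (fun k y => y ^+ f k) (fun k => (f k)%:R * x ^+ (f k).-1).
Proof.
move=> fk; pose X := ab x + 1; have X1 : 1 <= X by rewrite lerDr.
pose P := 4 * X; have P1 : 1 <= P by rewrite /P; lra.
have X0 : 0 <= X := le_trans ler01 X1; have P0 : 0 <= P := le_trans ler01 P1.
have near h : ab h < 1 -> ab (x + h) <= X by move=> h1; apply: le_trans (abD _ _) _; rewrite lerD2l ltW.
have xX : ab x <= X by rewrite lerDl.
have der k : ab (k%:R * x ^+ k.-1) <= (2 * X) ^+ k.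
  rewrite abM abX exprMn; apply: ler_pM; rewrite ?exprn_ge0 //.
    by apply: le_trans (ab_nat_le ab_eq0 abM abD _) _; rewrite -natrX ler_nat ltnW // ltn_expl.
  case: k => [|k] /=; first by rewrite !expr0.
  by apply: (@le_trans _ _ (X ^+ k)); [rewrite lerXn2r ?nnegrE | rewrite ler_weXn2l].
have XP : 2 * X <= P by rewrite /P; lra.
have pw k : (2 * X) ^+ k <= P ^+ k by rewrite lerXn2r ?nnegrE ?mulr_ge0.
have rem k h : ab h < 1 -> ab ((x + h) ^+ k - x ^+ k - h * (k%:R * x ^+ k.-1)) <= P ^+ k * ab h ^+ 2.
  move=> h1; elim: k => [|k IHk]; first by rewrite !expr0 mul0r mulr0 subr0 subrr ab0 mul1r exprn_ge0.
  have -> : (x + h) ^+ k.+1 - x ^+ k.+1 - h * (k.+1%:R * x ^+ k.+1.-1) =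
    ((x + h) ^+ k - x ^+ k - h * (k%:R * x ^+ k.-1)) * (x + h) + h * h * (k%:R * x ^+ k.-1).
    case: k {IHk} => [|k]; first by rewrite /= !expr0 !mul0r; ring.
    by rewrite /= -[k.+2%:R]natr1 !exprS; ring.
  apply: le_trans (abD _ _) _; rewrite 2!abM [ab (h * h)]abM.
  have e1 := ler_pM (ab_ge0 _) (ab_ge0 _) IHk (near h h1).
  have e2 : ab h * ab h * ab (k%:R * x ^+ k.-1) <= P ^+ k * ab h ^+ 2.
    by rewrite -expr2 mulrC ler_wpM2r ?exprn_ge0 // (le_trans (der k)).
  have w0 : 0 <= P ^+ k * ab h ^+ 2 by rewrite mulr_ge0 ?exprn_ge0.
  have XP1 : X + 1 <= P by rewrite /P; lra.
  apply: le_trans (lerD e1 e2) _; rewrite [P ^+ k.+1]exprS -mulrA [P * _]mulrC -{2}[P ^+ k * _]mulr1 -mulrDr.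
  exact: ler_wpM2l.
have up k : P ^+ f k <= P ^+ k.+1 by rewrite ler_weXn2l // (leq_trans (fk k)).
exists P, 1; split=> // k; split; first exact: le_trans (der _) (le_trans (pw _) (up k)).
move=> h h1; split; last by apply: le_trans (rem _ _ h1) _; rewrite ler_wpM2r ?exprn_ge0.
rewrite abX; apply: le_trans (up k); rewrite lerXn2r ?nnegrE //.
by apply: le_trans (near h h1) _; rewrite /P; lra.
Qed.

Lemma ud_inverse (e : nat -> K) y d0 : (forall k, ab (e k) <= 1) -> 0 < d0 -> (forall k, d0 <= ab (1 - e k * y)) ->
  ud y (fun k z => (1 - e k * z)^-1) (fun k => e k * (1 - e k * y)^-1 ^+ 2).
Proof.
move=> e1 d00 low; pose M := 2 / d0 + 1; have M1 : 1 <= M by rewrite lerDr divr_ge0 // ltW.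
have M0 : 0 <= M := le_trans ler01 M1.
have near h k : ab h < d0 / 2 -> d0 / 2 <= ab (1 - e k * (y + h)).
  move=> hd; have -> : 1 - e k * (y + h) = (1 - e k * y) + - (e k * h) by ring.
  have : ab (1 - e k * y) <= ab ((1 - e k * y) + - (e k * h)) + ab (e k * h).
    by apply: le_trans (abD _ _); rewrite -addrA addNr addr0.
  have := low k; have : ab (e k * h) <= ab h by rewrite abM ler_piMl.
  lra.
have inv h k : ab h < d0 / 2 -> ab (1 - e k * (y + h))^-1 <= M.
  move=> hd; rewrite abV; have n := near h k hd; have d2 : 0 < d0 / 2 by rewrite divr_gt0.
  apply: (@le_trans _ _ (d0 / 2)^-1); first by rewrite lef_pV2 ?posrE // (lt_le_trans d2).
  by rewrite invf_div lerDl.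
have h0 : ab 0 < d0 / 2 by rewrite ab0 divr_gt0.
have inv0 k : ab (1 - e k * y)^-1 <= M by have := inv 0 k h0; rewrite addr0.
have MM k : M ^+ 3 <= (M ^+ 3) ^+ k.+1 by rewrite -exprM ler_weXn2l // leq_pmulr.
have M3 : 1 <= M ^+ 3 by rewrite exprn_ege1.
have le23 : M ^+ 2 <= M ^+ 3 by rewrite ler_weXn2l.
have le13 : M <= M ^+ 3 by rewrite -{1}[M]expr1 ler_weXn2l.
exists (M ^+ 3), (Num.min (d0 / 2) 1); split=> //; first by rewrite lt_min divr_gt0 /=.
  by rewrite ge_min lexx orbT.
move=> k; split.
  rewrite abM abX; apply: le_trans (MM k); apply: le_trans le23.
  by rewrite -[leRHS]mul1r; apply: ler_pM; rewrite ?exprn_ge0 // lerXn2r ?nnegrE.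
move=> h; rewrite lt_min => /andP[hd _]; split; first exact: le_trans (inv h k hd) (le_trans le13 (MM k)).
have nz0 : 1 - e k * y != 0 by apply: contraTneq (low k) => ->; rewrite ab0 -ltNge.
have nz : 1 - e k * (y + h) != 0 by apply: contraTneq (near h k hd) => ->; rewrite ab0 -ltNge divr_gt0.
have -> : (1 - e k * (y + h))^-1 - (1 - e k * y)^-1 - h * (e k * (1 - e k * y)^-1 ^+ 2) =
   (e k * e k) * (h * h) * ((1 - e k * y)^-1 ^+ 2 * (1 - e k * (y + h))^-1).
  by field; rewrite nz0 nz.
have b0 : ab ((1 - e k * y)^-1 ^+ 2) <= M ^+ 2 by rewrite abX lerXn2r ?nnegrE.
have a1 : ab (e k * e k) <= 1 by rewrite abM -[leRHS]mulr1; apply: ler_pM.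
have a2 : ab ((1 - e k * y)^-1 ^+ 2 * (1 - e k * (y + h))^-1) <= M ^+ 3.
  have -> : M ^+ 3 = M ^+ 2 * M by rewrite exprSr.
  by rewrite abM; apply: ler_pM => //; exact: inv.
have hh : ab (h * h) = ab h ^+ 2 by rewrite abM -expr2.
rewrite abM [ab (e k * e k * _)]abM hh mulrC.
apply: ler_pM; [by []|by rewrite mulr_ge0 ?exprn_ge0|exact: le_trans a2 (MM k)|].
by rewrite ler_piMl ?exprn_ge0.
Qed.

Definition ab_cauchy S := forall e : R, 0 < e -> exists N : nat, forall i j, (N <= i)%N -> (N <= j)%N -> ab (S i - S j) <= e.

Variable w : nat -> K.
Hypothesis w_small : forall C e : R, 1 <= C -> 0 < e -> exists N, forall M, \sum_(N <= k < M) C ^+ k.+1 * ab (w k) <= e.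

Lemma w_bounded C : 1 <= C -> exists2 B, 0 <= B & forall M, \sum_(k < M) C ^+ k.+1 * ab (w k) <= B.
Proof.
move=> C1; have C0 : 0 <= C := le_trans ler01 C1; have [N HN] := w_small C1 (@ltr01 R).
have t0 k : 0 <= C ^+ k.+1 * ab (w k) by rewrite mulr_ge0 ?exprn_ge0.
exists (\sum_(k < N) C ^+ k.+1 * ab (w k) + 1) => [|M]; first by rewrite addr_ge0 ?sumr_ge0.
have [le|lt] := leqP N M.
  rewrite -!(big_mkord xpredT (fun k => C ^+ k.+1 * ab (w k))) (@big_cat_nat _ _ _ N 0 M) //=.
  by rewrite lerD2l.
rewrite -(subnKC (ltnW lt)) big_split_ord /= -addrA lerDl addr_ge0 // sumr_ge0 // => k _; exact: t0.
Qed.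

Lemma series_cauchy (t : nat -> K) C : 1 <= C -> (forall k, ab (t k) <= C ^+ k.+1) ->
  ab_cauchy (fun N => \sum_(k < N) w k * t k).
Proof.
move=> C1 H e e0; have [N HN] := w_small C1 e0; exists N.
have main i j : (N <= i)%N -> (i <= j)%N -> ab (\sum_(k < j) w k * t k - \sum_(k < i) w k * t k) <= e.
  move=> le le'; rewrite -!(big_mkord xpredT (fun k => w k * t k)) (@big_cat_nat _ _ _ i 0 j) //= addrAC subrr add0r.
  apply: le_trans (ab_sum ab0 abD _ _ _) _; apply: le_trans (HN j).
  rewrite [leRHS](@big_cat_nat _ _ _ i) //=; apply: (@le_trans _ _ (\sum_(i <= k < j) C ^+ k.+1 * ab (w k))).
    by apply: ler_sum => k _; rewrite abM mulrC ler_wpM2r.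
  by rewrite lerDr sumr_ge0 // => k _; rewrite mulr_ge0 ?exprn_ge0 // (le_trans ler01).
move=> i j li lj; have [le|/ltnW le] := leqP i j; last exact: main.
by rewrite (abB_sym ab_ge0 ab_eq0 abM); exact: main.
Qed.

(** Termwise differentiation: the remainders add up to at most B |h|^2, where B bounds the sums of
    C^(k+1) |w_k|. *)
Lemma series_der x t t' (f : K -> K) g : ud x t t' ->
  (exists2 d, 0 < d & forall h, ab h < d -> islim ab (fun N => \sum_(k < N) w k * t k (x + h)) (f (x + h))) ->
  islim ab (fun N => \sum_(k < N) w k * t' k) g -> isder f x g.
Proof.
move=> [C [d [C1 d0 d1 H]]] [d' d0' Hf] Hg e e0.
have [B B0 HB] := w_bounded C1.
exists (Num.min (Num.min d d') (e / (B + 1))) => [|h h0].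
  by rewrite !lt_min d0 d0' divr_gt0 // ltr_wpDl.
rewrite !lt_min => /andP[/andP[hd hd'] he].
have hp : 0 < ab h by exact: ab_gt0.
have Hx : islim ab (fun N => \sum_(k < N) w k * t k x) (f x).
  have := Hf 0; rewrite ab0 addr0; exact.
have L : islim ab (fun N => \sum_(k < N) w k * (t k (x + h) - t k x - h * t' k)) (f (x + h) - f x - h * g).
  apply: (islim_ext (S := fun N => (\sum_(k < N) w k * t k (x + h) + (-1) * (\sum_(k < N) w k * t k x)) +
       (- h) * (\sum_(k < N) w k * t' k))).
    move=> N; rewrite !mulr_sumr -!big_split; apply: eq_bigr => k _ /=; ring.
  have -> : f (x + h) - f x - h * g = (f (x + h) + (-1) * f x) + (- h) * g by ring.
  apply: islimD => //; last exact: islimZ.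
  by apply: islimD => //; [exact: Hf|exact: islimZ].
have bnd : ab (f (x + h) - f x - h * g) <= B * ab h ^+ 2.
  rewrite -[X in ab X]subr0; apply: (islim_bound ab_ge0 ab_eq0 abM abD L (N0 := 0)) => N _; rewrite subr0.
  apply: le_trans (ab_sum ab0 abD _ _ _) _; apply: le_trans (ler_wpM2r _ (HB N)) => //; rewrite ?exprn_ge0 //.
  rewrite mulr_suml; apply: ler_sum => k _; rewrite abM mulrC mulrAC ler_wpM2r //.
  by have [_ /(_ h hd)[_]] := H k.
have -> : (f (x + h) - f x) / h - g = (f (x + h) - f x - h * g) / h.
  by rewrite [RHS]mulrBl [h * g]mulrC mulfK.
rewrite abM abV ler_pdivrMr //; apply: le_trans bnd _.
rewrite expr2 mulrA ler_wpM2r //; apply: le_trans (ler_wpM2l B0 (ltW he)) _.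
rewrite mulrCA ger_pMr // ler_pdivrMr ?ltr_wpDl // mul1r; lra.
Qed.

End SeriesDerivative.

(** * Finite-dimensional subspaces over a complete field are closed *)

Section FiniteSpan.
Variables (k K : fieldType) (R : archiRealFieldType) (abk : k -> R) (ab : K -> R) (g : {rmorphism k -> K}).
Hypotheses (ab_ge0 : nonneg ab) (ab_eq0 : definite ab) (abM : multiplicative ab) (abD : subadditive ab).
Hypotheses (g_isom : forall x, ab (g x) = abk x) (k_complete : forall S, ab_cauchy abk S -> exists l, islim abk S l).

Fixpoint field_span (bs : seq K) (x : K) : Prop :=
  if bs is b :: bs' then exists q y, x = g q * b + y /\ field_span bs' y else x = 0.

Lemma field_span0 bs : field_span bs 0.
Proof. by elim: bs => //= b bs IH; exists 0, 0; rewrite rmorph0 mul0r addr0. Qed.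

Lemma field_span_lin bs q x y : field_span bs x -> field_span bs y -> field_span bs (g q * x + y).
Proof.
elim: bs x y => [|b bs IH] x y /=; first by move=> -> ->; rewrite mulr0 addr0.
move=> [q1 [x1 [-> h1]]] [q2 [y1 [-> h2]]]; exists (q * q1 + q2), (g q * x1 + y1).
by split; [rewrite rmorphD rmorphM; ring|exact: IH].
Qed.

Lemma field_span_mem bs b : b \in bs -> field_span bs b.
Proof.
elim: bs => //= b' bs IH; rewrite inE => /orP[/eqP ->|/IH h].
  by exists 1, 0; rewrite rmorph1 mul1r addr0; split=> //; exact: field_span0.
by exists 0, b; rewrite rmorph0 mul0r add0r.
Qed.

(** Induction on the generators. If b is not in the span of the others, it has positive distance d
    from it, since that span is closed. Then differences of the coordinates along b are at most 1/d
    times differences of the vectors, so the coordinates converge by completeness. *)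
Lemma field_span_closed bs S l : (forall j, field_span bs (S j)) -> islim ab S l -> field_span bs l.
Proof.
elim: bs S l => [|b bs IH] S l /= HS Sl.
  by apply: (islim_uniq ab_ge0 ab_eq0 abM abD Sl); apply: (islim_ext (S := fun=> 0)) (islim_cst ab_eq0 0) => j; rewrite HS.
have [inb|nb] := EM (field_span bs b).
  exists 0, l; rewrite rmorph0 mul0r add0r; split=> //; apply: IH Sl => j.
  by have [q [y [-> hy]]] := HS j; exact: field_span_lin.
have [d d0 Hd] : exists2 d, 0 < d & forall y, field_span bs y -> d <= ab (b - y).
  apply: contrapT => H; apply: nb.
  have Hex (j : nat) : exists y, field_span bs y /\ ab (b - y) <= j.+1%:R^-1.
    apply: contrapT => H'; apply: H; exists j.+1%:R^-1; first by rewrite invr_gt0 ltr0n.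
    by move=> y hy; rewrite leNgt; apply/negP => lt; apply: H'; exists y; split=> //; exact: ltW.
  have [y Hy] := choice Hex.
  apply: (IH y) => [j|e e0]; first by have [] := Hy j.
  exists (Num.bound e^-1) => j le; rewrite (abB_sym ab_ge0 ab_eq0 abM).
  have [_ h] := Hy j; apply: le_trans h _; rewrite -[e]invrK lef_pV2 ?posrE ?invr_gt0 ?ltr0n //.
  apply: le_trans (ltW (archi_boundP _)) _; first by rewrite invr_ge0 ltW.
  by rewrite ler_nat (leq_trans le).
have Hex (j : nat) : exists qy : k * K, S j = g qy.1 * b + qy.2 /\ field_span bs qy.2.
  by have [q [y h]] := HS j; exists (q, y).
have [qy Hqy] := choice Hex.
have dist i j : ab (g ((qy i).1 - (qy j).1)) * d <= ab (S i - S j).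
  have [-> hi] := Hqy i; have [-> hj] := Hqy j; set q := (qy i).1 - (qy j).1.
  have [q0|q0] := eqVneq q 0; first by rewrite q0 rmorph0 (ab_eq0 0).2 // mul0r.
  have gq0 : g q != 0 by rewrite fmorph_eq0.
  have -> : g (qy i).1 * b + (qy i).2 - (g (qy j).1 * b + (qy j).2) =
    g q * (b - (g (- q^-1) * (qy i).2 + (g (q^-1) * (qy j).2 + 0))).
    by rewrite rmorphN fmorphV addr0 mulrBr mulrDr mulNr mulrN !mulrA divff // !mul1r /q rmorphB; ring.
  rewrite abM ler_wpM2l //; apply: Hd; apply: field_span_lin => //; apply: field_span_lin => //; exact: field_span0.
have [q0 Hq0] : exists q0, islim abk (fun j => (qy j).1) q0.
  apply: k_complete => e e0; have [N HN] := Sl (e * d / 2) (divr_gt0 (mulr_gt0 e0 d0) (ltr0n _ 2)).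
  exists N => i j li lj; rewrite -g_isom -(ler_pM2r d0); apply: le_trans (dist i j) _.
  have -> : S i - S j = (S i - l) + (l - S j) by ring.
  apply: le_trans (abD _ _) _; rewrite (abB_sym ab_ge0 ab_eq0 abM l); have := HN i li; have := HN j lj; lra.
exists q0, (l - g q0 * b); split; first by rewrite addrC subrK.
apply: (IH (fun j => (qy j).2)) => [j|]; first by have [] := Hqy j.
apply: (islim_ext (S := fun j => S j + (- b) * g (qy j).1)).
  by move=> j; have [-> _] := Hqy j; ring.
have -> : l - g q0 * b = l + (- b) * g q0 by ring.
apply: islimD => //; apply: islimZ => // e e0; have [N HN] := Hq0 e e0; exists N => j lj.
by rewrite -rmorphB g_isom; exact: HN.
Qed.
End FiniteSpan.

From mathcomp Require Import all_classical all_reals all_analysis.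
Local Open Scope classical_set_scope.

(** * Topological limits and derivatives in a valued field *)

Section Bridge.
Variables (R : realType) (K : valuedFieldType R).
Implicit Types (x l : K) (S : nat -> K).

Lemma absv_ball x (e : R) y : ball x e y <-> absv (x - y) < e.
Proof. by rewrite ballEmdist. Qed.

Lemma islim_cvg S l : islim (@absv R K) S l <-> S @ \oo --> l.
Proof.
split=> [H|/cvg_ballP H e e0].
  apply/cvg_ballP => e e0; have [N HN] := H (e / 2) (divr_gt0 e0 (ltr0n _ 2)).
  exists N => // j /= le; apply/absv_ball; rewrite -absvN opprB; apply: le_lt_trans (HN j le) _.
  by rewrite ltr_pdivrMr // ltr_pMr // ltr1n.
have [N _ HN] := H e e0; exists N => j le; have /absv_ball := HN j le.
by rewrite -absvN opprB => /ltW.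
Qed.

Lemma islim_limn S l : islim (@absv R K) S l -> limn S = l.
Proof. by move=> /islim_cvg H; apply: cvg_lim H; exact: metric_hausdorff. Qed.

Lemma complete_islim S : absv_complete K -> ab_cauchy (@absv R K) S -> exists l, islim (@absv R K) S l.
Proof.
move=> cK H; have : cvg (S @ \oo).
  apply: cK; apply/cauchy_ballP => e e0.
  have [N HN] := H (e / 2) (divr_gt0 e0 (ltr0n _ 2)).
  exists ([set S j | j in [set j | (N <= j)%N]], [set S j | j in [set j | (N <= j)%N]]) => /=.
    by split; exists N => // j /= le; exists j.
  move=> [x y] /= [[i li <-] [j lj <-]]; apply/absv_ball; apply: le_lt_trans (HN i j li lj) _.
  by rewrite ltr_pdivrMr // ltr_pMr // ltr1n.
by move=> h; exists (lim (S @ \oo)); apply/islim_cvg.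
Qed.

(** The powers of a are nonzero and tend to 0, so 0 is not isolated. This is what makes the limit
    defining [Kderive] unique. *)
Lemma dnbhs0_proper (a : K) : 0 < absv a -> absv a < 1 -> ProperFilter ((0 : K)^').
Proof.
move=> a0 a1; apply: Build_ProperFilter_ex => A /nbhs_ballP[e /= e0 HA].
have [N HN] := pow_small a0 a1 (divr_gt0 e0 (ltr0n _ 2)).
have aN : absv (a ^+ N) = absv a ^+ N := abX (@absv_eq0 R K) (@absvM R K) _ _.
exists (a ^+ N); apply: HA.
  apply/absv_ball; rewrite sub0r absvN aN.
  by apply: le_lt_trans (HN N (leqnn N)) _; rewrite ltr_pdivrMr // ltr_pMr // ltr1n.
by rewrite expf_neq0 //; apply: contraTneq a0 => ->; rewrite (absv_eq0 0).2 // ltxx.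
Qed.

Lemma isder_Kderive (a : K) (f : K -> K) x l : 0 < absv a -> absv a < 1 -> isder (@absv R K) f x l -> Kderive f x = l.
Proof.
move=> a0 a1 H; have pf := dnbhs0_proper a0 a1; apply: cvg_lim; first exact: metric_hausdorff.
apply/cvg_ballP => e e0; have [d d0 Hd] := H (e / 2) (divr_gt0 e0 (ltr0n _ 2)).
apply/nbhs_ballP; exists d => //= h /absv_ball hd h0; apply/absv_ball; rewrite -absvN opprB.
apply: le_lt_trans (Hd h _ _) _ => //; last by rewrite ltr_pdivrMr // ltr_pMr // ltr1n.
by move: hd; rewrite sub0r absvN.
Qed.
End Bridge.

(** * The derivatives of H and F as series, and the product G *)

Section SeriesValues.
Variables (R : realType) (K : valuedFieldType R).
Hypothesis K_complete : absv_complete K.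
Variables (a : K) (r : nat -> nat).
Hypotheses (a_gt0 : 0 < absv a) (a_lt1 : absv a < 1).
Hypothesis r_growth : forall B, for_large k, (B * k <= r k)%N.
Notation ab := (@absv R K).
Let ab_ge0 := @absv_ge0 R K.
Let ab_eq0 := @absv_eq0 R K.
Let abM := @absvM R K.
Let abD := @absvD R K.
Let ab0 : ab 0 = 0. Proof. exact/absv_eq0. Qed.
Let ab1 := ab1 ab_eq0 abM.
Let abX := abX ab_eq0 abM.
Notation w := (fun k => a ^+ r k).

Lemma w_small (C e : R) : 1 <= C -> 0 < e -> exists N, forall M, \sum_(N <= k < M) C ^+ k.+1 * ab (w k) <= e.
Proof.
move=> C1 e0; have C0 : 0 < C := lt_le_trans ltr01 C1.
have [||B [k0 HB]] := @pow_beats R (ab a) (2 * C) (e / (2 * C)) a_gt0 a_lt1; rewrite ?divr_gt0 ?mulr_gt0 //.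
have [k1 Hk1] := r_growth B; exists (maxn k0 k1) => M.
apply: (@le_trans _ _ (\sum_(maxn k0 k1 <= k < M) e / 2 * 2^-1 ^+ k)); last first.
  by rewrite -mulr_sumr; have := @sum_half R (maxn k0 k1) M; set s := \sum_(_ <= _ < _) _; nra.
rewrite big_nat_cond [leRHS]big_nat_cond; apply: ler_sum => k /andP[/andP[+ _] _].
rewrite geq_max => /andP[le0 le1]; have := HB k (r k) le0 (Hk1 k le1); rewrite abX.
rewrite exprMn exprS ler_pdivlMr ?mulr_gt0 // => h.
have -> : e / 2 * 2^-1 ^+ k = (2^-1 ^+ k) * (e / 2) by rewrite mulrC.
rewrite mulrA ler_pdivlMr // exprVn mulrC ler_pdivlMl ?exprn_gt0 //.
by apply: le_trans h; rewrite le_eqVlt; apply/orP; left; apply/eqP; ring.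
Qed.

Lemma w_tends0 (d : R) : 0 < d -> for_large k, ab (w k) <= d.
Proof.
move=> d0; have [B HB] := pow_small a_gt0 a_lt1 d0; have [k0 Hk] := r_growth 1.
exists (maxn k0 B) => k; rewrite geq_max => /andP[le0 le1]; rewrite abX; apply: HB.
by apply: leq_trans le1 _; have := Hk k le0; rewrite mul1n.
Qed.

Definition adm (y : K) := forall k, 1 - a ^+ r k * y != 0.

Lemma adm_bound y : adm y -> exists2 d, 0 < d & forall k, d <= ab (1 - a ^+ r k * y).
Proof.
move=> H; have [|d d0 Hd] := away_from_0 ab_ge0 ab_eq0 abM abD w_tends0 (y := y).
  by move=> k; rewrite mulrC.
by exists d => // k; rewrite mulrC.
Qed.

Lemma w_le1 k : ab (w k) <= 1. Proof. by rewrite abX exprn_ile1 ?absv_ge0 // ltW. Qed.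

Definition xpart l x k : K := (k ^_ l)%:R * x ^+ (k - l).
Definition ypart m y k : K := m`!%:R * (w k) ^+ m * (1 - w k * y)^-1 ^+ m.+1.
Definition partial_sum l m x y N := \sum_(k < N) w k * (xpart l x k * ypart m y k).
(** The series obtained by differentiating H termwise, l times in x and m times in y; the limit is
    meaningful for admissible y by [Dval_lim]. *)
Definition Dval l m x y := limn (partial_sum l m x y).

Lemma exp_const (C : R) : exists2 C', 1 <= C' & forall k, C <= C' ^+ k.+1.
Proof.
exists (Num.max 1 C) => [|k]; first by rewrite le_max lexx.
apply: (@le_trans _ _ (Num.max 1 C)); first by rewrite le_max lexx orbT.
by rewrite -{1}[Num.max 1 C]expr1 ler_weXn2l // le_max lexx.
Qed.

Lemma ypart_bound m y : adm y -> exists2 C : R, 1 <= C & forall k, ab (ypart m y k) <= C ^+ k.+1.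
Proof.
move=> /adm_bound[d d0 Hd]; have [C C1 HC] := exp_const ((m`!)%:R * d^-1 ^+ m.+1).
exists C => // k; apply: le_trans (HC k); rewrite /ypart !absvM.
have b1 : ab (m`!%:R : K) <= m`!%:R := ab_nat_le ab_eq0 abM abD _.
have b2 : ab (w k ^+ m) <= 1 by rewrite abX exprn_ile1 ?absv_ge0 ?w_le1.
have b3 : ab ((1 - w k * y)^-1 ^+ m.+1) <= d^-1 ^+ m.+1.
  rewrite abX (abV ab_ge0 ab_eq0 abM).
  rewrite lerXn2r ?nnegrE ?invr_ge0 ?absv_ge0 ?(ltW d0) // lef_pV2 ?posrE //.
  exact: lt_le_trans d0 (Hd k).
apply: ler_pM; rewrite ?mulr_ge0 ?absv_ge0 //.
by rewrite -[leRHS]mulr1; apply: ler_pM; rewrite ?absv_ge0.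
Qed.

Lemma ffact_bound l : exists2 C : R, 1 <= C & forall k, ab ((k ^_ l)%:R : K) <= C ^+ k.+1.
Proof.
exists (2 ^+ l) => [|k]; first by rewrite exprn_ege1 // ler1n.
apply: le_trans (ab_nat_le ab_eq0 abM abD _) _.
rewrite -exprM mulnC exprM -!natrX ler_nat.
apply: (@leq_trans (k ^ l)); last first.
  by case: l => [|l]; rewrite ?expn0 // leq_exp2r // ltnW // (ltn_trans (ltn_expl k (ltnSn 1))) // ltn_exp2l.
elim: l => [|l IHl]; first by rewrite ffactn0.
by rewrite ffactnSr expnSr leq_mul // leq_subr.
Qed.

Lemma ud_xpart l x : ud ab x (fun k y => xpart l y k) (xpart l.+1 x).
Proof.
have [C C1 HC] := ffact_bound l.
have sub k : (k - l <= k)%N by exact: leq_subr.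
apply: ud_ext (ud_scale ab_ge0 ab_eq0 abM abD C1 HC (ud_monomial ab_ge0 ab_eq0 abM abD x sub)) => // k.
by rewrite /xpart ffactnSr natrM mulrA -subnS.
Qed.

Lemma ud_ypart m y : adm y -> ud ab y (fun k z => ypart m z k) (ypart m.+1 y).
Proof.
move=> /[dup] Hy /adm_bound[d d0 Hd].
have [C C1 HC] := exp_const (m`!%:R : R).
have H0 k : ab (m`!%:R * w k ^+ m) <= C ^+ k.+1.
  apply: le_trans (HC k); rewrite absvM -[leRHS]mulr1; apply: ler_pM; rewrite ?absv_ge0 //.
    exact: (ab_nat_le ab_eq0 abM abD).
  by rewrite abX exprn_ile1 ?absv_ge0 ?w_le1.
apply: ud_ext (ud_scale ab_ge0 ab_eq0 abM abD C1 H0 (ud_pow ab_ge0 ab_eq0 abM abD m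
   (ud_inverse ab_ge0 ab_eq0 abM abD w_le1 d0 Hd))) => // k.
by rewrite /ypart factS natrM !exprS expr0; ring.
Qed.

Lemma partial_bounds l m x y : adm y -> exists2 C : R, 1 <= C & forall k, ab (xpart l x k * ypart m y k) <= C ^+ k.+1.
Proof.
move=> Hy; have [C [d [C1 d0 _ H]]] := ud_xpart l x; have [D D1 HD] := ypart_bound m Hy.
exists (C * D) => [|k]; first by rewrite -[1]mulr1 ler_pM.
rewrite absvM exprMn; apply: ler_pM; rewrite ?absv_ge0 //.
by have [_ /(_ 0)] := H k; rewrite addr0 ab0 => /(_ d0)[].
Qed.

Lemma Dval_lim l m x y : adm y -> islim ab (partial_sum l m x y) (Dval l m x y).
Proof.
move=> Hy; have [C C1 HC] := partial_bounds l m x Hy.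
have [g Hg] := complete_islim K_complete (series_cauchy ab_ge0 ab_eq0 abM abD w_small C1 HC).
by rewrite /Dval (islim_limn Hg).
Qed.

Lemma adm_near y : adm y -> exists2 d : R, 0 < d & forall h, ab h < d -> adm (y + h).
Proof.
move=> /adm_bound[d d0 Hd]; exists d => // h hd k; apply: contraTneq (Hd k) => e; rewrite -ltNge.
have -> : 1 - a ^+ r k * y = w k * h by rewrite -[LHS]subr0 -e; ring.
by apply: le_lt_trans hd; rewrite absvM ler_piMl ?absv_ge0 ?w_le1.
Qed.

Let series_derivative := series_der ab_ge0 ab_eq0 abM abD w_small.

Lemma H_fun_derive_y m x y : adm y -> Kderiven m (H_fun a r x) y = Dval 0 m x y.
Proof.
elim: m y => [|m IHm] y Hy.
  rewrite /Kderiven /= /H_fun /Dval; congr (limn _); apply/funext => N.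
  rewrite /partial_sum big_mkord; apply: eq_bigr => k _.
  by rewrite /xpart /ypart ffactn0 mul1r subn0 fact0 mul1r expr0 mul1r expr1 mulrA.
have [C [dd [C1 dd0 _ Hx]]] := ud_xpart 0 x.
have HC k : ab (xpart 0 x k) <= C ^+ k.+1.
  by have [_ /(_ 0)] := Hx k; rewrite addr0 ab0 => /(_ dd0)[].
rewrite /Kderiven iterS; apply: (isder_Kderive a_gt0 a_lt1); apply: series_derivative (Dval_lim 0 m.+1 x Hy).
  exact: (ud_scale ab_ge0 ab_eq0 abM abD C1 HC (ud_ypart m Hy)).
have [d d0 Hd] := adm_near Hy; exists d => // h /Hd Hh.
rewrite -[iter _ _ _ _]/(Kderiven m (H_fun a r x) (y + h)) IHm //; exact: Dval_lim.
Qed.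

(** Termwise differentiation, first in y, where admissibility persists near y by [adm_near], and
    then in x for fixed y. For y = 0 it yields the derivatives of F. *)
Lemma Kpartial_H l m x y : adm y -> Kpartial l m (H_fun a r) x y = Dval l m x y.
Proof.
move=> Hy; rewrite /Kpartial; elim: l x => [|l IHl] x; first exact: H_fun_derive_y.
rewrite /Kderiven iterS; apply: (isder_Kderive a_gt0 a_lt1); apply: series_derivative (Dval_lim l.+1 m x Hy).
  have [D D1 HD] := ypart_bound m Hy.
  apply: ud_ext (ud_scale ab_ge0 ab_eq0 abM abD D1 HD (ud_xpart l x)) => [k z|k]; by rewrite mulrC.
exists 1 => // h _; rewrite -[iter _ _ _ _]/(Kderiven l (fun x' => Kderiven m (H_fun a r x') y) (x + h)) IHl; exact: Dval_lim.
Qed.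

Lemma adm0 : adm 0. Proof. by move=> k; rewrite mulr0 subr0 oner_neq0. Qed.
Lemma F_fun_derive l m x : Kderiven l (F_fun a r m) x = Dval l m x 0.
Proof. exact: (Kpartial_H l m x adm0). Qed.

(** The partial products stay bounded and their tails tend to 1, so they form a Cauchy sequence; y
    may be a zero of G. *)
Lemma G_fun_lim y : islim ab (fun N => \prod_(k < N) (1 - w k * y)) (G_fun a r y).
Proof.
have cau : ab_cauchy ab (fun N => \prod_(k < N) (1 - w k * y)).
  have near (e : R) : 0 < e -> exists N, forall i j, (N <= i)%N -> (i <= j)%N ->
      ab (\prod_(i <= k < j) (1 - w k * y) - 1) <= e.
    move=> e0; pose s := Num.min 2^-1 (e / 2) / (ab y + 1).
    have y0 : 0 < ab y + 1 by rewrite ltr_wpDl ?absv_ge0.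
    have m0 : 0 < Num.min 2^-1 (e / 2) by rewrite lt_min invr_gt0 ltr0n divr_gt0.
    have [N HN] := w_small (lexx (1 : R)) (divr_gt0 m0 y0); exists N => i j li lj.
    have S : \sum_(i <= k < j) ab (w k * y) <= Num.min 2^-1 (e / 2).
      have h := HN j; rewrite (@big_cat_nat _ _ _ i) //= in h.
      have h' : \sum_(i <= k < j) ab (w k) <= Num.min 2^-1 (e / 2) / (ab y + 1).
        apply: le_trans h; rewrite -[leLHS]add0r lerD ?sumr_ge0 // => [k _|]; first by rewrite mulr_ge0 ?absv_ge0 ?exprn_ge0.
        by under [leRHS]eq_bigr do rewrite expr1n mul1r.
      under eq_bigr do rewrite absvM; rewrite -mulr_suml.
      apply: le_trans (ler_wpM2r (absv_ge0 y) h') _.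
      by rewrite -mulrA ler_piMr ?(ltW m0) // ler_pdivrMl // mulr1 lerDl.
    have m2 : Num.min 2^-1 (e / 2) <= 2^-1 by rewrite ge_min lexx.
    have := prod_near1 ab_ge0 ab_eq0 abM abD m2 S.
    move/le_trans; apply; have : Num.min 2^-1 (e / 2) <= e / 2 by rewrite ge_min lexx orbT.
    lra.
  have cat i j : (i <= j)%N -> \prod_(k < j) (1 - w k * y) = \prod_(k < i) (1 - w k * y) * \prod_(i <= k < j) (1 - w k * y).
    by move=> le; rewrite -!(big_mkord xpredT (fun k => 1 - w k * y)) -big_cat_nat.
  have [N0 H0] := near 1 ltr01; pose B := 2 * ab (\prod_(k < N0) (1 - w k * y)) + 1.
  have B0 : 0 < B by rewrite ltr_wpDl // mulr_ge0 ?absv_ge0.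
  have bnd i : (N0 <= i)%N -> ab (\prod_(k < i) (1 - w k * y)) <= B.
    move=> le; rewrite (cat N0 i le) absvM.
    have : ab (\prod_(N0 <= k < i) (1 - w k * y)) <= 2.
      set p := \prod_(_ <= _ < _) _; have -> : p = (p - 1) + 1 by rewrite subrK.
      apply: le_trans (absvD _ _) _; rewrite ab1; have := H0 N0 i (leqnn _) le; rewrite -/p; lra.
    rewrite /B; have := absv_ge0 (\prod_(k < N0) (1 - w k * y)); nra.
  move=> e e0; have [N1 H1] := near (e / B) (divr_gt0 e0 B0); exists (maxn N0 N1).
  have main i j : (maxn N0 N1 <= i)%N -> (i <= j)%N -> ab (\prod_(k < j) (1 - w k * y) - \prod_(k < i) (1 - w k * y)) <= e.
    rewrite geq_max => /andP[l0 l1] lj; rewrite (cat i j lj) -{2}[\prod_(k < i) _]mulr1 -mulrBr absvM.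
    apply: le_trans (ler_pM (absv_ge0 _) (absv_ge0 _) (bnd i l0) (H1 i j l1 lj)) _.
    by rewrite mulrC divfK // gt_eqF.
  move=> i j li lj; have [le|/ltnW le] := leqP i j; last exact: main.
  by rewrite -absvN opprB; exact: main.
have [g Hg] := complete_islim K_complete cau.
rewrite /G_fun; have -> : (fun N => \prod_(0 <= k < N) (1 - w k * y)) = (fun N => \prod_(k < N) (1 - w k * y)).
  by apply/funext => N; rewrite big_mkord.
by rewrite (islim_limn Hg).
Qed.

End SeriesValues.

Lemma closed_split (F : fieldType) (p : {poly F}) : GRing.closed_field_axiom F -> p != 0 ->
  exists rs, p %= \prod_(x <- rs) ('X - x%:P).
Proof.
move=> ax; have [N] := ubnP (size p); elim: N p => // N IHN p; rewrite ltnS => le p0.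
have [/size_poly1P[c c0 ->]|s1] := boolP (size p == 1%N).
  by exists [::]; rewrite big_nil polyC_eqp1.
have s0 : (0 < (size p).-1)%N by have := size_poly_eq0 p; move: s1 p0; case: (size p) => [|[|k]] // _ /negPf ->.
have [x Hx] := ax (size p).-1 (fun i => - p`_i / lead_coef p) s0.
have rx : root p x.
  have sE : size p = (size p).-1.+1 by rewrite prednK // lt0n size_poly_eq0.
  rewrite /root horner_coef sE.
  rewrite big_ord_recr /= Hx mulr_sumr -big_split big1 //= => i _.
  by rewrite -lead_coefE; field; rewrite lead_coef_eq0.
have /dvdpP[p' e] : 'X - x%:P %| p by rewrite dvdp_XsubCl.
have p'0 : p' != 0 by apply: contraNneq p0 => h; rewrite e h mul0r.
have [|//|rs Hrs] := IHN p'; first by rewrite e size_Mmonic ?monicXsubC // size_XsubC addn2 /= in le.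
by exists (x :: rs); rewrite e big_cons mulrC eqp_mul2l ?polyXsubC_eq0.
Qed.

Lemma recurrenceE m c r : linear_recurrence m.+1 c r ->
  forall k, r (k + m.+1)%N = (\sum_(j < m.+1) c (m.+1 - j) * r (k + j))%N.
Proof.
move=> H k; rewrite H big_nat_rev big_add1 /= big_mkord; apply: eq_bigr => i _.
by rewrite add1n !subSS; congr (_ * r _)%N; have := ltn_ord i; lia.
Qed.

Lemma char_polyE m c : char_poly_rec m.+1 c = cpoly m c rat.
Proof.
rewrite /char_poly_rec /cpoly big_nat_rev big_add1 /= big_mkord; congr (_ - _); apply: eq_bigr => i _.
by rewrite add1n !subSS subKn // ltnW.
Qed.

Lemma condR_good_roots v m c r : c m.+1 <> 0%N -> (0 < m)%N -> linear_recurrence m.+1 c r ->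
  (exists k, r k != 0%N) -> condR v m.+1 c r -> exists rts, good_roots m c r rts.
Proof.
move=> /eqP cn m0 /recurrenceE r_rec r_neq0; case: v => [|p pp] /=.
  move=> [p1 pN1 ratio ngeo]; rewrite char_polyE in p1 pN1.
  apply: (good_roots_infinite cn r_rec r_neq0 p1 pN1) => // z w rz rw.
  by apply: ratio; rewrite /char_roots /= char_polyE map_cpoly.
move=> [irr [rho1 [rhos [e dom]]]]; exists (rho1 :: rhos).
rewrite char_polyE in irr e; apply: good_roots_prime => //.
by rewrite /rootprod -e map_cpoly.
Qed.

(** At a prime p the p-part of k is a divisor of k, hence at most k; at infinity already |k| >=
    1. *)
Lemma rat_absv_nat (R : realType) v k : (0 < k)%N -> k%:R^-1 <= rat_absv R v k%:R.
Proof.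
move=> k0; have kR : (0 : R) < k%:R by rewrite ltr0n.
case: v => [|p pp] /=.
  rewrite rmorph_nat ger0_norm ?ler0n //; apply: (@le_trans _ _ 1); last by rewrite ler1n.
  by rewrite invf_le1 // ler1n.
have kQ : (k%:R : rat) = k%:Z%:Q by rewrite -pmulrn.
rewrite kQ numq_int denq_int /= logn1 sub0r.
have -> : (k%:Z%:Q == 0 :> rat) = false by rewrite intr_eq0; case: (k) k0.
have p0 : (0 : R) < p%:R by rewrite ltr0n prime_gt0.
rewrite -invr_expz -exprnP lef_pV2 ?posrE ?exprn_gt0 // -natrX ler_nat.
by apply: dvdn_leq => //; exact: pfactor_dvdnn.
Qed.

(** * The values lie in the algebraic closure of Q_v *)

Section Range.
Variables (R : realType) (v : place) (T : local_tower R v) (emb : {rmorphism algC -> Cv T}).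
Notation f := (Qvbar_to_Cv T).
Definition QvCv : {rmorphism Qv T -> Cv T} := (f \o @Qv_to_Qvbar R v T)%FUN.

Lemma QvCv_isom x : absv (QvCv x) = absv x.
Proof. by have [iso _ _] := Cv_completion T; rewrite /QvCv /= iso Qvbar_absv. Qed.

Lemma absv_nat k : (0 < k)%N -> k%:R^-1 <= absv (k%:R : Cv T).
Proof.
move=> k0; have -> : (k%:R : Cv T) = QvCv (rat_to_Qv T k%:R) by rewrite !rmorph_nat.
have [iso _ _] := Qv_completion T; rewrite QvCv_isom iso; exact: rat_absv_nat.
Qed.

(** The minimal polynomial of z splits in the closed field [Qvbar T], and the embedding of z is one
    of the images of its roots. *)
Lemma algebraic_range (z : algC) : exists y, f y = emb z.
Proof.
have [p [e mon _]] := minCpolyP z.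
have [ax _] := Qvbar_closure T.
pose g : {rmorphism rat -> Qvbar T} := (@Qv_to_Qvbar R v T \o @rat_to_Qv R v T)%FUN.
have p0 : map_poly g p != 0 by rewrite map_poly_eq0 monic_neq0.
have [rs Hrs] := closed_split ax p0.
have rz : root (map_poly f (map_poly g p)) (emb z).
  have -> : map_poly f (map_poly g p) = map_poly emb (minCpoly z).
    rewrite e -!map_poly_comp; apply: eq_map_poly => x /=.
    exact: etrans (fmorph_eq_rat (f \o g) x) (esym (fmorph_eq_rat (emb \o @ratr algC) x)).
  by rewrite fmorph_root root_minCpoly.
have : root (map_poly f (\prod_(x <- rs) ('X - x%:P))) (emb z).
  by rewrite -(eqp_root (p := map_poly f (map_poly g p))) // eqp_map.
rewrite rmorph_prod /=; under eq_bigr do rewrite rmorphB /= map_polyX map_polyC.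
rewrite -(big_map f xpredT (fun y => 'X - y%:P)) root_prod_XsubC => /mapP[y _ ->]; by exists y.
Qed.

Lemma span_range bs x : (forall b, b \in bs -> exists y, f y = b) -> field_span QvCv bs x -> exists y, f y = x.
Proof.
elim: bs x => [|b bs IH] x H /=; first by move=> ->; exists 0; rewrite rmorph0.
move=> [q [y [-> hy]]]; have [z zE] := IH y (fun b' hb => H b' (mem_behead (s := b :: bs) hb)) hy.
have [b' bE] := H b (mem_head _ _).
by exists (Qv_to_Qvbar T q * b' + z); rewrite rmorphD rmorphM zE bE.
Qed.

(** All S N lie in one number field L, so their images lie in the Q_v-span of the images of a basis
    of L. This span contains the limit, being closed, and consists of images of elements of
    [Qvbar T]. *)
Lemma limit_range (s : seq algC) (S : nat -> algC) l : (forall (L : fieldExtType rat) (LC : {rmorphism L -> algC}),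
     (forall x, x \in s -> exists y, LC y = x) -> forall N, exists y, LC y = S N) ->
  islim (@absv R (Cv T)) (fun N => emb (S N)) l -> range f l.
Proof.
move=> HS Sl; have [L [LC HLC]] := number_field s.
have [y Hy] := choice (HS L LC HLC).
pose bs := [seq emb (LC b) | b <- vbasis (fullv : {vspace L})].
have cQ : forall S', ab_cauchy (@absv R (Qv T)) S' -> exists l', islim (@absv R (Qv T)) S' l'.
  by have [_ _ cQ] := Qv_completion T; move=> S'; exact: complete_islim.
have inspan N : field_span QvCv bs (emb (S N)).
  rewrite -(Hy N) (coord_vbasis (memvf (y N))) !rmorph_sum.
  elim/big_rec: _ => [|i x _ Hx]; first exact: field_span0.
  have -> : emb (LC (coord (vbasis fullv) i (y N) *: (vbasis (fullv : {vspace L}))`_i)) =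
    QvCv (rat_to_Qv T (coord (vbasis fullv) i (y N))) * emb (LC (vbasis (fullv : {vspace L}))`_i).
    rewrite -mulr_algl !rmorphM; congr (_ * _).
    pose h1 : {rmorphism rat -> Cv T} := (emb \o (LC \o in_alg L))%FUN.
    pose h2 : {rmorphism rat -> Cv T} := (QvCv \o @rat_to_Qv R v T)%FUN.
    exact: etrans (fmorph_eq_rat h1 _) (esym (fmorph_eq_rat h2 _)).
  apply: field_span_lin => //; apply: field_span_mem; apply: map_f; apply: mem_nth; by rewrite size_tuple.
have := field_span_closed (@absv_ge0 R (Cv T)) (@absv_eq0 R (Cv T)) (@absvM R (Cv T)) (@absvD R (Cv T)) QvCv_isom cQ inspan Sl.
case/span_range => [b|z <-]; last by exists z.
by move=> /mapP[b' _ ->]; exact: algebraic_range.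
Qed.
End Range.

Theorem theorem1p11 (R : realType) (v : place) (T : local_tower R v)
    (emb : {rmorphism algC -> Cv T})
    (a : algC) (n : nat) (c r : nat -> nat) :
  0 < absv (emb a) -> absv (emb a) < 1 ->
  (2 <= n)%N ->
  linear_recurrence n c r ->
  (exists2 k, (k < n)%N & r k <> 0%N) ->
  c n <> 0%N ->
  condR v n c r ->
  let S := H_values emb a r `|` F_values emb a r `|` G_values emb a r in
  [/\ infinite_set S, S `<=` range (Qvbar_to_Cv T) & alg_independent S].
Proof.
move=> a0 a1 n2 rec [k0 _ rk0] cn cR S.
case: n n2 rec cn cR => [//|m]; rewrite ltnS => m0 rec cn cR.
have r_neq0 : exists k, r k != 0%N by exists k0; apply/eqP.
have [rts rtsP] := condR_good_roots cn m0 rec r_neq0 cR.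
have [rtsE nd no_unity _] := rtsP.
have r_rec := recurrenceE rec; have cn' : c m.+1 != 0%N by apply/eqP.
have growth := r_growth cn' rtsE nd no_unity r_rec r_neq0.
have [_ _ cK] := Cv_completion T.
have charK : [pchar (Cv T)] =i pred0 by move=> p; rewrite (fmorph_pchar emb) pchar_num.
pose val (i : Idx) : Cv T := match i with
  | inl (al, be, mm, l) => Dval (emb a) r l mm (emb al) (emb be) | inr be => G_fun (emb a) r (emb be) end.
have admK be : admC r a be -> adm (emb a) r (emb be).
  by move=> H k; rewrite -rmorphXn -rmorphM -(rmorph1 emb) -rmorphB fmorph_eq0 mulrC; exact: H.
pose FS al be mm l M := \sum_(k < M) a ^+ r k * (((k ^_ l)%:R * al ^+ (k - l)) *
    (mm`!%:R * (a ^+ r k) ^+ mm * (1 - a ^+ r k * be)^-1 ^+ mm.+1)).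
have val_F al be mm l : al != 0 -> admC r a be -> islim (@absv R (Cv T)) (fun M => emb (FS al be mm l M)) (val (inl (al, be, mm, l))).
  move=> _ Hbe; apply: islim_ext (Dval_lim cK a0 a1 growth l mm (emb al) (admK _ Hbe)) => M.
  rewrite /partial_sum rmorph_sum; apply: eq_bigr => k _.
  by rewrite /xpart /ypart !rmorphM !rmorphXn fmorphV rmorphB rmorph1 rmorphM rmorphXn !rmorph_nat.
have val_G be : admC r a be -> islim (@absv R (Cv T)) (fun M => emb (\prod_(k < M) (1 - a ^+ r k * be))) (val (inr be)).
  move=> _; apply: islim_ext (G_fun_lim cK a0 a1 growth (emb be)) => M.
  by rewrite rmorph_prod; apply: eq_bigr => k _; rewrite rmorphB rmorph1 rmorphM rmorphXn.
(* The derivatives of F enter as the indices with beta = 0, where every factor 1 - a^(r k) beta is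
   1. *)
have SE w : S w -> exists i, valid r a i /\ w = val i.
  have adE be : admissible a r be -> be != 0 /\ admC r a be.
    move=> [be0 H]; split=> // k; rewrite subr_eq0 eq_sym; apply: contra (H k) => /eqP e.
    have ak : a ^+ r k != 0.
      by rewrite expf_neq0 //; apply: contraTneq a0 => ->; rewrite rmorph0 (absv_eq0 0).2 // ltxx.
    by rewrite -(inj_eq (mulIf ak)) e mulVf.
  case=> [[|]|].
  - move=> [al [be [l [mm [al0 /adE[be0 Hbe] ->]]]]]; exists (inl (al, be, mm, l)); split=> //.
    by rewrite /val (Kpartial_H cK a0 a1 growth) //; exact: admK.
  - move=> [al [l [mm [al0 ->]]]]; exists (inl (al, 0, mm, l)); split.
      by split=> // k; rewrite mul0r subr0 oner_neq0.
    by rewrite /val rmorph0 (F_fun_derive cK a0 a1 growth).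
  by move=> [be [/adE[be0 Hbe] ->]]; exists (inr be).
have weight := weight_exists cn' rtsE no_unity R.
have indep := indexed_independent cn' rtsP r_rec r_neq0 charK (@absv_ge0 R (Cv T)) (@absv_eq0 R (Cv T))
  (@absvM R (Cv T)) (@absvD R (Cv T)) (@absv_nat R v T) weight a0 a1 val_F val_G.
have inj := indexed_injective cn' rtsP r_rec r_neq0 charK (@absv_ge0 R (Cv T)) (@absv_eq0 R (Cv T))
  (@absvM R (Cv T)) (@absvD R (Cv T)) (@absv_nat R v T) weight a0 a1 val_F val_G.
split.
(* The numbers F_k(1) have pairwise distinct indices, hence are pairwise distinct. *)
- pose w0 (k : nat) := val (inl (1, 0, k, 0%N)).
  have v0 k : valid r a (inl (1, 0, k, 0%N)).
    by split=> [|j]; rewrite ?oner_neq0 // mul0r subr0 oner_neq0.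
  have w0S k : S (w0 k).
    left; right; exists 1, 0%N, k; split; first exact: oner_neq0.
    by rewrite /w0 /val rmorph0 (F_fun_derive cK a0 a1 growth).
  move=> fS; apply: infinite_nat; have := @finite_preimage _ _ S w0.
  have -> : w0 @^-1` S = setT by apply/seteqP; split=> // k _; exact: w0S.
  apply=> //; move=> k k' _ _ e; by have [] := inj _ _ (v0 k) (v0 k') e.
- move=> w /SE[i [vi ->]].
  case: i vi => [[[[al be] mm] l] [al0 Hbe]|be [be0 Hbe]].
    apply: (limit_range (s := [:: a; al; be]) _ (val_F al be mm l al0 Hbe)) => L LC H N.
    have [aL aE] := H a (mem_head _ _).
    have [alL alE] : exists y, LC y = al by apply: H; rewrite !inE eqxx orbT.
    have [beL beE] : exists y, LC y = be by apply: H; rewrite !inE eqxx !orbT.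
    exists (\sum_(k < N) aL ^+ r k * (((k ^_ l)%:R * alL ^+ (k - l)) *
      (mm`!%:R * (aL ^+ r k) ^+ mm * (1 - aL ^+ r k * beL)^-1 ^+ mm.+1))).
    rewrite rmorph_sum; apply: eq_bigr => k _.
    by rewrite !rmorphM !rmorphXn fmorphV rmorphB rmorph1 rmorphM rmorphXn !rmorph_nat aE alE beE.
  apply: (limit_range (s := [:: a; be]) _ (val_G be Hbe)) => L LC H N.
  have [aL aE] := H a (mem_head _ _).
  have [beL beE] : exists y, LC y = be by apply: H; rewrite !inE eqxx orbT.
  exists (\prod_(k < N) (1 - aL ^+ r k * beL)).
  by rewrite rmorph_prod; apply: eq_bigr => k _; rewrite rmorphB rmorph1 rmorphM rmorphXn aE beE.
move=> N z z_inj zS P HP.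
have [ix Hix] := choice (fun i => SE _ (zS i)).
apply: (indep N ix P) => [i j e|i|]; [|by have [] := Hix i|].
  by apply: z_inj; have [_ ->] := Hix i; have [_ ->] := Hix j; rewrite e.
by rewrite -[RHS]HP; congr (mpoly.mmap _ _ P); apply/funext => i; have [_ ->] := Hix i.
Qed.
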